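(* For every rational number $k\geqslant 1$ and every $\phi\in[0,\pi)$, as $T\to\infty$, $$\sum_{0<t_n(\phi)\leqslant T}\left|\zeta\left(\tfrac12+it_n(\phi)\right)\right|^{2k}\gg T(\log T)^{k^2+1}.$$
   Context: $\zeta$ is the Riemann zeta-function. Let $\Delta(s)=2^s\pi^{s-1}\Gamma(1-s)\sin(\pi s/2)$, so that $\zeta(s)=\Delta(s)\zeta(1-s)$; $\Delta(\tfrac12+it)$ lies on the unit circle for real $t$. For $\phi\in[0,\pi)$, $t_1(\phi)<t_2(\phi)<\dots$ denote the positive roots $t$ of the equation $e^{2i\phi}=\Delta(\tfrac12+it)$, in ascending order. The implied constant may depend on $k$ and $\phi$. *)

(* Defs.v *)
From Coquelicot Require Import Coquelicot.
From Stdlib Require Import Reals QArith Qreals List.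
Local Open Scope R_scope.

Notation CC := Complex.C.

Definition Cexp (z : CC) : CC :=
  (exp (Re z) * cos (Im z), exp (Re z) * sin (Im z)).

Definition Cpowr (a : R) (z : CC) : CC := Cexp (Cmult (RtoC (ln a)) z).

Definition Csin (z : CC) : CC :=
  Cdiv (Cminus (Cexp (Cmult Ci z)) (Cexp (Copp (Cmult Ci z)))) (Cmult (RtoC 2) Ci).

(* Euler's integral for Gamma, valid for Re z > 0 *)
Definition CGamma (z : CC) : CC :=
  RInt_gen (V := Complex.C_R_CompleteNormedModule)
    (fun x : R => Cmult (Cpowr x (Cminus z (RtoC 1))) (RtoC (exp (- x))))
    (at_right 0) (Rbar_locally p_infty).

(* Dirichlet eta function (alternating zeta), convergent for Re s > 0:
   eta(s) = sum_{n>=1} (-1)^(n-1) n^(-s) *)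
Definition eta_term (s : CC) (n : nat) : CC :=
  Cmult (RtoC ((-1) ^ n)) (Cpowr (INR (S n)) (Copp s)).

Definition eta (s : CC) : CC :=
  (Series (fun n => Re (eta_term s n)), Series (fun n => Im (eta_term s n))).

(* Riemann zeta function in the half-plane Re s > 0 (s <> 1):
   zeta(s) = eta(s) / (1 - 2^(1-s)) *)
Definition zeta (s : CC) : CC :=
  Cdiv (eta s) (Cminus (RtoC 1) (Cpowr 2 (Cminus (RtoC 1) s))).

(* Delta(s) = 2^s pi^(s-1) Gamma(1-s) sin(pi s / 2) (used for Re s < 1) *)
Definition Delta (s : CC) : CC :=
  Cmult (Cmult (Cmult (Cpowr 2 s) (Cpowr PI (Cminus s (RtoC 1))))
               (CGamma (Cminus (RtoC 1) s)))
        (Csin (Cdiv (Cmult (RtoC PI) s) (RtoC 2))).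

Definition crit (t : R) : CC := (/ 2, t).

Definition is_root_phi (phi t : R) : Prop :=
  Cexp (Cmult Ci (RtoC (2 * phi))) = Delta (crit t).

(* x^y for x >= 0, y > 0, with 0^y = 0 *)
Definition rpow (x y : R) : R :=
  if Req_EM_T x 0 then 0 else Rpower x y.

(* Main.v *)
Require Import Defs.
From Coquelicot Require Import Coquelicot.
From Stdlib Require Import Reals ZArith QArith Qreals List Lra Lia ClassicalEpsilon Arith.
From Stdlib Require FinFun.
Local Open Scope R_scope.

(* Write [k = r/s].  The bound is a resonance argument: with a short Dirichlet polynomial
   [A] imitating [zeta^(1/s)], one compares the sum of [zeta A^(r-s) conj(A)^r] over the roots
   with the sum of [|A|^(2r)] over the roots; their sizes are [T (log T)^(k^2+1)], and
   Young's inequality transfers the lower bound to [|zeta|^(2k)].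

   On the critical line [Delta (1/2 + i t) = exp (- 2 i Th t)] with [Th] convex and of slope about
   [(log t) / 2] (Gauss's product for Gamma), so the roots for [phi], interlaced with those for
   [phi + pi/2], form a grid [u_i] with decreasing gaps of size about [pi / log T].  At a grid point
   [zeta = (-1)^i exp (2 i phi) conj zeta], hence summing over the roots, that is over even [i], amounts
   to summing both [zeta B] and [exp (2 i phi) conj(zeta) B] over the whole grid.  On the whole
   grid every frequency [log (m / n)] that occurs turns by less than [8 pi / 5] per step, so the
   Kusmin-Landau inequality leaves only the diagonal terms; those of the conjugate sum are smaller by a
   factor [log T].  The diagonal sums run over smooth numbers free of small primes and are evaluated by
   Mertens-type estimates, with Rankin's trick for the truncation.  Instead of [zeta] we use
   [|1 - 2^s|^2 zeta(s)], which is approximated by partial sums of the alternating series.  The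
   functional equation is derived from the Mellin transform of [1/(e^x - 1) - 1/x] and the
   partial fractions of the cosecant. *)

(** Rationality of [k] enters because only integer powers of [A] are Dirichlet polynomials. The
    coefficients of [A] are s^(-Om n), so that A^r and zeta A^(r-s) both imitate zeta^k; the
    diagonal sums then behave like the sum of k^(2 Om n) / n, of size (log T)^(k^2), and the number
    of roots supplies the factor T log T. Approximating zeta takes about T terms, so the frequencies
    reach slightly beyond log T, while consecutive roots are about 2 pi / log T apart: along the
    roots alone a frequency near log T makes a full turn per step and does not average out. Halving
    the step removes this obstacle. The factor |1 - 2^s|^2 is invariant under s -> 1 - s, is
    bounded, and cancels the denominator in the definition of [zeta]; paired with odd numbers its
    effect on the coefficients has a favourable sign, hence [A] avoids the prime 2. Avoiding the
    primes up to a multiple of k^2 keeps the Euler factors 1 / (1 - k^2 / p) bounded. The length of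
    [A] is a small power of T: off-diagonal terms stay below T^(5/8) log T up to a constant, yet log
    y, for the smoothness bound y, remains comparable with log T. *)

Ltac cmod_replace t :=
  match goal with |- Cmod ?X <= _ =>
    replace X with t by (rewrite ?RtoC_minus; ring) end.

(** * Points of the unit circle and finite sums over lists *)

Definition cis (x : R) : CC := (cos x, sin x).

Lemma cis_add x y : cis (x + y) = Cmult (cis x) (cis y).
Proof.
  unfold cis, Cmult; simpl; rewrite cos_plus, sin_plus; f_equal; ring.
Qed.

Lemma cis_0 : cis 0 = RtoC 1.
Proof. unfold cis; rewrite cos_0, sin_0; reflexivity. Qed.

Lemma cis_conj x : Cconj (cis x) = cis (- x).
Proof. unfold cis, Cconj; simpl; rewrite cos_neg, sin_neg; reflexivity. Qed.

Lemma Cmod_cis x : Cmod (cis x) = 1.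
Proof.
  unfold Cmod, cis; simpl.
  replace (cos x * (cos x * 1) + sin x * (sin x * 1)) with 1; [apply sqrt_1|].
  generalize (sin2_cos2 x); unfold Rsqr; lra.
Qed.

Lemma cis_neq_0 x : cis x <> RtoC 0.
Proof. apply Cmod_gt_0; rewrite Cmod_cis; lra. Qed.

(** Sums run over arbitrary lists, so that intervals, divisors, primes and the terms of Dirichlet
    polynomials obey the same lemmas. *)
Fixpoint rsum {A : Type} (l : list A) (f : A -> R) : R :=
  match l with nil => 0 | a :: l' => f a + rsum l' f end.

Fixpoint csum {A : Type} (l : list A) (f : A -> CC) : CC :=
  match l with nil => RtoC 0 | a :: l' => Cplus (f a) (csum l' f) end.

Section sums.
Context {A B : Type}.
Implicit Types (l : list A) (f g : A -> R) (F G : A -> CC).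

Lemma rsum_ext l f g : (forall a, In a l -> f a = g a) -> rsum l f = rsum l g.
Proof.
  induction l as [|a l IH]; simpl; intros H; [reflexivity|].
  rewrite H by (left; reflexivity). f_equal. apply IH; auto.
Qed.

Lemma csum_ext l F G : (forall a, In a l -> F a = G a) -> csum l F = csum l G.
Proof.
  induction l as [|a l IH]; simpl; intros H; [reflexivity|].
  rewrite H by (left; reflexivity). f_equal. apply IH; auto.
Qed.

Lemma rsum_app l1 l2 f : rsum (l1 ++ l2) f = rsum l1 f + rsum l2 f.
Proof. induction l1 as [|a l IH]; simpl; [ring|rewrite IH; ring]. Qed.

Lemma csum_app l1 l2 F : csum (l1 ++ l2) F = Cplus (csum l1 F) (csum l2 F).
Proof. induction l1 as [|a l IH]; simpl; [ring|rewrite IH; ring]. Qed.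

Lemma rsum_plus l f g : rsum l (fun a => f a + g a) = rsum l f + rsum l g.
Proof. induction l as [|a l IH]; simpl; [ring|rewrite IH; ring]. Qed.

Lemma rsum_minus l f g : rsum l (fun a => f a - g a) = rsum l f - rsum l g.
Proof. induction l as [|a l IH]; simpl; [ring|rewrite IH; ring]. Qed.

Lemma csum_plus l F G : csum l (fun a => Cplus (F a) (G a)) = Cplus (csum l F) (csum l G).
Proof. induction l as [|a l IH]; simpl; [ring|rewrite IH; ring]. Qed.

Lemma csum_minus l F G : csum l (fun a => Cminus (F a) (G a)) = Cminus (csum l F) (csum l G).
Proof. induction l as [|a l IH]; simpl; [ring|rewrite IH; ring]. Qed.

Lemma rsum_scal l f c : rsum l (fun a => c * f a) = c * rsum l f.
Proof. induction l as [|a l IH]; simpl; [ring|rewrite IH; ring]. Qed.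

Lemma csum_scal l F c : csum l (fun a => Cmult c (F a)) = Cmult c (csum l F).
Proof. induction l as [|a l IH]; simpl; [ring|rewrite IH; ring]. Qed.

Lemma rsum_0 l f : (forall a, In a l -> f a = 0) -> rsum l f = 0.
Proof.
  induction l as [|a l IH]; simpl; intros H; [reflexivity|].
  rewrite H by auto. rewrite IH by auto. ring.
Qed.

Lemma rsum_le l f g : (forall a, In a l -> f a <= g a) -> rsum l f <= rsum l g.
Proof.
  induction l as [|a l IH]; simpl; intros H; [lra|].
  apply Rplus_le_compat; auto.
Qed.

Lemma rsum_nonneg l f : (forall a, In a l -> 0 <= f a) -> 0 <= rsum l f.
Proof.
  intros H. rewrite <- (rsum_0 l (fun _ => 0)) by auto. apply rsum_le; auto.
Qed.

Lemma rsum_const l c : rsum l (fun _ => c) = INR (length l) * c.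
Proof.
  induction l as [|a l IH]; [simpl; ring|].
  change (length (a :: l)) with (S (length l)). rewrite S_INR. simpl. rewrite IH; ring.
Qed.

Lemma csum_const l (c : CC) : csum l (fun _ => c) = Cmult (RtoC (INR (length l))) c.
Proof.
  induction l as [|a l IH]; [simpl; ring|].
  change (length (a :: l)) with (S (length l)). rewrite S_INR. simpl. rewrite IH.
  rewrite RtoC_plus; ring.
Qed.

Lemma rsum_single_le l f a : In a l -> (forall b, In b l -> 0 <= f b) -> f a <= rsum l f.
Proof.
  induction l as [|b l IH]; simpl; [easy|]. intros [->|H] Hp.
  - assert (0 <= rsum l f) by (apply rsum_nonneg; auto). lra.
  - specialize (IH H (fun b Hb => Hp b (or_intror Hb))). specialize (Hp b (or_introl eq_refl)). lra.
Qed.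

Lemma rsum_swap l (m : list B) (f : A -> B -> R) :
  rsum l (fun a => rsum m (fun b => f a b)) = rsum m (fun b => rsum l (fun a => f a b)).
Proof.
  induction l as [|a l IH]; simpl.
  - symmetry; induction m as [|b m IHm]; simpl; lra.
  - rewrite IH. symmetry.
    clear IH. induction m as [|b m IHm]; simpl; [ring|rewrite IHm; ring].
Qed.

Lemma csum_swap l (m : list B) (f : A -> B -> CC) :
  csum l (fun a => csum m (fun b => f a b)) = csum m (fun b => csum l (fun a => f a b)).
Proof.
  induction l as [|a l IH]; simpl.
  - symmetry; induction m as [|b m IHm]; simpl; [|rewrite IHm]; ring.
  - rewrite IH. symmetry.
    clear IH. induction m as [|b m IHm]; simpl; [ring|rewrite IHm; ring].
Qed.

Lemma rsum_map (h : B -> A) (m : list B) f : rsum (map h m) f = rsum m (fun b => f (h b)).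
Proof. induction m as [|b m IH]; simpl; [|rewrite IH]; reflexivity. Qed.

Lemma csum_map (h : B -> A) (m : list B) F : csum (map h m) F = csum m (fun b => F (h b)).
Proof. induction m as [|b m IH]; simpl; [|rewrite IH]; reflexivity. Qed.

Lemma Cmod_csum l F : Cmod (csum l F) <= rsum l (fun a => Cmod (F a)).
Proof.
  induction l as [|a l IH]; simpl; [rewrite Cmod_0; lra|].
  eapply Rle_trans; [apply Cmod_triangle|lra].
Qed.

Lemma RtoC_rsum l f : RtoC (rsum l f) = csum l (fun a => RtoC (f a)).
Proof. induction l as [|a l IH]; simpl; [reflexivity|rewrite RtoC_plus, IH; reflexivity]. Qed.

Lemma Cconj_csum l F : Cconj (csum l F) = csum l (fun a => Cconj (F a)).
Proof.
  induction l as [|a l IH]; simpl; [unfold Cconj; simpl; rewrite Ropp_0; reflexivity|].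
  rewrite Cplus_conj, IH; reflexivity.
Qed.

End sums.

Lemma rsum_seq_S a n f : rsum (seq a (S n)) f = rsum (seq a n) f + f (a + n)%nat.
Proof. rewrite seq_S, rsum_app; simpl; ring. Qed.

Lemma csum_seq_S a n f : csum (seq a (S n)) f = Cplus (csum (seq a n) f) (f (a + n)%nat).
Proof. rewrite seq_S, csum_app; simpl; ring. Qed.

Lemma csum_seq_split a n m f :
  csum (seq a (n + m)) f = Cplus (csum (seq a n) f) (csum (seq (a + n) m) f).
Proof. rewrite seq_app, csum_app; reflexivity. Qed.

(** * The Kusmin-Landau inequality *)

Definition mono_upto (M : nat) (g : nat -> R) : Prop :=
  (forall i, (S i < M)%nat -> g (S i) <= g i) \/ (forall i, (S i < M)%nat -> g i <= g (S i)).

(** Partial summation: the upper boundary term is subtracted, the one at 0 costs |g 0|, and since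
    [g] decreases its total variation telescopes to [g 0 - g M]. *)
Lemma abel_decr_aux (E : nat -> CC) (g : nat -> R) M :
  (forall i, Cmod (E i) = 1) -> (forall i, (S i < S M)%nat -> g (S i) <= g i) ->
  Cmod (Cminus (csum (seq 0 (S M)) (fun i => Cmult (Cminus (E (S i)) (E i)) (RtoC (g i))))
               (Cmult (E (S M)) (RtoC (g M)))) <= Rabs (g 0%nat) + (g 0%nat - g M).
Proof.
  intros HE. induction M as [|M IH]; intros H.
  - simpl csum.
    cmod_replace (- (E 0%nat * RtoC (g 0%nat)))%C.
    rewrite Cmod_opp, Cmod_mult, HE, Cmod_R. lra.
  - rewrite csum_seq_S. simpl Nat.add.
    cmod_replace
      ((csum (seq 0 (S M)) (fun i => (E (S i) - E i) * RtoC (g i)) - E (S M) * RtoC (g M)) +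
       E (S M) * RtoC (g M - g (S M)))%C.
    eapply Rle_trans; [apply Cmod_triangle|].
    rewrite Cmod_mult, HE, Cmod_R, Rmult_1_l.
    specialize (IH (fun i Hi => H i ltac:(lia))).
    rewrite (Rabs_right (g M - _)) by (generalize (H M ltac:(lia)); lra). lra.
Qed.

Lemma abel_decr (E : nat -> CC) (g : nat -> R) M G :
  (forall i, Cmod (E i) = 1) -> (forall i, (S i < M)%nat -> g (S i) <= g i) ->
  (forall i, (i < M)%nat -> Rabs (g i) <= G) -> 0 <= G ->
  Cmod (csum (seq 0 M) (fun i => Cmult (Cminus (E (S i)) (E i)) (RtoC (g i)))) <= 4 * G.
Proof.
  intros HE Hg Hb HG. destruct M as [|M]; [simpl; rewrite Cmod_0; lra|].
  generalize (abel_decr_aux E g M HE Hg). set (S1 := csum _ _). intros H.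
  replace S1 with ((S1 - E (S M) * RtoC (g M)) + E (S M) * RtoC (g M))%C by ring.
  eapply Rle_trans; [apply Cmod_triangle|]. rewrite Cmod_mult, HE, Cmod_R.
  generalize (Hb 0%nat ltac:(lia)) (Hb M ltac:(lia)) (Rle_abs (g 0%nat)) (Rle_abs (- g M)).
  rewrite Rabs_Ropp. lra.
Qed.

Lemma abel_mono (E : nat -> CC) (g : nat -> R) M G :
  (forall i, Cmod (E i) = 1) -> mono_upto M g -> (forall i, (i < M)%nat -> Rabs (g i) <= G) -> 0 <= G ->
  Cmod (csum (seq 0 M) (fun i => Cmult (Cminus (E (S i)) (E i)) (RtoC (g i)))) <= 4 * G.
Proof.
  intros HE [Hg|Hg] Hb HG; [apply abel_decr; auto|].
  rewrite <- Cmod_opp.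
  replace (- csum (seq 0 M) (fun i => (E (S i) - E i) * RtoC (g i)))%C with
    (csum (seq 0 M) (fun i => (E (S i) - E i) * RtoC (- g i)))%C.
  - apply abel_decr; auto.
    + intros i Hi. specialize (Hg i Hi). lra.
    + intros i Hi. rewrite Rabs_Ropp. auto.
  - replace (- _)%C with (RtoC (Ropp 1) * csum (seq 0 M) (fun i => (E (S i) - E i) * RtoC (g i)))%C by (rewrite RtoC_opp; ring).
    rewrite <- csum_scal. apply csum_ext; intros; rewrite !RtoC_opp; ring.
Qed.

Lemma csum_telescope (E : nat -> CC) M :
  csum (seq 0 M) (fun i => Cminus (E (S i)) (E i)) = Cminus (E M) (E 0%nat).
Proof.
  induction M as [|M IH]; [simpl; ring|]. rewrite csum_seq_S, IH; simpl; ring.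
Qed.

(* [1/(e^{id}-1) = -1/2 - (i/2) cot(d/2)] turns the sum into a telescoping one with monotone weights. *)
Theorem kusmin_landau (th : nat -> R) (M : nat) (G : R) :
  (forall i, (i < M)%nat -> sin ((th (S i) - th i) / 2) <> 0) ->
  mono_upto M (fun i => cos ((th (S i) - th i) / 2) / sin ((th (S i) - th i) / 2)) ->
  (forall i, (i < M)%nat ->
     Rabs (cos ((th (S i) - th i) / 2) / sin ((th (S i) - th i) / 2)) <= G) -> 0 <= G ->
  Cmod (csum (seq 0 M) (fun i => cis (th i))) <= 1 + 2 * G.
Proof.
  intros Hs Hm Hb HG.
  set (g := fun i => cos ((th (S i) - th i) / 2) / sin ((th (S i) - th i) / 2)).
  set (E := fun i => cis (th i)).
  assert (H : csum (seq 0 M) E =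
    Cplus (Cmult (RtoC (- / 2)) (csum (seq 0 M) (fun i => Cminus (E (S i)) (E i))))
     (Cmult (Cmult Ci (RtoC (- / 2))) (csum (seq 0 M) (fun i => Cmult (Cminus (E (S i)) (E i)) (RtoC (g i)))))).
  { rewrite <- !csum_scal, <- csum_plus. apply csum_ext. intros i Hi.
    apply in_seq in Hi. specialize (Hs i ltac:(lia)). unfold g, E.
    set (d := (th (S i) - th i) / 2) in *.
    replace (th (S i)) with (th i + (d + d)) by (unfold d; field).
    rewrite !cis_add.
    assert (K : ((cis d * cis d - RtoC 1) * (RtoC (- / 2) + Ci * RtoC (- / 2) * RtoC (cos d / sin d)) = RtoC 1)%C).
    { generalize (sin2_cos2 d); unfold Rsqr; intros Hd.
      unfold cis, Cmult, Cplus, Cminus, Copp, RtoC, Ci; simpl.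
      set (C := cos d) in *. set (Sn := sin d) in *.
      assert (HC : C * C = 1 - Sn * Sn) by lra.
      f_equal.
      - replace (C * C - Sn * Sn + - (1)) with (- 2 * Sn * Sn) by lra.

        transitivity (Sn * Sn + C * C); [field; auto | lra].
      - replace (C * C - Sn * Sn + - (1)) with (- 2 * Sn * Sn) by lra. field; auto. }
    rewrite <- (Cmult_1_r (cis (th i))) at 1. rewrite <- K. ring. }
  rewrite H. eapply Rle_trans; [apply Cmod_triangle|].
  rewrite !Cmod_mult, !Cmod_R, Cmod_Ci, csum_telescope.
  assert (Cmod (E M - E 0%nat) <= 2).
  { eapply Rle_trans; [apply Cmod_triangle|]. rewrite Cmod_opp. unfold E. rewrite !Cmod_cis. lra. }
  assert (Cmod (csum (seq 0 M) (fun i => Cmult (Cminus (E (S i)) (E i)) (RtoC (g i)))) <= 4 * G).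
  { apply abel_mono; auto. intros i; apply Cmod_cis. }
  rewrite Rabs_Ropp, Rabs_right by lra. lra.
Qed.

(** Partial summation writes the weighted sum as a combination of partial sums of [e] whose
    coefficients, the differences [a i - a (S i)] and one final weight, are nonnegative and add up
    to [a 0]. *)
Lemma abel_weights (e : nat -> CC) (a : nat -> R) (K : R) (M : nat) :
  (forall m, (m <= M)%nat -> Cmod (csum (seq 0 m) e) <= K) ->
  (forall i, a (S i) <= a i) -> (forall i, 0 <= a i) ->
  Cmod (csum (seq 0 M) (fun i => Cmult (RtoC (a i)) (e i))) <= K * a 0%nat.
Proof.
  intros HK Hd Hp.
  destruct M as [|M].
  { simpl. rewrite Cmod_0. apply Rmult_le_pos; [|apply Hp]. specialize (HK 0%nat ltac:(lia)). simpl in HK.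
    rewrite Cmod_0 in HK; lra. }
  assert (H : forall M, (forall m, (m <= S M)%nat -> Cmod (csum (seq 0 m) e) <= K) ->
    Cmod (Cminus (csum (seq 0 (S M)) (fun i => Cmult (RtoC (a i)) (e i)))
       (Cmult (RtoC (a M)) (csum (seq 0 (S M)) e))) <= K * (a 0%nat - a M)).
  { clear M HK. induction M as [|M IH]; intros HK.
    - simpl. cmod_replace (RtoC 0). rewrite Cmod_0; lra.
    - rewrite (csum_seq_S _ (S M)). rewrite (csum_seq_S _ (S M) e). simpl Nat.add.
      cmod_replace
       ((csum (seq 0 (S M)) (fun i => RtoC (a i) * e i) - RtoC (a M) * csum (seq 0 (S M)) e)
        + RtoC (a M - a (S M)) * csum (seq 0 (S M)) e)%C.
      eapply Rle_trans; [apply Cmod_triangle|].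
      rewrite Cmod_mult, Cmod_R, (Rabs_right (a M - a (S M))) by (specialize (Hd M); lra).
      assert (Cmod (csum (seq 0 (S M)) e) <= K) by (apply HK; lia).
      specialize (IH (fun m Hm => HK m ltac:(lia))).
      specialize (Hd M). nra. }
  specialize (H M HK).
  set (S1 := csum (seq 0 (S M)) (fun i => Cmult (RtoC (a i)) (e i))) in *.
  set (S2 := csum (seq 0 (S M)) e) in *.
  replace S1 with ((S1 - RtoC (a M) * S2) + RtoC (a M) * S2)%C by ring.
  eapply Rle_trans; [apply Cmod_triangle|]. rewrite Cmod_mult, Cmod_R, (Rabs_right (a M)) by (apply Rle_ge, Hp).
  assert (Cmod S2 <= K) by (apply HK; lia). specialize (Hp M). nra.
Qed.

(** * Integrals of complex functions of a real variable *)

(** The componentwise form lets the real lemmas on integrals, continuity and derivatives apply to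
    each part. *)
Definition CI (K : R -> CC) (a b : R) (w : CC) : Prop :=
  is_RInt (fun x => fst (K x)) a b (fst w) /\ is_RInt (fun x => snd (K x)) a b (snd w).

Definition Ccont (K : R -> CC) (x : R) : Prop :=
  continuous (fun x => fst (K x)) x /\ continuous (fun x => snd (K x)) x.

Definition CD (F : R -> CC) (x : R) (w : CC) : Prop :=
  is_derive (fun x => fst (F x)) x (fst w) /\ is_derive (fun x => snd (F x)) x (snd w).

Lemma CI_ext K K' a b w :
  (forall x, Rmin a b < x < Rmax a b -> K x = K' x) -> CI K a b w -> CI K' a b w.
Proof.
  intros H [H1 H2]; split; (eapply is_RInt_ext; [|eassumption]); intros x Hx; simpl; rewrite H; auto.
Qed.

Lemma is_RInt_inj (f : R -> R) a b (l l' : R) : is_RInt f a b l -> is_RInt f a b l' -> l = l'.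
Proof.
  intros H H'. apply (is_RInt_unique (V := R_CompleteNormedModule)) in H.
  apply (is_RInt_unique (V := R_CompleteNormedModule)) in H'. congruence.
Qed.

Lemma CI_unique K a b w w' : CI K a b w -> CI K a b w' -> w = w'.
Proof.
  intros [H1 H2] [H3 H4]. destruct w, w'; simpl in *.
  f_equal; eapply is_RInt_inj; eassumption.
Qed.

Lemma CI_plus K K' a b w w' :
  CI K a b w -> CI K' a b w' -> CI (fun x => Cplus (K x) (K' x)) a b (Cplus w w').
Proof.
  intros [H1 H2] [H3 H4]; split; [refine (is_RInt_plus _ _ _ _ _ _ H1 H3)|refine (is_RInt_plus _ _ _ _ _ _ H2 H4)].
Qed.

Lemma CI_scal K a b w c : CI K a b w -> CI (fun x => Cmult c (K x)) a b (Cmult c w).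
Proof.
  intros [H1 H2]; split; simpl.
  - refine (is_RInt_minus _ _ _ _ _ _ (is_RInt_scal _ _ _ (fst c) _ H1) (is_RInt_scal _ _ _ (snd c) _ H2)).
  - refine (is_RInt_plus _ _ _ _ _ _ (is_RInt_scal _ _ _ (fst c) _ H2) (is_RInt_scal _ _ _ (snd c) _ H1)).
Qed.

Lemma CI_Chasles K a b c w w' : CI K a b w -> CI K b c w' -> CI K a c (Cplus w w').
Proof.
  intros [H1 H2] [H3 H4]; split; [refine (is_RInt_Chasles _ _ _ _ _ _ H1 H3)|refine (is_RInt_Chasles _ _ _ _ _ _ H2 H4)].
Qed.

Lemma CI_ex K a b : (forall x, Rmin a b <= x <= Rmax a b -> Ccont K x) -> exists w, CI K a b w.
Proof.
  intros H.
  destruct (ex_RInt_continuous (fun x => fst (K x)) a b) as [u Hu]; [intros x Hx; apply H; auto|].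
  destruct (ex_RInt_continuous (fun x => snd (K x)) a b) as [v Hv]; [intros x Hx; apply H; auto|].
  exists (u, v); split; auto.
Qed.

Lemma CI_FTC F K a b :
  (forall x, Rmin a b <= x <= Rmax a b -> CD F x (K x)) ->
  (forall x, Rmin a b <= x <= Rmax a b -> Ccont K x) ->
  CI K a b (Cminus (F b) (F a)).
Proof.
  intros H1 H2; split.
  - refine (is_RInt_derive (fun x => fst (F x)) (fun x => fst (K x)) a b _ _); intros x Hx; [apply H1|apply H2]; auto.
  - refine (is_RInt_derive (fun x => snd (F x)) (fun x => snd (K x)) a b _ _); intros x Hx; [apply H1|apply H2]; auto.
Qed.

Lemma CI_bound K g a b w G :
  a <= b -> (forall x, a <= x <= b -> Cmod (K x) <= g x) -> CI K a b w -> is_RInt g a b G ->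
  Cmod w <= G.
Proof.
  intros Hab Hg [H1 H2] HG.
  (* The norm of the product module is the Euclidean one, written with absolute values; it is
     identified with [Cmod] before the integral inequality is applied. *)
  assert (HN : forall z : CC, norm (z : C_R_NormedModule) = Cmod z).
  { intros [u v]. unfold Cmod. change (norm _) with (sqrt (Rabs u ^ 2 + Rabs v ^ 2)).
    f_equal. simpl fst; simpl snd. rewrite !pow2_abs. reflexivity. }
  rewrite <- HN.
  apply (norm_RInt_le (V := C_R_NormedModule) K g a b); auto.
  - intros x Hx; rewrite HN; auto.
  - destruct w; apply (is_RInt_fct_extend_pair K); auto.
Qed.

Lemma CI_scale K c a b w :
  CI K (c * a) (c * b) w -> CI (fun x => Cmult (RtoC c) (K (c * x))) a b w.
Proof.
  intros [H1 H2].
  rewrite <- (Rplus_0_r (c * a)), <- (Rplus_0_r (c * b)) in H1, H2.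
  apply is_RInt_comp_lin in H1. apply is_RInt_comp_lin in H2.
  split; (eapply is_RInt_ext; [|eassumption]); intros x _; simpl; rewrite Rplus_0_r;
    unfold scal; simpl; unfold mult; simpl; ring.
Qed.

(* improper integral over the half-line (0, oo) *)
Definition IG (K : R -> CC) (v : CC) : Prop :=
  forall eps, 0 < eps -> exists dl B, 0 < dl /\ 0 < B /\
    forall a b, 0 < a < dl -> B < b -> exists w, CI K a b w /\ Cmod (Cminus w v) < eps.

Lemma IG_ext K K' v : (forall x, 0 < x -> K x = K' x) -> IG K v -> IG K' v.
Proof.
  intros H HK eps He. destruct (HK eps He) as (dl & B & Hd & HB & Hw).
  exists dl, B; repeat split; auto. intros a b Ha Hb. destruct (Hw a b Ha Hb) as (w & Hw1 & Hw2).
  exists w; split; auto. eapply CI_ext; [|eassumption].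
  intros x Hx; apply H. apply Rlt_trans with (2 := proj1 Hx). apply Rmin_case; lra.
Qed.

Lemma IG_plus K K' v v' : IG K v -> IG K' v' -> IG (fun x => Cplus (K x) (K' x)) (Cplus v v').
Proof.
  intros H H' eps He.
  destruct (H (eps / 2) ltac:(lra)) as (d & B & Hd & HB & Hw).
  destruct (H' (eps / 2) ltac:(lra)) as (d' & B' & Hd' & HB' & Hw').
  exists (Rmin d d'), (Rmax B B'). repeat split.
  - apply Rmin_case; auto.
  - apply Rmax_case; auto.
  - intros a b Ha Hb.
    generalize (Rmin_l d d') (Rmin_r d d') (Rmax_l B B') (Rmax_r B B'); intros.
    destruct (Hw a b ltac:(lra) ltac:(lra)) as (w & Hw1 & Hw2).
    destruct (Hw' a b ltac:(lra) ltac:(lra)) as (w' & Hw1' & Hw2').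
    exists (Cplus w w'). split; [apply CI_plus; auto|].
    replace (Cminus (Cplus w w') (Cplus v v')) with (Cplus (Cminus w v) (Cminus w' v')) by ring.
    eapply Rle_lt_trans; [apply Cmod_triangle|]. lra.
Qed.

Lemma IG_scal K v c : IG K v -> IG (fun x => Cmult c (K x)) (Cmult c v).
Proof.
  intros H eps He.
  assert (Hc : 0 < 1 + Cmod c) by (generalize (Cmod_ge_0 c); lra).
  destruct (H (eps / (1 + Cmod c))) as (d & B & Hd & HB & Hw); [apply Rdiv_lt_0_compat; auto|].
  exists d, B; repeat split; auto. intros a b Ha Hb. destruct (Hw a b Ha Hb) as (w & Hw1 & Hw2).
  exists (Cmult c w); split; [apply CI_scal; auto|].
  replace (Cminus (Cmult c w) (Cmult c v)) with (Cmult c (Cminus w v)) by ring.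
  rewrite Cmod_mult. apply Rle_lt_trans with ((1 + Cmod c) * Cmod (w - v)).
  - apply Rmult_le_compat_r; [apply Cmod_ge_0|lra].
  - apply Rmult_lt_compat_l with (r := 1 + Cmod c) in Hw2; auto.
    replace ((1 + Cmod c) * (eps / (1 + Cmod c))) with eps in Hw2 by (field; lra). auto.
Qed.

Lemma IG_unique K v v' : IG K v -> IG K v' -> v = v'.
Proof.
  intros H H'. assert (E : Cminus v v' = RtoC 0).
  { apply Cmod_eq_0. apply Rle_antisym; [|apply Cmod_ge_0].
    apply le_epsilon. intros eps He.
    destruct (H (eps / 2) ltac:(lra)) as (d & B & Hd & HB & Hw).
    destruct (H' (eps / 2) ltac:(lra)) as (d' & B' & Hd' & HB' & Hw').
    assert (Ha : 0 < Rmin d d') by (apply Rmin_case; auto).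
    generalize (Rmin_l d d') (Rmin_r d d') (Rmax_l B B') (Rmax_r B B'); intros.
    destruct (Hw (Rmin d d' / 2) (Rmax B B' + 1) ltac:(lra) ltac:(lra)) as (w & Hw1 & Hw2).
    destruct (Hw' (Rmin d d' / 2) (Rmax B B' + 1) ltac:(lra) ltac:(lra)) as (w' & Hw1' & Hw2').
    rewrite (CI_unique _ _ _ _ _ Hw1' Hw1) in Hw2'.
    replace (Cminus v v') with (Cplus (Cminus w v') (Copp (Cminus w v))) by ring.
    rewrite Rplus_0_l. eapply Rle_trans; [apply Cmod_triangle|]. rewrite Cmod_opp. lra. }
  replace v with (Cplus (Cminus v v') v') by ring. rewrite E. ring.
Qed.

(** The link with the filter limit in the definition of [CGamma]: the two thresholds of [IG] give a
    neighbourhood of 0 on the right and one of infinity. *)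
Lemma IG_RInt_gen K v : IG K v ->
  RInt_gen (V := C_R_CompleteNormedModule) K (at_right 0) (Rbar_locally p_infty) = v.
Proof.
  intros H. apply (is_RInt_gen_unique (V := C_R_CompleteNormedModule)).
  intros P [eps HP].
  destruct (H eps (cond_pos eps)) as (d & B & Hd & HB & Hw).
  exists (fun a => 0 < a < d) (fun b => B < b).
  - exists (mkposreal d Hd). intros y Hy Hy0. split; auto.
    unfold ball in Hy; simpl in Hy; unfold AbsRing_ball in Hy; simpl in Hy.
    unfold minus, plus, opp, abs in Hy; simpl in Hy. rewrite Ropp_0, Rplus_0_r in Hy.
    apply Rabs_lt_between in Hy. lra.
  - exists B; auto.
  - intros a b Ha Hb. destruct (Hw a b Ha Hb) as (w & [H1 H2] & Hw2).
    exists w. split; [destruct w; apply (is_RInt_fct_extend_pair K); auto|].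
    apply HP. generalize (Rmax_Cmod (w - v)%C); intros HM.
    generalize (Rmax_l (Rabs (fst (w - v)%C)) (Rabs (snd (w - v)%C))) (Rmax_r (Rabs (fst (w - v)%C)) (Rabs (snd (w - v)%C))).
    intros. split; (apply Rle_lt_trans with (2 := Hw2)); eapply Rle_trans; eauto.
Qed.

(** x^(-1/2) / (1 + x) is the common majorant of the Mellin integrands. Its primitive is elementary,
    which makes both tails explicit and the total mass equal to [PI]. *)
Lemma is_derive_atan_sqrt x : 0 < x -> is_derive (fun x => 2 * atan (sqrt x)) x (/ sqrt x * / (1 + x)).
Proof.
  intros Hx. assert (0 < sqrt x) by (apply sqrt_lt_R0; auto).
  auto_derive; auto.
  rewrite (Rmult_1_r (sqrt x)), sqrt_sqrt by lra.
  field. split; lra.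
Qed.

Lemma atan_le_id x : 0 <= x -> atan x <= x.
Proof.
  intros [Hx|<-]; [|rewrite atan_0; lra].
  destruct (MVT_gen atan 0 x (fun y => / (1 + y ^ 2))) as (c & Hc & E).
  - intros y _. auto_derive; auto. field. nra.
  - intros y _. apply continuity_pt_filterlim, (ex_derive_continuous (V := R_NormedModule)).
    auto_derive; auto.
  - rewrite atan_0 in E. assert (/ (1 + c ^ 2) <= 1).
    { rewrite <- Rinv_1. apply Rinv_le_contravar; [lra|]. nra. }
    nra.
Qed.

Lemma atan_sqrt_inf b : 0 < b -> PI / 2 - atan (sqrt b) <= / sqrt b.
Proof.
  intros Hb. assert (0 < sqrt b) by (apply sqrt_lt_R0; auto).
  rewrite <- atan_inv by auto. apply atan_le_id. left; apply Rinv_0_lt_compat; auto.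
Qed.

Lemma CI_dom_bound K C a b w :
  (forall x, 0 < x -> Cmod (K x) <= / sqrt x * (C / (1 + x))) -> 0 < a <= b -> CI K a b w ->
  Cmod w <= C * (2 * atan (sqrt b) - 2 * atan (sqrt a)).
Proof.
  intros HK Hab Hw.
  apply (CI_bound K (fun x => scal C (/ sqrt x * / (1 + x))) a b w); [lra| |auto|].
  - intros x Hx. eapply Rle_trans; [apply HK; lra|]. right. unfold scal; simpl; unfold mult; simpl. field.
    split; [lra|]. apply Rgt_not_eq, sqrt_lt_R0; lra.
  - apply (is_RInt_scal (V := R_NormedModule)).
    rewrite <- (Rplus_0_r (2 * atan (sqrt b) - 2 * atan (sqrt a))), Rplus_0_r.
    refine (is_RInt_derive (fun x => 2 * atan (sqrt x)) (fun x => / sqrt x * / (1 + x)) a b _ _).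
    + intros x Hx. rewrite Rmin_left in Hx by lra. apply is_derive_atan_sqrt; lra.
    + intros x Hx. rewrite Rmin_left in Hx by lra.
      assert (0 < sqrt x) by (apply sqrt_lt_R0; lra).
      apply (ex_derive_continuous (V := R_NormedModule)). auto_derive. repeat split; lra.
Qed.

Lemma inv_sqrt_small e : 0 < e -> exists n, / sqrt (INR n + 1) < e.
Proof.
  intros He.
  destruct (nfloor_ex (/ e ^ 2)) as [n [_ Hn]].
  { left; apply Rinv_0_lt_compat; nra. }
  exists n. rewrite <- (Rinv_inv e). apply Rinv_lt_contravar.
  - apply Rmult_lt_0_compat; [apply Rinv_0_lt_compat; auto|]. apply sqrt_lt_R0. generalize (pos_INR n); lra.
  - rewrite <- (sqrt_pow2 (/ e)) by (left; apply Rinv_0_lt_compat; auto).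
    apply sqrt_lt_1_alt. split; [apply pow2_ge_0|]. rewrite pow_inv. auto.
Qed.

Lemma inv_sqrt_le x y : 0 < x <= y -> / sqrt y <= / sqrt x.
Proof.
  intros H. apply Rinv_le_contravar; [apply sqrt_lt_R0; lra|apply sqrt_le_1_alt; lra].
Qed.

Lemma Un_cv_le_dist (u : nat -> R) l c N :
  Un_cv u l -> (forall m, (N <= m)%nat -> Rabs (u m - u N) <= c) -> Rabs (l - u N) <= c.
Proof.
  intros Hu Hc. apply le_epsilon. intros e He.
  destruct (Hu e He) as [n Hn]. specialize (Hn (n + N)%nat ltac:(lia)). unfold R_dist in Hn.
  specialize (Hc (n + N)%nat ltac:(lia)).
  replace (l - u N) with ((u (n + N)%nat - u N) - (u (n + N)%nat - l)) by ring.
  eapply Rle_trans; [apply Rabs_triang|]. rewrite Rabs_Ropp. lra.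
Qed.

(** The rate n^(-1/2) is that of both tails of the majorant when (0, oo) is cut down to [1/n, n]. *)
Lemma Cauchy_explicit (u : nat -> R) (C : R) : 0 <= C ->
  (forall n m, (n <= m)%nat -> Rabs (u m - u n) <= C * / sqrt (INR n + 1)) ->
  exists l, forall n, Rabs (l - u n) <= C * / sqrt (INR n + 1).
Proof.
  intros HC Hu.
  destruct (R_complete u) as [l Hl].
  - intros e He. destruct (inv_sqrt_small (e / (2 * C + 1))) as [N HN].
    { apply Rdiv_lt_0_compat; lra. }
    exists N. intros n m Hn Hm. unfold R_dist.
    replace (u n - u m) with ((u n - u N) - (u m - u N)) by ring.
    eapply Rle_lt_trans; [apply Rabs_triang|]. rewrite Rabs_Ropp.
    generalize (Hu N n ltac:(lia)) (Hu N m ltac:(lia)); intros.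
    apply Rle_lt_trans with ((2 * C) * / sqrt (INR N + 1)); [lra|].
    apply Rle_lt_trans with ((2 * C) * (e / (2 * C + 1))).
    + apply Rmult_le_compat_l; lra.
    + apply Rmult_lt_reg_r with (2 * C + 1); [lra|]. field_simplify; lra.
  - exists l. intros n. apply Un_cv_le_dist; auto.
Qed.

Lemma IG_dom K C : 0 <= C ->
  (forall x, 0 < x -> Ccont K x) ->
  (forall x, 0 < x -> Cmod (K x) <= / sqrt x * (C / (1 + x))) ->
  exists v, IG K v /\ Cmod v <= C * PI.
Proof.
  intros HC Hc HK.
  assert (Hex : forall a b, 0 < a -> 0 < b -> exists w, CI K a b w).
  { intros a b Ha Hb. apply CI_ex. intros x Hx. apply Hc.
    apply Rlt_le_trans with (2 := proj1 Hx). apply Rmin_case; auto. }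
  assert (Hn1 : forall n, 0 < / (INR n + 1) <= INR n + 1).
  { intros n. generalize (pos_INR n); intros. split; [apply Rinv_0_lt_compat; lra|].
    apply Rle_trans with 1; [|lra]. rewrite <- Rinv_1. apply Rinv_le_contravar; lra. }
  assert (Hw : exists w : nat -> CC, forall n, CI K (/ (INR n + 1)) (INR n + 1) (w n)).
  { apply (choice (fun n w => CI K (/ (INR n + 1)) (INR n + 1) w)).
    intros n. apply Hex; generalize (Hn1 n); lra. }
  destruct Hw as [w Hw].
  (* Two tails are added: near 0 the bound is atan u <= u with u the square root of the endpoint,
     near infinity it is PI/2 - atan u <= 1/u. *)
  assert (Hest : forall n a b v, 0 < a <= / (INR n + 1) -> INR n + 1 <= b -> CI K a b v ->
            Cmod (Cminus v (w n)) <= 4 * C * / sqrt (INR n + 1)).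
  { intros n a b v Ha Hb Hv. generalize (Hn1 n); intros Hn.
    destruct (Hex a (/ (INR n + 1))) as [u1 Hu1]; [lra|lra|].
    destruct (Hex (INR n + 1) b) as [u2 Hu2]; [lra|lra|].
    assert (E : v = Cplus (Cplus u1 (w n)) u2).
    { eapply CI_unique; [exact Hv|]. eapply CI_Chasles; [|exact Hu2]. eapply CI_Chasles; eauto. }
    rewrite E. replace (Cminus _ _) with (Cplus u1 u2) by ring.
    eapply Rle_trans; [apply Cmod_triangle|].
    apply (CI_dom_bound K C) in Hu1; [|auto|lra]. apply (CI_dom_bound K C) in Hu2; [|auto|lra].
    assert (0 <= atan (sqrt a)).
    { rewrite <- atan_0. destruct (sqrt_pos a) as [H|H]; [left; apply atan_increasing; auto|rewrite <- H; lra]. }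
    generalize (atan_le_id (sqrt (/ (INR n + 1))) (sqrt_pos _)).
    generalize (atan_sqrt_inf (INR n + 1) ltac:(lra)).
    generalize (proj2 (atan_bound (sqrt b))).
    rewrite (sqrt_inv (INR n + 1)) in *. intros I1 I2 I3.
    set (X := / sqrt (INR n + 1)) in *.
    assert (C * (2 * atan X - 2 * atan (sqrt a)) <= C * (2 * X)) by (apply Rmult_le_compat_l; lra).
    assert (C * (2 * atan (sqrt b) - 2 * atan (sqrt (INR n + 1))) <= C * (2 * X)) by (apply Rmult_le_compat_l; lra).
    lra. }
  assert (Hnm : forall n m, (n <= m)%nat -> Cmod (Cminus (w m) (w n)) <= 4 * C * / sqrt (INR n + 1)).
  { intros n m Hnm. apply le_INR in Hnm.
    apply (Hest n (/ (INR m + 1)) (INR m + 1)); [|lra|apply Hw].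
    generalize (pos_INR n); intros.
    split; [apply Rinv_0_lt_compat; lra|apply Rinv_le_contravar; lra]. }
  assert (Hre : forall z : CC, Rabs (fst z) <= Cmod z) by (intros z; eapply Rle_trans; [apply Rmax_l|apply Rmax_Cmod]).
  assert (Him : forall z : CC, Rabs (snd z) <= Cmod z) by (intros z; eapply Rle_trans; [apply Rmax_r|apply Rmax_Cmod]).
  destruct (Cauchy_explicit (fun n => fst (w n)) (4 * C) ltac:(lra)) as [l1 Hl1].
  { intros n m H. eapply Rle_trans; [|apply (Hnm n m H)]. apply (Hre (w m - w n)%C). }
  destruct (Cauchy_explicit (fun n => snd (w n)) (4 * C) ltac:(lra)) as [l2 Hl2].
  { intros n m H. eapply Rle_trans; [|apply (Hnm n m H)]. apply (Him (w m - w n)%C). }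
  assert (Hlim : forall n, Cmod (Cminus (w n) (l1, l2)) <= 8 * C * / sqrt (INR n + 1)).
  { intros n. replace (Cminus (w n) (l1, l2)) with
      (Copp (Cplus (RtoC (l1 - fst (w n))) (Cmult Ci (RtoC (l2 - snd (w n)))))).
    - rewrite Cmod_opp. eapply Rle_trans; [apply Cmod_triangle|].
      rewrite Cmod_mult, Cmod_Ci, !Cmod_R. generalize (Hl1 n) (Hl2 n); simpl; lra.
    - unfold Cminus, Copp, Cplus, Cmult, RtoC, Ci; destruct (w n); simpl; f_equal; ring. }
  assert (HIG : IG K (l1, l2)).
  { intros e He.
    destruct (inv_sqrt_small (e / (12 * C + 1))) as [n Hn].
    { apply Rdiv_lt_0_compat; lra. }
    exists (/ (INR n + 1)), (INR n + 1). generalize (Hn1 n); intros Hn'.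
    split; [lra|split; [lra|]].
    intros a b Ha Hb. destruct (Hex a b) as [v Hv]; [lra|lra|].
    exists v; split; auto.
    replace (Cminus v (l1, l2)) with (Cplus (Cminus v (w n)) (Cminus (w n) (l1, l2))) by ring.
    eapply Rle_lt_trans; [apply Cmod_triangle|].
    specialize (Hest n a b v ltac:(lra) ltac:(lra) Hv). specialize (Hlim n).
    apply Rle_lt_trans with (12 * C * / sqrt (INR n + 1)); [lra|].
    apply Rle_lt_trans with (12 * C * (e / (12 * C + 1))).
    + apply Rmult_le_compat_l; lra.
    + apply Rmult_lt_reg_r with (12 * C + 1); [lra|]. field_simplify; lra. }
  exists (l1, l2). split; auto.
  apply le_epsilon. intros e He. destruct (HIG e He) as (d & B & Hd & HB & H).
  set (a := Rmin d 1 / 2). assert (0 < Rmin d 1) by (apply Rmin_case; lra).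
  generalize (Rmin_l d 1) (Rmin_r d 1); intros.
  destruct (H a (B + 1)) as (v & Hv & Hv'); [unfold a; lra|lra|].
  replace (l1, l2) with (Cplus v (Copp (Cminus v (l1, l2)))) by ring.
  eapply Rle_trans; [apply Cmod_triangle|]. rewrite Cmod_opp.
  apply (CI_dom_bound K C) in Hv; [|auto|unfold a; lra].
  assert (0 <= atan (sqrt a)).
  { rewrite <- atan_0. destruct (sqrt_pos a) as [H'|H']; [left; apply atan_increasing; auto|rewrite <- H'; lra]. }
  generalize (proj2 (atan_bound (sqrt (B + 1)))). intros I1.
  assert (C * (2 * atan (sqrt (B + 1)) - 2 * atan (sqrt a)) <= C * PI) by (apply Rmult_le_compat_l; lra).
  lra.
Qed.

(** * The Mellin transform on the critical line *)

(* [Kf t f x = x^(s-1) f(x)] with [s = 1/2 + i t] *)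
Definition Kf (t : R) (f : R -> R) (x : R) : CC :=
  (/ sqrt x * cos (t * ln x) * f x, / sqrt x * sin (t * ln x) * f x).

Definition mellin (t : R) (f : R -> R) (v : CC) : Prop := IG (Kf t f) v.

Lemma Kf_cis t f x : Kf t f x = Cmult (RtoC (/ sqrt x * f x)) (cis (t * ln x)).
Proof. unfold Kf, cis, Cmult, RtoC; simpl; f_equal; ring. Qed.

Lemma Cmod_Kf t f x : 0 < x -> Cmod (Kf t f x) = / sqrt x * Rabs (f x).
Proof.
  intros Hx. rewrite Kf_cis, Cmod_mult, Cmod_cis, Cmod_R, Rabs_mult, Rmult_1_r.
  rewrite (Rabs_right (/ sqrt x)); auto. apply Rle_ge; left; apply Rinv_0_lt_compat, sqrt_lt_R0; auto.
Qed.

Lemma Ccont_Kf t f x : 0 < x -> continuous f x -> Ccont (Kf t f) x.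
Proof.
  intros Hx Hf. assert (0 < sqrt x) by (apply sqrt_lt_R0; auto).
  split; simpl; apply (continuous_mult (K := R_AbsRing)); auto;
    apply (ex_derive_continuous (V := R_NormedModule)); auto_derive; repeat split; lra.
Qed.

Lemma mellin_dom t f C : 0 <= C ->
  (forall x, 0 < x -> continuous f x) -> (forall x, 0 < x -> Rabs (f x) <= C / (1 + x)) ->
  exists v, mellin t f v /\ Cmod v <= C * PI.
Proof.
  intros HC Hc Hb. apply IG_dom; auto.
  - intros x Hx; apply Ccont_Kf; auto.
  - intros x Hx; rewrite Cmod_Kf by auto. apply Rmult_le_compat_l; auto.
    left; apply Rinv_0_lt_compat, sqrt_lt_R0; auto.
Qed.

Lemma mellin_unique t f v v' : mellin t f v -> mellin t f v' -> v = v'.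
Proof. apply IG_unique. Qed.

Lemma mellin_ext t f g v : (forall x, 0 < x -> f x = g x) -> mellin t f v -> mellin t g v.
Proof. intros H; apply IG_ext; intros x Hx; unfold Kf; rewrite H; auto. Qed.

Lemma mellin_plus t f g v w : mellin t f v -> mellin t g w -> mellin t (fun x => f x + g x) (Cplus v w).
Proof.
  intros H H'. eapply IG_ext; [|apply (IG_plus _ _ _ _ H H')].
  intros x _; unfold Kf, Cplus; simpl; f_equal; ring.
Qed.

Lemma mellin_scal t f v c : mellin t f v -> mellin t (fun x => c * f x) (Cmult (RtoC c) v).
Proof.
  intros H. eapply IG_ext; [|apply (IG_scal _ _ (RtoC c) H)].
  intros x _; unfold Kf, Cmult, RtoC; simpl; f_equal; ring.
Qed.

Lemma mellin_minus t f g v w : mellin t f v -> mellin t g w -> mellin t (fun x => f x - g x) (Cminus v w).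
Proof.
  intros H H'. apply (mellin_scal _ _ _ (Ropp 1)) in H'. eapply mellin_ext; [|].
  2: { replace (Cminus v w) with (Cplus v (Cmult (RtoC (Ropp 1)) w)); [apply mellin_plus; eassumption|].
       rewrite RtoC_opp; ring. }
  intros x _; simpl; ring.
Qed.

Lemma IG_scale K v c : 0 < c -> IG K v -> IG (fun x => Cmult (RtoC c) (K (c * x))) v.
Proof.
  intros Hc H e He. destruct (H e He) as (d & B & Hd & HB & Hw).
  exists (d / c), (B / c). split; [apply Rdiv_lt_0_compat; auto|]. split; [apply Rdiv_lt_0_compat; auto|].
  intros a b Ha Hb.
  destruct (Hw (c * a) (c * b)) as (w & H1 & H2).
  - split; [apply Rmult_lt_0_compat; lra|]. apply Rmult_lt_reg_r with (/ c); [apply Rinv_0_lt_compat; auto|].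
    replace (c * a * / c) with a by (field; lra). apply Ha.
  - apply Rmult_lt_reg_r with (/ c); [apply Rinv_0_lt_compat; auto|].
    replace (c * b * / c) with b by (field; lra). apply Hb.
  - exists w; split; auto. apply CI_scale; auto.
Qed.

(** Dilation by c multiplies the transform by c^(-s), which at s = 1/2 + i t is c^(-1/2) times
    [cis (- (t * ln c))]. *)
Lemma mellin_scale t f v c : 0 < c -> mellin t f v ->
  mellin t (fun x => f (c * x)) (Cmult (Cmult (RtoC (/ sqrt c)) (cis (- (t * ln c)))) v).
Proof.
  intros Hc H. assert (Hs : 0 < sqrt c) by (apply sqrt_lt_R0; auto).
  eapply IG_ext; [|apply IG_scal, (IG_scale _ _ c Hc H)].
  intros x Hx. assert (Hsx : 0 < sqrt x) by (apply sqrt_lt_R0; auto).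
  rewrite !Kf_cis, ln_mult, sqrt_mult by lra.
  replace (t * (ln c + ln x)) with (t * ln c + t * ln x) by ring.
  rewrite cis_add.
  transitivity (Cmult (Cmult (RtoC (/ sqrt c * (c * (/ (sqrt c * sqrt x) * f (c * x)))))
     (Cmult (cis (- (t * ln c))) (cis (t * ln c)))) (cis (t * ln x))).
  - rewrite !RtoC_mult. ring.
  - rewrite <- cis_add, Rplus_opp_l, cis_0, Cmult_1_r. f_equal. f_equal.
    rewrite <- (sqrt_sqrt c) at 2 by lra. field. split; lra.
Qed.

Lemma mellin_bound t f v C lam : 0 <= C -> 0 < lam ->
  (forall x, 0 < x -> continuous f x) -> (forall x, 0 < x -> Rabs (f x) <= C / (1 + lam * x)) ->
  mellin t f v -> Cmod v <= C * PI / sqrt lam.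
Proof.
  intros HC Hl Hc Hb Hv.
  assert (Hil : 0 < / lam) by (apply Rinv_0_lt_compat; auto).
  assert (Hs : 0 < sqrt lam) by (apply sqrt_lt_R0; auto).
  destruct (mellin_dom t (fun x => f (/ lam * x)) C HC) as (w & Hw & Hw').
  - intros x Hx. apply (continuous_comp (fun x => / lam * x) f).
    + apply (ex_derive_continuous (V := R_NormedModule)). auto_derive; auto.
    + apply Hc. apply Rmult_lt_0_compat; auto.
  - intros x Hx. eapply Rle_trans; [apply Hb, Rmult_lt_0_compat; auto|].
    right. f_equal. field. lra.
  - rewrite (mellin_unique _ _ _ _ Hw (mellin_scale _ _ _ _ Hil Hv)) in Hw'.
    rewrite !Cmod_mult, Cmod_cis, Cmod_R, sqrt_inv, Rinv_inv, Rabs_right in Hw' by lra.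
    apply Rmult_le_reg_l with (sqrt lam); auto. field_simplify; lra.
Qed.

(** * Gauss's product for the Gamma function *)

Lemma exp_pow_nat x n : exp (INR n * x) = exp x ^ n.
Proof.
  induction n as [|n IH]; [simpl; rewrite Rmult_0_l; apply exp_0|].
  rewrite S_INR, Rmult_plus_distr_r, Rmult_1_l, exp_plus, IH. simpl; ring.
Qed.

(** The fourth power of 1 + u <= e^u gives a minorant of degree 4 with positive coefficients, which
    absorbs x^2 + x^3 below; the coefficient 1/16 of x^3 explains a constant such as 19. *)
Lemma exp_lower4 x : 0 <= x -> (1 + x / 4) ^ 4 <= exp x.
Proof.
  intros Hx. replace (exp x) with (exp (x / 4) ^ 4).
  - apply pow_incr. split; [lra|]. generalize (exp_ineq1_le (x / 4)); lra.
  - rewrite <- exp_pow_nat. f_equal. simpl. field.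
Qed.

(** At x / n this is Gauss's approximation (1 - x/n)^n to e^(-x), cut off at x = n. Its Mellin
    transform is a beta integral. *)
Definition gauss_f (n : nat) (x : R) : R := Rmax 0 (1 - x) ^ n.

Lemma bernoulli_le u n : 0 <= u <= 1 -> 1 - INR n * u <= (1 - u) ^ n.
Proof.
  intros Hu. induction n as [|n IH]; [simpl; lra|].
  rewrite S_INR. simpl pow.
  assert (0 <= (1 - u) ^ n) by (apply pow_le; lra).
  assert (0 <= INR n) by apply pos_INR.
  assert ((1 - u) * (1 - INR n * u) <= (1 - u) * (1 - u) ^ n) by (apply Rmult_le_compat_l; lra).
  nra.
Qed.

(** The difference lies between 0 and e^(-x) x^2 / n. For u = x/n <= 1 this follows from (1 - u)^n
    >= e^(-x) (1 - u^2)^n and Bernoulli's inequality; for u > 1 the approximation vanishes and x^2 /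
    n exceeds 1. *)
Lemma gauss_approx n x : (1 <= n)%nat -> 0 < x ->
  Rabs (exp (- x) - gauss_f n (x / INR n)) <= 19 / INR n / (1 + x).
Proof.
  intros Hn Hx. assert (HN : 1 <= INR n) by (apply (le_INR 1); auto).
  assert (He : 0 < exp x) by apply exp_pos.
  assert (H2 : exp (- x) * x ^ 2 / INR n <= 19 / INR n / (1 + x)).
  { rewrite exp_Ropp. apply Rmult_le_reg_r with (INR n * (1 + x) * exp x).
    - repeat apply Rmult_lt_0_compat; lra.
    - replace (/ exp x * x ^ 2 / INR n * (INR n * (1 + x) * exp x)) with (x ^ 2 * (1 + x)) by (field; lra).
      replace (19 / INR n / (1 + x) * (INR n * (1 + x) * exp x)) with (19 * exp x) by (field; lra).
      generalize (exp_lower4 x ltac:(lra)). intros.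
      assert (0 <= x ^ 4) by (apply pow_le; lra).
      assert (0 <= x ^ 3) by (apply pow_le; lra). assert (0 <= x ^ 2) by (apply pow_le; lra).
      replace ((1 + x / 4) ^ 4) with (1 + x + 6 / 16 * x ^ 2 + / 16 * x ^ 3 + / 256 * x ^ 4) in H by field.
      replace (x ^ 2 * (1 + x)) with (x ^ 2 + x ^ 3) by ring. lra. }
  eapply Rle_trans; [|exact H2]. unfold gauss_f.
  set (u := x / INR n).
  assert (Hu : 0 < u) by (apply Rdiv_lt_0_compat; lra).
  assert (Eu : INR n * u = x) by (unfold u; field; lra).
  assert (Hen : exp (- x) = exp (- u) ^ n).
  { rewrite <- exp_pow_nat. f_equal. rewrite <- Eu. ring. }
  destruct (Rle_dec u 1) as [Hu1|Hu1].
  - rewrite Rmax_right by lra.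
    assert (A1 : (1 - u) ^ n <= exp (- x)).
    { rewrite Hen. apply pow_incr. split; [lra|]. generalize (exp_ineq1_le (- u)); lra. }
    rewrite Rabs_right by lra.
    assert (A2 : exp (- x) * (1 - INR n * u ^ 2) <= (1 - u) ^ n).
    { apply Rle_trans with (exp (- x) * (1 - u ^ 2) ^ n).
      - apply Rmult_le_compat_l; [left; apply exp_pos|]. apply bernoulli_le. nra.
      - rewrite Hen. rewrite <- Rpow_mult_distr. apply pow_incr.
        assert (0 < exp (- u)) by apply exp_pos.
        split; [apply Rmult_le_pos; [lra|nra]|]. replace (1 - u ^ 2) with ((1 + u) * (1 - u)) by ring.
        assert (exp (- u) * (1 + u) <= 1).
        { rewrite exp_Ropp. assert (0 < exp u) by apply exp_pos. apply Rmult_le_reg_l with (exp u); auto.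
          rewrite <- Rmult_assoc, Rinv_r by lra. generalize (exp_ineq1_le u); lra. }
        rewrite <- Rmult_assoc. rewrite <- (Rmult_1_l (1 - u)) at 2. apply Rmult_le_compat_r; lra. }
    replace (exp (- x) * x ^ 2 / INR n) with (exp (- x) * (INR n * u ^ 2)); [lra|].
    unfold u. field. lra.
  - rewrite Rmax_left by lra. rewrite pow_i by lia. rewrite Rminus_0_r.
    rewrite Rabs_right by (left; apply exp_pos).
    assert (0 < exp (- x)) by apply exp_pos.
    assert (1 <= x ^ 2 / INR n).
    { rewrite <- Eu. replace ((INR n * u) ^ 2 / INR n) with (INR n * u ^ 2) by (field; lra). nra. }
    unfold Rdiv in *. rewrite Rmult_assoc. nra.
Qed.

(* [pw t P y = y^s P(y)] with [s = 1/2 + i t] *)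
Definition pw (t : R) (P : R -> R) (y : R) : CC :=
  (sqrt y * cos (t * ln y) * P y, sqrt y * sin (t * ln y) * P y).

Lemma pw_cis t P y : pw t P y = Cmult (RtoC (sqrt y * P y)) (cis (t * ln y)).
Proof. unfold pw, cis, Cmult, RtoC; simpl; f_equal; ring. Qed.

Lemma CD_pw t P dP y : 0 < y -> is_derive P y dP ->
  CD (pw t P) y (Cplus (Cmult (/ 2, t) (Kf t P y)) (Kf t (fun x => x * dP) y)).
Proof.
  intros Hy HP. assert (Hs : 0 < sqrt y) by (apply sqrt_lt_R0; auto).
  assert (HD : forall (f : R -> R) (df : R), is_derive f y df ->
     is_derive (fun y => f y * P y) y (df * P y + f y * dP)).
  { intros f df Hf. apply (is_derive_mult f P y df dP); auto. intros; apply Rmult_comm. }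
  split; simpl.
  - evar_last.
    + apply HD. instantiate (1 := / (2 * sqrt y) * cos (t * ln y) - sqrt y * sin (t * ln y) * (t * / y)).
      auto_derive; [repeat split; auto|]. field. repeat split; lra.
    + replace (/ y) with (/ (sqrt y * sqrt y)) by (rewrite sqrt_sqrt; lra).
      replace (/ sqrt y * cos (t * ln y) * (y * dP)) with (/ sqrt y * cos (t * ln y) * (sqrt y * sqrt y * dP)) by (rewrite sqrt_sqrt; lra).
      field. lra.
  - evar_last.
    + apply HD. instantiate (1 := / (2 * sqrt y) * sin (t * ln y) + sqrt y * cos (t * ln y) * (t * / y)).
      auto_derive; [repeat split; auto|]. field. repeat split; lra.
    + replace (/ y) with (/ (sqrt y * sqrt y)) by (rewrite sqrt_sqrt; lra).
      replace (/ sqrt y * sin (t * ln y) * (y * dP)) with (/ sqrt y * sin (t * ln y) * (sqrt y * sqrt y * dP)) by (rewrite sqrt_sqrt; lra).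
      field. lra.
Qed.

(** Integration by parts in Mellin form, from (y^s P)' = y^(s-1) (s P + y P'). It yields the
    recursion for the beta integral and the integrals of powers. *)
Lemma CI_pw t P dP a b : 0 < a <= b ->
  (forall y, a <= y <= b -> is_derive P y (dP y)) ->
  (forall y, a <= y <= b -> continuous dP y) ->
  CI (fun y => Cplus (Cmult (/ 2, t) (Kf t P y)) (Kf t (fun x => x * dP x) y)) a b
     (Cminus (pw t P b) (pw t P a)).
Proof.
  intros Hab HP Hc.
  assert (Hcont : forall y, a <= y <= b ->
    Ccont (fun y => Cplus (Cmult (/ 2, t) (Kf t P y)) (Kf t (fun x => x * dP x) y)) y).
  { intros y Hy.
    assert (HP' : continuous P y).
    { apply (ex_derive_continuous (V := R_NormedModule)). eexists; apply HP; auto. }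
    destruct (Ccont_Kf t P y) as [A1 A2]; [lra|auto|].
    destruct (Ccont_Kf t (fun x => x * dP x) y) as [B1 B2]; [lra| |].
    { apply (continuous_mult (K := R_AbsRing) (fun x => x) dP); [apply continuous_id|auto]. }
    split; simpl.
    - apply (continuous_plus (V := R_NormedModule)); [|exact B1].
      apply (continuous_minus (V := R_NormedModule)); apply (continuous_scal_r (V := R_NormedModule)); assumption.
    - apply (continuous_plus (V := R_NormedModule)); [|exact B2].
      apply (continuous_plus (V := R_NormedModule)); apply (continuous_scal_r (V := R_NormedModule)); assumption. }
  apply CI_FTC; rewrite Rmin_left, Rmax_right by lra; auto.
  intros y Hy. apply (CD_pw t P (dP y)); [lra|auto].
Qed.

(* [bbeta t n = n! / (s (s + 1) ... (s + n))] with [s = 1/2 + i t]; [brho t n] below is its modulus. *)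
Fixpoint bbeta (t : R) (n : nat) : CC :=
  match n with
  | O => Cinv (/ 2, t)
  | S m => Cmult (Cdiv (RtoC (INR (S m))) (/ 2 + INR (S m), t)) (bbeta t m)
  end.

Lemma pair_neq_0 (x y : R) : 0 < x -> (x, y) <> RtoC 0.
Proof. intros Hx H. injection H; intros. lra. Qed.

Lemma Cmod_ge_fst (x y : R) : x <= Cmod (x, y).
Proof.
  eapply Rle_trans; [apply Rle_abs|]. eapply Rle_trans; [|apply Rmax_Cmod]. apply (Rmax_l (Rabs x)).
Qed.

Lemma Cmod_pw t P y : Cmod (pw t P y) = sqrt y * Rabs (P y).
Proof.
  rewrite pw_cis, Cmod_mult, Cmod_cis, Cmod_R, Rabs_mult, Rmult_1_r, (Rabs_right (sqrt y)); auto.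
  apply Rle_ge, sqrt_pos.
Qed.

Lemma is_derive_pow1 n y : is_derive (fun y => (1 - y) ^ S n) y (- (INR (S n) * (1 - y) ^ n)).
Proof.
  auto_derive; auto. change (match n with 0%nat => 1 | S _ => INR n + 1 end) with (INR (S n)).
  unfold Nat.pred. unfold Rminus. ring.
Qed.

(** Induction by parts: for P = (1 - y)^(n+1) one has y P' = (n+1) ((1 - y)^(n+1) - (1 - y)^n),
    hence (s + n + 1) I_(n+1) = (n + 1) I_n up to the boundary term at [a], which is of order sqrt
    a. *)
Lemma beta_integral t n : exists C, 0 <= C /\ forall a, 0 < a <= 1 ->
  exists w, CI (Kf t (fun y => (1 - y) ^ n)) a 1 w /\ Cmod (Cminus w (bbeta t n)) <= C * sqrt a.
Proof.
  induction n as [|n (C & HC & IH)].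
  - exists 2. split; [lra|]. intros a Ha.
    exists (Cmult (Cinv (/ 2, t)) (Cminus (pw t (fun _ => 1) 1) (pw t (fun _ => 1) a))).
    assert (Hz : (/ 2, t) <> RtoC 0) by (apply pair_neq_0; lra).
    split.
    + apply CI_ext with (K := fun y => Cmult (Cinv (/ 2, t))
         (Cplus (Cmult (/ 2, t) (Kf t (fun _ => 1) y)) (Kf t (fun x => x * 0) y))).
      * intros y _. replace (Kf t (fun x => x * 0) y) with (RtoC 0).
        2: { unfold Kf, RtoC; f_equal; ring. }
        rewrite Cplus_0_r, Cmult_assoc, Cinv_l by auto. rewrite Cmult_1_l. reflexivity.
      * apply CI_scal. apply (CI_pw t (fun _ => 1) (fun _ => 0)); [lra| |].
        -- intros; apply (is_derive_const (V := R_NormedModule) 1).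
        -- intros; apply continuous_const.
    + simpl bbeta. replace (pw t (fun _ => 1) 1) with (RtoC 1).
      2: { rewrite pw_cis, ln_1, Rmult_0_r, cis_0, sqrt_1, Rmult_1_l. ring. }
      cmod_replace (- (/ (/ 2, t)%R * pw t (fun _ => 1%R) a))%C.
      rewrite Cmod_opp, Cmod_mult, Cmod_inv, Cmod_pw, Rabs_R1, Rmult_1_r by auto.
      apply Rmult_le_compat_r; [apply sqrt_pos|].
      rewrite <- (Rinv_inv 2) at 2. apply Rinv_le_contravar; [lra|]. apply Cmod_ge_fst.
  - exists (2 * (INR (S n) * C + 1)). assert (HN : 0 <= INR (S n)) by apply pos_INR.
    split; [nra|]. intros a Ha.
    destruct (IH a Ha) as (w & Hw & Hwb).
    destruct (CI_ex (Kf t (fun y => (1 - y) ^ S n)) a 1) as [u Hu].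
    { intros x Hx. rewrite Rmin_left in Hx by lra. apply Ccont_Kf; [lra|].
      apply (ex_derive_continuous (V := R_NormedModule)). eexists; apply is_derive_pow1. }
    exists u. split; auto.
    assert (Hz : (/ 2 + INR (S n), t) <> RtoC 0) by (apply pair_neq_0; lra).
    assert (E : Cminus (Cmult (/ 2 + INR (S n), t) u) (Cmult (RtoC (INR (S n))) w) =
                Copp (pw t (fun y => (1 - y) ^ S n) a)).
    { generalize (CI_pw t (fun y => (1 - y) ^ S n) (fun y => - (INR (S n) * (1 - y) ^ n)) a 1 ltac:(lra)).
      intros H. specialize (H (fun y _ => is_derive_pow1 n y)).
      assert (H' : CI (fun y => Cplus (Cmult (/ 2 + INR (S n), t) (Kf t (fun y => (1 - y) ^ S n) y))
          (Cmult (RtoC (- INR (S n))) (Kf t (fun y => (1 - y) ^ n) y))) a 1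
          (Cplus (Cmult (/ 2 + INR (S n), t) u) (Cmult (RtoC (- INR (S n))) w))).
      { apply CI_plus; apply CI_scal; auto. }
      rewrite RtoC_opp in H'.
      replace (Cminus _ _) with (Cplus (Cmult (/ 2 + INR (S n), t) u) (Cmult (- RtoC (INR (S n)))%C w)) by ring.
      eapply CI_unique; [exact H'|].
      replace (Copp (pw t (fun y => (1 - y) ^ S n) a)) with
        (Cminus (pw t (fun y => (1 - y) ^ S n) 1) (pw t (fun y => (1 - y) ^ S n) a)).
      - eapply CI_ext; [|apply H].
        + intros y _. rewrite <- RtoC_opp. unfold Kf, Cplus, Cmult, RtoC; simpl fst; simpl snd.
          cbn [pow]. f_equal; ring.
        + intros y _. apply (ex_derive_continuous (V := R_NormedModule)). auto_derive; auto.
      - replace (pw t (fun y => (1 - y) ^ S n) 1) with (RtoC 0); [ring|].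
        unfold pw, RtoC. rewrite Rminus_diag_eq by auto. rewrite pow_i by lia. f_equal; ring. }
    assert (E2 : Cminus u (bbeta t (S n)) = Cmult (Cinv (/ 2 + INR (S n), t))
        (Cminus (Cmult (RtoC (INR (S n))) (Cminus w (bbeta t n))) (pw t (fun y => (1 - y) ^ S n) a))).
    { change (bbeta t (S n)) with (Cmult (Cdiv (RtoC (INR (S n))) (/ 2 + INR (S n), t)) (bbeta t n)).
      apply (f_equal (Cmult (Cinv (/ 2 + INR (S n), t)))) in E.
      replace u with (Cmult (Cmult (Cinv (/ 2 + INR (S n), t)) (/ 2 + INR (S n), t)) u)
        by (rewrite Cinv_l by auto; ring).
      unfold Cdiv.
      transitivity (Cplus (Cmult (/ (/ 2 + INR (S n), t)%R) (Cminus (Cmult (/ 2 + INR (S n), t) u) (Cmult (RtoC (INR (S n))) w)))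
        (Cmult (/ (/ 2 + INR (S n), t)%R) (Cmult (RtoC (INR (S n))) (Cminus w (bbeta t n))))); [ring|].
      rewrite E. ring. }
    rewrite E2, Cmod_mult, Cmod_inv by auto.
    assert (I1 : / Cmod (/ 2 + INR (S n), t) <= 2).
    { rewrite <- (Rinv_inv 2) at 2. apply Rinv_le_contravar; [lra|].
      eapply Rle_trans; [|apply Cmod_ge_fst]. lra. }
    assert (I2 : Cmod (Cminus (Cmult (RtoC (INR (S n))) (Cminus w (bbeta t n))) (pw t (fun y => (1 - y) ^ S n) a))
       <= (INR (S n) * C + 1) * sqrt a).
    { eapply Rle_trans; [apply Cmod_triangle|]. rewrite Cmod_opp, Cmod_mult, Cmod_R, Cmod_pw.
      rewrite (Rabs_right (INR (S n))) by lra.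
      rewrite Rabs_right by (apply Rle_ge, pow_le; lra).
      assert ((1 - a) ^ S n <= 1) by (apply Rle_trans with (1 ^ S n); [apply pow_incr; lra|rewrite pow1; lra]).
      generalize (sqrt_pos a); intros.
      assert (INR (S n) * Cmod (w - bbeta t n) <= INR (S n) * (C * sqrt a)) by (apply Rmult_le_compat_l; auto).
      nra. }
    assert (0 <= / Cmod (/ 2 + INR (S n), t)).
    { left; apply Rinv_0_lt_compat, Cmod_gt_0; auto. }
    rewrite Rmult_assoc.
    apply Rmult_le_compat; auto. apply Cmod_ge_0.
Qed.

Lemma mellin_gauss_f t n : (1 <= n)%nat -> mellin t (gauss_f n) (bbeta t n).
Proof.
  intros Hn e He. destruct (beta_integral t n) as (C & HC & H).
  exists (Rmin 1 ((e / (C + 1)) ^ 2)), 1.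
  assert (Hp : 0 < e / (C + 1)) by (apply Rdiv_lt_0_compat; lra).
  split; [apply Rmin_case; [lra|apply pow_lt; auto]|]. split; [lra|].
  intros a b Ha Hb. generalize (Rmin_l 1 ((e / (C + 1)) ^ 2)) (Rmin_r 1 ((e / (C + 1)) ^ 2)); intros.
  destruct (H a ltac:(lra)) as (w & Hw & Hwb). exists w; split.
  - replace w with (Cplus w (RtoC 0)) by ring.
    apply CI_Chasles with 1.
    + eapply CI_ext; [|exact Hw]. intros x Hx. rewrite Rmin_left, Rmax_right in Hx by lra.
      unfold Kf, gauss_f. rewrite Rmax_right by lra. reflexivity.
    + apply CI_ext with (K := fun _ => RtoC 0).
      * intros x Hx. rewrite Rmin_left, Rmax_right in Hx by lra.
        unfold Kf, gauss_f. rewrite Rmax_left by lra. rewrite pow_i by lia. unfold RtoC; f_equal; ring.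
      * split; simpl; (evar_last; [apply (is_RInt_const (V := R_NormedModule))|]);
          unfold scal; simpl; unfold mult; simpl; ring.
  - eapply Rle_lt_trans; [exact Hwb|].
    assert (sqrt a < e / (C + 1)).
    { rewrite <- (sqrt_pow2 (e / (C + 1))) by lra. apply sqrt_lt_1_alt. lra. }
    apply Rle_lt_trans with (C * (e / (C + 1))); [apply Rmult_le_compat_l; lra|].
    apply Rmult_lt_reg_r with (C + 1); [lra|]. field_simplify; lra.
Qed.

Lemma continuous_gauss_f n x : continuous (gauss_f n) x.
Proof.
  unfold gauss_f.
  apply (continuous_comp (fun x => Rmax 0 (1 - x)) (fun y => y ^ n)).
  - apply continuous_ext with (fun x => (1 - x + Rabs (1 - x)) / 2).
    + intros y. unfold Rmax, Rabs. destruct (Rle_dec 0 (1 - y)), (Rcase_abs (1 - y)); lra.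
    + apply (continuous_mult (K := R_AbsRing)); [|apply continuous_const].
      apply (continuous_plus (V := R_NormedModule)).
      * apply (ex_derive_continuous (V := R_NormedModule)); auto_derive; auto.
      * apply continuous_Rabs_comp. apply (ex_derive_continuous (V := R_NormedModule)); auto_derive; auto.
  - apply (ex_derive_continuous (V := R_NormedModule)); auto_derive; auto.
Qed.

(** Dilating [gauss_f n] by 1/n multiplies its transform by n^s, which gives Gauss's product; the
    error is the constant of [gauss_approx] times the mass [PI] of the majorant. *)
Lemma gamma_gauss t v n : (1 <= n)%nat -> mellin t (fun x => exp (- x)) v ->
  Cmod (Cminus v (Cmult (Cmult (RtoC (sqrt (INR n))) (cis (t * ln (INR n)))) (bbeta t n))) <= 19 * PI / INR n.
Proof.
  intros Hn Hv. assert (HN : 1 <= INR n) by (apply (le_INR 1); auto).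
  assert (Hin : 0 < / INR n) by (apply Rinv_0_lt_compat; lra).
  generalize (mellin_scale t _ _ _ Hin (mellin_gauss_f t n Hn)). intros H.
  rewrite sqrt_inv, Rinv_inv, ln_Rinv in H by lra.
  replace (- (t * - ln (INR n))) with (t * ln (INR n)) in H by ring.
  generalize (mellin_minus _ _ _ _ _ Hv H). intros H'.
  eapply (mellin_bound _ _ _ (19 / INR n) 1) in H'.
  - rewrite sqrt_1 in H'. eapply Rle_trans; [exact H'|]. right; field; lra.
  - apply Rlt_le, Rdiv_lt_0_compat; lra.
  - lra.
  - intros x Hx. apply (continuous_minus (V := R_NormedModule)).
    + apply (ex_derive_continuous (V := R_NormedModule)); auto_derive; auto.
    + apply (continuous_comp (fun x => / INR n * x) (gauss_f n)); [|apply continuous_gauss_f].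
      apply (ex_derive_continuous (V := R_NormedModule)); auto_derive; auto.
  - intros x Hx. rewrite Rmult_1_l. rewrite (Rmult_comm (/ INR n)). apply gauss_approx; auto.
Qed.

Fixpoint brho (t : R) (n : nat) : R :=
  match n with
  | O => / sqrt ((/ 2) ^ 2 + t ^ 2)
  | S m => INR (S m) / sqrt ((/ 2 + INR (S m)) ^ 2 + t ^ 2) * brho t m
  end.

Lemma polar (x t : R) : 0 < x -> (x, t) = Cmult (RtoC (sqrt (x ^ 2 + t ^ 2))) (cis (atan (t / x))).
Proof.
  intros Hx.
  assert (Hq : 0 < 1 + t / x * (t / x)) by nra.
  assert (EQ : sqrt (x ^ 2 + t ^ 2) = x * sqrt (1 + t / x * (t / x))).
  { replace (x ^ 2 + t ^ 2) with (x ^ 2 * (1 + t / x * (t / x))) by (field; lra).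
    rewrite sqrt_mult, sqrt_pow2 by nra. reflexivity. }
  rewrite EQ. assert (0 < sqrt (1 + t / x * (t / x))) by (apply sqrt_lt_R0; auto).
  unfold cis, Cmult, RtoC; simpl fst; simpl snd.
  rewrite cos_atan, sin_atan. unfold Rsqr.
  f_equal; field; lra.
Qed.

Lemma bbeta_polar t n :
  bbeta t n = Cmult (RtoC (brho t n)) (cis (- rsum (seq 0 (S n)) (fun j => atan (t / (/ 2 + INR j))))).
Proof.
  induction n as [|n IH].
  - simpl. rewrite !Rplus_0_r.
    assert (H : 0 < sqrt ((/2)^2 + t ^ 2)) by (apply sqrt_lt_R0; nra).
    rewrite (polar (/ 2) t) by lra. simpl pow in *.
    rewrite RtoC_inv by lra. rewrite <- (Cmult_1_r (/ _)%C).
    rewrite <- (cis_conj (atan (t / / 2))).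
    assert (K : Cmult (cis (atan (t / / 2))) (Cconj (cis (atan (t / / 2)))) = RtoC 1).
    { rewrite cis_conj, <- cis_add, Rplus_opp_r, cis_0. reflexivity. }
    rewrite <- K. field. split; first [apply cis_neq_0|intros HH; apply RtoC_inj in HH; lra].
  - rewrite rsum_seq_S. simpl Nat.add. change (bbeta t (S n)) with (Cmult (Cdiv (RtoC (INR (S n))) (/ 2 + INR (S n), t)) (bbeta t n)).
    rewrite IH. change (brho t (S n)) with (INR (S n) / sqrt ((/ 2 + INR (S n)) ^ 2 + t ^ 2) * brho t n).
    assert (HN : 0 <= INR (S n)) by apply pos_INR.
    assert (H : 0 < sqrt ((/ 2 + INR (S n)) ^ 2 + t ^ 2)) by (apply sqrt_lt_R0; nra).
    rewrite (polar (/ 2 + INR (S n)) t) by lra.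
    set (A := atan (t / (/ 2 + INR (S n)))). set (Q := sqrt _) in *. set (P := rsum _ _).
    rewrite Ropp_plus_distr, cis_add, !RtoC_mult, RtoC_div by lra.
    assert (K : Cmult (cis A) (cis (- A)) = RtoC 1).
    { rewrite <- cis_add, Rplus_opp_r, cis_0. reflexivity. }
    transitivity (RtoC (INR (S n)) / (RtoC Q * cis A) * (RtoC (brho t n) * cis (- P)) * (cis A * cis (- A)))%C.
    + rewrite K. ring.
    + field. split; first [apply cis_neq_0|intros HH; apply RtoC_inj in HH; lra].
Qed.

(** * The modulus of Gamma on the critical line *)

Definition ch (x : R) : R := (exp x + exp (- x)) / 2.
Definition sh (x : R) : R := (exp x - exp (- x)) / 2.

Lemma is_derive_ch x : is_derive ch x (sh x).
Proof. unfold ch, sh. auto_derive; auto. field. Qed.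

Lemma is_derive_sh x : is_derive sh x (ch x).
Proof. unfold ch, sh. auto_derive; auto. field. Qed.

Lemma ch_0 : ch 0 = 1.
Proof. unfold ch. rewrite Ropp_0, exp_0. field. Qed.

Lemma sh_0 : sh 0 = 0.
Proof. unfold sh. rewrite Ropp_0, exp_0. field. Qed.

Lemma ch_ge_1 x : 1 <= ch x.
Proof.
  unfold ch. assert (0 < exp x) by apply exp_pos. rewrite exp_Ropp.
  apply Rmult_le_reg_r with (2 * exp x); [lra|]. field_simplify; [|lra].
  generalize (pow2_ge_0 (exp x - 1)). lra.
Qed.

(* The recursion of these Wallis-type integrals matches that of [brho], which identifies the limit of [brho]. *)
Definition Jf (a : R) (n : nat) (x : R) : R := cos x ^ n * ch (a * x).
Definition Jn (a : R) (n : nat) : R := RInt (Jf a n) 0 (PI / 2).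

Lemma continuous_Jf a n x : continuous (Jf a n) x.
Proof.
  apply (ex_derive_continuous (V := R_NormedModule)). unfold Jf, ch. auto_derive; auto.
Qed.

Lemma is_RInt_Jf a n : is_RInt (Jf a n) 0 (PI / 2) (Jn a n).
Proof.
  apply (RInt_correct (V := R_CompleteNormedModule)), ex_RInt_continuous. intros; apply continuous_Jf.
Qed.

Lemma Jn_rec a n : (INR (n + 2) ^ 2 + a ^ 2) * Jn a (n + 2) = INR (n + 2) * INR (n + 1) * Jn a n.
Proof.
  (* The primitive produced by two integrations by parts. It vanishes at both ends, through cos at
     PI/2 and through sin and sh at 0. *)
  set (F := fun x => INR (n + 2) * cos x ^ (n + 1) * sin x * ch (a * x) + a * cos x ^ (n + 2) * sh (a * x)).
  assert (HF : is_RInt (fun x => (INR (n + 2) ^ 2 + a ^ 2) * Jf a (n + 2) x - INR (n + 2) * INR (n + 1) * Jf a n x)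
     0 (PI / 2) (F (PI / 2) - F 0)).
  { refine (is_RInt_derive F _ 0 (PI / 2) _ _).
    - intros x _. unfold F, Jf, ch, sh. auto_derive; auto.
      replace (Init.Nat.pred (n + 1)) with n by lia. replace (Init.Nat.pred (n + 2)) with (S n) by lia.
      replace (n + 1)%nat with (S n) by lia. replace (n + 2)%nat with (S (S n)) by lia.
      cbn [pow]. rewrite !S_INR.
      assert (E : sin x * sin x = 1 - cos x * cos x) by (generalize (sin2_cos2 x); unfold Rsqr; lra).
      set (c := cos x) in *. set (s := sin x) in *. set (N := INR n). set (P := c ^ n).
      set (e1 := exp (a * x)). set (e2 := exp (- (a * x))).
      replace (1 * - s * ((N + 1) * P)) with (- (N + 1) * P * s) by ring.
      enough (HH : forall X, s * s = X -> X = 1 - c * c ->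
       (INR n + 1 + 1) * (- (N + 1) * P * s) * s = - (INR n + 1 + 1) * (N + 1) * P * X).
      2: { intros X <- _. ring. }
      unfold N in *.
      match goal with |- ?L = ?R => enough (L - R = - (INR n + 1 + 1) * (INR n + 1) * P * (s * s - (1 - c * c)) * ((e1 + e2) / 2)) end.
      + rewrite E in H. lra.
      + field.
    - intros x _. apply (continuous_minus (V := R_NormedModule));
        apply (continuous_scal_r (V := R_NormedModule)); apply continuous_Jf. }
  assert (HJ : is_RInt (fun x => (INR (n + 2) ^ 2 + a ^ 2) * Jf a (n + 2) x - INR (n + 2) * INR (n + 1) * Jf a n x)
     0 (PI / 2) ((INR (n + 2) ^ 2 + a ^ 2) * Jn a (n + 2) - INR (n + 2) * INR (n + 1) * Jn a n)).
  { apply (is_RInt_minus (V := R_NormedModule)); apply (is_RInt_scal (V := R_NormedModule)); apply is_RInt_Jf. }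
  generalize (is_RInt_inj _ _ _ _ _ HF HJ). unfold F.
  rewrite cos_PI2, sin_0, (Rmult_0_r a), sh_0. rewrite !pow_i by lia. lra.
Qed.

Lemma Jn_1 a : (1 + a ^ 2) * Jn a 1 = ch (a * (PI / 2)).
Proof.
  set (F := fun x => sin x * ch (a * x) + a * cos x * sh (a * x)).
  assert (HF : is_RInt (fun x => (1 + a ^ 2) * Jf a 1 x) 0 (PI / 2) (F (PI / 2) - F 0)).
  { refine (is_RInt_derive F _ 0 (PI / 2) _ _).
    - intros x _. unfold F, Jf, ch, sh. auto_derive; auto. field.
    - intros x _. apply (continuous_scal_r (V := R_NormedModule)); apply continuous_Jf. }
  assert (HJ : is_RInt (fun x => (1 + a ^ 2) * Jf a 1 x) 0 (PI / 2) ((1 + a ^ 2) * Jn a 1)).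
  { apply (is_RInt_scal (V := R_NormedModule)); apply is_RInt_Jf. }
  generalize (is_RInt_inj _ _ _ _ _ HF HJ). unfold F.
  rewrite cos_PI2, sin_PI2, sin_0, (Rmult_0_r a), sh_0. lra.
Qed.

Lemma Jn_0_0 : Jn 0 0 = PI / 2.
Proof.
  assert (H : is_RInt (fun _ => 1) 0 (PI / 2) (scal (PI / 2 - 0) 1)) by apply (is_RInt_const (V := R_NormedModule)).
  unfold scal in H; simpl in H; unfold mult in H; simpl in H.
  assert (H' : is_RInt (fun _ => 1) 0 (PI / 2) (Jn 0 0)).
  { eapply is_RInt_ext; [|apply is_RInt_Jf]. intros x _. unfold Jf. rewrite Rmult_0_l, ch_0. simpl; ring. }
  rewrite (is_RInt_inj _ _ _ _ _ H' H). ring.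
Qed.

(** With y = x/2 <= PI/4: sin x = 2 sin y cos y >= 2 y cos^2 y >= y. *)
Lemma half_le_sin x : 0 <= x <= PI / 2 -> x / 2 <= sin x.
Proof.
  intros Hx. generalize PI_RGT_0; intros HP.
  set (y := x / 2).
  assert (Hs : y * cos y <= sin y).
  { destruct (MVT_gen sin 0 y cos) as (c & Hc & E).
    - intros z _. auto_derive; auto. ring.
    - intros z _. apply continuity_sin.
    - rewrite Rmin_left, Rmax_right in Hc by (unfold y; lra). rewrite sin_0 in E.
      assert (cos y <= cos c) by (apply cos_decr_1; unfold y in *; lra).
      replace (sin y) with (cos c * y) by lra. unfold y in *. nra. }
  assert (Hc : cos (PI / 4) <= cos y) by (apply cos_decr_1; unfold y; lra).
  assert (Hc2 : cos (PI / 4) * cos (PI / 4) = / 2).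
  { rewrite cos_PI4. assert (0 < sqrt 2) by (apply sqrt_lt_R0; lra).
    replace (1 / sqrt 2 * (1 / sqrt 2)) with (/ (sqrt 2 * sqrt 2)) by (field; lra). rewrite sqrt_sqrt; lra. }
  assert (0 < cos (PI / 4)) by (apply cos_gt_0; lra).
  replace (sin x) with (sin (2 * y)) by (f_equal; unfold y; field).
  rewrite sin_2a. assert (0 <= y) by (unfold y; lra).
  change (x / 2) with y.
  assert (y * / 2 <= y * (cos y * cos y)) by (apply Rmult_le_compat_l; nra). nra.
Qed.

(** 2 (ch u - 1) is the square of e^(u/2) - e^(-u/2), and this difference is at most u e^(u/2). *)
Lemma ch_sub_1_le u : 0 <= u -> ch u - 1 <= u ^ 2 * exp u / 2.
Proof.
  intros Hu. unfold ch.
  assert (E : exp u = exp (u / 2) * exp (u / 2)) by (rewrite <- exp_plus; f_equal; field).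
  assert (E' : exp (- u) = exp (- (u / 2)) * exp (- (u / 2))) by (rewrite <- exp_plus; f_equal; field).
  assert (E1 : exp (u / 2) * exp (- (u / 2)) = 1) by (rewrite <- exp_plus, Rplus_opp_r; apply exp_0).
  assert (H : exp (- u) >= 1 - u) by (generalize (exp_ineq1_le (- u)); lra).
  assert (0 < exp (u / 2)) by apply exp_pos. assert (0 < exp (- (u / 2))) by apply exp_pos.
  set (p := exp (u / 2)) in *. set (q := exp (- (u / 2))) in *.
  assert (Hpq : p - q <= u * p).
  { assert (q * 1 >= (1 - u) * p); [|lra]. replace (q * 1) with (q * (p * q)) by (rewrite E1; ring).
    rewrite E' in H. nra. }
  assert (q <= p).
  { unfold p, q. destruct Hu as [Hu|<-]; [left; apply exp_increasing; lra|].
    replace (- (0 / 2)) with (0 / 2) by field. lra. }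
  rewrite E, E'. replace ((p * p + q * q) / 2 - 1) with ((p - q) ^ 2 / 2) by (rewrite <- E1; field).
  replace (u ^ 2 * (p * p) / 2) with ((u * p) ^ 2 / 2) by field.
  assert ((p - q) ^ 2 <= (u * p) ^ 2) by (apply pow_incr; lra). lra.
Qed.

Lemma Jn_lower a n : Jn 0 n <= Jn a n.
Proof.
  generalize PI_RGT_0; intros.
  apply (is_RInt_le (Jf 0 n) (Jf a n) 0 (PI / 2)); [lra|apply is_RInt_Jf|apply is_RInt_Jf|].
  intros x Hx. unfold Jf. apply Rmult_le_compat_l; [apply pow_le, cos_ge_0; lra|].
  rewrite Rmult_0_l, ch_0. apply ch_ge_1.
Qed.

(** ch (a x) - 1 is at most a constant times sin^2 x, and cos^n x sin^2 x = cos^n x - cos^(n+2) x.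
    The excess is therefore of lower order than [Jn 0 n]. *)
Lemma Jn_upper a : 0 <= a -> exists C, 0 <= C /\ forall n, Jn a n <= Jn 0 n + C * (Jn 0 n - Jn 0 (n + 2)).
Proof.
  intros Ha. generalize PI_RGT_0; intros.
  set (C := 2 * a ^ 2 * exp (a * (PI / 2))).
  assert (HC : 0 <= C).
  { unfold C. apply Rmult_le_pos; [nra|left; apply exp_pos]. }
  exists C. split; auto. intros n.
  apply (is_RInt_le (Jf a n) (fun x => Jf 0 n x + C * (Jf 0 n x - Jf 0 (n + 2) x)) 0 (PI / 2)); [lra|apply is_RInt_Jf| |].
  - apply (is_RInt_plus (V := R_NormedModule)); [apply is_RInt_Jf|].
    apply (is_RInt_scal (V := R_NormedModule)). apply (is_RInt_minus (V := R_NormedModule)); apply is_RInt_Jf.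
  - intros x Hx. unfold Jf. rewrite Rmult_0_l, ch_0, pow_add.
    assert (Hc : 0 <= cos x ^ n) by (apply pow_le, cos_ge_0; lra).
    enough (ch (a * x) <= 1 + C * (1 - cos x ^ 2)) by nra.
    replace (1 - cos x ^ 2) with (sin x ^ 2) by (generalize (sin2_cos2 x); unfold Rsqr; simpl; lra).
    generalize (ch_sub_1_le (a * x) ltac:(nra)); intros H1.
    generalize (half_le_sin x ltac:(lra)); intros H2.
    assert (H3 : x ^ 2 <= 4 * sin x ^ 2) by nra.
    assert (H4 : exp (a * x) <= exp (a * (PI / 2))).
    { destruct (Rle_lt_or_eq_dec (a * x) (a * (PI / 2))) as [Hl|He]; [nra|left; apply exp_increasing; auto|rewrite He; lra]. }
    assert ((a * x) ^ 2 * exp (a * x) / 2 <= C * sin x ^ 2); [|lra].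
    unfold C. replace ((a * x) ^ 2 * exp (a * x) / 2) with ((a ^ 2 * x ^ 2 / 2) * exp (a * x)) by field.
    replace (2 * a ^ 2 * exp (a * (PI / 2)) * sin x ^ 2) with ((a ^ 2 * (4 * sin x ^ 2) / 2) * exp (a * (PI / 2))) by field.
    assert (0 <= a ^ 2) by apply pow2_ge_0. assert (0 <= x ^ 2) by apply pow2_ge_0.
    apply Rmult_le_compat; auto; [nra|left; apply exp_pos|].
    apply Rmult_le_compat_r; [lra|]. apply Rmult_le_compat_l; auto.
Qed.

Lemma Jn_0_decr n : Jn 0 (n + 1) <= Jn 0 n.
Proof.
  generalize PI_RGT_0; intros.
  apply (is_RInt_le (Jf 0 (n + 1)) (Jf 0 n) 0 (PI / 2)); [lra|apply is_RInt_Jf|apply is_RInt_Jf|].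
  intros x Hx. unfold Jf. rewrite Rmult_0_l, ch_0, pow_add, pow_1.
  assert (Hc : 0 <= cos x ^ n) by (apply pow_le, cos_ge_0; lra).
  generalize (COS_bound x); intros. nra.
Qed.

(** The recursion at a = 0 makes the product independent of n; this is Wallis's formula in exact
    form. *)
Lemma wallis_prod n : INR (n + 1) * Jn 0 n * Jn 0 (n + 1) = PI / 2.
Proof.
  induction n as [|n IH].
  - generalize (Jn_1 0). rewrite Rmult_0_l, ch_0. simpl Nat.add. rewrite Jn_0_0. simpl INR.
    intros E. assert (E1 : Jn 0 1 = 1) by lra. rewrite E1. lra.
  - generalize (Jn_rec 0 n). rewrite <- IH.
    replace (S n + 1)%nat with (n + 2)%nat by lia. replace (S n) with (n + 1)%nat by lia.
    replace (INR (n + 2) ^ 2 + 0 ^ 2) with (INR (n + 2) * INR (n + 2)) by (simpl; ring).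
    assert (0 < INR (n + 2)) by (apply lt_0_INR; lia).
    intros E. assert (INR (n + 2) * Jn 0 (n + 2) = INR (n + 1) * Jn 0 n).
    { apply Rmult_eq_reg_l with (INR (n + 2)); lra. }
    transitivity ((INR (n + 2) * Jn 0 (n + 2)) * Jn 0 (n + 1)); [ring|]. rewrite H0. ring.
Qed.

Lemma Jn_pos n : 0 < Jn 0 n.
Proof.
  generalize PI_RGT_0; intros.
  assert (H1 : forall n, 0 <= Jn 0 n).
  { intros m. enough (HH : scal (PI / 2 - 0) 0 <= Jn 0 m).
    { unfold scal in HH; simpl in HH; unfold mult in HH; simpl in HH. lra. }
    apply (is_RInt_le (fun _ => 0) (Jf 0 m) 0 (PI / 2)); [lra| |apply is_RInt_Jf|].
    - apply (is_RInt_const (V := R_NormedModule)).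
    - intros x Hx. unfold Jf. rewrite Rmult_0_l, ch_0, Rmult_1_r. apply pow_le, cos_ge_0; lra. }
  destruct (H1 n) as [H2|H2]; auto. generalize (wallis_prod n). rewrite <- H2. lra.
Qed.

Lemma brho_pos t n : 0 < brho t n.
Proof.
  induction n as [|n IH]; simpl brho.
  - apply Rinv_0_lt_compat, sqrt_lt_R0. nra.
  - apply Rmult_lt_0_compat; auto.
    assert (0 < INR (S n)) by (apply lt_0_INR; lia).
    change (match n with 0%nat => 1 | S _ => INR n + 1 end) with (INR (S n)).
    apply Rdiv_lt_0_compat; auto. apply sqrt_lt_R0. nra.
Qed.

Lemma brho_0_Jn n : brho 0 n = 2 * Jn 0 (2 * n + 1).
Proof.
  induction n as [|n IH].
  - simpl Nat.mul. simpl Nat.add. generalize (Jn_1 0). rewrite Rmult_0_l, ch_0. intros.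
    simpl brho. replace (/ 2 * (/ 2 * 1) + 0 * (0 * 1)) with ((/ 2) ^ 2) by (simpl; ring).
    rewrite sqrt_pow2 by lra. lra.
  - change (brho 0 (S n)) with (INR (S n) / sqrt ((/ 2 + INR (S n)) ^ 2 + 0 ^ 2) * brho 0 n).
    rewrite IH. generalize (Jn_rec 0 (2 * n + 1)).
    replace (2 * n + 1 + 2)%nat with (2 * S n + 1)%nat by lia.
    replace (2 * n + 1 + 1)%nat with (2 * S n)%nat by lia.
    assert (0 < INR (S n)) by (apply lt_0_INR; lia).
    replace ((/ 2 + INR (S n)) ^ 2 + 0 ^ 2) with ((/ 2 + INR (S n)) ^ 2) by ring. rewrite sqrt_pow2 by lra.
    rewrite plus_INR, mult_INR. simpl (INR 2). simpl (INR 1).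
    intros E. apply Rmult_eq_reg_l with ((2 * INR (S n) + 1) ^ 2); [|nra].
    transitivity (2 * (((1 + 1) * INR (S n) + 1) * ((1 + 1) * INR (S n)) * Jn 0 (2 * n + 1))).
    + field. lra.
    + rewrite <- E. ring.
Qed.

(** The step from n to n + 1 multiplies both sides by N^2 / ((N + 1/2)^2 + t^2) with N = n + 1, and
    at n = 0 both are known in closed form. *)
Lemma brho_Jn t n : Jn (2 * t) (2 * n + 1) * brho 0 n = ch (PI * t) / 2 * brho t n ^ 2.
Proof.
  induction n as [|n IH].
  - generalize (Jn_1 (2 * t)). replace (2 * t * (PI / 2)) with (PI * t) by field. intros <-.
    simpl Nat.mul; simpl Nat.add. simpl brho.
    replace (/ 2 * (/ 2 * 1) + 0 * (0 * 1)) with ((/ 2) ^ 2) by (simpl; ring).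
    rewrite sqrt_pow2 by lra. rewrite pow_inv, pow2_sqrt by nra. field. nra.
  - change (brho 0 (S n)) with (INR (S n) / sqrt ((/ 2 + INR (S n)) ^ 2 + 0 ^ 2) * brho 0 n).
    change (brho t (S n)) with (INR (S n) / sqrt ((/ 2 + INR (S n)) ^ 2 + t ^ 2) * brho t n).
    generalize (Jn_rec (2 * t) (2 * n + 1)).
    replace (2 * n + 1 + 2)%nat with (2 * S n + 1)%nat by lia.
    replace (2 * n + 1 + 1)%nat with (2 * S n)%nat by lia.
    assert (0 < INR (S n)) by (apply lt_0_INR; lia).
    replace ((/ 2 + INR (S n)) ^ 2 + 0 ^ 2) with ((/ 2 + INR (S n)) ^ 2) by ring. rewrite sqrt_pow2 by lra.

    assert (EQ : (INR (S n) / sqrt ((/ 2 + INR (S n)) ^ 2 + t ^ 2) * brho t n) ^ 2 =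
      INR (S n) ^ 2 * / ((/ 2 + INR (S n)) ^ 2 + t ^ 2) * brho t n ^ 2).
    { rewrite Rpow_mult_distr. unfold Rdiv. rewrite Rpow_mult_distr, pow_inv, pow2_sqrt by nra. reflexivity. }
    rewrite EQ.
    rewrite plus_INR, mult_INR. simpl (INR 2). simpl (INR 1).
    intros E.
    replace (ch (PI * t) / 2 * (INR (S n) ^ 2 * / ((/ 2 + INR (S n)) ^ 2 + t ^ 2) * brho t n ^ 2)) with
      (INR (S n) ^ 2 * / ((/ 2 + INR (S n)) ^ 2 + t ^ 2) * (ch (PI * t) / 2 * brho t n ^ 2)) by ring.
    rewrite <- IH.
    apply Rmult_eq_reg_l with (((1 + 1) * INR (S n) + 1) ^ 2 + (2 * t) ^ 2); [|nra].
    rewrite <- Rmult_assoc, E. field. split; nra.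
Qed.

(** The left side is the squared modulus of Gauss's product, so this is |Gamma(1/2 + i t)|^2 = PI /
    cosh (PI t), reached through Wallis integrals instead of the reflection formula. *)
Lemma brho_limit t : 0 <= t -> is_lim_seq (fun n => INR n * brho t n ^ 2) (PI / ch (PI * t)).
Proof.
  intros Ht. generalize PI_RGT_0; intros HP.
  destruct (Jn_upper (2 * t) ltac:(lra)) as (C & HC & HJ).
  assert (Hch : 1 <= ch (PI * t)) by apply ch_ge_1.
  assert (E : forall n, INR n * brho t n ^ 2 = 4 * INR n * Jn 0 (2 * n + 1) * Jn (2 * t) (2 * n + 1) / ch (PI * t)).
  { intros n. generalize (brho_Jn t n). rewrite brho_0_Jn. intros E.
    apply Rmult_eq_reg_l with (ch (PI * t) / 2); [|lra].
    transitivity (INR n * (ch (PI * t) / 2 * brho t n ^ 2)); [ring|]. rewrite <- E. field. lra. }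
  apply is_lim_seq_ext with (1 := fun n => eq_sym (E n)).
  (* As [Jn 0] decreases, the Wallis products at two neighbouring indices enclose the square of
     [Jn 0 (2 * n + 1)] between quantities asymptotic to PI / (4 n). *)
  assert (HW1 : forall n, PI / (4 * (INR n + 1)) <= Jn 0 (2 * n + 1) * Jn 0 (2 * n + 1)).
  { intros n. generalize (wallis_prod (2 * n + 1)) (Jn_0_decr (2 * n + 1)) (Jn_pos (2 * n + 1)). intros E1 H1 H2.
    replace (INR (2 * n + 1 + 1)) with (2 * (INR n + 1)) in E1 by (rewrite !plus_INR, mult_INR; simpl; ring).
    generalize (pos_INR n); intros.
    apply Rmult_le_reg_l with (2 * (INR n + 1)); [lra|].
    replace (2 * (INR n + 1) * (PI / (4 * (INR n + 1)))) with (PI / 2) by (field; lra). rewrite <- E1.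
    rewrite Rmult_assoc. apply Rmult_le_compat_l; [lra|]. apply Rmult_le_compat_l; lra. }
  assert (HW2 : forall n, Jn 0 (2 * n + 1) * Jn 0 (2 * n + 1) <= PI / (2 * (2 * INR n + 1))).
  { intros n. generalize (wallis_prod (2 * n)) (Jn_0_decr (2 * n)) (Jn_pos (2 * n + 1)). intros E1 H1 H2.
    replace (INR (2 * n + 1)) with (2 * INR n + 1) in E1 by (rewrite !plus_INR, mult_INR; simpl; ring).
    generalize (pos_INR n); intros.
    apply Rmult_le_reg_l with (2 * INR n + 1); [lra|].
    replace ((2 * INR n + 1) * (PI / (2 * (2 * INR n + 1)))) with (PI / 2) by (field; lra). rewrite <- E1.
    rewrite Rmult_assoc. apply Rmult_le_compat_l; [lra|]. apply Rmult_le_compat_r; lra. }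
  assert (HJ2 : forall n, Jn (2 * t) (2 * n + 1) <= Jn 0 (2 * n + 1) * (1 + C / (2 * INR n + 3))).
  { intros n. eapply Rle_trans; [apply HJ|]. generalize (Jn_rec 0 (2 * n + 1)).
    replace (INR (2 * n + 1 + 2)) with (2 * INR n + 3) by (rewrite !plus_INR, mult_INR; simpl; ring).
    replace (INR (2 * n + 1 + 1)) with (2 * INR n + 2) by (rewrite !plus_INR, mult_INR; simpl; ring).
    generalize (pos_INR n); intros H E1. right.
    replace (Jn 0 (2 * n + 1 + 2)) with ((2 * INR n + 2) / (2 * INR n + 3) * Jn 0 (2 * n + 1)); [field; lra|].
    apply Rmult_eq_reg_l with ((2 * INR n + 3) ^ 2 + 0 ^ 2); [|nra]. rewrite E1. field. lra. }
  apply is_lim_seq_le_le with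
    (u := fun n => (PI / ch (PI * t)) * (INR n / (INR n + 1)))
    (w := fun n => (PI / ch (PI * t)) * (INR n / (INR n + / 2) * (1 + C / (2 * INR n + 3)))).
  - intros n. generalize (HW1 n) (HW2 n) (HJ2 n) (Jn_lower (2 * t) (2 * n + 1)) (Jn_pos (2 * n + 1)) (pos_INR n).
    set (W := Jn 0 (2 * n + 1)). set (J := Jn (2 * t) (2 * n + 1)). intros I1 I2 I3 I4 I5 I6.
    assert (HcC : 0 <= C / (2 * INR n + 3)).
    { apply Rmult_le_pos; auto. left; apply Rinv_0_lt_compat; lra. }
    split; apply Rmult_le_reg_r with (ch (PI * t)); try lra.
    + replace (PI / ch (PI * t) * (INR n / (INR n + 1)) * ch (PI * t)) with (4 * INR n * (PI / (4 * (INR n + 1)))) by (field; lra).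
      replace (4 * INR n * W * J / ch (PI * t) * ch (PI * t)) with (4 * INR n * (W * J)) by (field; lra).
      apply Rmult_le_compat_l; [lra|]. nra.
    + replace (4 * INR n * W * J / ch (PI * t) * ch (PI * t)) with (4 * INR n * (W * J)) by (field; lra).
      replace (PI / ch (PI * t) * (INR n / (INR n + / 2) * (1 + C / (2 * INR n + 3))) * ch (PI * t)) with
        (4 * INR n * (PI / (2 * (2 * INR n + 1)) * (1 + C / (2 * INR n + 3)))) by (field; lra).
      apply Rmult_le_compat_l; [lra|].
      apply Rle_trans with (W * W * (1 + C / (2 * INR n + 3))); [nra|]. apply Rmult_le_compat_r; lra.
  - apply is_lim_seq_ext with (fun n => PI / ch (PI * t) * (1 - / (INR n + 1))).
    { intros n. generalize (pos_INR n); intros. field. lra. }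
    evar_last. { apply is_lim_seq_scal_l. eapply is_lim_seq_minus; [apply is_lim_seq_const| |].
      { apply (is_lim_seq_inv _ p_infty); [|easy].
        apply is_lim_seq_ext with (fun n => INR (n + 1)); [intros; rewrite plus_INR; reflexivity|].
        apply is_lim_seq_incr_n with (N := 1%nat) (u := INR). apply is_lim_seq_INR. }
      simpl. reflexivity. }
    simpl. f_equal. lra.
  - set (L := PI / ch (PI * t)).
    assert (Hinv : is_lim_seq (fun n => / (INR n + 1)) 0).
    { apply (is_lim_seq_inv _ p_infty); [|easy].
        apply is_lim_seq_ext with (fun n => INR (n + 1)); [intros; rewrite plus_INR; reflexivity|].
        apply is_lim_seq_incr_n with (N := 1%nat) (u := INR). apply is_lim_seq_INR. }
    apply is_lim_seq_le_le with (u := fun n => L * (1 - / (INR n + 1))) (w := fun n => L * (1 + C * / (INR n + 1))).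
    + intros n. generalize (pos_INR n); intros Hn.
      assert (0 < L) by (apply Rdiv_lt_0_compat; lra).
      assert (H1 : INR n / (INR n + 1) <= INR n / (INR n + / 2) <= 1).
      { split.
        - apply Rmult_le_compat_l; auto. apply Rinv_le_contravar; lra.
        - apply Rmult_le_reg_r with (INR n + / 2); [lra|]. field_simplify; lra. }
      assert (H2 : 0 <= C / (2 * INR n + 3) <= C * / (INR n + 1)).
      { split; [apply Rmult_le_pos; auto; left; apply Rinv_0_lt_compat; lra|].
        apply Rmult_le_compat_l; auto. apply Rinv_le_contravar; lra. }
      replace (1 - / (INR n + 1)) with (INR n / (INR n + 1)) by (field; lra).
      assert (0 <= INR n / (INR n + 1)) by (apply Rmult_le_pos; auto; left; apply Rinv_0_lt_compat; lra).
      split; apply Rmult_le_compat_l; try lra; nra.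
    + evar_last; [apply is_lim_seq_scal_l; eapply is_lim_seq_minus; [apply is_lim_seq_const|exact Hinv|reflexivity]|].
      simpl. f_equal. lra.
    + evar_last; [apply is_lim_seq_scal_l; eapply is_lim_seq_plus; [apply is_lim_seq_const|apply is_lim_seq_scal_l; exact Hinv|reflexivity]|].
      simpl. f_equal. lra.
Qed.

(** * The phase of Delta on the critical line *)

(* [- al t n] is the argument of Gauss's approximation of [Gamma (1/2 + i t)]. *)
Definition al (t : R) (n : nat) : R :=
  rsum (seq 0 (S (S n))) (fun j => atan (t / (/ 2 + INR j))) - t * ln (INR (S n)).

Definition alpha (t : R) : R := real (Lim_seq (al t)).

Lemma atan_ge u : 0 <= u -> u - u ^ 2 <= atan u.
Proof.
  intros Hu. destruct (Rle_dec 1 u) as [H|H].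
  - apply Rle_trans with 0; [nra|]. rewrite <- atan_0. left; apply atan_increasing; lra.
  - destruct (MVT_gen atan 0 u (fun y => / (1 + y ^ 2))) as (c & Hc & E).
    + intros y _. auto_derive; auto. field. nra.
    + intros y _. apply continuity_pt_filterlim, (ex_derive_continuous (V := R_NormedModule)).
      auto_derive; auto.
    + rewrite Rmin_left, Rmax_right in Hc by lra. rewrite atan_0 in E.
      assert (1 - c ^ 2 <= / (1 + c ^ 2)).
      { apply Rmult_le_reg_r with (1 + c ^ 2); [nra|]. rewrite Rinv_l by nra. nra. }
      assert (c ^ 2 <= u ^ 2) by (apply pow_incr; lra).
      replace (atan u) with (/ (1 + c ^ 2) * u) by lra.
      assert ((1 - u) * u <= / (1 + c ^ 2) * u); [|nra]. apply Rmult_le_compat_r; nra.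
Qed.

Lemma ln_le_sub1 x : 0 < x -> ln x <= x - 1.
Proof.
  intros Hx. generalize (exp_ineq1_le (ln x)). rewrite exp_ln; lra.
Qed.

Lemma ln_succ_bounds x : 0 < x -> / (x + 1) <= ln (x + 1) - ln x <= / x.
Proof.
  intros Hx. rewrite <- ln_div by lra. split.
  - assert (H := ln_le_sub1 (x / (x + 1)) ltac:(apply Rdiv_lt_0_compat; lra)).
    rewrite ln_div in H by lra. rewrite ln_div by lra.
    replace (x / (x + 1) - 1) with (- / (x + 1)) in H by (field; lra). lra.
  - eapply Rle_trans; [apply ln_le_sub1, Rdiv_lt_0_compat; lra|]. right; field; lra.
Qed.

(** The upper bound is atan u <= u <= t / (N + 1) <= t ln ((N + 1) / N) with N = n + 1; in the lower
    one every loss is of order N^(-2). The sequence thus decreases with summable steps, which gives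
    the limit [alpha]. *)
Lemma al_step t n : 0 <= t ->
  - ((2 * t + t ^ 2) / (INR n + 1) ^ 2) <= al t (S n) - al t n <= 0.
Proof.
  intros Ht. unfold al. rewrite (rsum_seq_S 0 (S (S n))). simpl Nat.add.
  set (P := rsum _ _). rewrite !S_INR. set (N := INR n + 1).
  assert (HN : 1 <= N) by (unfold N; generalize (pos_INR n); lra).
  generalize (ln_succ_bounds N ltac:(lra)); intros [L1 L2].
  set (u := t / (/ 2 + (N + 1))).
  assert (Hu : 0 <= u) by (apply Rmult_le_pos; auto; left; apply Rinv_0_lt_compat; lra).
  generalize (atan_le_id u Hu) (atan_ge u Hu); intros A1 A2.
  assert (U1 : u <= t * / (N + 1)) by (apply Rmult_le_compat_l; auto; apply Rinv_le_contravar; lra).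
  assert (U2 : t * / N - 3 / 2 * t / N ^ 2 <= u).
  { unfold u. apply Rmult_le_reg_r with (N ^ 2 * (/ 2 + (N + 1))); [nra|].
    field_simplify; nra. }
  assert (U3 : u ^ 2 <= t ^ 2 / N ^ 2).
  { replace (t ^ 2 / N ^ 2) with ((t * / N) ^ 2) by (field; lra). apply pow_incr. split; auto.
    eapply Rle_trans; [apply U1|]. apply Rmult_le_compat_l; auto. apply Rinv_le_contravar; lra. }
  assert (T1 : t * / (N + 1) <= t * (ln (N + 1) - ln N)) by (apply Rmult_le_compat_l; auto).
  assert (T2 : t * (ln (N + 1) - ln N) <= t * / N) by (apply Rmult_le_compat_l; auto).
  split; [|lra].
  replace ((2 * t + t ^ 2) / N ^ 2) with (2 * t / N ^ 2 + t ^ 2 / N ^ 2) by (field; lra).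
  assert (0 <= t / N ^ 2) by (apply Rmult_le_pos; auto; left; apply Rinv_0_lt_compat; nra).
  unfold Rdiv in *. lra.
Qed.

Lemma al_lower t n : 0 <= t -> al t 0 - 2 * (2 * t + t ^ 2) * (1 - / (INR n + 1)) <= al t n.
Proof.
  intros Ht. induction n as [|n IH].
  - simpl INR. rewrite Rplus_0_l, Rinv_1. lra.
  - generalize (proj1 (al_step t n Ht)). rewrite S_INR. generalize (pos_INR n). intros Hn.
    set (N := INR n + 1) in *. assert (HN : 1 <= N) by (unfold N; lra). intros H.
    assert (HK : 0 <= 2 * t + t ^ 2) by nra.
    assert ((2 * t + t ^ 2) / N ^ 2 <= 2 * (2 * t + t ^ 2) * (/ N - / (N + 1))).
    { replace (/ N - / (N + 1)) with (/ (N * (N + 1))) by (field; lra).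
      rewrite (Rmult_comm 2 (2 * t + t ^ 2)), Rmult_assoc. apply Rmult_le_compat_l; auto.
      apply Rmult_le_reg_r with (N ^ 2 * (N + 1)); [nra|]. field_simplify; nra. }
    lra.
Qed.

Lemma al_ex_lim t : 0 <= t -> ex_finite_lim_seq (al t).
Proof.
  intros Ht. apply ex_finite_lim_seq_decr with (al t 0 - 2 * (2 * t + t ^ 2)).
  - intros n. generalize (al_step t n Ht); lra.
  - intros n. eapply Rle_trans; [|apply al_lower; auto].
    assert (0 < / (INR n + 1)) by (apply Rinv_0_lt_compat; generalize (pos_INR n); lra). nra.
Qed.

Lemma al_lim t : 0 <= t -> is_lim_seq (al t) (alpha t).
Proof.
  intros Ht. apply Lim_seq_correct'. apply al_ex_lim; auto.
Qed.

Lemma alpha_bound t : 0 <= t -> Rabs (alpha t) <= PI + 2 * (2 * t + t ^ 2).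
Proof.
  intros Ht.
  assert (H0 : 0 <= al t 0 <= PI).
  { unfold al. simpl. rewrite ln_1, Rmult_0_r, !Rplus_0_r, Rminus_0_r.
    assert (Hp : forall x, 0 < x -> 0 <= atan (t / x) < PI / 2).
    { intros x Hx. split; [|apply atan_bound]. rewrite <- atan_0.
      assert (0 <= t / x) by (apply Rmult_le_pos; auto; left; apply Rinv_0_lt_compat; auto).
      destruct H as [H|<-]; [left; apply atan_increasing; auto|lra]. }
    generalize (Hp (/ 2) ltac:(lra)) (Hp (/ 2 + 1) ltac:(lra)). lra. }
  assert (H1 : al t 0 - 2 * (2 * t + t ^ 2) <= alpha t).
  { apply (is_lim_seq_le (fun _ => al t 0 - 2 * (2 * t + t ^ 2)) (al t) (al t 0 - 2 * (2 * t + t ^ 2)) (alpha t)).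
    - intros n. eapply Rle_trans; [|apply al_lower; auto].
      assert (0 < / (INR n + 1)) by (apply Rinv_0_lt_compat; generalize (pos_INR n); lra). nra.
    - apply is_lim_seq_const.
    - apply al_lim; auto. }
  assert (H2 : alpha t <= al t 0).
  { apply (is_lim_seq_le (al t) (fun _ => al t 0) (alpha t) (al t 0)).
    - intros n. induction n as [|n IH]; [lra|]. generalize (al_step t n Ht); lra.
    - apply al_lim; auto.
    - apply is_lim_seq_const. }
  apply Rabs_le. nra.
Qed.

Lemma brho_opp t n : brho (- t) n = brho t n.
Proof.
  induction n as [|n IH]; simpl; replace (- t * (- t * 1)) with (t * (t * 1)) by ring; [auto|rewrite IH; auto].
Qed.

Lemma exp_le_inv1 x : 0 <= x -> exp (- x) <= / (1 + x).
Proof.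
  intros Hx. rewrite exp_Ropp. apply Rinv_le_contravar; [lra|]. apply exp_ineq1_le.
Qed.

Lemma mellin_exp_ex t : exists v, mellin t (fun x => exp (- x)) v.
Proof.
  destruct (mellin_dom t (fun x => exp (- x)) 1) as (v & Hv & _); [lra| | |eauto].
  - intros x Hx. apply (ex_derive_continuous (V := R_NormedModule)); auto_derive; auto.
  - intros x Hx. rewrite Rabs_right by (left; apply exp_pos). unfold Rdiv. rewrite Rmult_1_l.
    apply exp_le_inv1; lra.
Qed.

Lemma is_lim_seq_INR_S : is_lim_seq (fun n => INR (S n)) p_infty.
Proof. apply (is_lim_seq_incr_1 INR), is_lim_seq_INR. Qed.

(** The limit of Gauss's product: the modulus comes from [brho_limit], the argument from [al_lim].
    The transform is taken at - t because [Delta] contains Gamma(1 - s) and 1 - s = 1/2 - i t, which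
    also reverses the sign of the argument. *)
Lemma gamma_polar t v : 0 <= t -> mellin (- t) (fun x => exp (- x)) v ->
  v = Cmult (RtoC (sqrt (PI / ch (PI * t)))) (cis (alpha t)).
Proof.
  intros Ht Hv.
  set (G := fun n => Cmult (RtoC (sqrt (INR (S n) * brho t (S n) ^ 2))) (cis (al t n))).
  assert (HG : forall n, Cmod (Cminus v (G n)) <= 19 * PI / INR (S n)).
  { intros n. generalize (gamma_gauss (- t) v (S n) ltac:(lia) Hv). rewrite bbeta_polar, brho_opp.
    intros H. replace (G n) with (Cmult (Cmult (RtoC (sqrt (INR (S n)))) (cis (- t * ln (INR (S n)))))
      (Cmult (RtoC (brho t (S n))) (cis (- rsum (seq 0 (S (S n))) (fun j => atan (- t / (/ 2 + INR j))))))); auto.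
    unfold G. rewrite sqrt_mult, sqrt_pow2, RtoC_mult; [|left; apply brho_pos|apply pos_INR|apply pow2_ge_0].
    unfold al. replace (- rsum (seq 0 (S (S n))) (fun j => atan (- t / (/ 2 + INR j)))) with
      (rsum (seq 0 (S (S n))) (fun j => atan (t / (/ 2 + INR j)))).
    - unfold Rminus. rewrite cis_add. replace (- (t * ln (INR (S n)))) with (- t * ln (INR (S n))) by ring. ring.
    - replace (- rsum (seq 0 (S (S n))) (fun j => atan (- t / (/ 2 + INR j)))) with
        ((-1) * rsum (seq 0 (S (S n))) (fun j => atan (- t / (/ 2 + INR j)))) by ring.
      rewrite <- rsum_scal. apply rsum_ext. intros j _. unfold Rdiv. rewrite Ropp_mult_distr_l_reverse, atan_opp. ring. }
  assert (Hm : is_lim_seq (fun n => sqrt (INR (S n) * brho t (S n) ^ 2)) (sqrt (PI / ch (PI * t)))).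
  { apply (is_lim_seq_continuous sqrt).
    - apply continuity_pt_sqrt. apply Rlt_le, Rdiv_lt_0_compat; [apply PI_RGT_0|]. generalize (ch_ge_1 (PI * t)); lra.
    - apply (is_lim_seq_incr_1 (fun n => INR n * brho t n ^ 2)). apply brho_limit; auto. }
  assert (Hc : is_lim_seq (fun n => cos (al t n)) (cos (alpha t))).
  { apply (is_lim_seq_continuous cos); [apply continuity_cos|apply al_lim; auto]. }
  assert (Hs : is_lim_seq (fun n => sin (al t n)) (sin (alpha t))).
  { apply (is_lim_seq_continuous sin); [apply continuity_sin|apply al_lim; auto]. }
  assert (Hz : is_lim_seq (fun n => 19 * PI / INR (S n)) 0).
  { evar_last; [apply is_lim_seq_scal_l, (is_lim_seq_inv _ p_infty); [apply is_lim_seq_INR_S|easy]|].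
    simpl. f_equal. ring. }
  assert (Hcv : forall (g : nat -> R) (x l : R), (forall n, Rabs (x - g n) <= 19 * PI / INR (S n)) ->
     is_lim_seq g l -> x = l).
  { intros g x l H Hg.
    assert (is_lim_seq g x).
    { apply is_lim_seq_le_le with (u := fun n => x - 19 * PI / INR (S n)) (w := fun n => x + 19 * PI / INR (S n)).
      - intros n. specialize (H n). apply Rabs_le_between in H. lra.
      - evar_last; [eapply is_lim_seq_minus; [apply is_lim_seq_const|exact Hz|reflexivity]|]. simpl; f_equal; ring.
      - evar_last; [eapply is_lim_seq_plus; [apply is_lim_seq_const|exact Hz|reflexivity]|]. simpl; f_equal; ring. }
    apply is_lim_seq_unique in H0. apply is_lim_seq_unique in Hg. rewrite H0 in Hg. injection Hg; auto. }
  destruct v as [v1 v2]. unfold Cmult, RtoC, cis; simpl fst; simpl snd. f_equal.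
  - apply (Hcv (fun n => fst (G n))).
    + intros n. eapply Rle_trans; [|apply (HG n)]. eapply Rle_trans; [|apply Rmax_Cmod]. apply Rmax_l.
    + unfold G, Cmult, RtoC, cis; simpl fst; simpl snd.
      eapply is_lim_seq_minus'; [apply (is_lim_seq_mult' _ _ _ _ Hm Hc)|].
      eapply is_lim_seq_mult'; [apply is_lim_seq_const|exact Hs].
  - apply (Hcv (fun n => snd (G n))).
    + intros n. eapply Rle_trans; [|apply (HG n)]. eapply Rle_trans; [|apply Rmax_Cmod]. apply Rmax_r.
    + unfold G, Cmult, RtoC, cis; simpl fst; simpl snd.
      eapply is_lim_seq_plus'; [apply (is_lim_seq_mult' _ _ _ _ Hm Hs)|].
      eapply is_lim_seq_mult'; [apply is_lim_seq_const|exact Hc].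
Qed.

Lemma exp_half_ln x : 0 < x -> exp (ln x * - / 2) = / sqrt x.
Proof.
  intros Hx. rewrite <- exp_ln with (x := / sqrt x) by (apply Rinv_0_lt_compat, sqrt_lt_R0; auto).
  f_equal. rewrite ln_Rinv by (apply sqrt_lt_R0; auto).
  replace (ln x) with (ln (sqrt x) + ln (sqrt x)); [field|].
  rewrite <- ln_mult by (apply sqrt_lt_R0; auto). rewrite sqrt_sqrt by lra. reflexivity.
Qed.

Lemma CGamma_MI t v : mellin (- t) (fun x => exp (- x)) v -> CGamma (Cminus (RtoC 1) (crit t)) = v.
Proof.
  intros Hv. unfold CGamma. apply IG_RInt_gen. eapply IG_ext; [|exact Hv].
  intros x Hx. rewrite Kf_cis. unfold Cpowr, Cexp, crit, Cminus, Cplus, Copp, Cmult, RtoC, cis; simpl.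
  replace (ln x * (1 + - / 2 + - (1)) - 0 * (0 + - t + - 0)) with (ln x * - / 2) by ring.
  replace (ln x * (0 + - t + - 0) + 0 * (1 + - / 2 + - (1))) with (- t * ln x) by ring.
  rewrite exp_half_ln by auto. f_equal; ring.
Qed.

(* The Riemann-Siegel theta function. *)
Definition Th (t : R) : R :=
  - (t * ln 2 + t * ln PI + alpha t + atan (sh (PI * t / 2) / ch (PI * t / 2))) / 2.

Lemma Csin_crit t : Csin (Cdiv (Cmult (RtoC PI) (crit t)) (RtoC 2)) =
  Cmult (RtoC (/ sqrt 2)) (ch (PI * t / 2), sh (PI * t / 2)).
Proof.
  unfold Csin. assert (0 < sqrt 2) by (apply sqrt_lt_R0; lra).
  replace (Cmult Ci (Cdiv (Cmult (RtoC PI) (crit t)) (RtoC 2))) with (- (PI * t / 2), PI / 4).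
  2: { unfold crit, Cdiv, Cinv, Cmult, Ci, RtoC; simpl. f_equal; field. }
  unfold Cexp, Copp; simpl fst; simpl snd; unfold Re, Im; simpl fst; simpl snd.
  rewrite cos_neg, sin_neg, cos_PI4, sin_PI4, !Ropp_involutive.
  unfold Cdiv, Cinv, Cmult, Cminus, Cplus, Copp, Ci, RtoC, ch, sh; simpl.
  f_equal; field; lra.
Qed.

Lemma ch_double b : ch b ^ 2 + sh b ^ 2 = ch (2 * b).
Proof.
  unfold ch, sh. replace (2 * b) with (b + b) by ring. rewrite Ropp_plus_distr, !exp_plus.
  rewrite exp_Ropp. assert (0 < exp b) by apply exp_pos. field. lra.
Qed.

Lemma Cpowr_2_crit t : Cpowr 2 (crit t) = Cmult (RtoC (sqrt 2)) (cis (t * ln 2)).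
Proof.
  unfold Cpowr, Cexp, crit, Cmult, RtoC, cis; simpl.
  replace (ln 2 * / 2 - 0 * t) with (- (ln 2 * - / 2)) by ring.
  rewrite exp_Ropp, exp_half_ln, Rinv_inv by lra.
  replace (ln 2 * t + 0 * / 2) with (t * ln 2) by ring. f_equal; ring.
Qed.

Lemma Cpowr_PI_crit t : Cpowr PI (Cminus (crit t) (RtoC 1)) = Cmult (RtoC (/ sqrt PI)) (cis (t * ln PI)).
Proof.
  generalize PI_RGT_0; intros HP.
  unfold Cpowr, Cexp, crit, Cminus, Cplus, Copp, Cmult, RtoC, cis; simpl.
  replace (ln PI * (/ 2 + - (1)) - 0 * (t + - 0)) with (ln PI * - / 2) by field.
  rewrite exp_half_ln by lra. replace (ln PI * (t + - 0) + 0 * (/ 2 + - (1))) with (t * ln PI) by ring. f_equal; ring.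
Qed.

(** The moduli of the four factors, sqrt 2, 1 / sqrt PI, sqrt (PI / ch (PI t)) and sqrt (ch (PI t) /
    2), multiply to 1; the arguments add up to [- 2 * Th t] by the definition of [Th]. *)
Theorem Delta_phase t : 0 <= t -> Defs.Delta (crit t) = cis (- 2 * Th t).
Proof.
  intros Ht. generalize PI_RGT_0; intros HP.
  destruct (mellin_exp_ex (- t)) as [v Hv].
  unfold Defs.Delta. rewrite (CGamma_MI t v Hv), (gamma_polar t v Ht Hv), Csin_crit.
  rewrite (polar (ch (PI * t / 2))) by (generalize (ch_ge_1 (PI * t / 2)); lra).
  rewrite ch_double. replace (2 * (PI * t / 2)) with (PI * t) by field.
  assert (Hch : 1 <= ch (PI * t)) by apply ch_ge_1.
  rewrite Cpowr_2_crit, Cpowr_PI_crit.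
  unfold Th. replace (-2 * _) with (t * ln 2 + t * ln PI + alpha t + atan (sh (PI * t / 2) / ch (PI * t / 2))) by field.
  rewrite !cis_add.
  transitivity (Cmult (RtoC (sqrt 2 * / sqrt PI * sqrt (PI / ch (PI * t)) * (/ sqrt 2 * sqrt (ch (PI * t)))))
    (Cmult (Cmult (Cmult (cis (t * ln 2)) (cis (t * ln PI))) (cis (alpha t))) (cis (atan (sh (PI * t / 2) / ch (PI * t / 2)))))).
  { rewrite !RtoC_mult. ring. }
  replace (sqrt 2 * / sqrt PI * sqrt (PI / ch (PI * t)) * (/ sqrt 2 * sqrt (ch (PI * t)))) with 1; [ring|].
  rewrite sqrt_div by lra.
  assert (0 < sqrt 2) by (apply sqrt_lt_R0; lra). assert (0 < sqrt PI) by (apply sqrt_lt_R0; lra).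
  assert (0 < sqrt (ch (PI * t))) by (apply sqrt_lt_R0; lra). field. repeat split; lra.
Qed.

Definition dal (n : nat) (t : R) : R :=
  rsum (seq 0 (S (S n))) (fun j => (/ 2 + INR j) / ((/ 2 + INR j) ^ 2 + t ^ 2)) - ln (INR (S n)).

Lemma is_derive_rsum {A : Type} (l : list A) (f df : A -> R -> R) t :
  (forall j, In j l -> is_derive (f j) t (df j t)) ->
  is_derive (fun t => rsum l (fun j => f j t)) t (rsum l (fun j => df j t)).
Proof.
  induction l as [|j l IH]; simpl; intros H.
  - apply (is_derive_const (V := R_NormedModule)).
  - apply (is_derive_plus (V := R_NormedModule)); [apply H|apply IH]; auto.
Qed.

Lemma is_derive_al n t : is_derive (fun t => al t n) t (dal n t).
Proof.
  unfold al, dal. apply (is_derive_minus (V := R_NormedModule)).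
  - apply (is_derive_rsum _ (fun j t => atan (t / (/ 2 + INR j)))
      (fun j t => (/ 2 + INR j) / ((/ 2 + INR j) ^ 2 + t ^ 2))).
    intros j _. generalize (pos_INR j); intros. auto_derive; [lra|]. field. split; nra.
  - set (L := ln (INR (S n))). auto_derive; auto. ring.
Qed.

Lemma is_derive_atan_tanh t :
  is_derive (fun t => atan (sh (PI * t / 2) / ch (PI * t / 2))) t (PI / 2 / ch (PI * t)).
Proof.
  assert (H : 1 <= ch (PI * t / 2)) by apply ch_ge_1.
  assert (H' : 1 <= ch (PI * t)) by apply ch_ge_1.
  generalize (ch_double (PI * t / 2)). replace (2 * (PI * t / 2)) with (PI * t) by field. intros E.
  assert (Hl : is_derive (fun t => PI * t / 2) t (PI / 2)) by (auto_derive; auto; field).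
  assert (Hs : is_derive (fun t => sh (PI * t / 2)) t (PI / 2 * ch (PI * t / 2))).
  { apply (is_derive_comp sh (fun t => PI * t / 2)); [apply is_derive_sh|auto]. }
  assert (Hc : is_derive (fun t => ch (PI * t / 2)) t (PI / 2 * sh (PI * t / 2))).
  { apply (is_derive_comp ch (fun t => PI * t / 2)); [apply is_derive_ch|auto]. }
  assert (Hat : forall x, is_derive atan x (/ (1 + x ^ 2))) by (intros x; auto_derive; auto; field; nra).
  evar_last.
  - apply (is_derive_comp atan (fun t => sh (PI * t / 2) / ch (PI * t / 2))); [apply Hat|].
    apply (is_derive_div _ _ _ _ _ Hs Hc). lra.
  - unfold scal; simpl; unfold mult; simpl. rewrite <- E.
    set (c := ch (PI * t / 2)) in *. set (s := sh (PI * t / 2)) in *.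
    assert (Ecs : c * c - s * s = 1).
    { unfold c, s, ch, sh. rewrite exp_Ropp. assert (0 < exp (PI * t / 2)) by apply exp_pos. field. lra. }
    replace (PI / 2 * c * c - s * (PI / 2 * s)) with (PI / 2 * (c * c - s * s)) by ring. rewrite Ecs.
    field. split; nra.
Qed.

Lemma MVT_derive (f df : R -> R) a b : a < b -> (forall x, a <= x <= b -> is_derive f x (df x)) ->
  exists c, a <= c <= b /\ f b - f a = df c * (b - a).
Proof.
  intros Hab H. destruct (MVT_gen f a b df) as (c & Hc & E).
  - intros x Hx. rewrite Rmin_left, Rmax_right in Hx by lra. apply H; lra.
  - intros x Hx. rewrite Rmin_left, Rmax_right in Hx by lra.
    apply continuity_pt_filterlim, (ex_derive_continuous (V := R_NormedModule)). eexists; apply H; lra.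
  - rewrite Rmin_left, Rmax_right in Hc by lra. exists c; auto.
Qed.

(** Concavity is phrased with chords because this form passes to the limit [alpha], for which no
    derivative is established. *)
Lemma concave_slopes (f df : R -> R) :
  (forall x, 0 <= x -> is_derive f x (df x)) -> (forall x y, 0 <= x <= y -> df y <= df x) ->
  forall a b c, 0 <= a -> a < b -> b < c -> (f c - f b) * (b - a) <= (f b - f a) * (c - b).
Proof.
  intros Hd Hm a b c Ha Hab Hbc.
  destruct (MVT_derive f df a b Hab) as (u & Hu & Eu); [intros; apply Hd; lra|].
  destruct (MVT_derive f df b c Hbc) as (v & Hv & Ev); [intros; apply Hd; lra|].
  rewrite Eu, Ev. assert (df v <= df u) by (apply Hm; lra).
  replace (df v * (c - b) * (b - a)) with (df v * ((c - b) * (b - a))) by ring.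
  replace (df u * (b - a) * (c - b)) with (df u * ((c - b) * (b - a))) by ring.
  apply Rmult_le_compat_r; nra.
Qed.

Lemma ch_incr x y : 0 <= x < y -> ch x < ch y.
Proof.
  intros H. destruct (MVT_derive ch sh x y) as (c & Hc & E); [lra|intros; apply is_derive_ch|].
  assert (0 <= sh c).
  { unfold sh. destruct (Req_dec c 0) as [->|Hn]; [rewrite Ropp_0; lra|].
    assert (exp (- c) < exp c) by (apply exp_increasing; lra). lra. }
  enough (ch x <> ch y) by nra.
  intros HE. assert (Hx : exp x < exp y) by (apply exp_increasing; lra).
  assert (H1 : exp x * exp (- x) = 1) by (rewrite <- exp_plus, Rplus_opp_r; apply exp_0).
  assert (H2 : exp y * exp (- y) = 1) by (rewrite <- exp_plus, Rplus_opp_r; apply exp_0).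
  assert (H3 : 1 <= exp x) by (generalize (exp_ineq1_le x); lra).
  unfold ch in HE. assert (0 < exp (- x)) by apply exp_pos. assert (0 < exp (- y)) by apply exp_pos.
  assert (exp (- x) = exp (- y) + (exp y - exp x)) by lra.
  assert (exp (- y) * exp x < 1).
  { apply Rlt_le_trans with (exp (- y) * exp y); [apply Rmult_lt_compat_l; auto|lra]. }
  assert (1 <= exp y * exp x) by nra.
  assert ((exp y - exp x) * (exp x * exp y - 1) = 0).
  { assert (K : exp x * exp y * (exp (- x) - exp (- y)) = exp x * exp y * (exp y - exp x)) by (f_equal; lra).
    assert (K' : exp x * exp y * (exp (- x) - exp (- y)) = exp y * (exp x * exp (- x)) - exp x * (exp y * exp (- y))) by ring.
    rewrite H1, H2 in K'. lra. }
  assert (exp x * exp y > 1) by nra. nra.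
Qed.

Lemma dal_decr n x y : 0 <= x <= y -> dal n y <= dal n x.
Proof.
  intros H. unfold dal. apply Rplus_le_compat_r. apply rsum_le. intros j _.
  generalize (pos_INR j); intros. apply Rmult_le_compat_l; [lra|]. apply Rinv_le_contravar; nra.
Qed.

Lemma alpha_concave a b c : 0 <= a -> a < b -> b < c ->
  (alpha c - alpha b) * (b - a) <= (alpha b - alpha a) * (c - b).
Proof.
  intros Ha Hab Hbc.
  apply (is_lim_seq_le (fun n => (al c n - al b n) * (b - a)) (fun n => (al b n - al a n) * (c - b))
    ((alpha c - alpha b) * (b - a)) ((alpha b - alpha a) * (c - b))).
  - intros n. apply (concave_slopes (fun t => al t n) (dal n)); auto.
    + intros; apply is_derive_al.
    + intros; apply dal_decr; auto.
  - apply is_lim_seq_mult'; [|apply is_lim_seq_const]. apply is_lim_seq_minus'; apply al_lim; lra.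
  - apply is_lim_seq_mult'; [|apply is_lim_seq_const]. apply is_lim_seq_minus'; apply al_lim; lra.
Qed.

Theorem Th_convex a b c : 0 <= a -> a < b -> b < c ->
  (Th b - Th a) * (c - b) < (Th c - Th b) * (b - a).
Proof.
  intros Ha Hab Hbc. generalize (alpha_concave a b c Ha Hab Hbc); intros H1.
  set (g := fun t => atan (sh (PI * t / 2) / ch (PI * t / 2))).
  set (dg := fun t => PI / 2 / ch (PI * t)). generalize PI_RGT_0; intros HP.
  assert (Hdec : forall x y, 0 <= x < y -> dg y < dg x).
  { intros x y Hxy. unfold dg. apply Rmult_lt_compat_l; [lra|].
    generalize (ch_ge_1 (PI * x)) (ch_ge_1 (PI * y)); intros.
    apply Rinv_lt_contravar; [nra|]. apply ch_incr. nra. }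
  assert (H2 : (g c - g b) * (b - a) < (g b - g a) * (c - b)).
  (* The limit may lose strictness in [alpha_concave], so strict convexity is drawn from this term
     alone. Cutting [b, c] at its midpoint keeps one intermediate point strictly to the right of
     [b], hence of [u]. *)
  { set (m := (b + c) / 2).
    destruct (MVT_derive g dg a b Hab) as (u & Hu & Eu); [intros; apply is_derive_atan_tanh|].
    destruct (MVT_derive g dg b m) as (v & Hv & Ev); [unfold m; lra|intros; apply is_derive_atan_tanh|].
    destruct (MVT_derive g dg m c) as (w & Hw & Ew); [unfold m; lra|intros; apply is_derive_atan_tanh|].
    assert (dg v <= dg u).
    { destruct (Req_dec u v) as [->|]; [lra|]. left; apply Hdec; lra. }
    assert (dg w < dg u) by (apply Hdec; unfold m in *; lra).
    replace (g c - g b) with ((g c - g m) + (g m - g b)) by ring. rewrite Eu, Ev, Ew.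
    replace (c - m) with ((c - b) / 2) by (unfold m; field). replace (m - b) with ((c - b) / 2) by (unfold m; field).
    assert (0 < (c - b) * (b - a)) by nra.
    replace ((dg w * ((c - b) / 2) + dg v * ((c - b) / 2)) * (b - a)) with ((dg w + dg v) / 2 * ((c - b) * (b - a))) by field.
    replace (dg u * (b - a) * (c - b)) with (dg u * ((c - b) * (b - a))) by ring.
    apply Rmult_lt_compat_r; lra. }
  unfold Th. fold (g a) (g b) (g c). nra.
Qed.

(** The sum is compared with the increments of (1/2) ln (x^2 + t^2), whose derivative is x / (x^2 +
    t^2). The errors are O(1 / (m^2 + 1)) and telescope to at most 8; replacing (1/2) ln ((N + 1)^2
    + t^2) by ln N costs at most 2, as t <= N. *)
Lemma dal_bound n t : 1 <= t -> t <= INR (S n) -> Rabs (dal n t + ln t) <= 10.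
Proof.
  intros Ht Hn. unfold dal.
  assert (HS : forall m, Rabs (rsum (seq 0 m) (fun j => (/ 2 + INR j) / ((/ 2 + INR j) ^ 2 + t ^ 2)) -
     (/ 2 * ln (INR m ^ 2 + t ^ 2) - / 2 * ln (t ^ 2))) <= 8 * (1 - / (INR m + 1))).
  { induction m as [|m IH].
    - simpl. rewrite Rmult_0_l, !Rplus_0_l, Rinv_1, !Rminus_diag, Rabs_R0. lra.
    - rewrite rsum_seq_S. simpl Nat.add. rewrite S_INR.
      generalize (pos_INR m); intros Hm. set (M := INR m) in *.
      assert (P0 : 0 < M ^ 2 + t ^ 2) by nra. assert (P1 : 0 < (M + 1) ^ 2 + t ^ 2) by nra.
      set (T := (/ 2 + M) / ((/ 2 + M) ^ 2 + t ^ 2)).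
      set (D := / 2 * ln ((M + 1) ^ 2 + t ^ 2) - / 2 * ln (M ^ 2 + t ^ 2)).
      assert (HD : (M + / 2) / ((M + 1) ^ 2 + t ^ 2) <= D <= (M + / 2) / (M ^ 2 + t ^ 2)).
      { unfold D. split.
        - assert (H := ln_le_sub1 ((M ^ 2 + t ^ 2) / ((M + 1) ^ 2 + t ^ 2)) ltac:(apply Rdiv_lt_0_compat; auto)).
          rewrite ln_div in H by auto.
          replace ((M ^ 2 + t ^ 2) / ((M + 1) ^ 2 + t ^ 2) - 1) with (- 2 * ((M + / 2) / ((M + 1) ^ 2 + t ^ 2))) in H by (field; lra).
          lra.
        - assert (H := ln_le_sub1 (((M + 1) ^ 2 + t ^ 2) / (M ^ 2 + t ^ 2)) ltac:(apply Rdiv_lt_0_compat; auto)).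
          rewrite ln_div in H by auto.
          replace (((M + 1) ^ 2 + t ^ 2) / (M ^ 2 + t ^ 2) - 1) with (2 * ((M + / 2) / (M ^ 2 + t ^ 2))) in H by (field; lra).
          lra. }
      assert (HT : (M + / 2) / ((M + 1) ^ 2 + t ^ 2) <= T <= (M + / 2) / (M ^ 2 + t ^ 2)).
      { unfold T. rewrite (Rplus_comm (/ 2)). split; (apply Rmult_le_compat_l; [lra|]); apply Rinv_le_contravar; nra. }
      assert (HG : (M + / 2) / (M ^ 2 + t ^ 2) - (M + / 2) / ((M + 1) ^ 2 + t ^ 2) <= 2 / (M ^ 2 + 1)).
      { replace ((M + / 2) / (M ^ 2 + t ^ 2) - (M + / 2) / ((M + 1) ^ 2 + t ^ 2)) with
          (2 / (M ^ 2 + t ^ 2) * ((M + / 2) ^ 2 / ((M + 1) ^ 2 + t ^ 2))) by (field; lra).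
        assert (0 <= (M + / 2) ^ 2 / ((M + 1) ^ 2 + t ^ 2) <= 1).
        { split; [apply Rmult_le_pos; [nra|left; apply Rinv_0_lt_compat; auto]|].
          apply Rmult_le_reg_r with ((M + 1) ^ 2 + t ^ 2); auto. field_simplify; nra. }
        assert (0 < 2 / (M ^ 2 + t ^ 2) <= 2 / (M ^ 2 + 1)).
        { split; [apply Rdiv_lt_0_compat; lra|]. apply Rmult_le_compat_l; [lra|]. apply Rinv_le_contravar; nra. }
        nra. }
      assert (HQ : 2 / (M ^ 2 + 1) <= 8 * (/ (M + 1) - / (M + 1 + 1))).
      { replace (/ (M + 1) - / (M + 1 + 1)) with (/ ((M + 1) * (M + 2))) by (field; lra).
        apply Rmult_le_reg_r with ((M ^ 2 + 1) * ((M + 1) * (M + 2))); [apply Rmult_lt_0_compat; nra|].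
        field_simplify; nra. }
      assert (Rabs (T - D) <= 8 * (/ (M + 1) - / (M + 1 + 1))) by (apply Rabs_le; lra).
      set (Sm := rsum _ _) in *.
      replace (Sm + T - (/ 2 * ln ((M + 1) ^ 2 + t ^ 2) - / 2 * ln (t ^ 2))) with
        ((Sm - (/ 2 * ln (M ^ 2 + t ^ 2) - / 2 * ln (t ^ 2))) + (T - D)) by (unfold D; ring).
      eapply Rle_trans; [apply Rabs_triang|]. lra. }
  specialize (HS (S (S n))). set (Sm := rsum _ _) in *.
  assert (E : / 2 * ln (t ^ 2) = ln t).
  { replace (t ^ 2) with (t * t) by ring. rewrite ln_mult by lra. field. }
  rewrite E in HS. rewrite S_INR in HS. set (N := INR (S n)) in *.
  assert (HN : 1 <= N) by lra.
  assert (H1 : 0 <= / 2 * ln ((N + 1) ^ 2 + t ^ 2) - ln N <= 2).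
  { replace (ln N) with (/ 2 * ln (N ^ 2)).
    2: { replace (N ^ 2) with (N * N) by ring. rewrite ln_mult by lra. field. }
    split.
    - assert (ln (N ^ 2) <= ln ((N + 1) ^ 2 + t ^ 2)); [|lra]. apply ln_le; nra.
    - assert (ln ((N + 1) ^ 2 + t ^ 2) - ln (N ^ 2) <= 4); [|lra].
      rewrite <- ln_div by nra. eapply Rle_trans; [apply ln_le_sub1, Rdiv_lt_0_compat; nra|].
      apply Rmult_le_reg_r with (N ^ 2); [nra|]. field_simplify; nra. }
  assert (0 < / (N + 1 + 1)) by (apply Rinv_0_lt_compat; lra).
  apply Rabs_le_between in HS. apply Rabs_le. lra.
Qed.

(** Before the limit, - 2 [Th] has the derivative ln 2 + ln PI + [dal n t] + PI / (2 ch (PI t)),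
    which is within 20 of - ln t for large n. The mean value theorem turns this into a bound on
    increments, and that bound survives the limit. *)
Theorem Th_slope a b : 1 <= a -> a < b ->
  (/ 2 * ln a - 10) * (b - a) <= Th b - Th a <= (/ 2 * ln b + 10) * (b - a).
Proof.
  intros Ha Hab. generalize PI_RGT_0 PI_4; intros HP HP4.
  set (F := fun n t => t * ln 2 + t * ln PI + al t n + atan (sh (PI * t / 2) / ch (PI * t / 2))).
  assert (Hlim : is_lim_seq (fun n => F n b - F n a) (- 2 * (Th b - Th a))).
  { replace (Finite (- 2 * (Th b - Th a))) with
     (Finite ((b * ln 2 + b * ln PI + alpha b + atan (sh (PI * b / 2) / ch (PI * b / 2))) -
       (a * ln 2 + a * ln PI + alpha a + atan (sh (PI * a / 2) / ch (PI * a / 2))))) by (f_equal; unfold Th; field).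
    unfold F. apply is_lim_seq_minus'; apply is_lim_seq_plus'; try apply is_lim_seq_const;
      apply is_lim_seq_plus'; try apply is_lim_seq_const; apply al_lim; lra. }
  assert (L2 : 0 <= ln 2 <= 1).
  { split; [rewrite <- ln_1; apply ln_le; lra|]. generalize (ln_le_sub1 2 ltac:(lra)); lra. }
  assert (LP : 0 <= ln PI <= 3).
  { split; [rewrite <- ln_1; apply ln_le; [lra|]|].
    - generalize PI2_3_2; intros. lra.
    - generalize (ln_le_sub1 PI HP); lra. }
  assert (Hev : exists n0, forall n, (n0 <= n)%nat ->
     - (ln b + 20) * (b - a) <= F n b - F n a <= - (ln a - 20) * (b - a)).
  { destruct (nfloor_ex b ltac:(lra)) as [n0 Hn0]. exists n0. intros n Hn.
    destruct (MVT_derive (F n) (fun t => ln 2 + ln PI + dal n t + PI / 2 / ch (PI * t)) a b Hab) as (c & Hc & E).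
    - intros x _. unfold F. apply (is_derive_plus (V := R_NormedModule)); [|apply is_derive_atan_tanh].
      apply (is_derive_plus (V := R_NormedModule)); [|apply is_derive_al].
      auto_derive; auto; ring.
    - rewrite E.
      assert (Hd : Rabs (dal n c + ln c) <= 10).
      { apply dal_bound; [lra|]. rewrite S_INR. apply le_INR in Hn. lra. }
      apply Rabs_le_between in Hd.
      assert (0 <= PI / 2 / ch (PI * c) <= 2).
      { generalize (ch_ge_1 (PI * c)); intros. split; [apply Rmult_le_pos; [lra|left; apply Rinv_0_lt_compat; lra]|].
        apply Rmult_le_reg_r with (ch (PI * c)); [lra|]. field_simplify; lra. }
      assert (ln a <= ln c) by (apply ln_le; lra). assert (ln c <= ln b) by (apply ln_le; lra).
      split; apply Rmult_le_compat_r; lra. }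
  destruct Hev as [n0 Hev].
  assert (H1 : - (ln b + 20) * (b - a) <= - 2 * (Th b - Th a)).
  { apply (is_lim_seq_le_loc (fun _ => - (ln b + 20) * (b - a)) (fun n => F n b - F n a)
      (- (ln b + 20) * (b - a)) (- 2 * (Th b - Th a))); auto.
    - exists n0. intros n Hn. apply Hev; auto.
    - apply is_lim_seq_const. }
  assert (H2 : - 2 * (Th b - Th a) <= - (ln a - 20) * (b - a)).
  { apply (is_lim_seq_le_loc (fun n => F n b - F n a) (fun _ => - (ln a - 20) * (b - a))
      (- 2 * (Th b - Th a)) (- (ln a - 20) * (b - a))); auto.
    - exists n0. intros n Hn. apply Hev; auto.
    - apply is_lim_seq_const. }
  split; lra.
Qed.

(** Only the finiteness of the number of levels met on (0, T] is drawn from this crude bound. *)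
Lemma Th_bounded T : exists B, forall t, 0 <= t <= T -> Rabs (Th t) <= B.
Proof.
  generalize PI_RGT_0; intros HP.
  exists (T * Rabs (ln 2) + T * Rabs (ln PI) + (PI + 2 * (2 * T + T ^ 2)) + PI).
  intros t Ht. unfold Th.
  assert (H1 : Rabs (t * ln 2) <= T * Rabs (ln 2)).
  { rewrite Rabs_mult, (Rabs_right t) by lra. apply Rmult_le_compat_r; [apply Rabs_pos|lra]. }
  assert (H2 : Rabs (t * ln PI) <= T * Rabs (ln PI)).
  { rewrite Rabs_mult, (Rabs_right t) by lra. apply Rmult_le_compat_r; [apply Rabs_pos|lra]. }
  generalize (alpha_bound t ltac:(lra)); intros H3.
  generalize (atan_bound (sh (PI * t / 2) / ch (PI * t / 2))); intros H4.
  set (A := atan _) in *.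
  apply Rabs_le_between in H1. apply Rabs_le_between in H2. apply Rabs_le_between in H3.
  assert (t ^ 2 <= T ^ 2) by (apply pow_incr; lra).
  apply Rabs_le. split; lra.
Qed.

(** [alpha] is known only as a pointwise limit, so continuity is obtained from the local Lipschitz
    bound contained in [Th_slope]. *)
Lemma Th_continuous t : 1 < t -> continuity_pt Th t.
Proof.
  intros Ht.
  set (C := ln (2 * t) + 20).
  assert (HC : 0 < C).
  { unfold C. assert (0 <= ln (2 * t)) by (rewrite <- ln_1; apply ln_le; lra). lra. }
  intros e He. set (d := Rmin (Rmin (t - 1) t) (e / C)).
  assert (Hd : 0 < d) by (unfold d; repeat apply Rmin_case; try lra; apply Rdiv_lt_0_compat; lra).
  exists d. split; auto. intros y [_ Hy]. unfold dist in *; simpl in *. unfold R_dist in *.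
  assert (D1 : d <= Rmin (t - 1) t) by apply Rmin_l. assert (D2 : d <= e / C) by apply Rmin_r.
  generalize (Rmin_l (t - 1) t) (Rmin_r (t - 1) t); intros.
  assert (Hy2 := Hy). apply Rabs_lt_between in Hy2.
  assert (Hb : Rabs (Th y - Th t) <= C * Rabs (y - t)).
  { assert (Hg : forall a b, 1 <= a -> a < b -> b <= 2 * t -> Rabs (Th b - Th a) <= C * (b - a)).
    { intros a b Ha Hab Hb. destruct (Th_slope a b Ha Hab) as [S1 S2].
      assert (0 <= ln a) by (rewrite <- ln_1; apply ln_le; lra).
      assert (ln b <= ln (2 * t)) by (apply ln_le; lra).
      assert (0 <= ln (2 * t)) by (rewrite <- ln_1; apply ln_le; lra).
      assert (- C * (b - a) <= (/ 2 * ln a - 10) * (b - a)) by (apply Rmult_le_compat_r; unfold C in *; lra).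
      assert ((/ 2 * ln b + 10) * (b - a) <= C * (b - a)) by (apply Rmult_le_compat_r; unfold C in *; lra).
      apply Rabs_le. split; lra. }
    destruct (Rtotal_order y t) as [Hl|[->|Hl]].
    - rewrite (Rabs_minus_sym (Th y)), (Rabs_minus_sym y), (Rabs_right (t - y)) by lra. apply Hg; lra.
    - rewrite !Rminus_diag, Rabs_R0. lra.
    - rewrite (Rabs_right (y - t)) by lra. apply Hg; lra. }
  eapply Rle_lt_trans; [exact Hb|]. apply Rlt_le_trans with (C * (e / C)).
  - apply Rmult_lt_compat_l; lra.
  - right; field; lra.
Qed.

(** * Partial fractions of the cosecant *)

Definition dirichlet (N : nat) (x : R) : R := 1 + 2 * rsum (seq 1 N) (fun n => cos (INR n * x)).

Lemma dirichlet_sin N x : sin (x / 2) * dirichlet N x = sin ((INR N + / 2) * x).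
Proof.
  unfold dirichlet. induction N as [|N IH].
  - simpl. rewrite Rmult_0_r, Rplus_0_r, Rmult_1_r, Rplus_0_l. f_equal. field.
  - rewrite rsum_seq_S. simpl Nat.add. rewrite S_INR.
    transitivity (sin (x / 2) * (1 + 2 * rsum (seq 1 N) (fun n => cos (INR n * x))) + 2 * sin (x / 2) * cos ((INR N + 1) * x)); [ring|].
    rewrite IH.
    replace ((INR N + 1 + / 2) * x) with ((INR N + 1) * x + x / 2) by field.
    replace ((INR N + / 2) * x) with ((INR N + 1) * x - x / 2) by field.
    rewrite sin_plus, sin_minus. ring.
Qed.

Lemma continuous_dirichlet N x : continuous (dirichlet N) x.
Proof.
  apply (ex_derive_continuous (V := R_NormedModule)).
  exists (0 + 2 * rsum (seq 1 N) (fun n => - INR n * sin (INR n * x))).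
  unfold dirichlet. apply (is_derive_plus (V := R_NormedModule)); [apply (is_derive_const (V := R_NormedModule))|].
  apply is_derive_scal.
  apply (is_derive_rsum (seq 1 N) (fun n x => cos (INR n * x)) (fun n x => - INR n * sin (INR n * x))).
  intros n _. auto_derive; auto. ring.
Qed.

Lemma dirichlet_bound N x : Rabs (dirichlet N x) <= 1 + 2 * INR N.
Proof.
  unfold dirichlet. eapply Rle_trans; [apply Rabs_triang|]. rewrite Rabs_R1, Rabs_mult, (Rabs_right 2) by lra.
  apply Rplus_le_compat_l, Rmult_le_compat_l; [lra|].
  induction N as [|N IH]; [simpl; rewrite Rabs_R0; lra|].
  rewrite rsum_seq_S, !S_INR. eapply Rle_trans; [apply Rabs_triang|].
  match goal with |- context [Rabs (cos ?y)] =>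
    assert (Rabs (cos y) <= 1) by (apply Rabs_le; generalize (COS_bound y); lra) end. lra.
Qed.

Lemma deriv_bound (g dg : R -> R) K b : (forall x, 0 <= x <= b -> is_derive g x (dg x)) -> g 0 = 0 ->
  (forall x, 0 <= x <= b -> Rabs (dg x) <= K) -> forall x, 0 <= x <= b -> Rabs (g x) <= K * x.
Proof.
  intros Hd H0 HK x [[Hx|<-] Hb]; [|rewrite H0, Rabs_R0; lra].
  destruct (MVT_derive g dg 0 x Hx) as (c & Hc & E); [intros; apply Hd; lra|].
  rewrite H0, !Rminus_0_r in E. rewrite E, Rabs_mult, (Rabs_right x) by lra.
  apply Rmult_le_compat_r; [lra|]. apply HK; lra.
Qed.

(** A Riemann-Lebesgue estimate with a rate. Since g vanishes to second order at 0, g / sin (x/2)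
    has a bounded derivative, and one integration by parts against sin ((N + 1/2) x) gains the
    denominator. The constant 24 = 16 + 4 + 4 collects the remaining integral and two boundary
    terms. *)
Lemma dirichlet_small (g dg ddg : R -> R) K N I :
  (forall x, is_derive g x (dg x)) -> (forall x, is_derive dg x (ddg x)) ->
  g 0 = 0 -> dg 0 = 0 -> (forall x, 0 <= x <= PI -> Rabs (ddg x) <= K) -> 0 <= K ->
  is_RInt (fun x => g x * dirichlet N x) 0 PI I -> Rabs I <= 24 * K * PI / (INR N + / 2).
Proof.
  intros Hg Hdg g0 dg0 HK K0 HI. generalize PI_RGT_0; intros HP.
  set (M := INR N + / 2). assert (HM : / 2 <= M) by (unfold M; generalize (pos_INR N); lra).
  assert (B1 : forall x, 0 <= x <= PI -> Rabs (dg x) <= K * x) by (apply (deriv_bound dg ddg); auto).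
  assert (B0 : forall x, 0 <= x <= PI -> Rabs (g x) <= K * x * x).
  { intros x Hx. apply (deriv_bound g dg (K * x) x); auto; [|lra].
    intros y Hy. eapply Rle_trans; [apply B1; lra|]. apply Rmult_le_compat_l; lra. }
  assert (Cg : forall x, continuous g x) by (intros x; apply (ex_derive_continuous (V := R_NormedModule)); eexists; apply Hg).
  assert (Cdg : forall x, continuous dg x) by (intros x; apply (ex_derive_continuous (V := R_NormedModule)); eexists; apply Hdg).
  assert (Cf : forall x, continuous (fun x => g x * dirichlet N x) x).
  { intros x. apply (continuous_mult (K := R_AbsRing)); [apply Cg|apply continuous_dirichlet]. }
  apply le_epsilon. intros e He.
  set (B := K * PI * PI * (1 + 2 * INR N)).
  assert (HB : 0 <= B).
  { unfold B. generalize (pos_INR N); intros. apply Rmult_le_pos; [|lra].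
    apply Rmult_le_pos; [apply Rmult_le_pos|]; lra. }
  (* The quotient g / sin (x/2) is 0/0 at the origin, so a short interval [0, d] is split off, on
     which the crude bound [B] of the integrand contributes at most [e]. *)
  set (d := Rmin (PI / 2) (e / (B + 1))).
  assert (Hd : 0 < d) by (unfold d; apply Rmin_case; [lra|apply Rdiv_lt_0_compat; lra]).
  assert (Hd1 : d <= PI / 2) by apply Rmin_l. assert (Hd2 : d <= e / (B + 1)) by apply Rmin_r.
  destruct (ex_RInt_continuous (fun x => g x * dirichlet N x) 0 d) as [I1 HI1]; [intros; apply Cf|].
  destruct (ex_RInt_continuous (fun x => g x * dirichlet N x) d PI) as [I2 HI2]; [intros; apply Cf|].
  assert (E : I = I1 + I2).
  { eapply is_RInt_inj; [exact HI|]. apply (is_RInt_Chasles (V := R_NormedModule) _ _ _ _ _ _ HI1 HI2). }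
  assert (H1 : Rabs I1 <= e).
  { assert (H : norm I1 <= (d - 0) * B).
    { apply (norm_RInt_le_const (V := R_NormedModule) (fun x => g x * dirichlet N x) 0 d I1 B); [lra| |exact HI1].
      intros x Hx. unfold norm; simpl; unfold abs; simpl. rewrite Rabs_mult. unfold B.
      apply Rmult_le_compat; try apply Rabs_pos; [|apply dirichlet_bound].
      eapply Rle_trans; [apply B0; lra|]. rewrite !Rmult_assoc. apply Rmult_le_compat_l; auto. nra. }
    change (norm I1) with (Rabs I1) in H. rewrite Rminus_0_r in H. eapply Rle_trans; [exact H|].
    apply Rle_trans with (e / (B + 1) * B); [apply Rmult_le_compat_r; auto|].
    apply Rmult_le_reg_r with (B + 1); [lra|]. field_simplify; [|lra]. nra. }
  assert (Hs : forall x, 0 < x <= PI -> x / 4 <= sin (x / 2)).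
  { intros x Hx. generalize (half_le_sin (x / 2) ltac:(lra)). lra. }
  assert (Hs2 : forall x, 0 < x <= PI -> sin (x / 2) <= x / 2).
  { intros x Hx. left. apply sin_lt_x. lra. }
  set (q := fun x => g x / sin (x / 2)).
  set (dq := fun x => (dg x * sin (x / 2) - g x * (/ 2 * cos (x / 2))) / sin (x / 2) ^ 2).
  assert (Hq : forall x, 0 < x <= PI -> is_derive q x (dq x)).
  { intros x Hx. unfold q, dq. apply (is_derive_div g (fun x => sin (x / 2)) x (dg x) (/ 2 * cos (x / 2))); [apply Hg| |].
    - auto_derive; auto. unfold Rdiv; field.
    - generalize (Hs x Hx); lra. }
  assert (Bq : forall x, 0 < x <= PI -> Rabs (q x) <= 4 * K * PI).
  { intros x Hx. specialize (Hs x Hx). unfold q. unfold Rdiv. rewrite Rabs_mult, Rabs_inv, (Rabs_right (sin _)) by lra.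
    apply Rmult_le_reg_r with (sin (x / 2)); [lra|]. rewrite Rmult_assoc, Rinv_l, Rmult_1_r by lra.
    eapply Rle_trans; [apply B0; lra|].
    assert (K * x * x <= K * PI * x) by (apply Rmult_le_compat_r; [lra|apply Rmult_le_compat_l; lra]).
    assert (K * PI * x <= K * PI * (4 * sin (x / 2))); [|lra]. apply Rmult_le_compat_l; [nra|lra]. }
  assert (Bdq : forall x, 0 < x <= PI -> Rabs (dq x) <= 16 * K).
  { intros x Hx. specialize (Hs x Hx). specialize (Hs2 x Hx). unfold dq.
    assert (Hp2 : 0 < sin (x / 2) ^ 2) by (apply pow_lt; lra). rewrite Rabs_div by lra.
    rewrite (Rabs_right (sin (x / 2) ^ 2)) by lra.
    match goal with |- ?A / ?B <= _ =>
      apply Rmult_le_reg_r with B; [auto|]; replace (A / B * B) with A by (field; lra) end.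
    assert (A1 : Rabs (dg x * sin (x / 2)) <= K * x * (x / 2)).
    { rewrite Rabs_mult, (Rabs_right (sin _)) by lra. apply Rmult_le_compat; [apply Rabs_pos|lra|apply B1; lra|lra]. }
    assert (A2 : Rabs (g x * (/ 2 * cos (x / 2))) <= K * x * x * / 2).
    { rewrite Rabs_mult. apply Rmult_le_compat; [apply Rabs_pos|apply Rabs_pos|apply B0; lra|].
      rewrite Rabs_mult, (Rabs_right (/ 2)) by lra.
      assert (Rabs (cos (x / 2)) <= 1) by (apply Rabs_le; generalize (COS_bound (x / 2)); lra). lra. }
    eapply Rle_trans; [apply Rabs_triang|]. rewrite Rabs_Ropp.
    assert (x * x <= 16 * sin (x / 2) ^ 2) by nra.
    assert (K * (x * x) <= K * (16 * sin (x / 2) ^ 2)) by (apply Rmult_le_compat_l; lra). lra. }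
  assert (Cdq : forall x, 0 < x <= PI -> continuous dq x).
  { intros x Hx. specialize (Hs x Hx). unfold dq.
    apply (continuous_mult (K := R_AbsRing)).
    - apply (continuous_minus (V := R_NormedModule)); apply (continuous_mult (K := R_AbsRing)); auto;
        apply (ex_derive_continuous (V := R_NormedModule)); auto_derive; auto.
    - apply (ex_derive_continuous (V := R_NormedModule)). auto_derive.
      assert (0 < sin (x / 2) ^ 2) by (apply pow_lt; lra). simpl in H. unfold Rdiv in H. lra. }
  assert (HH : is_RInt (fun x => g x * dirichlet N x - dq x * cos (M * x) / M) d PI
                (- q PI * cos (M * PI) / M - - q d * cos (M * d) / M)).
  { refine (is_RInt_ext (fun x => q x * sin (M * x) - dq x * cos (M * x) / M) _ _ _ _ _ _).
    - intros x Hx. rewrite Rmin_left, Rmax_right in Hx by lra. simpl. f_equal. unfold q, M.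
      rewrite <- dirichlet_sin. specialize (Hs x ltac:(lra)). field. lra.
    - refine (is_RInt_derive (fun x => - q x * cos (M * x) / M) _ d PI _ _).
      + intros x Hx. rewrite Rmin_left, Rmax_right in Hx by lra.
        evar_last.
        * apply (is_derive_ext (fun x => q x * (- cos (M * x) / M))); [intros; simpl; unfold Rdiv; ring|].
          apply (is_derive_mult q (fun x => - cos (M * x) / M) x (dq x) (sin (M * x))).
          -- apply Hq; lra.
          -- auto_derive; auto. field. lra.
          -- intros; apply Rmult_comm.
        * unfold plus, mult; simpl. field. lra.
      + intros x Hx. rewrite Rmin_left, Rmax_right in Hx by lra.
        apply (continuous_minus (V := R_NormedModule)).
        * apply (continuous_mult (K := R_AbsRing)).
          -- apply (ex_derive_continuous (V := R_NormedModule)). eexists; apply Hq; lra.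
          -- apply (ex_derive_continuous (V := R_NormedModule)); auto_derive; auto.
        * apply (continuous_mult (K := R_AbsRing)); [|apply continuous_const].
          apply (continuous_mult (K := R_AbsRing)); [apply Cdq; lra|].
          apply (ex_derive_continuous (V := R_NormedModule)); auto_derive; auto. }
  destruct (ex_RInt_continuous (fun x => dq x * cos (M * x) / M) d PI) as [I3 HI3].
  { intros x Hx. rewrite Rmin_left, Rmax_right in Hx by lra.
    apply (continuous_mult (K := R_AbsRing)); [|apply continuous_const].
    apply (continuous_mult (K := R_AbsRing)); [apply Cdq; lra|].
    apply (ex_derive_continuous (V := R_NormedModule)); auto_derive; auto. }
  assert (E2 : I2 - I3 = - q PI * cos (M * PI) / M - - q d * cos (M * d) / M).
  { eapply is_RInt_inj; [|exact HH]. apply (is_RInt_minus (V := R_NormedModule)); assumption. }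
  assert (H3 : Rabs I3 <= PI * (16 * K / M)).
  { assert (H : norm I3 <= (PI - d) * (16 * K / M)).
    { apply (norm_RInt_le_const (V := R_NormedModule) (fun x => dq x * cos (M * x) / M) d PI I3); [lra| |exact HI3].
      intros x Hx. unfold norm; simpl; unfold abs; simpl. unfold Rdiv.
      rewrite !Rabs_mult, Rabs_inv, (Rabs_right M) by lra.
      apply Rmult_le_compat_r; [left; apply Rinv_0_lt_compat; lra|].
      assert (Rabs (cos (M * x)) <= 1) by (apply Rabs_le; generalize (COS_bound (M * x)); lra).
      generalize (Bdq x ltac:(lra)) (Rabs_pos (dq x)) (Rabs_pos (cos (M * x))). intros. nra. }
    change (norm I3) with (Rabs I3) in H. eapply Rle_trans; [exact H|].
    apply Rmult_le_compat_r; [|lra]. apply Rmult_le_pos; [lra|left; apply Rinv_0_lt_compat; lra]. }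
  assert (Hb : forall x, 0 < x <= PI -> Rabs (- q x * cos (M * x) / M) <= 4 * K * PI / M).
  { intros x Hx. unfold Rdiv. rewrite !Rabs_mult, Rabs_inv, Rabs_Ropp, (Rabs_right M) by lra.
    apply Rmult_le_compat_r; [left; apply Rinv_0_lt_compat; lra|].
    assert (Rabs (cos (M * x)) <= 1) by (apply Rabs_le; generalize (COS_bound (M * x)); lra).
    generalize (Bq x Hx) (Rabs_pos (q x)) (Rabs_pos (cos (M * x))). intros. nra. }
  assert (H2 : Rabs I2 <= 24 * K * PI / M).
  { replace I2 with ((- q PI * cos (M * PI) / M - - q d * cos (M * d) / M) + I3) by lra.
    eapply Rle_trans; [apply Rabs_triang|].
    eapply Rle_trans; [apply Rplus_le_compat_r, Rabs_triang|]. rewrite Rabs_Ropp.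
    generalize (Hb PI ltac:(lra)) (Hb d ltac:(lra)). unfold Rdiv in *. intros. lra. }
  rewrite E. eapply Rle_trans; [apply Rabs_triang|]. lra.
Qed.

Lemma exp_abs_bounds y : Rabs (ch y) <= exp (Rabs y) /\ Rabs (sh y) <= exp (Rabs y).
Proof.
  assert (H1 : exp y <= exp (Rabs y)).
  { destruct (Rle_abs y) as [H|H]; [left; apply exp_increasing; auto|rewrite <- H; lra]. }
  assert (H2 : exp (- y) <= exp (Rabs y)).
  { rewrite <- (Rabs_Ropp y). destruct (Rle_abs (- y)) as [H|H]; [left; apply exp_increasing; auto|rewrite <- H; lra]. }
  assert (0 < exp y) by apply exp_pos. assert (0 < exp (- y)) by apply exp_pos.
  unfold ch, sh. split; apply Rabs_le; lra.
Qed.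

(* [fC p q x = cos (a x)] with [a = p + i q] *)
Definition fC (p q x : R) : CC := (cos (p * x) * ch (q * x), - (sin (p * x) * sh (q * x))).
Definition dfC (p q x : R) : CC :=
  (- p * sin (p * x) * ch (q * x) + q * cos (p * x) * sh (q * x),
   - (p * cos (p * x) * sh (q * x) + q * sin (p * x) * ch (q * x))).

(** This is a^2 for a = p + i q; [fC] solves f'' = - a^2 f. *)
Definition sqC (p q : R) : CC := (p ^ 2 - q ^ 2, 2 * p * q).

Lemma CD_fC p q x : CD (fC p q) x (dfC p q x).
Proof.
  unfold fC, dfC, ch, sh; split; simpl; (auto_derive; [auto|field]).
Qed.

Lemma CD_dfC p q x : CD (dfC p q) x (Cmult (Copp (sqC p q)) (fC p q x)).
Proof.
  unfold fC, dfC, ch, sh, sqC, Copp, Cmult; split; simpl; (auto_derive; [auto|field]).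
Qed.

(** Because f'' = - a^2 f, the function f' cos (n x) + n f sin (n x) is a primitive of (n^2 - a^2) f
    cos (n x); it vanishes at 0 and equals (-1)^n f'(PI) at PI. *)
Lemma CI_fC_cos p q n :
  exists w, CI (fun x => Cmult (fC p q x) (RtoC (cos (INR n * x)))) 0 PI w /\
   Cmult (Cminus (RtoC (INR n ^ 2)) (sqC p q)) w = Cmult (RtoC ((-1) ^ n)) (dfC p q PI).
Proof.
  assert (Hc : forall x, Ccont (fun x => Cmult (fC p q x) (RtoC (cos (INR n * x)))) x).
  { intros x. unfold fC, Cmult, RtoC, ch, sh. split; simpl; apply (ex_derive_continuous (V := R_NormedModule));
      auto_derive; auto. }
  destruct (CI_ex (fun x => Cmult (fC p q x) (RtoC (cos (INR n * x)))) 0 PI) as [w Hw]; [intros; apply Hc|].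
  exists w. split; auto.
  set (F := fun x => Cplus (Cmult (dfC p q x) (RtoC (cos (INR n * x)))) (Cmult (fC p q x) (RtoC (INR n * sin (INR n * x))))).
  eapply CI_unique; [apply CI_scal, Hw|].
  replace (Cmult (RtoC ((-1) ^ n)) (dfC p q PI)) with (Cminus (F PI) (F 0)).
  - apply CI_FTC.
    + intros x _. unfold F, fC, dfC, ch, sh, sqC, Copp, Cminus, Cplus, Cmult, RtoC; split; simpl; (auto_derive; [auto|field]).
    + intros x _. destruct (Hc x) as [A1 A2]. split; simpl.
      * apply (continuous_minus (V := R_NormedModule)); apply (continuous_scal_r (V := R_NormedModule)); assumption.
      * apply (continuous_plus (V := R_NormedModule)); apply (continuous_scal_r (V := R_NormedModule)); assumption.
  - unfold F. rewrite (Rmult_0_r (INR n)), sin_0, cos_0, (Rmult_0_r (INR n)).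
    replace (sin (INR n * PI)) with 0.
    2: { symmetry. apply sin_eq_0_1. exists (Z.of_nat n). rewrite INR_IZR_INZ. reflexivity. }
    replace (cos (INR n * PI)) with ((-1) ^ n).
    2: { clear. induction n as [|n IH]; [simpl; rewrite Rmult_0_l, cos_0; reflexivity|].
         rewrite S_INR, Rmult_plus_distr_r, Rmult_1_l, neg_cos, <- IH. simpl; ring. }
    replace (dfC p q 0) with (RtoC 0).
    2: { unfold dfC, RtoC. rewrite !Rmult_0_r, sin_0, sh_0. f_equal; ring. }
    rewrite Rmult_0_r. ring.
Qed.

Lemma CI_csum {A : Type} (l : list A) (K : A -> R -> CC) (w : A -> CC) a b :
  (forall i, In i l -> CI (K i) a b (w i)) -> CI (fun x => csum l (fun i => K i x)) a b (csum l w).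
Proof.
  induction l as [|i l IH]; simpl; intros H.
  - split; simpl; (evar_last; [apply (is_RInt_const (V := R_NormedModule))|]);
      unfold scal; simpl; unfold mult; simpl; ring.
  - apply CI_plus; auto.
Qed.

(** A partial sum of the partial fraction series of - PI / (a sin (PI a)), with a = p + i q. *)
Definition pf_sum (p q : R) (N : nat) : CC :=
  Cminus (Cmult (RtoC 2) (csum (seq 1 N) (fun n => Cdiv (RtoC ((-1) ^ n)) (Cminus (RtoC (INR n ^ 2)) (sqC p q)))))
     (Cinv (sqC p q)).

(** Integrating cos (a x) against the Dirichlet kernel over [0, PI] gives, mode by mode,
    [dfC p q PI] times the partial sum. On the other hand the kernel has integral [PI] and
    concentrates at 0, where cos (a x) = 1. *)
Theorem partial_fractions p q :
  (forall n, Cminus (RtoC (INR n ^ 2)) (sqC p q) <> RtoC 0) ->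
  exists C, forall N, Cmod (Cminus (Cmult (dfC p q PI) (pf_sum p q N)) (RtoC PI)) <= C / (INR N + / 2).
Proof.
  intros Hne. generalize PI_RGT_0; intros HP.
  set (w := dfC p q PI).
  set (v := fun n : nat => Cdiv (Cmult (RtoC ((-1) ^ n)) w) (Cminus (RtoC (INR n ^ 2)) (sqC p q))).
  assert (Hv : forall n, CI (fun x => Cmult (fC p q x) (RtoC (cos (INR n * x)))) 0 PI (v n)).
  { intros n. destruct (CI_fC_cos p q n) as (u & Hu & E). replace (v n) with u; auto.
    unfold v, w. rewrite <- E. field. apply Hne. }
  set (L := 4 * (Rabs p + Rabs q + 1) ^ 2 * exp (Rabs q * PI)).
  exists (2 * (24 * L * PI)). intros N.
  assert (HV : CI (fun x => Cmult (fC p q x) (RtoC (dirichlet N x))) 0 PI (Cmult w (pf_sum p q N))).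
  { replace (Cmult w (pf_sum p q N)) with (Cplus (v 0%nat) (Cmult (RtoC 2) (csum (seq 1 N) v))).
    - eapply CI_ext; [|apply CI_plus; [apply (Hv 0%nat)|apply CI_scal, (CI_csum (seq 1 N) (fun n x => Cmult (fC p q x) (RtoC (cos (INR n * x)))))]].
      + intros x _. cbv beta. rewrite csum_scal, <- RtoC_rsum. unfold dirichlet.
        simpl INR. rewrite Rmult_0_l, cos_0. rewrite RtoC_plus, RtoC_mult. ring.
      + intros n _. apply Hv.
    - unfold pf_sum, v. rewrite <- csum_scal.
      transitivity (Cminus (csum (seq 1 N) (fun n => Cmult (Cmult (RtoC 2) w) (Cdiv (RtoC ((-1) ^ n)) (Cminus (RtoC (INR n ^ 2)) (sqC p q))))) (Cmult w (Cinv (sqC p q)))).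
      + assert (Hq : sqC p q <> RtoC 0).
        { intros H. apply (Hne 0%nat). rewrite H. simpl INR. replace (0 ^ 2) with 0 by ring. ring. }
        assert (E2 : Cdiv (Cmult (RtoC ((-1) ^ 0)) w) (Cminus (RtoC (INR 0 ^ 2)) (sqC p q)) = Copp (Cmult w (Cinv (sqC p q)))).
        { simpl INR. replace (0 ^ 2) with 0 by ring. simpl pow. field. try split; auto.
          all: intros H; apply Hq; replace (sqC p q) with (- (0 - sqC p q))%C by ring; rewrite H; ring. }
        rewrite E2, Cplus_comm. apply (f_equal (fun z => Cplus z (Copp (Cmult w (Cinv (sqC p q)))))).
        apply csum_ext. intros n _. unfold Cdiv. ring.
      + rewrite csum_scal. ring. }
  assert (HD : is_RInt (dirichlet N) 0 PI PI).
  { unfold dirichlet.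
    replace PI with (PI + 2 * rsum (seq 1 N) (fun n => 0)) at 2.
    2: { rewrite rsum_0 by auto. ring. }
    apply (is_RInt_plus (V := R_NormedModule)).
    - evar_last; [apply (is_RInt_const (V := R_NormedModule))|]. unfold scal; simpl; unfold mult; simpl; ring.
    - apply (is_RInt_scal (V := R_NormedModule)).
      assert (Hg : forall l, (forall n, In n l -> (1 <= n)%nat) -> is_RInt (fun x => rsum l (fun n => cos (INR n * x))) 0 PI (rsum l (fun _ => 0))).
      { induction l as [|n l IH]; intros Hl; simpl.
        - evar_last; [apply (is_RInt_const (V := R_NormedModule))|]. unfold scal; simpl; unfold mult; simpl; ring.
        - apply (is_RInt_plus (V := R_NormedModule)); [|apply IH; intros; apply Hl; right; auto].
          assert (1 <= INR n) by (apply (le_INR 1), Hl; left; auto).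
          evar_last; [apply (is_RInt_derive (fun x => sin (INR n * x) / INR n) (fun x => cos (INR n * x)))|].
          + intros x _. auto_derive; auto. field. lra.
          + intros x _. apply (ex_derive_continuous (V := R_NormedModule)); auto_derive; auto.
          + unfold minus, plus, opp; simpl. rewrite Rmult_0_r, sin_0.
            replace (sin (INR n * PI)) with 0; [field; lra|].
            symmetry. apply sin_eq_0_1. exists (Z.of_nat n). rewrite INR_IZR_INZ. reflexivity. }
      apply Hg. intros n Hn. apply in_seq in Hn. lia. }
  destruct HV as [V1 V2]. set (W := Cmult w (pf_sum p q N)) in *.
  assert (Hbd : forall x, 0 <= x <= PI -> Rabs (cos (p * x)) <= 1 /\ Rabs (sin (p * x)) <= 1 /\
     Rabs (ch (q * x)) <= exp (Rabs q * PI) /\ Rabs (sh (q * x)) <= exp (Rabs q * PI)).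
  { intros x Hx. split; [apply Rabs_le; generalize (COS_bound (p * x)); lra|].
    split; [apply Rabs_le; generalize (SIN_bound (p * x)); lra|].
    assert (exp (Rabs (q * x)) <= exp (Rabs q * PI)).
    { rewrite Rabs_mult, (Rabs_right x) by lra.
      destruct (Rle_lt_or_eq_dec (Rabs q * x) (Rabs q * PI)) as [H|H].
      - apply Rmult_le_compat_l; [apply Rabs_pos|lra].
      - left; apply exp_increasing; auto.
      - rewrite H; lra. }
    generalize (exp_abs_bounds (q * x)). intros [B1 B2]. split; lra. }
  set (X := exp (Rabs q * PI)) in *. assert (HX : 0 < X) by apply exp_pos.
  assert (Hpr : forall a b, Rabs a <= 1 -> Rabs b <= X -> Rabs (a * b) <= X).
  { intros a b Ha Hb. rewrite Rabs_mult. generalize (Rabs_pos a) (Rabs_pos b). nra. }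
  assert (HsqK : forall a b, Rabs a <= X -> Rabs b <= X ->
     Rabs (- (p ^ 2 - q ^ 2) * a + 2 * p * q * b) <= L).
  { intros a b Ha Hb.
    assert (Hp : Rabs (- (p ^ 2 - q ^ 2)) <= (Rabs p + Rabs q + 1) ^ 2).
    { generalize (pow2_abs p) (pow2_abs q) (Rabs_pos p) (Rabs_pos q). intros E1 E2 P1 P2. apply Rabs_le. nra. }
    assert (Hq : Rabs (2 * p * q) <= (Rabs p + Rabs q + 1) ^ 2).
    { rewrite !Rabs_mult, (Rabs_right 2) by lra. generalize (Rabs_pos p) (Rabs_pos q). nra. }
    eapply Rle_trans; [apply Rabs_triang|]. rewrite !(Rabs_mult _ a), !(Rabs_mult _ b).
    assert (Rabs (- (p ^ 2 - q ^ 2)) * Rabs a <= (Rabs p + Rabs q + 1) ^ 2 * X) by (apply Rmult_le_compat; auto; apply Rabs_pos).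
    assert (Rabs (2 * p * q) * Rabs b <= (Rabs p + Rabs q + 1) ^ 2 * X) by (apply Rmult_le_compat; auto; apply Rabs_pos).
    unfold L. assert (0 <= (Rabs p + Rabs q + 1) ^ 2 * X) by (apply Rmult_le_pos; [apply pow2_ge_0|lra]). lra. }
  assert (HL : 0 <= L).
  { unfold L. apply Rmult_le_pos; [|lra]. generalize (pow2_ge_0 (Rabs p + Rabs q + 1)); lra. }
  (* Subtracting the value 1 at the origin makes the real part vanish to second order, as
     [dirichlet_small] demands; the imaginary part already does. *)
  assert (R1 : Rabs (fst W - PI) <= 24 * L * PI / (INR N + / 2)).
  { apply (dirichlet_small (fun x => fst (fC p q x) - 1) (fun x => fst (dfC p q x))
      (fun x => fst (Cmult (Copp (sqC p q)) (fC p q x))) L N); auto.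
    - intros x. destruct (CD_fC p q x) as [D1 _].
      evar_last; [apply (is_derive_minus (V := R_NormedModule)); [exact D1|apply (is_derive_const (V := R_NormedModule))]|].
      unfold minus, plus, opp, zero; simpl. ring.
    - intros x. apply CD_dfC.
    - unfold fC; simpl. rewrite !Rmult_0_r, cos_0, ch_0. ring.
    - unfold dfC; simpl. rewrite !Rmult_0_r, sin_0, sh_0. ring.
    - intros x Hx. destruct (Hbd x Hx) as (B1 & B2 & B3 & B4). unfold Cmult, Copp, sqC, fC; simpl.
      replace (- (p * (p * 1) - q * (q * 1)) * (cos (p * x) * ch (q * x)) - - (2 * p * q) * - (sin (p * x) * sh (q * x))) with
       (- (p ^ 2 - q ^ 2) * (cos (p * x) * ch (q * x)) + 2 * p * q * (- (sin (p * x) * sh (q * x)))) by (simpl; ring).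
      apply HsqK; [apply Hpr; auto|rewrite Rabs_Ropp; apply Hpr; auto].
    - eapply is_RInt_ext; [|apply (is_RInt_minus (V := R_NormedModule) _ _ _ _ _ _ V1 HD)].
      intros x _. unfold minus, plus, opp; simpl. ring. }
  assert (R2 : Rabs (snd W) <= 24 * L * PI / (INR N + / 2)).
  { apply (dirichlet_small (fun x => snd (fC p q x)) (fun x => snd (dfC p q x))
      (fun x => snd (Cmult (Copp (sqC p q)) (fC p q x))) L N); auto.
    - intros x. apply CD_fC.
    - intros x. apply CD_dfC.
    - unfold fC; simpl. rewrite !Rmult_0_r, sh_0. ring.
    - unfold dfC; simpl. rewrite !Rmult_0_r, sin_0, sh_0. ring.
    - intros x Hx. destruct (Hbd x Hx) as (B1 & B2 & B3 & B4). unfold Cmult, Copp, sqC, fC; simpl.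
      replace (- (p * (p * 1) - q * (q * 1)) * - (sin (p * x) * sh (q * x)) + - (2 * p * q) * (cos (p * x) * ch (q * x))) with
       (- (p ^ 2 - q ^ 2) * - (sin (p * x) * sh (q * x)) + 2 * p * q * (- (cos (p * x) * ch (q * x)))) by (simpl; ring).
      apply HsqK; rewrite Rabs_Ropp; apply Hpr; auto.
    - eapply is_RInt_ext; [|exact V2]. intros x _. simpl. ring. }
  replace (Cminus W (RtoC PI)) with (Cplus (RtoC (fst W - PI)) (Cmult Ci (RtoC (snd W)))).
  2: { clearbody W. destruct W as [W1 W2]. unfold Cplus, Cminus, Copp, Cmult, Ci, RtoC; simpl. apply injective_projections; simpl; ring. }
  eapply Rle_trans; [apply Cmod_triangle|]. rewrite Cmod_mult, Cmod_Ci, !Cmod_R. unfold Rdiv in *. lra.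
Qed.

(** * Partial sums of the eta series *)

Definition eterm (t : R) (n : nat) : CC :=
  Cmult (RtoC ((-1) ^ n * / sqrt (INR (S n)))) (cis (- (t * ln (INR (S n))))).

Definition ep (t : R) (N : nat) : CC := csum (seq 0 N) (eterm t).

Lemma eta_term_crit t n : eta_term (crit t) n = eterm t n.
Proof.
  unfold eta_term, eterm, Cpowr, Cexp, crit, Copp, Cmult, RtoC, cis. cbn [fst snd Re Im].
  assert (0 < INR (S n)) by (apply lt_0_INR; lia).
  replace (ln (INR (S n)) * - / 2 - 0 * - t) with (ln (INR (S n)) * - / 2) by ring.
  replace (ln (INR (S n)) * - t + 0 * - / 2) with (- (t * ln (INR (S n)))) by ring.
  rewrite exp_half_ln by auto. apply injective_projections; cbn [fst snd]; ring.
Qed.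

Lemma cis_pi n : cis (INR n * PI) = RtoC ((-1) ^ n).
Proof.
  induction n as [|n IH]; [simpl; rewrite Rmult_0_l; apply cis_0|].
  rewrite S_INR, Rmult_plus_distr_r, Rmult_1_l, cis_add, IH.
  replace (cis PI) with (RtoC (-1)) by (unfold cis; rewrite cos_PI, sin_PI; reflexivity).
  rewrite <- RtoC_mult. f_equal. simpl; ring.
Qed.

Lemma tan_half_bound y : Rabs y <= / 2 -> 0 < cos y /\ Rabs (sin y / cos y) <= 1.
Proof.
  intros Hy. generalize PI2_3_2 PI_RGT_0; intros HP HP0.
  apply Rabs_le_between in Hy.
  assert (Hc : 0 < cos y) by (apply cos_gt_0; lra). split; auto.
  change (sin y / cos y) with (tan y). rewrite <- tan_PI4.
  apply Rabs_le. split.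
  - rewrite <- tan_neg. left. apply tan_increasing; lra.
  - left. apply tan_increasing; lra.
Qed.

Lemma tan_mono x y : Rabs x <= / 2 -> Rabs y <= / 2 -> x <= y -> sin x / cos x <= sin y / cos y.
Proof.
  intros Hx Hy Hxy. generalize PI2_3_2 PI_RGT_0; intros HP HP0.
  apply Rabs_le_between in Hx. apply Rabs_le_between in Hy.
  destruct Hxy as [H|<-]; [|lra]. left. apply (tan_increasing x y); lra.
Qed.

Lemma seq_add_map N k m : seq (N + k) m = map (Nat.add N) (seq k m).
Proof.
  revert k. induction m as [|m IH]; intros k; [reflexivity|].
  simpl. f_equal. rewrite <- IH. f_equal. lia.
Qed.

(** The sign (-1)^n adds PI to each phase increment, which becomes PI - t ln (1 + 1/n) and stays
    away from multiples of 2 PI once n >= |t|. The cotangent of half of it is the tangent of an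
    angle at most 1/2, hence at most 1, and [kusmin_landau] gives 3 = 1 + 2; the weights are removed
    by partial summation. *)
Lemma ep_tail t N m : Rabs t <= INR N -> Cmod (Cminus (ep t (N + m)) (ep t N)) <= 3 * / sqrt (INR N + 1).
Proof.
  intros Ht. unfold ep. rewrite csum_seq_split. simpl Nat.add.
  cmod_replace (csum (seq N m) (eterm t)).
  rewrite <- (Nat.add_0_r N) at 1. rewrite seq_add_map, csum_map.
  set (th := fun i => INR (N + i) * PI - t * ln (INR (S (N + i)))).
  rewrite (csum_ext _ _ (fun i => Cmult (RtoC (/ sqrt (INR (S (N + i))))) (cis (th i)))).
  2: { intros i _. unfold eterm, th, Rminus. rewrite cis_add, cis_pi, RtoC_mult. ring. }
  replace (/ sqrt (INR N + 1)) with (/ sqrt (INR (S (N + 0)))) by (rewrite Nat.add_0_r, S_INR; reflexivity).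
  assert (Hpos : forall i, INR N + 1 <= INR (S (N + i))).
  { intros i. rewrite <- S_INR. apply le_INR. lia. }
  generalize (pos_INR N); intros HN.
  apply (abel_weights (fun i => cis (th i)) (fun i => / sqrt (INR (S (N + i))))).
  - intros m' _. replace 3 with (1 + 2 * 1) by ring.
    set (y := fun i => t / 2 * (ln (INR (S (N + i)) + 1) - ln (INR (S (N + i))))).
    assert (Hd : forall i, (th (S i) - th i) / 2 = PI / 2 - y i).
    { intros i. unfold th, y. replace (N + S i)%nat with (S (N + i)) by lia.
      rewrite (S_INR (S (N + i))), (S_INR (N + i)). field. }
    assert (Hl : forall i, 0 <= ln (INR (S (N + i)) + 1) - ln (INR (S (N + i))) <= / INR (S (N + i))).
    { intros i. specialize (Hpos i). generalize (ln_succ_bounds (INR (S (N + i))) ltac:(lra)).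
      intros [L1 L2]. split; auto. eapply Rle_trans; [|exact L1]. left; apply Rinv_0_lt_compat; lra. }
    assert (Hy : forall i, Rabs (y i) <= / 2).
    { intros i. unfold y. rewrite Rabs_mult. specialize (Hl i). specialize (Hpos i).
      rewrite (Rabs_right (ln _ - _)) by lra. unfold Rdiv. rewrite Rabs_mult, (Rabs_right (/ 2)) by lra.
      assert (Rabs t * (ln (INR (S (N + i)) + 1) - ln (INR (S (N + i)))) <= INR (S (N + i)) * / INR (S (N + i))).
      { apply Rmult_le_compat; try lra. apply Rabs_pos. }
      rewrite Rinv_r in H by lra. lra. }
    assert (Hcs : forall i, cos ((th (S i) - th i) / 2) / sin ((th (S i) - th i) / 2) = sin (y i) / cos (y i)).
    { intros i. rewrite Hd, cos_shift, sin_shift. reflexivity. }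
    assert (Hdec : forall i, ln (INR (S (N + S i)) + 1) - ln (INR (S (N + S i))) <= ln (INR (S (N + i)) + 1) - ln (INR (S (N + i)))).
    { intros i. replace (INR (S (N + S i))) with (INR (S (N + i)) + 1).
      2: { rewrite <- S_INR. f_equal. lia. }
      specialize (Hpos i). set (M := INR (S (N + i))) in *.
      rewrite <- !ln_div by lra. apply ln_le; [apply Rdiv_lt_0_compat; lra|].
      apply Rmult_le_reg_r with (M * (M + 1)); [nra|]. field_simplify; nra. }
    apply kusmin_landau.
    + intros i _. rewrite Hd, sin_shift. apply Rgt_not_eq. apply tan_half_bound; auto.
    + destruct (Rle_dec 0 t) as [H0|H0].
      * left. intros i _. rewrite !Hcs. apply tan_mono; auto. unfold y. apply Rmult_le_compat_l; [lra|apply Hdec].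
      * right. intros i _. rewrite !Hcs. apply tan_mono; auto. unfold y. specialize (Hdec i). nra.
    + intros i _. rewrite Hcs. apply tan_half_bound; auto.
    + lra.
  - intros i. apply inv_sqrt_le. split; [specialize (Hpos i); lra|]. apply le_INR. lia.
  - intros i. left. apply Rinv_0_lt_compat, sqrt_lt_R0. specialize (Hpos i). lra.
Qed.

Lemma sum_n_rsum (f : nat -> R) n : sum_n f n = rsum (seq 0 (S n)) f.
Proof.
  induction n as [|n IH]; [rewrite sum_O; simpl; ring|].
  rewrite sum_Sn, IH, (rsum_seq_S 0 (S n)). reflexivity.
Qed.

Lemma fst_csum {A : Type} (l : list A) F : fst (csum l F) = rsum l (fun a => fst (F a)).
Proof. induction l as [|a l IH]; simpl; [reflexivity|rewrite IH; reflexivity]. Qed.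

Lemma snd_csum {A : Type} (l : list A) F : snd (csum l F) = rsum l (fun a => snd (F a)).
Proof. induction l as [|a l IH]; simpl; [reflexivity|rewrite IH; reflexivity]. Qed.

Lemma Series_limit (f : nat -> R) (N : nat) (C : R) :
  (forall n m, (N <= n)%nat -> Rabs (rsum (seq 0 (n + m)) f - rsum (seq 0 n) f) <= C * / sqrt (INR n + 1)) -> 0 <= C ->
  forall n, (N <= n)%nat -> Rabs (Series f - rsum (seq 0 n) f) <= C * / sqrt (INR n + 1).
Proof.
  intros H HC.
  destruct (R_complete (fun n => rsum (seq 0 n) f)) as [l Hl].
  - intros e He. destruct (inv_sqrt_small (e / (2 * C + 1))) as [M HM].
    { apply Rdiv_lt_0_compat; lra. }
    set (n0 := (N + M)%nat). exists n0. intros n m Hn Hm. unfold R_dist.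
    assert (Hs : / sqrt (INR n0 + 1) < e / (2 * C + 1)).
    { eapply Rle_lt_trans; [|exact HM]. apply inv_sqrt_le. generalize (pos_INR M); split; [lra|].
      unfold n0. rewrite plus_INR. generalize (pos_INR N). lra. }
    replace n with (n0 + (n - n0))%nat by lia. replace m with (n0 + (m - n0))%nat by lia.
    generalize (H n0 (n - n0)%nat ltac:(unfold n0; lia)) (H n0 (m - n0)%nat ltac:(unfold n0; lia)). intros H1 H2.
    set (A := rsum (seq 0 (n0 + (n - n0))) f) in *. set (B := rsum (seq 0 (n0 + (m - n0))) f) in *.
    replace (A - B) with ((A - rsum (seq 0 n0) f) - (B - rsum (seq 0 n0) f)) by ring.
    eapply Rle_lt_trans; [apply Rabs_triang|]. rewrite Rabs_Ropp.
    apply Rle_lt_trans with ((2 * C) * / sqrt (INR n0 + 1)); [lra|].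
    apply Rle_lt_trans with ((2 * C) * (e / (2 * C + 1))).
    + apply Rmult_le_compat_l; lra.
    + apply Rmult_lt_reg_r with (2 * C + 1); [lra|]. field_simplify; lra.
  - assert (E : Series f = l).
    { apply is_series_unique. apply is_lim_seq_Reals in Hl.
      apply is_lim_seq_incr_1 in Hl. unfold is_series.
      apply (is_lim_seq_ext _ (sum_n f)) in Hl; [exact Hl|]. intros n. rewrite sum_n_rsum. reflexivity. }
    intros n Hn. rewrite E. apply Un_cv_le_dist with (u := fun n => rsum (seq 0 n) f); auto.
    intros m Hm. replace m with (n + (m - n))%nat by lia. apply H; auto.
Qed.

Theorem eta_approx t N : Rabs t <= INR N -> Cmod (Cminus (eta (crit t)) (ep t N)) <= 6 * / sqrt (INR N + 1).
Proof.
  intros Ht.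
  assert (Hre : forall z : CC, Rabs (fst z) <= Cmod z) by (intros z; eapply Rle_trans; [apply Rmax_l|apply Rmax_Cmod]).
  assert (Him : forall z : CC, Rabs (snd z) <= Cmod z) by (intros z; eapply Rle_trans; [apply Rmax_r|apply Rmax_Cmod]).
  assert (Ht' : forall n, (N <= n)%nat -> Rabs t <= INR n) by (intros n Hn; apply le_INR in Hn; lra).
  assert (E : eta (crit t) = (Series (fun n => fst (eterm t n)), Series (fun n => snd (eterm t n)))).
  { unfold eta. f_equal; apply Series_ext; intros n; rewrite eta_term_crit; reflexivity. }
  rewrite E.
  assert (H1 : Rabs (Series (fun n => fst (eterm t n)) - fst (ep t N)) <= 3 * / sqrt (INR N + 1)).
  { unfold ep. rewrite fst_csum. apply (Series_limit _ N); [|lra|lia].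
    intros n m Hn. rewrite <- !fst_csum. eapply Rle_trans; [|apply (ep_tail t n m); auto].
    apply (Hre (ep t (n + m) - ep t n)%C). }
  assert (H2 : Rabs (Series (fun n => snd (eterm t n)) - snd (ep t N)) <= 3 * / sqrt (INR N + 1)).
  { unfold ep. rewrite snd_csum. apply (Series_limit _ N); [|lra|lia].
    intros n m Hn. rewrite <- !snd_csum. eapply Rle_trans; [|apply (ep_tail t n m); auto].
    apply (Him (ep t (n + m) - ep t n)%C). }
  set (s1 := Series (fun n => fst (eterm t n))) in *. set (s2 := Series (fun n => snd (eterm t n))) in *.
  replace (Cminus (s1, s2) (ep t N)) with (Cplus (RtoC (s1 - fst (ep t N))) (Cmult Ci (RtoC (s2 - snd (ep t N))))).
  2: { destruct (ep t N). apply injective_projections; simpl; ring. }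
  eapply Rle_trans; [apply Cmod_triangle|]. rewrite Cmod_mult, Cmod_Ci, !Cmod_R. lra.
Qed.

Lemma ep_conj t N : Cconj (ep t N) = ep (- t) N.
Proof.
  unfold ep. rewrite Cconj_csum. apply csum_ext. intros n _. unfold eterm.
  rewrite Cmult_conj, cis_conj. f_equal.
  - unfold Cconj, RtoC; simpl. f_equal. ring.
  - f_equal. ring.
Qed.

(** Identities between limits are proved by bounding their difference, which does not depend on n,
    by a null sequence. *)
Lemma C_limit_unique (z : CC) (C : R) (n0 : nat) :
  (forall n, (n0 <= n)%nat -> Cmod z <= C * / sqrt (INR n + 1)) -> z = RtoC 0.
Proof.
  intros H. apply Cmod_eq_0. apply Rle_antisym; [|apply Cmod_ge_0].
  apply le_epsilon. intros e He.
  assert (HC : 0 < Rabs C + 1) by (generalize (Rabs_pos C); lra).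
  destruct (inv_sqrt_small (e / (Rabs C + 1))) as [M HM]; [apply Rdiv_lt_0_compat; lra|].
  eapply Rle_trans; [apply (H (n0 + M)%nat); lia|].
  assert (Hs : / sqrt (INR (n0 + M) + 1) <= e / (Rabs C + 1)).
  { left. eapply Rle_lt_trans; [|exact HM]. apply inv_sqrt_le. generalize (pos_INR M) (pos_INR n0).
    rewrite plus_INR. lra. }
  assert (0 <= / sqrt (INR (n0 + M) + 1)).
  { left; apply Rinv_0_lt_compat, sqrt_lt_R0. generalize (pos_INR (n0 + M)); lra. }
  apply Rle_trans with ((Rabs C + 1) * (e / (Rabs C + 1))).
  - apply Rle_trans with ((Rabs C + 1) * / sqrt (INR (n0 + M) + 1)).
    + apply Rmult_le_compat_r; auto. generalize (Rle_abs C); lra.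
    + apply Rmult_le_compat_l; lra.
  - right. field. lra.
Qed.

Lemma eta_conj t : Cconj (eta (crit t)) = eta (crit (- t)).
Proof.
  destruct (nfloor_ex (Rabs t) (Rabs_pos t)) as [n0 [_ Hn0]].
  assert (E : Cminus (Cconj (eta (crit t))) (eta (crit (- t))) = RtoC 0).
  { apply (C_limit_unique _ 12 (S n0)). intros n Hn.
    assert (Ht : Rabs t <= INR n) by (apply le_INR in Hn; rewrite S_INR in Hn; lra).
    cmod_replace (Cminus (Cconj (eta (crit t)) - ep (- t) n)%C (eta (crit (- t)) - ep (- t) n)%C).
    rewrite <- ep_conj at 1. rewrite <- Cminus_conj.
    eapply Rle_trans; [apply Cmod_triangle|]. rewrite Cmod_opp, Cmod_conj.
    generalize (eta_approx t n Ht) (eta_approx (- t) n ltac:(rewrite Rabs_Ropp; auto)). lra. }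
  replace (Cconj (eta (crit t))) with (Cplus (Cminus (Cconj (eta (crit t))) (eta (crit (- t)))) (eta (crit (- t)))) by ring.
  rewrite E. ring.
Qed.

(** * The functional equation *)

Lemma CI_Kf_minus t f g a b w w' :
  CI (Kf t f) a b w -> CI (Kf t g) a b w' -> CI (Kf t (fun x => f x - g x)) a b (Cminus w w').
Proof.
  intros H H'. replace (Cminus w w') with (Cplus w (Cmult (RtoC (Ropp 1)) w')) by (rewrite RtoC_opp; ring).
  eapply CI_ext; [|apply CI_plus; [exact H|apply CI_scal; exact H']].
  intros x _. unfold Kf, Cplus, Cmult, RtoC; simpl. f_equal; ring.
Qed.

Lemma CI_pow_low t k a : 0 < a <= 1 ->
  CI (Kf t (fun y => y ^ S k)) a 1
     (Cmult (Cinv (/ 2 + INR (S k), t)) (Cminus (RtoC 1) (pw t (fun y => y ^ S k) a))).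
Proof.
  intros Ha. assert (HN : 0 <= INR (S k)) by apply pos_INR.
  assert (Hz : (/ 2 + INR (S k), t) <> RtoC 0) by (apply pair_neq_0; lra).
  generalize (CI_pw t (fun y => y ^ S k) (fun y => INR (S k) * y ^ k) a 1 ltac:(lra)).
  intros H. eapply CI_ext; [|apply CI_scal].
  2: { replace (RtoC 1) with (pw t (fun y => y ^ S k) 1).
       2: { rewrite pw_cis, ln_1, Rmult_0_r, cis_0, sqrt_1, pow1. rewrite Rmult_1_l. ring. }
       apply H.
       - intros y _. auto_derive; auto. change (match k with 0%nat => 1 | S _ => INR k + 1 end) with (INR (S k)). simpl Nat.pred. ring.
       - intros y _. apply (ex_derive_continuous (V := R_NormedModule)). auto_derive; auto. }
  intros y _. cbv beta.
  match goal with |- Cmult _ ?B = _ =>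
    replace B with (Cmult (/ 2 + INR (S k), t) (Kf t (fun y => y ^ S k) y)) end.
  - rewrite Cmult_assoc, Cinv_l by auto. ring.
  - unfold Kf, Cmult, Cplus; cbn [fst snd pow]. f_equal; ring.
Qed.

Lemma CI_pow_high t k b : 1 <= b ->
  CI (Kf t (fun y => / y ^ S k)) 1 b
     (Cmult (Cinv (INR (S k) - / 2, - t)) (Cminus (RtoC 1) (pw t (fun y => / y ^ S k) b))).
Proof.
  intros Hb. assert (HN : 1 <= INR (S k)) by (apply (le_INR 1); lia).
  assert (Hz : (INR (S k) - / 2, - t) <> RtoC 0) by (apply pair_neq_0; lra).
  assert (Hp : forall y, 1 <= y -> y ^ S k <> 0) by (intros y Hy; apply pow_nonzero; lra).
  assert (Hp' : forall y, 1 <= y -> y ^ k <> 0) by (intros y Hy; apply pow_nonzero; lra).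
  generalize (CI_pw t (fun y => / y ^ S k) (fun y => - (INR (S k) * y ^ k) / (y ^ S k) ^ 2) 1 b ltac:(lra)).
  intros H.
  replace (Cmult (Cinv (INR (S k) - / 2, - t)) (Cminus (RtoC 1) (pw t (fun y => / y ^ S k) b))) with
    (Cmult (Copp (Cinv (INR (S k) - / 2, - t))) (Cminus (pw t (fun y => / y ^ S k) b) (pw t (fun y => / y ^ S k) 1))).
  2: { replace (pw t (fun y => / y ^ S k) 1) with (RtoC 1); [ring|].
       rewrite pw_cis, ln_1, Rmult_0_r, cis_0, sqrt_1, pow1, Rinv_1. rewrite Rmult_1_l. ring. }
  eapply CI_ext; [|apply CI_scal, H].
  - intros y Hy. rewrite Rmin_left in Hy by lra. cbv beta.
    match goal with |- Cmult _ ?B = _ =>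
      replace B with (Cmult (Copp (INR (S k) - / 2, - t)) (Kf t (fun y => / y ^ S k) y)) end.
    + rewrite Cmult_assoc.
      replace (Cmult (Copp (Cinv (INR (S k) - / 2, - t))) (Copp (INR (S k) - / 2, - t))) with
        (Cmult (Cinv (INR (S k) - / 2, - t)) (INR (S k) - / 2, - t)) by ring.
      rewrite Cinv_l by auto. ring.
    + specialize (Hp' y ltac:(lra)).
      assert (0 < sqrt y) by (apply sqrt_lt_R0; lra).
      unfold Kf, Cmult, Cplus, Copp; cbn [fst snd pow]. f_equal; field; repeat split; lra || auto.
  - intros y Hy. specialize (Hp y ltac:(lra)).
    apply (is_derive_inv (fun y => y ^ S k) y (INR (S k) * y ^ k)); auto.
    auto_derive; auto. change (match k with 0%nat => 1 | S _ => INR k + 1 end) with (INR (S k)). simpl Nat.pred. ring.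
  - intros y Hy. specialize (Hp y ltac:(lra)). specialize (Hp' y ltac:(lra)).
    apply (ex_derive_continuous (V := R_NormedModule)). auto_derive.
    apply Rmult_integral_contrapositive_currified; auto.
Qed.

(* [cpart a L] is a partial sum of [pi / sin (pi a)] *)
Definition cpart (a : CC) (L : nat) : CC :=
  csum (seq 0 L) (fun m => Cmult (RtoC ((-1) ^ m))
    (Cplus (Cinv (Cminus (RtoC (INR m + 1)) a)) (Cinv (Cplus (RtoC (INR m)) a)))).

Lemma geom_low y L : 1 + y ^ 2 <> 0 ->
  2 * y / (1 + y ^ 2) - rsum (seq 0 L) (fun m => 2 * (-1) ^ m * y ^ S (2 * m)) =
  (-1) ^ L * (y ^ (2 * L) * (2 * y / (1 + y ^ 2))).
Proof.
  intros Hy. induction L as [|L IH].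
  - simpl. field. simpl in Hy. lra.
  - rewrite rsum_seq_S. simpl Nat.add.
    transitivity (2 * y / (1 + y ^ 2) - rsum (seq 0 L) (fun m => 2 * (-1) ^ m * y ^ S (2 * m)) - 2 * (-1) ^ L * y ^ S (2 * L)); [simpl; ring|].
    rewrite IH. replace (2 * S L)%nat with (S (S (2 * L))) by lia.
    cbn [pow]. set (Y := y ^ (2 * L)). set (sg := (-1) ^ L). cbn [pow] in Hy. field. lra.
Qed.

Lemma geom_high y L : 0 < y ->
  2 * y / (1 + y ^ 2) - rsum (seq 0 L) (fun m => 2 * (-1) ^ m * / y ^ S (2 * m)) =
  (-1) ^ L * (/ y ^ (2 * L) * (2 * y / (1 + y ^ 2))).
Proof.
  intros Hy. generalize (geom_low (/ y) L). intros H.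
  assert (Hi : 0 < / y) by (apply Rinv_0_lt_compat; auto).
  specialize (H ltac:(nra)).
  replace (2 * / y / (1 + (/ y) ^ 2)) with (2 * y / (1 + y ^ 2)) in H by (field; nra).
  rewrite pow_inv in H. rewrite <- H. f_equal. apply rsum_ext. intros m _. rewrite pow_inv. reflexivity.
Qed.

Lemma Kf_rsum {A : Type} t (l : list A) (c : A -> R) (f : A -> R -> R) y :
  Kf t (fun y => rsum l (fun i => c i * f i y)) y = csum l (fun i => Cmult (RtoC (c i)) (Kf t (f i) y)).
Proof.
  induction l as [|i l IH].
  - simpl. unfold Kf, RtoC. simpl. f_equal; ring.
  - simpl. rewrite <- IH. unfold Kf, RtoC, Cmult, Cplus; simpl. f_equal; ring.
Qed.

(** The function is expanded in powers of x on (0, 1) and of 1/x on (1, oo). Up to the factor 2, the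
    terms x^(2m+1) and x^(-2m-1) integrate to the fractions 1 / (m + 1 - a) and 1 / (m + a) with a =
    1/4 + i t/2, and each geometric remainder contributes at most 1/L. *)
Lemma mellin_rational_approx t v : mellin (- t) (fun x => 2 * x / (1 + x ^ 2)) v ->
  forall L, (1 <= L)%nat -> Cmod (Cminus v (cpart (/ 4, t / 2) L)) <= 2 / INR L.
Proof.
  intros Hv L HL. assert (HLR : 1 <= INR L) by (apply (le_INR 1); auto).
  set (f := fun x => 2 * x / (1 + x ^ 2)) in *.
  assert (Hfc : forall x, continuous f x).
  { intros x. apply (ex_derive_continuous (V := R_NormedModule)). unfold f. auto_derive. nra. }
  apply le_epsilon. intros e He.
  destruct (Hv (e / 2) ltac:(lra)) as (dl & B & Hdl & HB & HW).
  (* [r] bounds the boundary terms left at the cuts [a] and [b]: each of the L summands is off by at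
     most 8 r, in total by e / 2. *)
  set (r := e / (16 * INR L)). assert (Hr : 0 < r) by (apply Rdiv_lt_0_compat; lra).
  set (a := Rmin (dl / 2) (Rmin 1 (r ^ 2))). set (b := Rmax (B + 1) (Rmax 1 (/ r ^ 2))).
  assert (Hr2 : 0 < r ^ 2) by (apply pow_lt; auto).
  assert (Ha : 0 < a) by (unfold a; repeat apply Rmin_case; lra).
  assert (Ha1 : a <= dl / 2) by apply Rmin_l.
  assert (Ha2 : a <= 1) by (eapply Rle_trans; [apply Rmin_r|apply Rmin_l]).
  assert (Ha3 : a <= r ^ 2) by (eapply Rle_trans; [apply Rmin_r|apply Rmin_r]).
  assert (Hb1 : B + 1 <= b) by apply Rmax_l.
  assert (Hb2 : 1 <= b) by (eapply Rle_trans; [|apply Rmax_r]; apply Rmax_l).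
  assert (Hb3 : / r ^ 2 <= b) by (eapply Rle_trans; [|apply Rmax_r]; apply Rmax_r).
  assert (Hsa : sqrt a <= r).
  { rewrite <- (sqrt_pow2 r) by lra. apply sqrt_le_1_alt; auto. }
  assert (Hsb : / sqrt b <= r).
  { rewrite <- (Rinv_inv r). apply Rinv_le_contravar; [apply Rinv_0_lt_compat; auto|].
    rewrite <- (sqrt_pow2 (/ r)) by (left; apply Rinv_0_lt_compat; auto). apply sqrt_le_1_alt. rewrite pow_inv. auto. }
  destruct (HW a b ltac:(lra) ltac:(lra)) as (w & Hw & Hwv).
  destruct (CI_ex (Kf (- t) f) a 1) as [w1 Hw1].
  { intros x Hx. rewrite Rmin_left in Hx by lra. apply Ccont_Kf; [lra|auto]. }
  destruct (CI_ex (Kf (- t) f) 1 b) as [w2 Hw2].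
  { intros x Hx. rewrite Rmin_left in Hx by lra. apply Ccont_Kf; [lra|auto]. }
  assert (Ew : w = Cplus w1 w2) by (eapply CI_unique; [exact Hw|eapply CI_Chasles; eauto]).
  set (lo := csum (seq 0 L) (fun m => Cmult (RtoC (2 * (-1) ^ m)) (Cmult (Cinv (/ 2 + INR (S (2 * m)), - t)) (Cminus (RtoC 1) (pw (- t) (fun y => y ^ S (2 * m)) a))))).
  set (hi := csum (seq 0 L) (fun m => Cmult (RtoC (2 * (-1) ^ m)) (Cmult (Cinv (INR (S (2 * m)) - / 2, - - t)) (Cminus (RtoC 1) (pw (- t) (fun y => / y ^ S (2 * m)) b))))).
  assert (Hlo : CI (Kf (- t) (fun y => rsum (seq 0 L) (fun m => 2 * (-1) ^ m * y ^ S (2 * m)))) a 1 lo).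
  { eapply CI_ext; [intros y _; symmetry; apply (Kf_rsum (- t) (seq 0 L) (fun m => 2 * (-1) ^ m) (fun m y => y ^ S (2 * m)))|].
    apply (CI_csum (seq 0 L) (fun m y => Cmult (RtoC (2 * (-1) ^ m)) (Kf (- t) (fun y => y ^ S (2 * m)) y))).
    intros m _. apply CI_scal, CI_pow_low. lra. }
  assert (Hhi : CI (Kf (- t) (fun y => rsum (seq 0 L) (fun m => 2 * (-1) ^ m * / y ^ S (2 * m)))) 1 b hi).
  { eapply CI_ext; [intros y _; symmetry; apply (Kf_rsum (- t) (seq 0 L) (fun m => 2 * (-1) ^ m) (fun m y => / y ^ S (2 * m)))|].
    apply (CI_csum (seq 0 L) (fun m y => Cmult (RtoC (2 * (-1) ^ m)) (Kf (- t) (fun y => / y ^ S (2 * m)) y))).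
    intros m _. apply CI_scal, CI_pow_high. lra. }
  assert (Habs1 : forall n, Rabs ((-1) ^ n) = 1) by (intros n; apply pow_1_abs).
  assert (D1 : Cmod (Cminus w1 lo) <= / INR L).
  { generalize (CI_Kf_minus _ _ _ _ _ _ _ Hw1 Hlo). intros H.
    set (N := (2 * L)%nat).
    apply Rle_trans with (2 / INR (S N) * 1 ^ S N - 2 / INR (S N) * a ^ S N).
    - apply (CI_bound _ (fun y => 2 * y ^ N) a 1 _ _ Ha2) with (2 := H).
      + intros y Hy. rewrite Cmod_Kf by lra. unfold f. rewrite geom_low by nra.
        rewrite Rabs_mult, Habs1, Rmult_1_l.
        assert (Hy1 : 0 <= y ^ N) by (apply pow_le; lra).
        assert (Hs : 0 < sqrt y <= 1). { split; [apply sqrt_lt_R0; lra|]. rewrite <- sqrt_1. apply sqrt_le_1_alt; lra. }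
        assert (Hq : 0 <= 2 * y / (1 + y ^ 2) <= 2 * sqrt y).
        { split; [apply Rmult_le_pos; [lra|left; apply Rinv_0_lt_compat; nra]|].
          apply Rmult_le_reg_r with (1 + y ^ 2); [nra|]. unfold Rdiv. rewrite Rmult_assoc, Rinv_l, Rmult_1_r by nra.
          assert (sqrt y * sqrt y = y) by (apply sqrt_sqrt; lra).
          assert (0 <= sqrt y * y ^ 2) by (apply Rmult_le_pos; nra). nra. }
        fold N. rewrite Rabs_right by (apply Rle_ge, Rmult_le_pos; lra).
        apply Rmult_le_reg_l with (sqrt y); [lra|]. rewrite <- Rmult_assoc, Rinv_r, Rmult_1_l by lra. fold N. nra.
      + refine (is_RInt_derive (fun y => 2 / INR (S N) * y ^ S N) _ a 1 _ _).
        * intros y _. assert (INR (S N) <> 0) by (apply not_0_INR; lia).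
          auto_derive; auto. change (match N with 0%nat => 1 | S _ => INR N + 1 end) with (INR (S N)). simpl Nat.pred. field; auto.
        * intros y _. apply (ex_derive_continuous (V := R_NormedModule)). auto_derive; auto.
    - rewrite pow1. assert (0 <= a ^ S N) by (apply pow_le; lra).
      assert (E : INR (S N) = 2 * INR L + 1) by (unfold N; rewrite S_INR, mult_INR; simpl; ring).
      rewrite E. assert (0 < 2 / (2 * INR L + 1)) by (apply Rdiv_lt_0_compat; lra).
      apply Rle_trans with (2 / (2 * INR L + 1)); [nra|].
      apply Rmult_le_reg_r with ((2 * INR L + 1) * INR L); [nra|]. field_simplify; lra. }
  assert (D2 : Cmod (Cminus w2 hi) <= / INR L).
  { generalize (CI_Kf_minus _ _ _ _ _ _ _ Hw2 Hhi). intros H.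
    set (N := (2 * L)%nat).
    assert (EN : INR N = 2 * INR L) by (unfold N; rewrite mult_INR; simpl; ring).
    apply Rle_trans with (- (2 / INR N) * / b ^ N - - (2 / INR N) * / 1 ^ N).
    - apply (CI_bound _ (fun y => 2 * / y ^ S N) 1 b _ _ Hb2) with (2 := H).
      + intros y Hy. rewrite Cmod_Kf by lra. unfold f. rewrite geom_high by lra.
        rewrite Rabs_mult, Habs1, Rmult_1_l.
        assert (Hy1 : 0 < / y ^ N) by (apply Rinv_0_lt_compat, pow_lt; lra).
        assert (Hs : 1 <= sqrt y). { rewrite <- sqrt_1. apply sqrt_le_1_alt; lra. }
        assert (Hq : 0 <= 2 * y / (1 + y ^ 2) <= 2 * / y).
        { split; [apply Rmult_le_pos; [lra|left; apply Rinv_0_lt_compat; nra]|].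
          apply Rmult_le_reg_r with (y * (1 + y ^ 2)); [nra|]. field_simplify; nra. }
        fold N. rewrite Rabs_right by (apply Rle_ge, Rmult_le_pos; lra).
        apply Rle_trans with (1 * (/ y ^ N * (2 * / y))).
        * apply Rmult_le_compat; [left; apply Rinv_0_lt_compat; lra|apply Rmult_le_pos; lra| |].
          -- rewrite <- Rinv_1. apply Rinv_le_contravar; lra.
          -- apply Rmult_le_compat_l; lra.
        * right. simpl pow. field. split; [apply pow_nonzero|]; lra.
      + refine (is_RInt_derive (fun y => - (2 / INR N) * / y ^ N) _ 1 b _ _).
        * intros y Hy. rewrite Rmin_left in Hy by lra.
          assert (Hyn : y ^ N <> 0) by (apply pow_nonzero; lra).
          auto_derive; auto. fold (pow y N).
          replace N with (S (Nat.pred N)) at 5 by (unfold N; lia).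
          replace N with (S (Nat.pred N)) in Hyn |- * by (unfold N; lia).
          set (j := Nat.pred N) in *. simpl Nat.pred.
          assert (INR (S j) <> 0) by (apply not_0_INR; lia).
          assert (y ^ j <> 0) by (apply pow_nonzero; lra).
          cbn [pow]. field. repeat split; auto; lra.
        * intros y Hy. rewrite Rmin_left in Hy by lra.
          assert (Hyn : y ^ S N <> 0) by (apply pow_nonzero; lra).
          apply (ex_derive_continuous (V := R_NormedModule)). auto_derive; auto.
    - rewrite pow1, Rinv_1, EN. assert (0 < / b ^ N) by (apply Rinv_0_lt_compat, pow_lt; lra).
      assert (0 < 2 / (2 * INR L)) by (apply Rdiv_lt_0_compat; lra).
      apply Rle_trans with (2 / (2 * INR L)); [nra|]. right. field. lra. }
  assert (D3 : Cmod (Cminus (Cplus lo hi) (cpart (/ 4, t / 2) L)) <= e / 2).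
  { unfold lo, hi, cpart. rewrite <- csum_plus, <- csum_minus.
    apply Rle_trans with (rsum (seq 0 L) (fun _ => 8 * r)).
    2: { rewrite rsum_const, length_seq. unfold r. right. field. lra. }
    eapply Rle_trans; [apply Cmod_csum|]. apply rsum_le. intros m _.
    assert (EM : INR (S (2 * m)) = 2 * INR m + 1) by (rewrite S_INR, mult_INR; simpl; ring).
    generalize (pos_INR m); intros Hm. rewrite EM, Ropp_involutive.
    set (z1 := (/ 2 + (2 * INR m + 1), - t)). set (z2 := (2 * INR m + 1 - / 2, t)).
    assert (Hz1 : z1 <> RtoC 0) by (apply pair_neq_0; lra).
    assert (Hz2 : z2 <> RtoC 0) by (apply pair_neq_0; lra).
    assert (E1 : Cinv (Cminus (RtoC (INR m + 1)) (/ 4, t / 2)) = Cmult (RtoC 2) (Cinv z1)).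
    { replace (Cminus (RtoC (INR m + 1)) (/ 4, t / 2)) with (Cmult (RtoC (/ 2)) z1).
      - rewrite RtoC_inv by lra. field; try split; auto; intros HH; apply RtoC_inj in HH; lra.
      - unfold z1, Cminus, Cplus, Copp, Cmult, RtoC; simpl. f_equal; field. }
    assert (E2 : Cinv (Cplus (RtoC (INR m)) (/ 4, t / 2)) = Cmult (RtoC 2) (Cinv z2)).
    { replace (Cplus (RtoC (INR m)) (/ 4, t / 2)) with (Cmult (RtoC (/ 2)) z2).
      - rewrite RtoC_inv by lra. field; try split; auto; intros HH; apply RtoC_inj in HH; lra.
      - unfold z2, Cplus, Cmult, RtoC; simpl. f_equal; field. }
    rewrite E1, E2, RtoC_mult.
    set (p1 := pw (- t) (fun y => y ^ S (2 * m)) a). set (p2 := pw (- t) (fun y => / y ^ S (2 * m)) b).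
    cmod_replace (- (RtoC 2 * RtoC ((-1) ^ m) * (/ z1 * p1 + / z2 * p2)))%C.
    rewrite Cmod_opp, !Cmod_mult, !Cmod_R, Habs1, Rabs_right by lra. rewrite Rmult_1_r.
    assert (P1 : Cmod p1 <= r).
    { unfold p1. rewrite Cmod_pw. rewrite Rabs_right by (apply Rle_ge, pow_le; lra).
      assert (a ^ S (2 * m) <= 1) by (rewrite <- (pow1 (S (2 * m))); apply pow_incr; lra).
      assert (0 <= a ^ S (2 * m)) by (apply pow_le; lra).
      generalize (sqrt_pos a). nra. }
    assert (P2 : Cmod p2 <= r).
    { unfold p2. rewrite Cmod_pw. assert (Hbp : 0 < b ^ (2 * m)) by (apply pow_lt; lra).
      assert (Hb' : 1 <= b ^ (2 * m)) by (apply pow_R1_Rle; lra).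
      assert (Hsp : 0 < sqrt b) by (apply sqrt_lt_R0; lra).
      rewrite Rabs_right by (left; apply Rinv_0_lt_compat, pow_lt; lra).
      replace (sqrt b * / b ^ S (2 * m)) with (/ b ^ (2 * m) * / sqrt b).
      - assert (0 < / b ^ (2 * m) <= 1).
        { split; [apply Rinv_0_lt_compat; auto|]. rewrite <- Rinv_1. apply Rinv_le_contravar; lra. }
        assert (0 < / sqrt b) by (apply Rinv_0_lt_compat; auto). nra.
      - change (b ^ S (2 * m)) with (b * b ^ (2 * m)).
        transitivity (sqrt b * / (sqrt b * sqrt b * b ^ (2 * m))); [field; split; lra|].
        rewrite sqrt_sqrt by lra. reflexivity. }
    assert (I1 : Cmod (Cinv z1) <= 2).
    { rewrite Cmod_inv by auto. rewrite <- (Rinv_inv 2) at 1. apply Rinv_le_contravar; [lra|].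
      unfold z1. eapply Rle_trans; [|apply Cmod_ge_fst]. lra. }
    assert (I2 : Cmod (Cinv z2) <= 2).
    { rewrite Cmod_inv by auto. rewrite <- (Rinv_inv 2) at 1. apply Rinv_le_contravar; [lra|].
      unfold z2. eapply Rle_trans; [|apply Cmod_ge_fst]. lra. }
    assert (Cmod (Cplus (Cmult (Cinv z1) p1) (Cmult (Cinv z2) p2)) <= 4 * r).
    { eapply Rle_trans; [apply Cmod_triangle|]. rewrite !Cmod_mult.
      generalize (Cmod_ge_0 p1) (Cmod_ge_0 p2) (Cmod_ge_0 (Cinv z1)) (Cmod_ge_0 (Cinv z2)). nra. }
    lra. }
  cmod_replace (Cplus (Cplus (Copp (Cminus w v)) (Cplus (Cminus w1 lo) (Cminus w2 hi)))
     (Cplus (Cminus w (Cplus w1 w2)) (Cminus (Cplus lo hi) (cpart (/ 4, t / 2) L)))).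
  rewrite Ew. replace (Cminus (Cplus w1 w2) (Cplus w1 w2)) with (RtoC 0) by ring. rewrite <- Ew, Cplus_0_l.
  eapply Rle_trans; [apply Cmod_triangle|].
  eapply Rle_trans; [apply Rplus_le_compat_r, Cmod_triangle|]. rewrite Cmod_opp.
  eapply Rle_trans; [apply Rplus_le_compat_r, Rplus_le_compat_l, Cmod_triangle|].
  unfold Rdiv in *. lra.
Qed.

Lemma inv_le_inv_sqrt n : / (INR n + / 2) <= 2 * / sqrt (INR n + 1).
Proof.
  generalize (pos_INR n); intros Hn.
  assert (Hs : 1 <= sqrt (INR n + 1)) by (rewrite <- sqrt_1 at 1; apply sqrt_le_1_alt; lra).
  assert (Es : sqrt (INR n + 1) * sqrt (INR n + 1) = INR n + 1) by (apply sqrt_sqrt; lra).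
  apply Rmult_le_reg_r with ((INR n + / 2) * sqrt (INR n + 1)); [nra|].
  field_simplify; nra.
Qed.

(** With n = m + 1, the fraction 1 / (n - a) of one term is paired with 1 / (n + a) of the next, of
    opposite sign, and 1 / (n - a) - 1 / (n + a) = 2 a / (n^2 - a^2). The regrouping leaves one
    unpaired fraction 1 / (N + a). *)
Lemma cpart_pf t N : 0 < t ->
  Cmult (Copp (/ 4, t / 2)) (pf_sum (/ 4) (t / 2) N) =
  Cplus (cpart (/ 4, t / 2) N) (Cmult (RtoC ((-1) ^ N)) (Cinv (Cplus (RtoC (INR N)) (/ 4, t / 2)))).
Proof.
  intros Ht. unfold pf_sum, cpart. set (a := (/ 4, t / 2)).
  assert (Ea : sqC (/ 4) (t / 2) = Cmult a a).
  { unfold sqC, a, Cmult; simpl. f_equal; field. }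
  rewrite Ea.
  assert (Ha : a <> RtoC 0) by (apply pair_neq_0; lra).
  assert (Hp : forall m, Cplus (RtoC (INR m)) a <> RtoC 0).
  { intros m. apply pair_neq_0. simpl. generalize (pos_INR m); lra. }
  assert (Hm : forall x, Cminus (RtoC x) a <> RtoC 0).
  { intros x H. unfold Cminus, Cplus, Copp, RtoC, a in H. injection H. simpl. lra. }
  induction N as [|N IH].
  - simpl. field; try split; auto; apply (Hp 0%nat).
  - rewrite !csum_seq_S. simpl Nat.add.
    match goal with |- ?L = ?R =>
      replace L with (Cplus (Cmult (Copp a) (Cminus (Cmult (RtoC 2) (csum (seq 1 N) (fun n => Cdiv (RtoC ((-1) ^ n)) (Cminus (RtoC (INR n ^ 2)) (Cmult a a))))) (Cinv (Cmult a a))))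
        (Cmult (Cmult (Copp a) (RtoC 2)) (Cdiv (RtoC ((-1) ^ S N)) (Cminus (RtoC (INR (S N) ^ 2)) (Cmult a a))))) by ring end.
    rewrite IH. set (cs := csum _ _).
    assert (H1 := Hp N). assert (H2 := Hp (S N)). assert (H3 := Hm (INR (S N))).
    rewrite S_INR in *.
    replace ((-1) ^ S N) with (- (-1) ^ N) by (simpl; ring). rewrite RtoC_opp.
    replace ((INR N + 1) ^ 2) with ((INR N + 1) * (INR N + 1)) by ring. rewrite RtoC_mult.
    set (M := RtoC (INR N + 1)) in *. set (sg := RtoC ((-1) ^ N)).
    replace (Cminus (Cmult M M) (Cmult a a)) with (Cmult (Cminus M a) (Cplus M a)) by ring.
    field. repeat split; auto.
Qed.

(** The transform is the limit of [cpart], and by [cpart_pf] that limit is the cosecant series at a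
    = 1/4 + i t/2, where sin (PI a) = sin (PI s / 2). *)
Lemma mellin_rational_sin t v : 0 < t -> mellin (- t) (fun x => 2 * x / (1 + x ^ 2)) v ->
  Cmult v (Csin (Cdiv (Cmult (RtoC PI) (crit t)) (RtoC 2))) = RtoC PI.
Proof.
  intros Ht Hv. set (Sn := Csin _). set (a := (/ 4, t / 2)).
  assert (Hw : dfC (/ 4) (t / 2) PI = Cmult (Copp a) Sn).
  { unfold Sn. rewrite Csin_crit. unfold dfC, a, Copp, Cmult, RtoC; simpl.
    replace (/ 4 * PI) with (PI / 4) by field. replace (t / 2 * PI) with (PI * t / 2) by field.
    rewrite cos_PI4, sin_PI4. assert (0 < sqrt 2) by (apply sqrt_lt_R0; lra). f_equal; field; lra. }
  destruct (partial_fractions (/ 4) (t / 2)) as [C HC].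
  { intros n H. unfold sqC, Cminus, Cplus, Copp, RtoC in H. injection H. simpl. intros. lra. }
  enough (E : Cminus (Cmult v Sn) (RtoC PI) = RtoC 0).
  { replace (Cmult v Sn) with (Cplus (Cminus (Cmult v Sn) (RtoC PI)) (RtoC PI)) by ring. rewrite E; ring. }
  apply (C_limit_unique _ (Cmod Sn * 20 + Rabs C * 2) 1%nat).
  intros n Hn. generalize (pos_INR n); intros Hn0. assert (Hn1 : 1 <= INR n) by (apply (le_INR 1); auto).
  specialize (HC n). rewrite Hw in HC.
  assert (Hna : Cmod (Cmult (RtoC ((-1) ^ n)) (Cinv (Cplus (RtoC (INR n)) a))) <= / INR n).
  { rewrite Cmod_mult, Cmod_R, pow_1_abs, Rmult_1_l.
    rewrite Cmod_inv by (apply pair_neq_0; simpl; lra). apply Rinv_le_contravar; [lra|].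
    eapply Rle_trans; [|apply Cmod_ge_fst]. simpl. lra. }
  generalize (mellin_rational_approx t v Hv n Hn). fold a. intros Hc.
  assert (Hdiff : Cmod (Cminus v (Cmult (Copp a) (pf_sum (/ 4) (t / 2) n))) <= 3 / INR n).
  { unfold a at 1. rewrite cpart_pf by auto. fold a.
    cmod_replace (Cplus (Cminus v (cpart a n)) (Copp (Cmult (RtoC ((-1) ^ n)) (Cinv (Cplus (RtoC (INR n)) a))))).
    eapply Rle_trans; [apply Cmod_triangle|]. rewrite Cmod_opp. unfold Rdiv in *. lra. }
  cmod_replace (Cplus (Cmult (Cminus v (Cmult (Copp a) (pf_sum (/ 4) (t / 2) n))) Sn)
     (Cminus (Cmult (Cmult (Copp a) Sn) (pf_sum (/ 4) (t / 2) n)) (RtoC PI))).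
  eapply Rle_trans; [apply Cmod_triangle|]. rewrite Cmod_mult.
  generalize (inv_le_inv_sqrt n). intros Hi.
  assert (Hi2 : / INR n <= 2 * / (INR n + / 2)).
  { apply Rmult_le_reg_r with (INR n * (INR n + / 2)); [nra|]. field_simplify; lra. }
  generalize (Cmod_ge_0 Sn); intros HS.
  assert (Cmod (Cminus v (Cmult (Copp a) (pf_sum (/ 4) (t / 2) n))) * Cmod Sn <= (20 * / sqrt (INR n + 1)) * Cmod Sn).
  { apply Rmult_le_compat_r; auto. unfold Rdiv in *.
    assert (0 < / sqrt (INR n + 1)) by (apply Rinv_0_lt_compat, sqrt_lt_R0; lra). lra. }
  assert (C / (INR n + / 2) <= Rabs C * (2 * / sqrt (INR n + 1))).
  { unfold Rdiv. apply Rle_trans with (Rabs C * / (INR n + / 2)).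
    - apply Rmult_le_compat_r; [left; apply Rinv_0_lt_compat; lra|apply Rle_abs].
    - apply Rmult_le_compat_l; [apply Rabs_pos|auto]. }
  lra.
Qed.

Lemma alternating_bound (a : nat -> R) M : (forall i, a (S i) <= a i) -> (forall i, 0 <= a i) ->
  0 <= rsum (seq 0 M) (fun i => (-1) ^ i * a i) <= a 0%nat.
Proof.
  revert a. induction M as [|M IH]; intros a Hd Hp; [simpl; specialize (Hp 0%nat); lra|].
  simpl. rewrite <- seq_shift, rsum_map.
  specialize (IH (fun i => a (S i)) (fun i => Hd (S i)) (fun i => Hp (S i))).
  rewrite (rsum_ext _ _ (fun i => (-1) * ((-1) ^ i * a (S i)))) by (intros; simpl; ring).
  rewrite rsum_scal. generalize (Hd 0%nat). lra.
Qed.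

Definition csch_term (x : R) (n : nat) : R := 2 * x / (x ^ 2 + (PI * INR n) ^ 2).

(** [partial_fractions] at a = i x / PI identifies the sum of the series, but with a constant that
    depends on x. Alternating signs and decreasing terms then give a remainder explicit in x, which
    can be integrated. *)
Lemma csch_partial x N : 0 < x ->
  Rabs (/ sh x - / x - rsum (seq 0 N) (fun i => (-1) ^ S i * csch_term x (S i))) <= csch_term x (S N).
Proof.
  intros Hx. generalize PI_RGT_0; intros HP.
  assert (Hsh : 0 < sh x).
  { unfold sh. assert (exp (- x) < exp x) by (apply exp_increasing; lra). lra. }
  set (S_ := fun N => rsum (seq 0 N) (fun i => (-1) ^ S i * csch_term x (S i))).
  assert (Hpos : forall i, 0 < csch_term x i).
  { intros i. unfold csch_term. apply Rdiv_lt_0_compat; nra. }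
  assert (Hdec : forall i, csch_term x (S i) <= csch_term x i).
  { intros i. unfold csch_term. apply Rmult_le_compat_l; [lra|]. generalize (pos_INR i); intros.
    apply Rinv_le_contravar; [nra|]. apply Rplus_le_compat_l, pow_incr. rewrite S_INR. nra. }
  assert (Htail : forall m, Rabs (S_ (N + m)%nat - S_ N) <= csch_term x (S N)).
  { intros m. unfold S_. rewrite seq_app, rsum_app. simpl Nat.add.
    match goal with |- Rabs (?A + ?B - ?A) <= _ => replace (A + B - A) with B by ring end.
    rewrite <- (Nat.add_0_r N) at 1. rewrite seq_add_map, rsum_map.
    rewrite (rsum_ext _ _ (fun i => (-1) ^ S N * ((-1) ^ i * csch_term x (S (N + i))))).
    2: { intros i _. replace (S (N + i)) with (S N + i)%nat by lia. rewrite pow_add. simpl. ring. }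
    rewrite rsum_scal, Rabs_mult, pow_1_abs, Rmult_1_l.
    generalize (alternating_bound (fun i => csch_term x (S (N + i))) m). intros H.
    rewrite Nat.add_0_r in H. rewrite Rabs_right; [apply H|apply Rle_ge, H].
    - intros i. replace (N + S i)%nat with (S (N + i)) by lia. apply Hdec.
    - intros i. left; apply Hpos.
    - intros i. replace (N + S i)%nat with (S (N + i)) by lia. apply Hdec.
    - intros i. left; apply Hpos. }
  set (q := x / PI). assert (Hq : 0 < q) by (apply Rdiv_lt_0_compat; auto).
  destruct (partial_fractions 0 q) as [C HC].
  { intros n H. unfold sqC, Cminus, Cplus, Copp, RtoC in H. injection H. simpl. intros.
    generalize (pos_INR n). nra. }
  assert (Epf : forall n, Cminus (Cmult (dfC 0 q PI) (pf_sum 0 q n)) (RtoC PI) = RtoC (PI * sh x * (S_ n + / x - / sh x))).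
  { intros n.
    assert (Ed : dfC 0 q PI = RtoC (q * sh x)).
    { unfold dfC, RtoC. rewrite Rmult_0_l, cos_0, sin_0. replace (q * PI) with x by (unfold q; field; lra). f_equal; ring. }
    assert (Es : sqC 0 q = RtoC (- q ^ 2)) by (unfold sqC, RtoC; f_equal; ring).
    assert (Ep : pf_sum 0 q n = RtoC (2 * rsum (seq 1 n) (fun n => (-1) ^ n / (INR n ^ 2 + q ^ 2)) + / q ^ 2)).
    { unfold pf_sum. rewrite Es, RtoC_plus, RtoC_mult, RtoC_rsum.
      assert (Hq2 : 0 < q ^ 2) by (apply pow_lt; auto).
      unfold Cminus. f_equal.
      - f_equal. apply csum_ext. intros i _.
        change (Cplus (RtoC (INR i ^ 2)) (Copp (RtoC (- q ^ 2)))) with (Cminus (RtoC (INR i ^ 2)) (RtoC (- q ^ 2))).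
        rewrite <- RtoC_minus. rewrite <- RtoC_div by nra. f_equal. f_equal. ring.
      - rewrite <- RtoC_inv by lra. rewrite <- RtoC_opp. f_equal. field. lra. }
    rewrite Ed, Ep, <- RtoC_mult, <- RtoC_minus. f_equal. unfold S_.
    replace (rsum (seq 1 n) (fun n => (-1) ^ n / (INR n ^ 2 + q ^ 2))) with
      (PI ^ 2 / (2 * x) * rsum (seq 0 n) (fun i => (-1) ^ S i * csch_term x (S i))).
    - unfold q. field. repeat split; lra.
    - rewrite <- seq_shift, rsum_map, <- rsum_scal. apply rsum_ext. intros i _. unfold csch_term, q.
      assert (0 < INR (S i)) by (apply lt_0_INR; lia).
      set (sg := (-1) ^ S i). field. repeat split; try lra; nra. }
  assert (Hlim : forall n, Rabs (/ sh x - / x - S_ n) <= Rabs C / (PI * sh x) * (2 * / sqrt (INR n + 1))).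
  { intros n. specialize (HC n). rewrite Epf, Cmod_R in HC.
    assert (HPs : 0 < PI * sh x) by (apply Rmult_lt_0_compat; auto).
    rewrite Rabs_mult, (Rabs_right (PI * sh x)) in HC by lra.
    replace (/ sh x - / x - S_ n) with (- (S_ n + / x - / sh x)) by ring. rewrite Rabs_Ropp.
    apply Rmult_le_reg_l with (PI * sh x); auto. eapply Rle_trans; [exact HC|].
    replace (PI * sh x * (Rabs C / (PI * sh x) * (2 * / sqrt (INR n + 1)))) with (Rabs C * (2 * / sqrt (INR n + 1))).
    - unfold Rdiv. apply Rle_trans with (Rabs C * / (INR n + / 2)).
      + apply Rmult_le_compat_r; [left; apply Rinv_0_lt_compat; generalize (pos_INR n); lra|apply Rle_abs].
      + apply Rmult_le_compat_l; [apply Rabs_pos|apply inv_le_inv_sqrt].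
    - assert (0 < sqrt (INR n + 1)) by (apply sqrt_lt_R0; generalize (pos_INR n); lra). field. repeat split; lra. }
  apply le_epsilon. intros e He.
  set (K := Rabs C / (PI * sh x) * 2).
  assert (HK : 0 <= K).
  { unfold K. apply Rmult_le_pos; [|lra]. apply Rmult_le_pos; [apply Rabs_pos|]. left; apply Rinv_0_lt_compat, Rmult_lt_0_compat; auto. }
  destruct (inv_sqrt_small (e / (K + 1))) as [m Hm]; [apply Rdiv_lt_0_compat; lra|].
  specialize (Hlim (N + m)%nat). specialize (Htail m).
  change (rsum (seq 0 N) (fun i => (-1) ^ S i * csch_term x (S i))) with (S_ N).
  replace (/ sh x - / x - S_ N) with ((/ sh x - / x - S_ (N + m)%nat) + (S_ (N + m)%nat - S_ N)) by ring.
  eapply Rle_trans; [apply Rabs_triang|].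
  assert (K * / sqrt (INR (N + m) + 1) <= e).
  { apply Rle_trans with ((K + 1) * (e / (K + 1))); [|right; field; lra].
    assert (0 < / sqrt (INR (N + m) + 1)) by (apply Rinv_0_lt_compat, sqrt_lt_R0; generalize (pos_INR (N + m)); lra).
    apply Rmult_le_compat; try lra. left. eapply Rle_lt_trans; [|exact Hm]. apply inv_sqrt_le.
    rewrite plus_INR. generalize (pos_INR N) (pos_INR m); lra. }
  unfold K in *. lra.
Qed.

(* Its Mellin transform is [Gamma s * zeta s] for [0 < Re s < 1]. *)
Definition hf (x : R) : R := / (exp x - 1) - / x.

Lemma exp_gt_1 x : 0 < x -> 1 + x < exp x.
Proof. intros Hx. apply exp_ineq1; lra. Qed.

Lemma continuous_hf x : 0 < x -> continuous hf x.
Proof.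
  intros Hx. generalize (exp_gt_1 x Hx); intros.
  apply (ex_derive_continuous (V := R_NormedModule)). unfold hf. auto_derive. split; lra.
Qed.

Lemma hf_bound x : 0 < x -> Rabs (hf x) <= 2 / (1 + x).
Proof.
  intros Hx. generalize (exp_gt_1 x Hx); intros He. unfold hf.
  assert (H1 : / (exp x - 1) <= / x) by (apply Rinv_le_contravar; lra).
  assert (H2 : 0 < / (exp x - 1)) by (apply Rinv_0_lt_compat; lra).
  assert (H3 : exp x * (1 - x) <= 1).
  { assert (1 - x <= exp (- x)) by (generalize (exp_ineq1_le (- x)); lra).
    assert (exp x * exp (- x) = 1) by (rewrite <- exp_plus, Rplus_opp_r; apply exp_0).
    assert (0 < exp x) by apply exp_pos. nra. }
  assert (H4 : / x - / (exp x - 1) <= 1).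
  { apply Rmult_le_reg_r with (x * (exp x - 1)); [nra|]. field_simplify; [|lra]. lra. }
  rewrite Rabs_left1 by lra.
  destruct (Rle_dec x 1) as [H|H].
  - apply Rle_trans with 1; [lra|]. apply Rmult_le_reg_r with (1 + x); [lra|]. field_simplify; lra.
  - apply Rle_trans with (/ x); [lra|]. apply Rmult_le_reg_r with (x * (1 + x)); [nra|]. field_simplify; lra.
Qed.

Lemma mellin_hf_ex t : exists v, mellin t hf v.
Proof.
  destruct (mellin_dom t hf 2) as (v & Hv & _); [lra|apply continuous_hf|apply hf_bound|eauto].
Qed.

(** Two combinations of hf(x) and hf(2x) are elementary: this one expands in exponentials, that of
    [hf_csch] in partial fractions. Comparing their Mellin transforms links [eta] at 1 - s with
    [eta] at s. *)
Lemma hf_fermi x : 0 < x -> hf x - 2 * hf (2 * x) = / (exp x + 1).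
Proof.
  intros Hx. generalize (exp_gt_1 x Hx); intros He. unfold hf.
  replace (2 * x) with (x + x) by ring. rewrite exp_plus.
  assert (exp x * exp x - 1 <> 0) by nra. field. repeat split; lra.
Qed.

Lemma hf_csch x : 0 < x -> 2 * hf x - 2 * hf (2 * x) = / sh x - / x.
Proof.
  intros Hx. generalize (exp_gt_1 x Hx); intros He. unfold hf, sh.
  replace (2 * x) with (x + x) by ring. rewrite exp_plus, exp_Ropp.
  assert (exp x * exp x - 1 <> 0) by nra. field. repeat split; lra.
Qed.

Lemma mellin_rsum {A : Type} t (l : list A) (f : A -> R -> R) (v : A -> CC) :
  (forall i, In i l -> mellin t (f i) (v i)) -> mellin t (fun x => rsum l (fun i => f i x)) (csum l v).
Proof.
  induction l as [|i l IH]; intros H.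
  - simpl. intros e He. exists 1, 1. split; [lra|split; [lra|]]. intros a b Ha Hb. exists (RtoC 0). split.
    + apply CI_ext with (K := fun _ => RtoC 0).
      * intros x _. unfold Kf, RtoC. f_equal; ring.
      * split; simpl; (evar_last; [apply (is_RInt_const (V := R_NormedModule))|]);
          unfold scal; simpl; unfold mult; simpl; ring.
    + replace (Cminus (RtoC 0) (RtoC 0)) with (RtoC 0) by ring. rewrite Cmod_0. auto.
  - simpl. apply mellin_plus; [apply H; left; auto|apply IH; intros; apply H; right; auto].
Qed.

Lemma continuous_rsum {A : Type} (l : list A) (f : A -> R -> R) x :
  (forall i, In i l -> continuous (f i) x) -> continuous (fun x => rsum l (fun i => f i x)) x.
Proof.
  induction l as [|i l IH]; intros H; simpl; [apply continuous_const|].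
  apply (continuous_plus (V := R_NormedModule)); [apply H; left; auto|apply IH; intros; apply H; right; auto].
Qed.

Lemma geom_fermi x N :
  / (exp x + 1) - rsum (seq 0 N) (fun i => (-1) ^ i * exp (- (INR (S i) * x))) =
  (-1) ^ N * (exp (- (INR N * x)) * / (exp x + 1)).
Proof.
  assert (He : 0 < exp x) by apply exp_pos.
  induction N as [|N IH].
  - simpl. rewrite Rmult_0_l, Ropp_0, exp_0. ring.
  - rewrite rsum_seq_S. simpl Nat.add.
    match goal with |- ?a - (?b + ?c) = _ => replace (a - (b + c)) with ((a - b) - c) by ring end.
    rewrite IH. rewrite S_INR. replace (- ((INR N + 1) * x)) with (- (INR N * x) + - x) by ring.
    rewrite exp_plus, exp_Ropp with (x := x). set (E := exp (- (INR N * x))). set (sg := (-1) ^ N).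
    change ((-1) ^ S N) with (-1 * (-1) ^ N). fold sg. field. lra.
Qed.

(** After N terms the alternating geometric series leaves at most e^(-N x) <= 1 / (1 + N x), so by
    [mellin_bound] the transforms of the partial sums converge at the rate N^(-1/2). *)
Lemma mellin_fermi t G v : mellin t (fun x => exp (- x)) G -> mellin t (fun x => / (exp x + 1)) v ->
  v = Cmult G (eta (crit t)).
Proof.
  intros HG Hv. generalize PI_RGT_0; intros HP.
  assert (Hpart : forall N, mellin t (fun x => rsum (seq 0 N) (fun i => (-1) ^ i * exp (- (INR (S i) * x)))) (Cmult G (ep t N))).
  { intros N. unfold ep. rewrite <- csum_scal.
    apply (mellin_rsum t (seq 0 N) (fun i x => (-1) ^ i * exp (- (INR (S i) * x)))).
    intros i _. assert (HS : 0 < INR (S i)) by (apply lt_0_INR; lia).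
    generalize (mellin_scal t _ _ ((-1) ^ i) (mellin_scale t _ _ (INR (S i)) HS HG)). intros H.
    eapply mellin_ext; [|].
    2: { replace (Cmult G (eterm t i)) with (Cmult (RtoC ((-1) ^ i)) (Cmult (Cmult (RtoC (/ sqrt (INR (S i)))) (cis (- (t * ln (INR (S i)))))) G)); [exact H|].
         unfold eterm. rewrite RtoC_mult. ring. }
    intros x _. reflexivity. }
  destruct (nfloor_ex (Rabs t) (Rabs_pos t)) as [n0 [_ Hn0]].
  enough (E : Cminus v (Cmult G (eta (crit t))) = RtoC 0).
  { replace v with (Cplus (Cminus v (Cmult G (eta (crit t)))) (Cmult G (eta (crit t)))) by ring. rewrite E; ring. }
  apply (C_limit_unique _ (PI + Cmod G * 6) (S n0)). intros n Hn.
  assert (Ht : Rabs t <= INR (S n)) by (apply le_INR in Hn; rewrite !S_INR in *; lra).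
  assert (HN : 0 < INR (S n)) by (apply lt_0_INR; lia).
  generalize (eta_approx t (S n) Ht). intros He.
  assert (Hs : / sqrt (INR (S n) + 1) <= / sqrt (INR n + 1)).
  { apply inv_sqrt_le. rewrite S_INR. generalize (pos_INR n); lra. }
  assert (H1 : Cmod (Cminus v (Cmult G (ep t (S n)))) <= PI * / sqrt (INR n + 1)).
  { generalize (mellin_minus _ _ _ _ _ Hv (Hpart (S n))). intros H.
    eapply (mellin_bound _ _ _ 1 (INR (S n))) in H; auto; try lra.
    - rewrite <- S_INR. eapply Rle_trans; [exact H|]. unfold Rdiv. rewrite Rmult_1_l. lra.
    - intros x Hx. apply (continuous_minus (V := R_NormedModule)).
      + assert (0 < exp x) by apply exp_pos.
        apply (ex_derive_continuous (V := R_NormedModule)). auto_derive. lra.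
      + apply (continuous_rsum (seq 0 (S n)) (fun i x => (-1) ^ i * exp (- (INR (S i) * x)))).
        intros i _. apply (ex_derive_continuous (V := R_NormedModule)). set (c := INR (S i)). auto_derive; auto.
    - intros x Hx. rewrite geom_fermi, Rabs_mult, pow_1_abs, Rmult_1_l.
      assert (0 < exp x) by apply exp_pos. assert (0 < exp (- (INR (S n) * x))) by apply exp_pos.
      assert (0 < / (exp x + 1) <= 1).
      { split; [apply Rinv_0_lt_compat; lra|]. rewrite <- Rinv_1. apply Rinv_le_contravar; lra. }
      rewrite Rabs_right by (apply Rle_ge, Rmult_le_pos; lra).
      assert (exp (- (INR (S n) * x)) <= / (1 + INR (S n) * x)) by (apply exp_le_inv1; nra).
      unfold Rdiv. rewrite Rmult_1_l. nra. }
  cmod_replace (Cplus (Cminus v (Cmult G (ep t (S n)))) (Copp (Cmult G (Cminus (eta (crit t)) (ep t (S n)))))).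
  eapply Rle_trans; [apply Cmod_triangle|]. rewrite Cmod_opp, Cmod_mult.
  generalize (Cmod_ge_0 G); intros.
  assert (Cmod G * Cmod (eta (crit t) - ep t (S n)) <= Cmod G * (6 * / sqrt (INR n + 1))) by (apply Rmult_le_compat_l; lra).
  lra.
Qed.

(** The n-th term of the series for 1 / sh x - 1 / x is, up to sign, 1 / (PI n) times 2 y / (1 +
    y^2) at y = x / (PI n). Its transform at 1 - s is (PI n)^(-s) times [c], so a transform at 1 - s
    produces [eta] at s. *)
Lemma mellin_csch t c v : mellin (- t) (fun x => 2 * x / (1 + x ^ 2)) c -> mellin (- t) (fun x => / sh x - / x) v ->
  v = Copp (Cmult (Cmult c (Cmult (RtoC (/ sqrt PI)) (cis (- (t * ln PI))))) (eta (crit t))).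
Proof.
  intros Hc Hv. generalize PI_RGT_0; intros HP.
  set (D := Cmult (RtoC (/ sqrt PI)) (cis (- (t * ln PI)))).
  assert (Hpart : forall N, mellin (- t) (fun x => rsum (seq 0 N) (fun i => (-1) ^ S i * csch_term x (S i)))
     (Copp (Cmult (Cmult c D) (ep t N)))).
  { intros N. unfold ep.
    replace (Copp (Cmult (Cmult c D) (csum (seq 0 N) (eterm t)))) with
      (csum (seq 0 N) (fun i => Cmult (Copp (Cmult c D)) (eterm t i))) by (rewrite csum_scal; ring).
    apply (mellin_rsum (- t) (seq 0 N) (fun i x => (-1) ^ S i * csch_term x (S i))).
    intros i _. assert (HS : 0 < INR (S i)) by (apply lt_0_INR; lia).
    set (a := PI * INR (S i)). assert (Ha : 0 < a) by (apply Rmult_lt_0_compat; auto).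
    assert (Hia : 0 < / a) by (apply Rinv_0_lt_compat; auto).
    generalize (mellin_scal (- t) _ _ ((-1) ^ S i * / a) (mellin_scale (- t) _ _ (/ a) Hia Hc)). intros H.
    eapply mellin_ext; [|].
    2: { match type of H with mellin _ _ ?X => replace (Cmult (Copp (Cmult c D)) (eterm t i)) with X; [exact H|] end.
         rewrite sqrt_inv, Rinv_inv, ln_Rinv by auto. unfold a at 3. rewrite ln_mult by auto.
         replace (- (- t * - (ln PI + ln (INR (S i))))) with (- (t * ln PI) + - (t * ln (INR (S i)))) by ring.
         rewrite cis_add. unfold D, eterm.
         assert (0 < sqrt PI) by (apply sqrt_lt_R0; auto). assert (0 < sqrt (INR (S i))) by (apply sqrt_lt_R0; auto).
         replace (Cmult (RtoC ((-1) ^ S i * / a)) (Cmult (Cmult (RtoC (sqrt a)) (Cmult (cis (- (t * ln PI))) (cis (- (t * ln (INR (S i))))))) c))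
           with (Cmult (RtoC ((-1) ^ S i * / a * sqrt a)) (Cmult (Cmult (cis (- (t * ln PI))) (cis (- (t * ln (INR (S i)))))) c))
           by (rewrite !RtoC_mult; ring).
         replace ((-1) ^ S i * / a * sqrt a) with (- (/ sqrt PI * ((-1) ^ i * / sqrt (INR (S i))))).
         - rewrite RtoC_opp, !RtoC_mult. ring.
         - transitivity ((-1) ^ S i * (/ (sqrt a * sqrt a) * sqrt a)).
           + unfold a. rewrite sqrt_mult by lra. change ((-1) ^ S i) with (-1 * (-1) ^ i). field. lra.
           + rewrite sqrt_sqrt by lra. ring. }
    intros x Hx. simpl. unfold csch_term. fold a. field. split; nra. }
  destruct (nfloor_ex (Rabs t) (Rabs_pos t)) as [n0 [_ Hn0]].
  enough (E : Cplus v (Cmult (Cmult c D) (eta (crit t))) = RtoC 0).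
  { replace v with (Cminus (Cplus v (Cmult (Cmult c D) (eta (crit t)))) (Cmult (Cmult c D) (eta (crit t)))) by ring. rewrite E; ring. }
  apply (C_limit_unique _ (4 * PI + Cmod (Cmult c D) * 6) (S n0)). intros n Hn.
  assert (Ht : Rabs t <= INR n) by (apply le_INR in Hn; rewrite !S_INR in *; lra).
  generalize (eta_approx t n Ht). intros He. generalize (pos_INR n); intros Hn1.
  assert (H1 : Cmod (Cplus v (Cmult (Cmult c D) (ep t n))) <= 4 * PI * / sqrt (INR n + 1)).
  { generalize (mellin_minus _ _ _ _ _ Hv (Hpart n)). intros H.
    set (a := PI * INR (S n)). assert (Ha : INR n + 1 <= a).
    { unfold a. rewrite S_INR. generalize PI2_3_2. nra. }
    assert (Hia : 0 < / a) by (apply Rinv_0_lt_compat; lra).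
    eapply (mellin_bound _ _ _ (4 / a) (/ a)) in H; auto.
    - replace (Cplus v (Cmult (Cmult c D) (ep t n))) with (Cminus v (Copp (Cmult (Cmult c D) (ep t n)))) by ring.
      eapply Rle_trans; [exact H|]. rewrite sqrt_inv.
      assert (0 < sqrt a) by (apply sqrt_lt_R0; lra).
      replace (4 / a * PI / / sqrt a) with (4 * PI * (/ (sqrt a * sqrt a) * sqrt a)) by (rewrite sqrt_sqrt by lra; field; lra).
      replace (/ (sqrt a * sqrt a) * sqrt a) with (/ sqrt a) by (field; lra).
      apply Rmult_le_compat_l; [lra|]. apply inv_sqrt_le. lra.
    - left; apply Rdiv_lt_0_compat; lra.
    - intros x Hx. apply (continuous_minus (V := R_NormedModule)).
      + assert (0 < sh x) by (unfold sh; assert (exp (- x) < exp x) by (apply exp_increasing; lra); lra).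
        apply (ex_derive_continuous (V := R_NormedModule)). unfold sh in *. auto_derive. split; [|lra].
        unfold Rdiv, Rminus in *. lra.
      + apply (continuous_rsum (seq 0 n) (fun i x => (-1) ^ S i * csch_term x (S i))).
        intros i _. apply (ex_derive_continuous (V := R_NormedModule)). unfold csch_term.
        set (q := PI * INR (S i)). set (sg := (-1) ^ S i). auto_derive. nra.
    - intros x Hx. eapply Rle_trans; [apply csch_partial; auto|]. unfold csch_term. fold a.
      apply Rmult_le_reg_r with ((x ^ 2 + a ^ 2) * (a + x)); [nra|].
      replace (2 * x / (x ^ 2 + a ^ 2) * ((x ^ 2 + a ^ 2) * (a + x))) with (2 * x * (a + x)) by (field; nra).
      replace (4 / a / (1 + / a * x) * ((x ^ 2 + a ^ 2) * (a + x))) with (4 * (x ^ 2 + a ^ 2)) by (field; lra).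
      nra. }
  cmod_replace (Cplus (Cplus v (Cmult (Cmult c D) (ep t n))) (Cmult (Cmult c D) (Cminus (eta (crit t)) (ep t n)))).
  eapply Rle_trans; [apply Cmod_triangle|]. rewrite (Cmod_mult (Cmult c D)).
  generalize (Cmod_ge_0 (Cmult c D)); intros.
  assert (Cmod (Cmult c D) * Cmod (eta (crit t) - ep t n) <= Cmod (Cmult c D) * (6 * / sqrt (INR n + 1))) by (apply Rmult_le_compat_l; lra).
  lra.
Qed.

(* This is [|1 - 2^s|^2 zeta(s)] at [s = 1/2 + i t], since [1 - s] is the conjugate of [s]; it satisfies the functional equation of [zeta]. *)
Definition omega (t : R) : CC :=
  Cmult (eta (crit t)) (Cminus (RtoC 1) (Cmult (RtoC (sqrt 2)) (cis (t * ln 2)))).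

(** With H the transform of [hf] at 1 - s, [hf_fermi] gives Gamma(1 - s) eta(1 - s) = H (1 - 2^s),
    and [hf_csch] gives 2 H (1 - 2^(s-1)) = - c PI^(-s) eta(s) with c sin (PI s / 2) = PI.
    Eliminating H relates eta(s) (1 - 2^s) to eta(1 - s) (1 - 2^(1-s)), which is the conjugate of
    [omega t]. *)
Theorem omega_functional t : 0 < t -> omega t = Cmult (Defs.Delta (crit t)) (Cconj (omega t)).
Proof.
  intros Ht. generalize PI_RGT_0; intros HP.
  destruct (mellin_exp_ex (- t)) as [G HG]. destruct (mellin_hf_ex (- t)) as [H HH].
  destruct (mellin_dom (- t) (fun x => 2 * x / (1 + x ^ 2)) 4) as (c & Hc & _); [lra| | |].
  { intros x Hx. apply (ex_derive_continuous (V := R_NormedModule)). auto_derive. nra. }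
  { intros x Hx. rewrite Rabs_right by (apply Rle_ge; left; apply Rdiv_lt_0_compat; nra).
    apply Rmult_le_reg_r with ((1 + x ^ 2) * (1 + x)); [nra|].
    replace (2 * x / (1 + x ^ 2) * ((1 + x ^ 2) * (1 + x))) with (2 * x * (1 + x)) by (field; nra).
    replace (4 / (1 + x) * ((1 + x ^ 2) * (1 + x))) with (4 * (1 + x ^ 2)) by (field; lra). nra. }
  generalize (mellin_scale (- t) _ _ 2 ltac:(lra) HH). intros H2.
  replace (- (- t * ln 2)) with (t * ln 2) in H2 by ring.
  set (X := cis (t * ln 2)) in *. set (r2 := sqrt 2).
  assert (Hr2 : 0 < r2) by (apply sqrt_lt_R0; lra).
  assert (Er2 : r2 * r2 = 2) by (apply sqrt_sqrt; lra).
  assert (E1 : Cmult G (eta (crit (- t))) = Cminus H (Cmult (RtoC 2) (Cmult (Cmult (RtoC (/ r2)) X) H))).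
  { symmetry. apply (mellin_fermi (- t)); auto.
    eapply mellin_ext; [|apply mellin_minus; [exact HH|apply mellin_scal; exact H2]]. intros x Hx. apply hf_fermi; auto. }
  assert (E3 := mellin_csch t c _ Hc (mellin_ext _ _ _ _ (fun x Hx => hf_csch x Hx)
    (mellin_minus _ _ _ _ _ (mellin_scal _ _ _ 2 HH) (mellin_scal _ _ _ 2 H2)))).
  fold r2 in E3.
  assert (E4 := mellin_rational_sin t c Ht Hc).
  unfold Defs.Delta. rewrite (CGamma_MI t G HG), Cpowr_2_crit, Cpowr_PI_crit.
  set (Sn := Csin _) in *. fold X r2.
  unfold omega. fold X r2. rewrite Cmult_conj, eta_conj, Cminus_conj, Cmult_conj.
  replace (Cconj X) with (cis (- (t * ln 2))) by (unfold X; rewrite cis_conj; reflexivity).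
  set (Xi := cis (- (t * ln 2))).
  assert (EX : Cmult X Xi = RtoC 1) by (unfold X, Xi; rewrite <- cis_add, Rplus_opp_r, cis_0; reflexivity).
  assert (EY : Cmult (cis (t * ln PI)) (cis (- (t * ln PI))) = RtoC 1) by (rewrite <- cis_add, Rplus_opp_r, cis_0; reflexivity).
  set (Y := cis (t * ln PI)) in *. set (Yi := cis (- (t * ln PI))) in *.
  assert (Hcj : forall x : R, Cconj (RtoC x) = RtoC x) by (intros x; unfold Cconj, RtoC; simpl; f_equal; ring).
  rewrite !Hcj. set (rp := sqrt PI) in *.
  assert (Hrp : 0 < rp) by (apply sqrt_lt_R0; auto).
  assert (Erp : rp * rp = PI) by (apply sqrt_sqrt; lra).
  set (e := eta (crit t)) in *. set (e' := eta (crit (- t))) in *.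
  assert (Er2C : Cmult (RtoC r2) (RtoC r2) = RtoC 2) by (rewrite <- RtoC_mult, Er2; reflexivity).
  assert (ErpC : Cmult (RtoC rp) (RtoC rp) = RtoC PI) by (rewrite <- RtoC_mult, Erp; reflexivity).
  rewrite RtoC_inv in E1, E3 |- * by lra. rewrite (RtoC_inv rp) in E3 by lra.
  assert (N2 : RtoC r2 <> RtoC 0) by (intros Q; apply RtoC_inj in Q; lra).
  assert (Np : RtoC rp <> RtoC 0) by (intros Q; apply RtoC_inj in Q; lra).
  (* solve for [eta] from the two Mellin identities *)
  assert (Ee : Cmult (Cmult (RtoC rp) (RtoC rp)) e = Copp (Cmult (Cmult (Cmult (RtoC rp) Y) Sn)
      (Cmult (Cmult (RtoC 2) H) (Cminus (RtoC 1) (Cmult (Cinv (RtoC r2)) X))))).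
  { rewrite ErpC, <- E4.
    transitivity (Copp (Cmult (Cmult (Cmult (RtoC rp) Y) Sn) (Copp (Cmult (Cmult c (Cmult (Cinv (RtoC rp)) Yi)) e)))).
    - transitivity (Cmult (Cmult (Cmult c Sn) e) (Cmult Y Yi)); [rewrite EY; ring|]. field. auto.
    - rewrite <- E3. f_equal. f_equal. ring. }
  assert (EH : Cmult G e' = Cmult H (Cminus (RtoC 1) (Cmult (RtoC r2) X))).
  { rewrite E1. transitivity (Cmult H (Cminus (RtoC 1) (Cmult (Cmult (Cmult (RtoC r2) (RtoC r2)) (Cinv (RtoC r2))) X))).
    - rewrite Er2C. ring.
    - field. auto. }
  apply (f_equal (Cmult (Cinv (Cmult (RtoC rp) (RtoC rp))))) in Ee.
  rewrite Cmult_assoc, Cinv_l, Cmult_1_l in Ee by (apply Cmult_neq_0; auto).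
  rewrite Ee.
  transitivity (Cmult (Cinv (RtoC rp)) (Copp (Cmult (Cmult Y Sn) (Cmult (RtoC 2) (Cmult (Cmult G e') (Cminus (RtoC 1) (Cmult (Cinv (RtoC r2)) X))))))).
  { rewrite EH. field. auto. }
  assert (EF : Cmult (RtoC 2) (Cminus (RtoC 1) (Cmult (Cinv (RtoC r2)) X)) = Copp (Cmult (Cmult (RtoC r2) X) (Cminus (RtoC 1) (Cmult (RtoC r2) Xi)))).
  { rewrite <- Er2C.
    transitivity (Cminus (Cmult (RtoC r2) (RtoC r2)) (Cmult (RtoC r2) X)); [field; auto|].
    transitivity (Cplus (Copp (Cmult (RtoC r2) X)) (Cmult (Cmult (RtoC r2) (RtoC r2)) (Cmult X Xi))); [rewrite EX; ring|ring]. }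
  transitivity (Cmult (Cinv (RtoC rp)) (Copp (Cmult (Cmult Y Sn) (Cmult (Cmult G e') (Cmult (RtoC 2) (Cminus (RtoC 1) (Cmult (Cinv (RtoC r2)) X))))))); [ring|].
  rewrite EF. ring.
Qed.

(** * Arithmetic functions *)

Lemma rsum_incl {A : Type} (l m : list A) (f : A -> R) :
  NoDup l -> incl l m -> (forall a, In a m -> 0 <= f a) -> rsum l f <= rsum m f.
Proof.
  revert m. induction l as [|a l IH]; intros m Hn Hi Hp; simpl.
  - apply rsum_nonneg; auto.
  - inversion Hn as [|? ? Ha Hn']; subst.
    destruct (in_split a m) as (m1 & m2 & ->); [apply Hi; left; auto|].
    assert (rsum l f <= rsum (m1 ++ m2) f).
    { apply IH; auto.
      - intros b Hb. assert (Hb' : In b (m1 ++ a :: m2)) by (apply Hi; right; auto).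
        apply in_app_or in Hb'. apply in_or_app. destruct Hb' as [H|[H|H]]; auto. subst; contradiction.
      - intros b Hb. apply Hp. apply in_app_or in Hb. apply in_or_app. destruct Hb; [left|right; right]; auto. }
    rewrite rsum_app in *. simpl. lra.
Qed.

Definition indic (P : Prop) : R := if excluded_middle_informative P then 1 else 0.

Lemma indic_true P : P -> indic P = 1.
Proof. intros H. unfold indic. destruct (excluded_middle_informative P); [auto|contradiction]. Qed.

Lemma indic_false P : ~ P -> indic P = 0.
Proof. intros H. unfold indic. destruct (excluded_middle_informative P); [contradiction|auto]. Qed.

Lemma indic_cases P : (P /\ indic P = 1) \/ (~ P /\ indic P = 0).
Proof. unfold indic. destruct (excluded_middle_informative P); auto. Qed.

Lemma indic_nonneg P : 0 <= indic P.
Proof. destruct (indic_cases P) as [[_ ->]|[_ ->]]; lra. Qed.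

Lemma indic_le_1 P : indic P <= 1.
Proof. destruct (indic_cases P) as [[_ ->]|[_ ->]]; lra. Qed.

Definition rprod {A : Type} (l : list A) (f : A -> R) : R := fold_right (fun a z => f a * z) 1 l.

Definition prime_nat (p : nat) : Prop := (1 < p)%nat /\ forall d, Nat.divide d p -> d = 1%nat \/ d = p.

Lemma prime_mul p a b : prime_nat p -> Nat.divide p (a * b) -> Nat.divide p a \/ Nat.divide p b.
Proof.
  intros [Hp Hd] H. destruct (Hd (Nat.gcd p a) (Nat.gcd_divide_l p a)) as [E|E].
  - right. apply (Nat.gauss p a b); auto.
  - left. rewrite <- E. apply Nat.gcd_divide_r.
Qed.

Lemma prime_divide_prime p q : prime_nat p -> prime_nat q -> Nat.divide p q -> p = q.
Proof. intros [Hp _] [_ Hq] H. destruct (Hq p H); lia. Qed.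

Lemma prime_divisor_ex n : (1 < n)%nat -> exists p, prime_nat p /\ Nat.divide p n.
Proof.
  induction n as [n IH] using (well_founded_induction lt_wf). intros Hn.
  destruct (classic (prime_nat n)) as [H|H]; [exists n; split; auto; apply Nat.divide_refl|].
  assert (exists d, Nat.divide d n /\ d <> 1%nat /\ d <> n) as (d & Hd & H1 & H2).
  { apply NNPP. intros Hc. apply H. split; auto. intros d Hd.
    destruct (Nat.eq_dec d 1); auto. destruct (Nat.eq_dec d n); auto. exfalso. apply Hc. eauto. }
  assert (d <= n)%nat by (apply Nat.divide_pos_le; auto; lia).
  assert (d <> 0)%nat by (intros ->; destruct Hd as [k Hk]; lia).
  destruct (IH d) as (p & Hp & Hpd); [lia|lia|]. exists p; split; auto. eapply Nat.divide_trans; eauto.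
Qed.

(** An arbitrary choice of prime divisor for n > 1; [Om_mul] shows that the count built on it does
    not depend on the choice. *)
Definition pdiv (n : nat) : nat :=
  epsilon (inhabits 2%nat) (fun p => prime_nat p /\ Nat.divide p n).

Lemma pdiv_spec n : (1 < n)%nat -> prime_nat (pdiv n) /\ Nat.divide (pdiv n) n.
Proof. intros Hn. apply (epsilon_spec (inhabits 2%nat) (fun p => prime_nat p /\ Nat.divide p n)), prime_divisor_ex; auto. Qed.

(** Division by a prime strictly decreases n > 1, so the fuel n used in [Om] always suffices. *)
Fixpoint omf (fuel n : nat) : nat :=
  match fuel with
  | O => 0%nat
  | S f => if Nat.leb n 1 then 0%nat else S (omf f (n / pdiv n))
  end.

(* [Om n] is the number of prime factors of [n] counted with multiplicity *)
Definition Om (n : nat) : nat := omf n n.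

Lemma div_pdiv n : (1 < n)%nat -> exists m, (n = pdiv n * m)%nat /\ (1 <= m < n)%nat /\ (n / pdiv n = m)%nat.
Proof.
  intros Hn. destruct (pdiv_spec n Hn) as [[Hp _] [m Hm]]. exists m.
  assert (E : (n / pdiv n = m)%nat) by (rewrite Hm at 1; apply Nat.div_mul; lia).
  split; [lia|]. split; auto. destruct m; [lia|]. split; [lia|]. nia.
Qed.

Lemma omf_fuel f f' n : (n <= f)%nat -> (n <= f')%nat -> omf f n = omf f' n.
Proof.
  revert f' n. induction f as [|f IH]; intros f' n H H'.
  - assert (n = 0)%nat by lia. subst. destruct f'; reflexivity.
  - destruct f' as [|f'].
    + assert (n = 0)%nat by lia. subst. reflexivity.
    + simpl. destruct (Nat.leb_spec n 1) as [Hn|Hn]; auto.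
      destruct (div_pdiv n Hn) as (m & _ & Hm & ->). f_equal. apply IH; lia.
Qed.

Lemma Om_step n : (1 < n)%nat -> Om n = S (Om (n / pdiv n)).
Proof.
  intros Hn. unfold Om. destruct n as [|n]; [lia|].
  change (omf (S n) (S n)) with (if Nat.leb (S n) 1 then 0%nat else S (omf n (S n / pdiv (S n)))).
  destruct (Nat.leb_spec (S n) 1); [lia|].
  destruct (div_pdiv (S n) Hn) as (m & _ & Hm & E). rewrite E. f_equal. apply omf_fuel; lia.
Qed.

Lemma Om_1 : Om 1 = 0%nat.
Proof. reflexivity. Qed.

(** Strong induction: the prime q chosen for p n either equals p or divides n = m q, and in the
    second case the induction hypothesis for m is used once with p and once with q. *)
Lemma Om_mul p n : prime_nat p -> (1 <= n)%nat -> Om (p * n) = S (Om n).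
Proof.
  revert p. induction n as [n IH] using (well_founded_induction lt_wf). intros p Hp Hn.
  assert (Hpn : (1 < p * n)%nat) by (destruct Hp; nia).
  rewrite Om_step by auto. f_equal.
  destruct (pdiv_spec (p * n) Hpn) as [Hq Hqd]. set (q := pdiv (p * n)) in *. clearbody q.
  destruct (Nat.eq_dec q p) as [->|Hne].
  - rewrite Nat.mul_comm, Nat.div_mul by (destruct Hp; lia). reflexivity.
  - destruct (prime_mul q p n Hq Hqd) as [H|[m Hm]].
    + exfalso. apply Hne. apply prime_divide_prime; auto.
    + subst n. assert (Hm0 : (1 <= m)%nat) by (destruct m; lia). destruct Hq as [Hq1 Hq2].
      replace (p * (m * q))%nat with (p * m * q)%nat by lia. rewrite Nat.div_mul by lia.
      rewrite (Nat.mul_comm m q). rewrite (IH m) by (auto; nia). rewrite (IH m) by (try split; auto; nia). reflexivity.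
Qed.

Lemma prime_ind (P : nat -> Prop) : P 1%nat ->
  (forall p m, prime_nat p -> (1 <= m)%nat -> P m -> P (p * m)%nat) -> forall n, (1 <= n)%nat -> P n.
Proof.
  intros H1 Hs n. induction n as [n IH] using (well_founded_induction lt_wf). intros Hn.
  destruct (Nat.eq_dec n 1) as [->|]; auto.
  destruct (div_pdiv n ltac:(lia)) as (m & E & Hm & _). rewrite E. apply Hs; [|lia|apply IH; lia].
  apply pdiv_spec; lia.
Qed.

(** * Divisor sums *)

Definition divs (n : nat) : list nat := filter (fun d => Nat.eqb (n mod d) 0) (seq 1 n).

Lemma in_divs n d : (1 <= n)%nat -> In d (divs n) <-> Nat.divide d n.
Proof.
  intros Hn. unfold divs. rewrite filter_In, in_seq, Nat.eqb_eq. split.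
  - intros [H1 H2]. apply Nat.Lcm0.mod_divide. auto.
  - intros H. assert (d <= n)%nat by (apply Nat.divide_pos_le; auto; lia).
    assert (d <> 0)%nat by (intros ->; destruct H; lia).
    split; [lia|]. apply Nat.Lcm0.mod_divide. auto.
Qed.

Lemma NoDup_divs n : NoDup (divs n).
Proof. apply NoDup_filter, seq_NoDup. Qed.

Definition conv (f g : nat -> R) (n : nat) : R := rsum (divs n) (fun d => f d * g (n / d)%nat).

Lemma divide_div n d : (1 <= n)%nat -> Nat.divide d n -> n = (d * (n / d))%nat /\ (1 <= d)%nat /\ (1 <= n / d)%nat.
Proof.
  intros Hn [k Hk]. assert (d <> 0)%nat by (intros ->; lia).
  assert (E : (n / d = k)%nat) by (rewrite Hk; apply Nat.div_mul; auto). rewrite E.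
  split; [lia|]. split; [lia|]. destruct k; lia.
Qed.

Lemma mul_div_cancel p m d : (1 <= d)%nat -> Nat.divide d m -> (p * m / d = p * (m / d))%nat.
Proof.
  intros Hd [k ->]. rewrite Nat.div_mul by lia. rewrite Nat.mul_assoc, Nat.div_mul by lia. reflexivity.
Qed.

Lemma mul_div_cancel2 p m d : (1 <= p)%nat -> (p * m / (p * d) = m / d)%nat.
Proof. intros Hp. apply Nat.Div0.div_mul_cancel_l. lia. Qed.

Section conv_pow.
Variables (al be : R).
Hypothesis (Hal : 0 <= al) (Hbe : 0 <= be).
Let f (d : nat) := al ^ Om d.
Let g (d : nat) := be ^ Om d.

(** The list consists of the divisors of m and their multiples by p. It contains every divisor of p
    m, and repeats some only if p divides m: this is the source of the inequality for all n and of
    the equality for squarefree n. *)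
Lemma conv_split p m : prime_nat p -> (1 <= m)%nat ->
  rsum (divs m ++ map (Nat.mul p) (divs m)) (fun d => f d * g (p * m / d)%nat) = (al + be) * conv f g m.
Proof.
  intros Hp Hm. rewrite rsum_app, rsum_map. unfold conv. rewrite Rmult_plus_distr_r, <- !rsum_scal, Rplus_comm.
  f_equal; apply rsum_ext; intros d Hd; apply in_divs in Hd; auto;
    destruct (divide_div m d Hm Hd) as (E & H1 & H2).
  - rewrite mul_div_cancel2 by (destruct Hp; lia). unfold f. rewrite Om_mul by auto. simpl. ring.
  - rewrite mul_div_cancel by auto. unfold g. rewrite Om_mul by auto. simpl. ring.
Qed.

Lemma conv_pow_le n : (1 <= n)%nat -> conv f g n <= (al + be) ^ Om n.
Proof.
  revert n. apply prime_ind.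
  - rewrite Om_1. unfold conv, divs, f, g. cbn. lra.
  - intros p m Hp Hm IH. rewrite Om_mul by auto. simpl.
    apply Rle_trans with ((al + be) * conv f g m); [|apply Rmult_le_compat_l; lra].
    rewrite <- (conv_split p m) by auto. unfold conv. apply rsum_incl; [apply NoDup_divs| |].
    + intros d Hd. assert (Hpm : (1 <= p * m)%nat) by (destruct Hp; nia).
      apply in_divs in Hd; auto. apply in_or_app.
      destruct (classic (Nat.divide p d)) as [[k Hk]|Hnd].
      * right. apply in_map_iff. exists k. split; [lia|]. apply in_divs; auto.
        destruct Hd as [j Hj]. exists j. destruct Hp. subst d. nia.
      * left. apply in_divs; auto. apply (Nat.gauss d p m); auto.
        destruct Hp as [Hp1 Hp2].
        destruct (Hp2 (Nat.gcd d p) (Nat.gcd_divide_r d p)) as [E|E]; auto.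
        exfalso. apply Hnd. rewrite <- E. apply Nat.gcd_divide_l.
    + intros d _. apply Rmult_le_pos; apply pow_le; auto.
Qed.

(** When p does not divide m the two halves of the list in [conv_split] are disjoint, so nothing is
    counted twice. *)
Lemma conv_pow_ge p m : prime_nat p -> (1 <= m)%nat -> ~ Nat.divide p m ->
  (al + be) * conv f g m <= conv f g (p * m).
Proof.
  intros Hp Hm Hnd. rewrite <- (conv_split p m) by auto. unfold conv.
  assert (Hpm : (1 <= p * m)%nat) by (destruct Hp; nia).
  apply rsum_incl.
  - apply NoDup_app; [apply NoDup_divs| |].
    + apply FinFun.Injective_map_NoDup; [|apply NoDup_divs]. intros a b H. destruct Hp. nia.
    + intros d Hd H. apply in_map_iff in H. destruct H as (k & <- & _).
      apply in_divs in Hd; auto. apply Hnd. eapply Nat.divide_trans; [|exact Hd]. exists k; lia.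
  - intros d Hd. apply in_divs; auto. apply in_app_or in Hd. destruct Hd as [Hd|Hd].
    + apply in_divs in Hd; auto. destruct Hd as [k ->]. exists (p * k)%nat. lia.
    + apply in_map_iff in Hd. destruct Hd as (k & <- & Hk). apply in_divs in Hk; auto.
      destruct Hk as [j ->]. exists j. lia.
  - intros d _. apply Rmult_le_pos; apply pow_le; auto.
Qed.

Definition squarefree (n : nat) : Prop := (1 <= n)%nat /\ forall p, prime_nat p -> ~ Nat.divide (p * p) n.

Lemma squarefree_divide n d : squarefree n -> Nat.divide d n -> squarefree d.
Proof.
  intros [Hn H] Hd. split; [destruct d; [destruct Hd; lia|lia]|].
  intros p Hp Hpd. apply (H p Hp). eapply Nat.divide_trans; eauto.
Qed.

Lemma conv_pow_squarefree n : squarefree n -> conv f g n = (al + be) ^ Om n.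
Proof.
  intros [Hn Hs]. revert n Hn Hs.
  apply (prime_ind (fun n => (forall p, prime_nat p -> ~ Nat.divide (p * p) n) -> conv f g n = (al + be) ^ Om n)).
  - intros _. rewrite Om_1. unfold conv, divs, f, g. cbn. lra.
  - intros p m Hp Hm IH Hs. apply Rle_antisym.
    + apply conv_pow_le. destruct Hp; nia.
    + rewrite Om_mul by auto. simpl. rewrite <- IH.
      * apply conv_pow_ge; auto. intros [k ->]. apply (Hs p Hp). exists k. lia.
      * intros q Hq Hd. apply (Hs q Hq). eapply Nat.divide_trans; [exact Hd|]. exists p. lia.
Qed.

End conv_pow.

(** * Smooth numbers *)

Definition smooth (ps : list nat) (n : nat) : Prop :=
  (1 <= n)%nat /\ forall p, prime_nat p -> Nat.divide p n -> In p ps.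

Lemma smooth_divide ps n d : smooth ps n -> Nat.divide d n -> smooth ps d.
Proof.
  intros [Hn H] Hd. split; [destruct d; [destruct Hd; lia|lia]|].
  intros p Hp Hpd. apply H; auto. eapply Nat.divide_trans; eauto.
Qed.

Lemma smooth_mul ps a b : smooth ps a -> smooth ps b -> smooth ps (a * b).
Proof.
  intros [Ha Ha'] [Hb Hb']. split; [nia|]. intros p Hp Hd. destruct (prime_mul p a b Hp Hd); auto.
Qed.

Lemma smooth_pow_le ps k n : 0 <= k -> (forall p, In p ps -> k <= INR p) -> smooth ps n -> k ^ Om n <= INR n.
Proof.
  intros Hk Hps [Hn Hs]. revert n Hn Hs.
  apply (prime_ind (fun n => (forall p, prime_nat p -> Nat.divide p n -> In p ps) -> k ^ Om n <= INR n)).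
  - intros _. rewrite Om_1. simpl. lra.
  - intros p m Hp Hm IH Hs. rewrite Om_mul by auto. rewrite mult_INR. simpl.
    assert (k <= INR p) by (apply Hps, Hs; auto; exists m; lia).
    assert (k ^ Om m <= INR m).
    { apply IH. intros q Hq Hd. apply Hs; auto. eapply Nat.divide_trans; [exact Hd|]. exists p; lia. }
    assert (0 <= k ^ Om m) by (apply pow_le; auto). apply Rmult_le_compat; auto.
Qed.

Definition sterm (ps : list nat) (ka : R) (n : nat) : R := indic (smooth ps n) * (ka ^ Om n / INR n).

Lemma sterm_nonneg ps ka n : 0 <= ka -> 0 <= sterm ps ka n.
Proof.
  intros Hk. unfold sterm. destruct (indic_cases (smooth ps n)) as [[[Hn _] ->]|[_ ->]]; [|lra].
  rewrite Rmult_1_l. apply Rmult_le_pos; [apply pow_le; auto|].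
  left; apply Rinv_0_lt_compat, lt_0_INR. lia.
Qed.

(* Splitting off the multiples of [p] gives [F(p::ps) <= F(ps) + (ka/p) F(p::ps)]. *)
Lemma smooth_sum_le ps ka Z : 0 <= ka -> (forall p, In p ps -> prime_nat p /\ ka < INR p) ->
  rsum (seq 1 Z) (sterm ps ka) <= rprod ps (fun p => / (1 - ka / INR p)).
Proof.
  intros Hka. induction ps as [|p ps IH]; intros Hps.
  - simpl. apply Rle_trans with (rsum (1%nat :: nil) (fun _ => 1)); [|simpl; lra].
    assert (E : forall n, In n (seq 1 Z) -> sterm nil ka n = indic (n = 1%nat)).
    { intros n Hn. apply in_seq in Hn. unfold sterm. destruct (Nat.eq_dec n 1) as [->|Hne].
      - rewrite !indic_true; auto; [rewrite Om_1; simpl; lra|]. split; [lia|].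
        intros q [Hq _] Hd. apply Nat.divide_1_r in Hd. lia.
      - rewrite (indic_false (n = 1%nat)) by auto. rewrite indic_false; [ring|].
        intros [_ H]. destruct (prime_divisor_ex n) as (q & Hq & Hd); [lia|]. apply (H q Hq Hd). }
    rewrite (rsum_ext _ _ _ E).
    assert (H : forall l : list nat, NoDup l -> rsum l (fun n => indic (n = 1%nat)) <= 1).
    { intros l Hl. induction Hl as [|n l Hnl Hl IHl]; simpl; [lra|].
      destruct (indic_cases (n = 1%nat)) as [[-> ->]|[_ ->]]; [|lra].
      rewrite rsum_0; [lra|]. intros m Hm. apply indic_false. intros ->. contradiction. }
    specialize (H _ (seq_NoDup Z 1)). simpl. lra.
  - destruct (Hps p (or_introl eq_refl)) as [Hp Hkp].
    assert (Hp0 : 0 < INR p) by lra.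
    set (F := rsum (seq 1 Z) (sterm (p :: ps) ka)).
    assert (Hsplit : F <= rsum (seq 1 Z) (sterm ps ka) + ka / INR p * F).
    { unfold F. rewrite <- rsum_scal.
      apply Rle_trans with (rsum (seq 1 Z) (fun n => sterm ps ka n + indic (Nat.divide p n) * sterm (p :: ps) ka n)).
      - apply rsum_le. intros n Hn.
        destruct (indic_cases (Nat.divide p n)) as [[_ ->]|[Hnd ->]].
        + generalize (sterm_nonneg ps ka n Hka). lra.
        + rewrite Rmult_0_l, Rplus_0_r. unfold sterm.
          destruct (indic_cases (smooth (p :: ps) n)) as [[[Hs1 Hs2] ->]|[_ ->]].
          * rewrite indic_true; [lra|]. split; auto. intros q Hq Hd.
            destruct (Hs2 q Hq Hd) as [->|]; auto. contradiction.
          * rewrite Rmult_0_l. apply sterm_nonneg; auto.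
      - rewrite rsum_plus. apply Rplus_le_compat_l.
        set (good := filter (fun n => Nat.eqb (n mod p) 0) (seq 1 Z)).
        apply Rle_trans with (rsum good (fun n => sterm (p :: ps) ka n)).
        { right. unfold good. clear. induction (seq 1 Z) as [|n l IH]; [reflexivity|]. simpl.
          destruct (Nat.eqb_spec (n mod p) 0) as [H|H]; simpl.
          - rewrite indic_true by (apply Nat.Lcm0.mod_divide; auto). rewrite IH. ring.
          - rewrite indic_false by (intros H'; apply H; apply Nat.Lcm0.mod_divide; auto). rewrite IH. ring. }
        apply Rle_trans with (rsum (map (Nat.mul p) (seq 1 Z)) (fun n => sterm (p :: ps) ka n)).
        { apply rsum_incl.
          - apply NoDup_filter, seq_NoDup.
          - intros n Hn. unfold good in Hn. apply filter_In in Hn. destruct Hn as [Hn Hm].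
            apply Nat.eqb_eq in Hm. apply Nat.Lcm0.mod_divide in Hm. destruct Hm as [k Hk].
            apply in_seq in Hn. apply in_map_iff. exists k. split; [lia|]. apply in_seq.
            destruct Hp as [Hp1 _]. destruct k; [lia|]. nia.
          - intros; apply sterm_nonneg; auto. }
        rewrite rsum_map. apply rsum_le. intros m Hm. apply in_seq in Hm.
        unfold sterm. destruct (indic_cases (smooth (p :: ps) (p * m))) as [[Hs ->]|[_ ->]].
        + rewrite indic_true by (eapply smooth_divide; [exact Hs|exists p; lia]).
          rewrite Om_mul by (auto; lia). rewrite mult_INR. right. simpl.
          assert (0 < INR m) by (apply lt_0_INR; lia). field. lra.
        + rewrite Rmult_0_l. apply Rmult_le_pos; [apply Rmult_le_pos; [auto|left; apply Rinv_0_lt_compat; auto]|].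
          apply (sterm_nonneg (p :: ps)); auto. }
    assert (Hc : 0 < 1 - ka / INR p).
    { enough (ka / INR p < 1) by lra. apply Rmult_lt_reg_r with (INR p); auto. field_simplify; lra. }
    assert (IH' := IH (fun q Hq => Hps q (or_intror Hq))).
    simpl. apply Rmult_le_reg_l with (1 - ka / INR p); auto. rewrite <- Rmult_assoc, Rinv_r, Rmult_1_l by lra.
    fold F. lra.
Qed.

(** * Squarefree smooth numbers *)

Fixpoint subset_products (ps : list nat) : list nat :=
  match ps with nil => 1%nat :: nil | p :: ps' => subset_products ps' ++ map (Nat.mul p) (subset_products ps') end.

Definition primes_list (ps : list nat) : Prop := NoDup ps /\ forall p, In p ps -> prime_nat p.

Lemma subp_smooth ps n : (forall p, In p ps -> prime_nat p) -> In n (subset_products ps) -> smooth ps n.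
Proof.
  revert n. induction ps as [|p ps IH]; intros n Hps Hn; simpl in Hn.
  - destruct Hn as [<-|[]]. split; [lia|]. intros q [Hq _] Hd. apply Nat.divide_1_r in Hd. lia.
  - assert (IH' : forall m, In m (subset_products ps) -> smooth (p :: ps) m).
    { intros m Hm. destruct (IH m (fun q Hq => Hps q (or_intror Hq)) Hm) as [H1 H2]. split; auto. intros; right; auto. }
    apply in_app_or in Hn. destruct Hn as [Hn|Hn]; auto.
    apply in_map_iff in Hn. destruct Hn as (m & <- & Hm). apply smooth_mul; auto.
    assert (Hp : prime_nat p) by (apply Hps; left; auto).
    split; [destruct Hp; lia|]. intros q Hq Hd. left. symmetry. apply prime_divide_prime; auto.
Qed.

Lemma subp_not_divide ps p n : (forall q, In q ps -> prime_nat q) -> prime_nat p -> ~ In p ps -> In n (subset_products ps) -> ~ Nat.divide p n.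
Proof.
  intros Hps Hp Hn Hin Hd. apply Hn. destruct (subp_smooth ps n Hps Hin) as [_ H]. apply H; auto.
Qed.

Lemma NoDup_subp ps : primes_list ps -> NoDup (subset_products ps).
Proof.
  intros [Hn Hp]. induction ps as [|p ps IH]; simpl.
  - constructor; [simpl; auto|constructor].
  - inversion Hn as [|? ? Hnp Hn']; subst. assert (Hpp : prime_nat p) by (apply Hp; left; auto).
    assert (Hps : forall q, In q ps -> prime_nat q) by (intros; apply Hp; right; auto).
    apply NoDup_app; [apply IH; auto| |].
    + apply FinFun.Injective_map_NoDup; [|apply IH; auto]. intros a b H. destruct Hpp. nia.
    + intros n Hin H. apply in_map_iff in H. destruct H as (k & <- & _).
      apply (subp_not_divide ps p (p * k) Hps Hpp Hnp Hin). exists k; lia.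
Qed.

Lemma subp_squarefree ps n : primes_list ps -> In n (subset_products ps) -> squarefree n.
Proof.
  revert n. induction ps as [|p ps IH]; intros n [Hnd Hp] Hn; simpl in Hn.
  - destruct Hn as [<-|[]]. split; [lia|]. intros q [Hq _] Hd. apply Nat.divide_1_r in Hd. nia.
  - inversion Hnd as [|? ? Hnp Hnd']; subst. assert (Hpp : prime_nat p) by (apply Hp; left; auto).
    assert (Hps : forall q, In q ps -> prime_nat q) by (intros; apply Hp; right; auto).
    apply in_app_or in Hn. destruct Hn as [Hn|Hn]; [apply IH; auto; split; auto|].
    apply in_map_iff in Hn. destruct Hn as (m & <- & Hm).
    destruct (IH m (conj Hnd' Hps) Hm) as [Hm1 Hm2]. split; [destruct Hpp; nia|].
    intros q Hq Hd. destruct (Nat.eq_dec q p) as [->|Hne].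
    + apply (subp_not_divide ps p m Hps Hpp Hnp Hm). destruct Hd as [k Hk]. exists k. destruct Hpp. nia.
    + apply (Hm2 q Hq).
      assert (Hqm : forall a, Nat.divide q (p * a) -> Nat.divide q a).
      { intros a Ha. destruct (prime_mul q p a Hq Ha) as [H|H]; auto. exfalso. apply Hne, prime_divide_prime; auto. }
      assert (H1 : Nat.divide q m) by (apply Hqm; eapply Nat.divide_trans; [|exact Hd]; exists q; lia).
      destruct H1 as [a ->]. assert (H2 : Nat.divide q (p * a)).
      { destruct Hd as [k Hk]. exists k. destruct Hq. nia. }
      apply Hqm in H2. destruct H2 as [b ->]. exists b. lia.
Qed.

Lemma subp_sum (ps : list nat) (W : nat -> R) (c : nat -> R) :
  (forall p, In p ps -> prime_nat p) -> W 1%nat = 1 ->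
  (forall p n, In p ps -> (1 <= n)%nat -> W (p * n)%nat = c p * W n) ->
  rsum (subset_products ps) W = rprod ps (fun p => 1 + c p).
Proof.
  intros Hps H1 Hm. induction ps as [|p ps IH]; simpl; [lra|].
  rewrite rsum_app, rsum_map.
  rewrite (rsum_ext (subset_products ps) (fun b => W (p * b)%nat) (fun b => c p * W b)).
  - rewrite rsum_scal, IH; [ring| |].
    + intros; apply Hps; right; auto.
    + intros; apply Hm; [right|]; auto.
  - intros n Hn. apply Hm; [left; auto|]. apply (subp_smooth ps n); auto. intros; apply Hps; right; auto.
Qed.

(** * Mertens-type estimates *)

Definition primeb (p : nat) : bool := if excluded_middle_informative (prime_nat p) then true else false.

Definition primes_between (lo hi : nat) : list nat := filter primeb (seq (S lo) (hi - lo)).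

Lemma in_primes_between lo hi p : In p (primes_between lo hi) <-> (lo < p <= hi)%nat /\ prime_nat p.
Proof.
  unfold primes_between, primeb. rewrite filter_In, in_seq.
  destruct (excluded_middle_informative (prime_nat p)) as [H|H]; intuition (try lia; try discriminate).
Qed.

Lemma primes_list_primes_between lo hi : primes_list (primes_between lo hi).
Proof.
  split; [apply NoDup_filter, seq_NoDup|]. intros p Hp. apply in_primes_between in Hp. apply Hp.
Qed.

Lemma rprod_le {A : Type} (l : list A) (f g : A -> R) :
  (forall a, In a l -> 0 <= f a <= g a) -> 0 <= rprod l f <= rprod l g.
Proof.
  induction l as [|a l IH]; intros H; simpl; [lra|].
  assert (0 <= f a <= g a) by (apply H; left; auto).
  assert (0 <= rprod l f <= rprod l g) by (apply IH; intros; apply H; right; auto).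
  fold (rprod l f) (rprod l g). split; [apply Rmult_le_pos; lra|]. apply Rmult_le_compat; lra.
Qed.

Lemma rprod_exp {A : Type} (l : list A) (h : A -> R) : rprod l (fun a => exp (h a)) = exp (rsum l h).
Proof.
  induction l as [|a l IH]; simpl; [rewrite exp_0; reflexivity|]. fold (rprod l (fun a => exp (h a))).
  rewrite IH, exp_plus. reflexivity.
Qed.

Lemma exp_le x y : x <= y -> exp x <= exp y.
Proof. intros [H| ->]; [left; apply exp_increasing; auto|lra]. Qed.

Lemma inv_one_minus_le v : 0 <= v <= / 2 -> / (1 - v) <= exp (v + 2 * v ^ 2).
Proof.
  intros Hv. apply Rle_trans with (exp (v / (1 - v))).
  - replace (/ (1 - v)) with (1 + v / (1 - v)) by (field; lra). apply exp_ineq1_le.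
  - apply exp_le. apply Rmult_le_reg_r with (1 - v); [lra|]. unfold Rdiv. rewrite Rmult_assoc, Rinv_l by lra. nra.
Qed.

Lemma one_plus_ge v : 0 <= v -> exp (v - v ^ 2) <= 1 + v.
Proof.
  intros Hv. apply Rle_trans with (exp (v / (1 + v))).
  - apply exp_le. apply Rmult_le_reg_r with (1 + v); [lra|]. unfold Rdiv. rewrite Rmult_assoc, Rinv_l by lra. nra.
  - generalize (exp_ineq1_le (- (v / (1 + v)))). rewrite exp_Ropp. intros H.
    assert (He : 0 < exp (v / (1 + v))) by apply exp_pos.
    replace (1 + - (v / (1 + v))) with (/ (1 + v)) in H by (field; lra).
    apply Rinv_le_contravar in H; [|apply Rinv_0_lt_compat; lra]. rewrite !Rinv_inv in H. auto.
Qed.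

Lemma prime_INR_ge_2 p : prime_nat p -> 2 <= INR p.
Proof. intros [H _]. apply (le_INR 2). lia. Qed.

Lemma sum_inv_sq_le lo hi : rsum (primes_between lo hi) (fun p => / INR p ^ 2) <= 1.
Proof.
  apply Rle_trans with (rsum (seq 2 hi) (fun n => / INR n ^ 2)).
  - apply rsum_incl; [apply primes_list_primes_between| |].
    + intros p Hp. apply in_primes_between in Hp. destruct Hp as [Hp [Hp' _]]. apply in_seq. lia.
    + intros n Hn. apply in_seq in Hn. left. apply Rinv_0_lt_compat, pow_lt, lt_0_INR. lia.
  - assert (H : forall m, rsum (seq 2 m) (fun n => / INR n ^ 2) <= 1 - / (INR m + 1)).
    { induction m as [|m IH]; [simpl; lra|]. rewrite rsum_seq_S.
      replace (INR (2 + m)) with (INR m + 2) by (rewrite plus_INR; simpl; ring). rewrite S_INR.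
      generalize (pos_INR m); intros.
      assert (/ (INR m + 2) ^ 2 <= / (INR m + 1) - / (INR m + 1 + 1)); [|lra].
      replace (/ (INR m + 1) - / (INR m + 1 + 1)) with (/ ((INR m + 1) * (INR m + 2))) by (field; lra).
      apply Rinv_le_contravar; nra. }
    specialize (H hi). assert (0 < / (INR hi + 1)) by (apply Rinv_0_lt_compat; generalize (pos_INR hi); lra). lra.
Qed.

(** If p divides n, the other primes of the list that divide n still divide n / p, so ln p is split
    off one prime at a time. *)
Lemma sum_ln_prime_divisors ps n : primes_list ps -> (1 <= n)%nat ->
  rsum ps (fun p => indic (Nat.divide p n) * ln (INR p)) <= ln (INR n).
Proof.
  intros [Hnd Hp]. revert n. induction ps as [|p ps IH]; intros n Hn; simpl.
  - rewrite <- ln_1. apply ln_le; [lra|]. apply (le_INR 1); auto.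
  - inversion Hnd as [|? ? Hnp Hnd']; subst. assert (Hpp : prime_nat p) by (apply Hp; left; auto).
    assert (Hps : forall q, In q ps -> prime_nat q) by (intros; apply Hp; right; auto).
    destruct (indic_cases (Nat.divide p n)) as [[[m ->] ->]|[_ ->]].
    + assert (Hm : (1 <= m)%nat) by (destruct m; lia). specialize (IH Hnd' Hps m Hm).
      generalize (prime_INR_ge_2 p Hpp); intros. assert (1 <= INR m) by (apply (le_INR 1); auto).
      rewrite mult_INR, ln_mult by lra.
      apply Rle_trans with (ln (INR p) + rsum ps (fun q => indic (Nat.divide q m) * ln (INR q))); [|lra].
      rewrite Rmult_1_l. apply Rplus_le_compat_l. apply rsum_le. intros q Hq.
      assert (Hq1 : 0 <= ln (INR q)).
      { rewrite <- ln_1. generalize (prime_INR_ge_2 q (Hps q Hq)); intros. apply ln_le; lra. }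
      apply Rmult_le_compat_r; auto.
      destruct (indic_cases (Nat.divide q (m * p))) as [[Hd ->]|[_ ->]]; [|apply indic_nonneg].
      rewrite indic_true; [lra|]. destruct (prime_mul q m p (Hps q Hq) Hd) as [H'|H']; auto.
      exfalso. apply Hnp. rewrite <- (prime_divide_prime q p); auto.
    + rewrite Rmult_0_l, Rplus_0_l. apply IH; auto.
Qed.

Lemma count_multiples p N : (1 <= p)%nat -> INR N / INR p - 1 <= rsum (seq 1 N) (fun n => indic (Nat.divide p n)).
Proof.
  intros Hp. assert (Hp' : 1 <= INR p) by (apply (le_INR 1); auto).
  apply Rle_trans with (INR (N / p)).
  - assert (E := Nat.div_mod N p ltac:(lia)). assert (Hm := Nat.mod_upper_bound N p ltac:(lia)).
    assert (HR : INR N <= INR p * (INR (N / p) + 1)).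
    { rewrite <- S_INR, <- mult_INR. apply le_INR. nia. }
    apply Rmult_le_reg_r with (INR p); [lra|]. replace ((INR N / INR p - 1) * INR p) with (INR N - INR p) by (field; lra). lra.
  - apply Rle_trans with (rsum (map (Nat.mul p) (seq 1 (N / p))) (fun n => indic (Nat.divide p n))).
    + rewrite rsum_map. rewrite (rsum_ext _ _ (fun _ => 1)).
      * rewrite rsum_const, length_seq. lra.
      * intros n _. apply indic_true. exists n; lia.
    + apply rsum_incl.
      * apply FinFun.Injective_map_NoDup; [|apply seq_NoDup]. intros a b H. nia.
      * intros n Hn. apply in_map_iff in Hn. destruct Hn as (k & <- & Hk). apply in_seq in Hk. apply in_seq.
        assert (p * (N / p) <= N)%nat by (apply Nat.Div0.mul_div_le). nia.
      * intros; apply indic_nonneg.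
Qed.

(** The sum of ln p over all pairs p | n with n <= y is at most y ln y; exchanging summations, each
    p is met at least y/p - 1 times. The trivial bound y ln y for the sum of ln p accounts for the
    factor 2. *)
Lemma sum_ln_p_over_p y : (1 <= y)%nat -> rsum (primes_between 0 y) (fun p => ln (INR p) / INR p) <= 2 * ln (INR y).
Proof.
  intros Hy. assert (HY : 1 <= INR y) by (apply (le_INR 1); auto).
  set (ps := primes_between 0 y).
  assert (Hln : forall n, In n (seq 1 y) -> 0 <= ln (INR n) <= ln (INR y)).
  { intros n Hn. apply in_seq in Hn. assert (1 <= INR n) by (apply (le_INR 1); lia).
    assert (INR n <= INR y) by (apply le_INR; lia). split; [rewrite <- ln_1|]; apply ln_le; lra. }
  assert (Hin : incl ps (seq 1 y)) by (intros p Hp; apply in_primes_between in Hp; apply in_seq; lia).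
  assert (H1 : rsum (seq 1 y) (fun n => rsum ps (fun p => indic (Nat.divide p n) * ln (INR p))) <= INR y * ln (INR y)).
  { apply Rle_trans with (rsum (seq 1 y) (fun _ => ln (INR y))).
    - apply rsum_le. intros n Hn. eapply Rle_trans; [apply sum_ln_prime_divisors; [apply primes_list_primes_between|apply in_seq in Hn; lia]|].
      apply Hln; auto.
    - rewrite rsum_const, length_seq. lra. }
  rewrite rsum_swap in H1.
  assert (H2 : rsum ps (fun p => (INR y / INR p - 1) * ln (INR p)) <= INR y * ln (INR y)).
  { eapply Rle_trans; [|exact H1]. apply rsum_le. intros p Hp.
    rewrite (rsum_ext _ _ (fun n => ln (INR p) * indic (Nat.divide p n))) by (intros; ring).
    rewrite rsum_scal, Rmult_comm. apply Rmult_le_compat_l; [apply Hln; auto|].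
    apply count_multiples. apply in_primes_between in Hp. lia. }
  assert (H3 : rsum ps (fun p => ln (INR p)) <= INR y * ln (INR y)).
  { apply Rle_trans with (rsum (seq 1 y) (fun p => ln (INR p))).
    - apply rsum_incl; [apply primes_list_primes_between|auto|intros; apply Hln; auto].
    - apply Rle_trans with (rsum (seq 1 y) (fun _ => ln (INR y))); [apply rsum_le; intros; apply Hln; auto|].
      rewrite rsum_const, length_seq. lra. }
  rewrite (rsum_ext _ _ (fun p => INR y * (ln (INR p) / INR p) - ln (INR p))) in H2.
  2: { intros p Hp. apply in_primes_between in Hp. assert (0 < INR p) by (apply lt_0_INR; lia). field. lra. }
  rewrite rsum_minus, rsum_scal in H2. apply Rmult_le_reg_l with (INR y); lra.
Qed.

Lemma zeta_partial_le Z sg : 0 < sg -> rsum (seq 1 Z) (fun n => Rpower (INR n) (- (1 + sg))) <= 1 + / sg.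
Proof.
  intros Hs.
  assert (H : forall m, rsum (seq 1 (S m)) (fun n => Rpower (INR n) (- (1 + sg))) <= 1 + / sg * (1 - Rpower (INR (S m)) (- sg))).
  { induction m as [|m IH].
    - simpl. unfold Rpower. rewrite ln_1, !Rmult_0_r, exp_0. lra.
    - rewrite rsum_seq_S. eapply Rle_trans; [apply Rplus_le_compat_r; exact IH|].
      replace (1 + S m)%nat with (S (S m)) by lia. rewrite (S_INR (S m)). set (N := INR (S m)).
      assert (HN : 1 <= N) by (apply (le_INR 1); lia).
      assert (E : Rpower (N + 1) (- (1 + sg)) <= / sg * (Rpower N (- sg) - Rpower (N + 1) (- sg))); [|lra].
      generalize (ln_succ_bounds N ltac:(lra)). intros [L1 _].
      unfold Rpower.
      assert (E1 : exp (- (1 + sg) * ln (N + 1)) = exp (- sg * ln (N + 1)) * / (N + 1)).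
      { replace (- (1 + sg) * ln (N + 1)) with (- sg * ln (N + 1) + - ln (N + 1)) by ring.
        rewrite exp_plus, exp_Ropp, exp_ln by lra. reflexivity. }
      assert (E2 : exp (- sg * ln N) = exp (- sg * ln (N + 1)) * exp (sg * (ln (N + 1) - ln N))).
      { rewrite <- exp_plus. f_equal. ring. }
      rewrite E1, E2. set (X := exp (- sg * ln (N + 1))). assert (HX : 0 < X) by apply exp_pos.
      assert (H : sg * / (N + 1) <= exp (sg * (ln (N + 1) - ln N)) - 1).
      { generalize (exp_ineq1_le (sg * (ln (N + 1) - ln N))). intros.
        assert (sg * / (N + 1) <= sg * (ln (N + 1) - ln N)) by (apply Rmult_le_compat_l; lra). lra. }
      apply Rmult_le_reg_l with sg; auto.
      replace (sg * (/ sg * (X * exp (sg * (ln (N + 1) - ln N)) - X))) with (X * (exp (sg * (ln (N + 1) - ln N)) - 1)) by (field; lra).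
      replace (sg * (X * / (N + 1))) with (X * (sg * / (N + 1))) by ring. apply Rmult_le_compat_l; lra. }
  assert (Hi : 0 < / sg) by (apply Rinv_0_lt_compat; auto).
  destruct Z as [|m]; [simpl; lra|]. eapply Rle_trans; [apply H|].
  assert (0 < Rpower (INR (S m)) (- sg)) by apply exp_pos. nra.
Qed.

Lemma list_bounded (l : list nat) : exists Z, forall n, In n l -> (n <= Z)%nat.
Proof.
  induction l as [|a l [Z HZ]]; [exists 0%nat; simpl; tauto|].
  exists (a + Z)%nat. intros n [<-|H]; [lia|]. specialize (HZ n H). lia.
Qed.

Lemma ln_ge_1 y : (3 <= y)%nat -> 1 <= ln (INR y).
Proof.
  intros Hy. assert (3 <= INR y) by (replace 3 with (INR 3) by (simpl; ring); apply le_INR; auto).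
  rewrite <- (ln_exp 1). apply ln_le; [apply exp_pos|]. generalize exp_le_3. lra.
Qed.

(** The product of 1 + p^(-1-sg) with sg = 1 / ln y is at most zeta(1 + sg) <= 1 + ln y. Returning
    from p^(-1-sg) to 1/p costs sg times the sum of ln p / p, at most 2. *)
Lemma sum_inv_p_upper y : (3 <= y)%nat -> rsum (primes_between 0 y) (fun p => / INR p) <= ln (ln (INR y)) + 4.
Proof.
  intros Hy. generalize (ln_ge_1 y Hy); intros HL. set (L := ln (INR y)) in *. set (ps := primes_between 0 y).
  set (sg := / L). assert (Hsg : 0 < sg) by (apply Rinv_0_lt_compat; lra).
  set (v := fun p => Rpower (INR p) (- (1 + sg))).
  assert (Hps : forall p, In p ps -> prime_nat p) by (apply primes_list_primes_between).
  assert (HP : rprod ps (fun p => 1 + v p) <= 1 + L).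
  { rewrite <- (subp_sum ps v v); auto.
    - destruct (list_bounded (subset_products ps)) as [Z HZ].
      apply Rle_trans with (rsum (seq 1 Z) v).
      + apply rsum_incl; [apply NoDup_subp, primes_list_primes_between| |intros; left; apply exp_pos].
        intros n Hn. apply in_seq. specialize (HZ n Hn). destruct (subp_smooth ps n Hps Hn). lia.
      + replace L with (/ sg) by (unfold sg; rewrite Rinv_inv; auto). apply zeta_partial_le; auto.
    - unfold v, Rpower. simpl. rewrite ln_1, Rmult_0_r, exp_0. reflexivity.
    - intros p n Hp Hn. unfold v, Rpower. generalize (prime_INR_ge_2 p (Hps p Hp)); intros.
      assert (0 < INR n) by (apply lt_0_INR; lia).
      rewrite mult_INR, ln_mult, Rmult_plus_distr_l, exp_plus by lra. reflexivity. }
  assert (Hv : forall p, In p ps -> 0 < v p <= / INR p /\ / INR p <= v p + sg * (ln (INR p) / INR p)).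
  { intros p Hp. generalize (prime_INR_ge_2 p (Hps p Hp)); intros.
    assert (Hlp : 0 <= ln (INR p)) by (rewrite <- ln_1; apply ln_le; lra).
    assert (E : v p = / INR p * exp (- (sg * ln (INR p)))).
    { unfold v, Rpower. replace (- (1 + sg) * ln (INR p)) with (- ln (INR p) + - (sg * ln (INR p))) by ring.
      rewrite exp_plus, exp_Ropp, exp_ln by lra. reflexivity. }
    assert (Hi : 0 < / INR p) by (apply Rinv_0_lt_compat; lra).
    split; [split; [apply exp_pos|]|].
    - rewrite E. rewrite <- (Rmult_1_r (/ INR p)) at 2. apply Rmult_le_compat_l; [lra|]. rewrite <- exp_0.
      apply exp_le. nra.
    - rewrite E. generalize (exp_ineq1_le (- (sg * ln (INR p)))). intros He. unfold Rdiv. nra. }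
  assert (HS : rsum ps v <= ln (1 + L) + 1).
  { assert (H : exp (rsum ps (fun p => v p - v p ^ 2)) <= 1 + L).
    { rewrite <- rprod_exp. eapply Rle_trans; [|exact HP]. apply rprod_le. intros p Hp. split; [left; apply exp_pos|].
      apply one_plus_ge. left; apply Hv; auto. }
    assert (H' : rsum ps (fun p => v p - v p ^ 2) <= ln (1 + L)).
    { rewrite <- (ln_exp (rsum _ _)). apply ln_le; auto. apply exp_pos. }
    rewrite rsum_minus in H'.
    assert (rsum ps (fun p => v p ^ 2) <= 1); [|lra].
    eapply Rle_trans; [|apply (sum_inv_sq_le 0 y)]. apply rsum_le. intros p Hp. destruct (Hv p Hp) as [[H1 H2] _].
    rewrite <- pow_inv. apply pow_incr. lra. }
  assert (HT : rsum ps (fun p => / INR p) <= rsum ps v + sg * rsum ps (fun p => ln (INR p) / INR p)).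
  { rewrite <- rsum_scal, <- rsum_plus. apply rsum_le. intros p Hp. apply Hv; auto. }
  assert (HM : sg * rsum ps (fun p => ln (INR p) / INR p) <= 2).
  { generalize (sum_ln_p_over_p y ltac:(lia)). fold L ps. intros H.
    apply Rle_trans with (sg * (2 * L)); [apply Rmult_le_compat_l; lra|]. unfold sg. right; field; lra. }
  assert (ln (1 + L) <= ln L + 1).
  { apply Rle_trans with (ln (2 * L)); [apply ln_le; lra|]. rewrite ln_mult by lra.
    generalize (ln_le_sub1 2 ltac:(lra)). lra. }
  lra.
Qed.

Lemma harmonic_ge N : ln (INR N + 1) <= rsum (seq 1 N) (fun n => / INR n).
Proof.
  induction N as [|N IH]; [simpl; rewrite Rplus_0_l, ln_1; lra|].
  rewrite rsum_seq_S. replace (1 + N)%nat with (S N) by lia. rewrite S_INR.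
  generalize (pos_INR N); intros. generalize (ln_succ_bounds (INR N + 1) ltac:(lra)). lra.
Qed.

(** Every n <= y is a product of primes up to y, so the harmonic sum is at most the product of 1 /
    (1 - 1/p); after taking logarithms the squares of 1/p cost 2. *)
Lemma sum_inv_p_lower y : (3 <= y)%nat -> ln (ln (INR y)) - 2 <= rsum (primes_between 0 y) (fun p => / INR p).
Proof.
  intros Hy. generalize (ln_ge_1 y Hy); intros HL. set (L := ln (INR y)) in *. set (ps := primes_between 0 y).
  assert (Hps : forall p, In p ps -> prime_nat p) by (apply primes_list_primes_between).
  assert (HY : 0 < INR y) by (apply lt_0_INR; lia).
  assert (H1 : L <= rsum (seq 1 y) (sterm ps 1)).
  { apply Rle_trans with (ln (INR y + 1)); [apply ln_le; lra|].
    eapply Rle_trans; [apply harmonic_ge|]. right. apply rsum_ext. intros n Hn. apply in_seq in Hn.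
    unfold sterm. rewrite indic_true, pow1; [unfold Rdiv; ring|]. split; [lia|]. intros p Hp Hd.
    apply in_primes_between. split; auto. split; [destruct Hp; lia|]. apply Nat.divide_pos_le in Hd; lia. }
  assert (H2 : rsum (seq 1 y) (sterm ps 1) <= rprod ps (fun p => / (1 - 1 / INR p))).
  { apply smooth_sum_le; [lra|]. intros p Hp. split; auto. generalize (prime_INR_ge_2 p (Hps p Hp)); lra. }
  assert (H3 : rprod ps (fun p => / (1 - 1 / INR p)) <= exp (rsum ps (fun p => / INR p + 2 * (/ INR p ^ 2)))).
  { rewrite <- rprod_exp. apply rprod_le. intros p Hp. generalize (prime_INR_ge_2 p (Hps p Hp)); intros.
    unfold Rdiv. rewrite Rmult_1_l. assert (Hi : 0 < / INR p <= / 2) by (split; [apply Rinv_0_lt_compat; lra|apply Rinv_le_contravar; lra]).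
    split; [left; apply Rinv_0_lt_compat; lra|]. rewrite <- pow_inv. apply inv_one_minus_le. lra. }
  assert (H4 : ln L <= rsum ps (fun p => / INR p + 2 * (/ INR p ^ 2))).
  { rewrite <- (ln_exp (rsum _ _)). apply ln_le; lra. }
  rewrite rsum_plus, rsum_scal in H4. generalize (sum_inv_sq_le 0 y). fold ps. intros. lra.
Qed.

Lemma sum_inv_p_rough lo y : (3 <= y)%nat ->
  ln (ln (INR y)) - 2 - INR lo <= rsum (primes_between lo y) (fun p => / INR p) <= ln (ln (INR y)) + 4.
Proof.
  intros Hy.
  assert (Hpos : forall n, In n (seq 1 y) -> 0 <= / INR n).
  { intros n Hn. apply in_seq in Hn. left; apply Rinv_0_lt_compat, lt_0_INR; lia. }
  split.
  - assert (H : rsum (primes_between 0 y) (fun p => / INR p) <= rsum (primes_between 0 lo ++ primes_between lo y) (fun p => / INR p)).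
    { apply rsum_incl; [apply primes_list_primes_between| |].
      - intros p Hp. apply in_primes_between in Hp. apply in_or_app. rewrite !in_primes_between.
        destruct (Nat.le_gt_cases p lo); [left|right]; intuition lia.
      - intros p Hp. left. apply Rinv_0_lt_compat, lt_0_INR. apply in_app_or in Hp. rewrite !in_primes_between in Hp. intuition lia. }
    rewrite rsum_app in H.
    assert (rsum (primes_between 0 lo) (fun p => / INR p) <= INR lo).
    { apply Rle_trans with (rsum (seq 1 lo) (fun p => 1)).
      - apply Rle_trans with (rsum (primes_between 0 lo) (fun _ => 1)).
        + apply rsum_le. intros p Hp. apply in_primes_between in Hp. destruct Hp as [_ Hp].
          rewrite <- Rinv_1. apply Rinv_le_contravar; [lra|]. generalize (prime_INR_ge_2 p Hp); lra.
        + apply rsum_incl; [apply primes_list_primes_between| |intros; lra].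
          intros p Hp. apply in_primes_between in Hp. apply in_seq. lia.
      - rewrite rsum_const, length_seq. lra. }
    generalize (sum_inv_p_lower y Hy). lra.
  - eapply Rle_trans; [|apply sum_inv_p_upper; auto]. apply rsum_incl; [apply primes_list_primes_between| |].
    + intros p Hp. apply in_primes_between in Hp. apply in_primes_between. intuition lia.
    + intros p Hp. apply in_primes_between in Hp. apply Hpos, in_seq. lia.
Qed.

(** The condition on [lo] makes ka / p <= 1/2 for every prime of the list, so each factor is at most
    exp (ka/p + 2 (ka/p)^2), and the sum of 1/p is ln ln y + O(1). *)
Lemma euler_upper ka lo : 0 <= ka -> 2 * ka <= INR lo -> exists C, 0 < C /\ forall y, (3 <= y)%nat ->
  rprod (primes_between lo y) (fun p => / (1 - ka / INR p)) <= C * Rpower (ln (INR y)) ka.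
Proof.
  intros Hka Hlo. exists (exp (4 * ka + 2 * ka ^ 2)). split; [apply exp_pos|]. intros y Hy.
  apply Rle_trans with (exp (rsum (primes_between lo y) (fun p => ka * / INR p + (2 * ka ^ 2) * / INR p ^ 2))).
  - rewrite <- rprod_exp. apply rprod_le. intros p Hp. apply in_primes_between in Hp. destruct Hp as [Hp Hpp].
    assert (HR : INR lo < INR p) by (apply lt_INR; lia). generalize (prime_INR_ge_2 p Hpp); intros.
    assert (Hv : 0 <= ka / INR p <= / 2).
    { split; [apply Rmult_le_pos; auto; left; apply Rinv_0_lt_compat; lra|].
      apply Rmult_le_reg_r with (INR p); [lra|]. unfold Rdiv. rewrite Rmult_assoc, Rinv_l; lra. }
    split; [left; apply Rinv_0_lt_compat; lra|].
    replace (ka * / INR p + 2 * ka ^ 2 * / INR p ^ 2) with (ka / INR p + 2 * (ka / INR p) ^ 2) by (field; lra).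
    apply inv_one_minus_le. auto.
  - unfold Rpower. rewrite <- exp_plus. apply exp_le. rewrite rsum_plus, !rsum_scal.
    generalize (sum_inv_sq_le lo y) (proj2 (sum_inv_p_rough lo y Hy)). intros.
    assert (ka * rsum (primes_between lo y) (fun p => / INR p) <= ka * (ln (ln (INR y)) + 4)) by (apply Rmult_le_compat_l; auto).
    assert (2 * ka ^ 2 * rsum (primes_between lo y) (fun p => / INR p ^ 2) <= 2 * ka ^ 2 * 1) by (apply Rmult_le_compat_l; nra).
    lra.
Qed.

Lemma euler_lower ka lo : 0 <= ka -> exists c, 0 < c /\ forall y, (3 <= y)%nat ->
  c * Rpower (ln (INR y)) ka <= rprod (primes_between lo y) (fun p => 1 + ka / INR p).
Proof.
  intros Hka. exists (exp (- (ka * (2 + INR lo) + ka ^ 2))). split; [apply exp_pos|]. intros y Hy.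
  apply Rle_trans with (exp (rsum (primes_between lo y) (fun p => ka * / INR p - ka ^ 2 * / INR p ^ 2))).
  - unfold Rpower. rewrite <- exp_plus. apply exp_le. rewrite rsum_minus, !rsum_scal.
    generalize (sum_inv_sq_le lo y) (proj1 (sum_inv_p_rough lo y Hy)). intros.
    assert (ka * (ln (ln (INR y)) - 2 - INR lo) <= ka * rsum (primes_between lo y) (fun p => / INR p)) by (apply Rmult_le_compat_l; auto).
    assert (ka ^ 2 * rsum (primes_between lo y) (fun p => / INR p ^ 2) <= ka ^ 2 * 1) by (apply Rmult_le_compat_l; nra).
    lra.
  - rewrite <- rprod_exp. apply rprod_le. intros p Hp. apply in_primes_between in Hp. destruct Hp as [Hp Hpp].
    generalize (prime_INR_ge_2 p Hpp); intros. split; [left; apply exp_pos|].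
    replace (ka * / INR p - ka ^ 2 * / INR p ^ 2) with (ka / INR p - (ka / INR p) ^ 2) by (field; lra).
    apply one_plus_ge. apply Rmult_le_pos; auto; left; apply Rinv_0_lt_compat; lra.
Qed.

Lemma filter_sum (l : list nat) (b : nat -> bool) (f : nat -> R) :
  rsum l f = rsum (filter b l) f + rsum (filter (fun n => negb (b n)) l) f.
Proof.
  induction l as [|a l IH]; simpl; [lra|]. destruct (b a); simpl; rewrite IH; ring.
Qed.

(* Rankin's trick with the shift [1 / ln y] *)
Lemma squarefree_sum_lower ka lo C0 : 0 <= ka -> 4 * ka + 1 <= INR C0 ->
  exists c, 0 < c /\ forall y, (3 <= y)%nat ->
  c * Rpower (ln (INR y)) ka <=
  rsum (filter (fun n => Nat.leb n (y ^ C0)) (subset_products (primes_between lo y))) (fun n => ka ^ Om n / INR n).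
Proof.
  intros Hka HC. destruct (euler_lower ka lo Hka) as (c & Hc & Hlow).
  exists (c / 2). split; [lra|]. intros y Hy. specialize (Hlow y Hy).
  generalize (ln_ge_1 y Hy); intros HL. set (L := ln (INR y)) in *. set (ps := primes_between lo y) in *.
  assert (HY : 0 < INR y) by (apply lt_0_INR; lia).
  assert (Hps : forall p, In p ps -> prime_nat p) by (apply primes_list_primes_between).
  set (x := (y ^ C0)%nat). set (sg := / L).
  assert (Hsg : 0 < sg) by (apply Rinv_0_lt_compat; lra).
  set (w := fun n => ka ^ Om n / INR n). set (P := rprod ps (fun p => 1 + ka / INR p)) in *.
  assert (Hw : rsum (subset_products ps) w = P).
  { apply (subp_sum ps w (fun p => ka / INR p)); auto.
    - unfold w. rewrite Om_1. simpl. field.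
    - intros p n Hp Hn. unfold w. rewrite Om_mul by auto. rewrite mult_INR.
      generalize (prime_INR_ge_2 p (Hps p Hp)); intros. assert (0 < INR n) by (apply lt_0_INR; lia). simpl. field. lra. }
  set (W := fun n => w n * Rpower (INR n) sg).
  assert (HW : rsum (subset_products ps) W = rprod ps (fun p => 1 + ka / INR p * Rpower (INR p) sg)).
  { apply (subp_sum ps W (fun p => ka / INR p * Rpower (INR p) sg)); auto.
    - unfold W, w, Rpower. rewrite Om_1. simpl. rewrite ln_1, Rmult_0_r, exp_0. field.
    - intros p n Hp Hn. unfold W, w. rewrite Om_mul by auto. rewrite mult_INR.
      generalize (prime_INR_ge_2 p (Hps p Hp)); intros. assert (0 < INR n) by (apply lt_0_INR; lia).
      unfold Rpower. rewrite ln_mult, Rmult_plus_distr_l, exp_plus by lra. simpl. field. lra. }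
  assert (HWb : rsum (subset_products ps) W <= P * exp (4 * ka)).
  { rewrite HW.
    apply Rle_trans with (rprod ps (fun p => (1 + ka / INR p) * exp (2 * ka * sg * (ln (INR p) / INR p)))).
    - apply rprod_le. intros p Hp. generalize (prime_INR_ge_2 p (Hps p Hp)); intros Hp2.
      assert (Hkp : 0 <= ka / INR p) by (apply Rmult_le_pos; auto; left; apply Rinv_0_lt_compat; lra).
      assert (Hlp : 0 <= ln (INR p)) by (rewrite <- ln_1; apply ln_le; lra).
      assert (Hpy : INR p <= INR y) by (apply le_INR; apply in_primes_between in Hp; lia).
      assert (HlpL : ln (INR p) <= L) by (apply ln_le; lra).
      split; [unfold Rpower; assert (0 < exp (sg * ln (INR p))) by apply exp_pos; nra|].
      set (u := sg * ln (INR p)).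
      assert (Hu : 0 <= u <= 1).
      { unfold u. split; [nra|]. apply Rle_trans with (sg * L); [apply Rmult_le_compat_l; lra|]. unfold sg. right; field; lra. }
      (* On [0, 1/2] this is the mean value theorem with e^(1/2) <= 2; on [1/2, 1] it is convexity,
         the chord between the values 2 and 3 being exactly 1 + 2 u. *)
      assert (Heu : exp u <= 1 + 2 * u).
      { destruct (MVT_gen exp 0 u exp) as (z & Hz & E).
        - intros; auto_derive; auto; ring.
        - intros; apply derivable_continuous_pt, derivable_pt_exp.
        - rewrite Rmin_left, Rmax_right in Hz by lra. rewrite exp_0 in E.
          destruct (Rle_dec u (/ 2)) as [Hh|Hh].
          + assert (exp z <= 2).
            { apply Rle_trans with (exp (/ 2)); [apply exp_le; lra|].
              assert (exp (/ 2) * exp (/ 2) <= 3) by (rewrite <- exp_plus; replace (/ 2 + / 2) with 1 by field; apply exp_le_3).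
              assert (0 < exp (/ 2)) by apply exp_pos. nra. }
            nra.
          + clear E z Hz.
            assert (H1 : exp (/ 2) <= 2).
            { assert (exp (/ 2) * exp (/ 2) <= 3) by (rewrite <- exp_plus; replace (/ 2 + / 2) with 1 by field; apply exp_le_3).
              assert (0 < exp (/ 2)) by apply exp_pos. nra. }
            generalize exp_le_3; intros H3.
            assert (Hcv : exp u <= (1 - (2 * u - 1)) * exp (/ 2) + (2 * u - 1) * exp 1).
            { set (th := 2 * u - 1).
              assert (A1 : exp (/ 2) >= exp u * (1 + (/ 2 - u))).
              { replace (exp (/ 2)) with (exp u * exp (/ 2 - u)) by (rewrite <- exp_plus; f_equal; ring).
                generalize (exp_ineq1_le (/ 2 - u)) (exp_pos u). nra. }
              assert (A2 : exp 1 >= exp u * (1 + (1 - u))).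
              { replace (exp 1) with (exp u * exp (1 - u)) by (rewrite <- exp_plus; f_equal; ring).
                generalize (exp_ineq1_le (1 - u)) (exp_pos u). nra. }
              assert (0 <= th <= 1) by (unfold th; lra).
              apply Rle_trans with ((1 - th) * (exp u * (1 + (/ 2 - u))) + th * (exp u * (1 + (1 - u)))).
              - right. unfold th. field.
              - assert ((1 - th) * (exp u * (1 + (/ 2 - u))) <= (1 - th) * exp (/ 2)) by (apply Rmult_le_compat_l; lra).
                assert (th * (exp u * (1 + (1 - u))) <= th * exp 1) by (apply Rmult_le_compat_l; lra). lra. }
            nra. }
      change (Rpower (INR p) sg) with (exp u).
      replace (2 * ka * sg * (ln (INR p) / INR p)) with (2 * (ka / INR p) * u) by (unfold u; field; lra).
      set (q := ka / INR p) in *.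
      apply Rle_trans with ((1 + q) * (1 + 2 * q * u)).
      + assert (q * exp u <= q * (1 + 2 * u)) by (apply Rmult_le_compat_l; auto).
        assert (0 <= q * (q * u)) by (apply Rmult_le_pos; nra). nra.
      + apply Rmult_le_compat_l; [lra|]. apply exp_ineq1_le.
    - assert (Hpr : forall l : list nat, forall f g : nat -> R, rprod l (fun p => f p * g p) = rprod l f * rprod l g).
      { intros l f g. induction l as [|a l IH]; simpl; [ring|]. fold (rprod l (fun p => f p * g p)) (rprod l f) (rprod l g).
        rewrite IH; ring. }
      rewrite Hpr, rprod_exp, rsum_scal. fold P. apply Rmult_le_compat_l.
      + unfold P. apply (rprod_le ps (fun p => 1 + ka / INR p) (fun p => 1 + ka / INR p)). intros p Hp. split; [|lra].
        assert (0 <= ka / INR p) by (apply Rmult_le_pos; auto; left; apply Rinv_0_lt_compat; generalize (prime_INR_ge_2 p (Hps p Hp)); lra). lra.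
      + apply exp_le.
        assert (Hsum : rsum ps (fun p => ln (INR p) / INR p) <= 2 * L).
        { eapply Rle_trans; [|apply sum_ln_p_over_p; lia]. apply rsum_incl; [apply primes_list_primes_between| |].
          - intros p Hp. apply in_primes_between in Hp. apply in_primes_between. intuition lia.
          - intros p Hp. apply in_primes_between in Hp. assert (1 <= INR p) by (apply (le_INR 1); lia).
            apply Rmult_le_pos; [rewrite <- ln_1; apply ln_le; lra|left; apply Rinv_0_lt_compat; lra]. }
        apply Rle_trans with (2 * ka * sg * (2 * L)); [apply Rmult_le_compat_l; [nra|auto]|].
        unfold sg. right; field; lra. }
  (* A number n beyond x = y^C0 satisfies n^(1 / ln y) >= e^C0, so e^(-C0) times the shifted weight
     already exceeds the weight. *)
  assert (Htail : rsum (filter (fun n => negb (Nat.leb n x)) (subset_products ps)) w <= exp (- INR C0) * rsum (subset_products ps) W).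
  { assert (Hwpos : forall n, In n (subset_products ps) -> 0 <= w n).
    { intros n Hn. destruct (subp_smooth ps n Hps Hn) as [Hn1 _]. unfold w. apply Rmult_le_pos; [apply pow_le; auto|].
      left; apply Rinv_0_lt_compat, lt_0_INR; lia. }
    apply Rle_trans with (rsum (filter (fun n => negb (Nat.leb n x)) (subset_products ps)) (fun n => exp (- INR C0) * W n)).
    - apply rsum_le. intros n Hn. apply filter_In in Hn. destruct Hn as [Hn Hb].
      apply Bool.negb_true_iff, Nat.leb_gt in Hb. unfold W. specialize (Hwpos n Hn).
      assert (1 <= exp (- INR C0) * Rpower (INR n) sg); [|nra].
      unfold Rpower. rewrite <- exp_plus. rewrite <- exp_0 at 1. apply exp_le.
      assert (Hx : INR C0 * L <= ln (INR n)).
      { apply Rle_trans with (ln (INR x)).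
        - unfold x, L. rewrite pow_INR. rewrite <- Rpower_pow by auto. unfold Rpower. rewrite ln_exp. lra.
        - apply ln_le; [|left; apply lt_INR; auto]. apply lt_0_INR. unfold x. apply Nat.neq_0_lt_0, Nat.pow_nonzero. lia. }
      assert (sg * (INR C0 * L) <= sg * ln (INR n)) by (apply Rmult_le_compat_l; lra).
      replace (sg * (INR C0 * L)) with (INR C0) in H by (unfold sg; field; lra). lra.
    - rewrite rsum_scal. apply Rmult_le_compat_l; [left; apply exp_pos|].
      rewrite (filter_sum (subset_products ps) (fun n => Nat.leb n x) W).
      assert (0 <= rsum (filter (fun n => Nat.leb n x) (subset_products ps)) W); [|lra].
      apply rsum_nonneg. intros n Hn. apply filter_In in Hn. unfold W. apply Rmult_le_pos; [apply Hwpos; apply Hn|left; apply exp_pos]. }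
  rewrite (filter_sum (subset_products ps) (fun n => Nat.leb n x) w) in Hw.
  assert (HPpos : 0 <= P).
  { eapply Rle_trans; [|exact Hlow]. apply Rmult_le_pos; [lra|left; apply exp_pos]. }
  (* The shift inflates the full sum by at most e^(4 ka); the condition on [C0] leaves the tail at
     most a fraction 1/e of the Euler product, less than one half. *)
  assert (HE : exp (- INR C0) * exp (4 * ka) <= / 2).
  { rewrite <- exp_plus. apply Rle_trans with (exp (- (1))); [apply exp_le; lra|].
    rewrite exp_Ropp. apply Rinv_le_contravar; [lra|]. generalize (exp_ineq1_le 1). lra. }
  assert (exp (- INR C0) * rsum (subset_products ps) W <= P / 2).
  { apply Rle_trans with (exp (- INR C0) * (P * exp (4 * ka))).
    - apply Rmult_le_compat_l; [left; apply exp_pos|auto].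
    - replace (exp (- INR C0) * (P * exp (4 * ka))) with (P * (exp (- INR C0) * exp (4 * ka))) by ring.
      unfold Rdiv. apply Rmult_le_compat_l; auto. }
  fold x. fold w in Hw |- *. lra.
Qed.

(** * The resonating Dirichlet polynomial *)

Lemma indic_sum_le {A : Type} (l m : list A) (P : A -> Prop) (H : A -> R) :
  NoDup l -> (forall a, In a l -> P a -> In a m) -> (forall a, In a m -> 0 <= H a) ->
  rsum l (fun a => indic (P a) * H a) <= rsum m H.
Proof.
  intros Hn Hi Hp.
  set (b := fun a => if excluded_middle_informative (P a) then true else false).
  assert (E : rsum l (fun a => indic (P a) * H a) = rsum (filter b l) H).
  { clear Hn Hi. induction l as [|a l IH]; simpl; [reflexivity|]. rewrite IH. unfold b at 2, indic.
    destruct (excluded_middle_informative (P a)); simpl; ring. }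
  rewrite E. apply rsum_incl; [apply NoDup_filter; auto| |auto].
  intros a Ha. apply filter_In in Ha. destruct Ha as [Ha Hb]. unfold b in Hb.
  destruct (excluded_middle_informative (P a)); [auto|discriminate].
Qed.

Lemma indic_sum_ge {A : Type} (l m : list A) (P : A -> Prop) (H : A -> R) :
  NoDup m -> (forall a, In a m -> In a l /\ P a) -> (forall a, In a l -> P a -> 0 <= H a) ->
  rsum m H <= rsum l (fun a => indic (P a) * H a).
Proof.
  intros Hn Hi Hp.
  rewrite (rsum_ext m H (fun a => indic (P a) * H a)).
  - apply rsum_incl; auto; [intros a Ha; apply Hi; auto|].
    intros a Ha. destruct (indic_cases (P a)) as [[HP ->]|[_ ->]]; [|lra]. rewrite Rmult_1_l; auto.
  - intros a Ha. rewrite indic_true by (apply Hi; auto). ring.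
Qed.

Lemma indic_single_le (Y m n : nat) (G : nat -> R) : (1 <= m)%nat -> (1 <= n)%nat -> (forall l, (1 <= l)%nat -> 0 <= G l) ->
  rsum (seq 1 Y) (fun l => indic ((m * l)%nat = n) * G l) <= indic (Nat.divide m n) * G (n / m)%nat.
Proof.
  intros Hm Hn HG. destruct (indic_cases (Nat.divide m n)) as [[Hd ->]|[Hd ->]].
  - destruct (divide_div n m Hn Hd) as (E & _ & Hq).
    eapply Rle_trans; [apply (indic_sum_le (seq 1 Y) ((n / m)%nat :: nil))|simpl; lra].
    + apply seq_NoDup.
    + intros l _ Hl. left. rewrite <- Hl, Nat.mul_comm. apply Nat.div_mul. lia.
    + intros l [<-|[]]. auto.
  - rewrite Rmult_0_l. rewrite rsum_0; [lra|]. intros l _. rewrite indic_false; [ring|]. intros <-. apply Hd. exists l; lia.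
Qed.

Section resonator.
Variables (ps : list nat) (x : nat) (be : R).
Hypothesis (Hbe : 0 <= be) (Hx : (1 <= x)%nat).

(** For be = 1/s these coefficients agree at the primes of [ps] up to x with those of zeta^(1/s).
    Apart from the cut at x they are completely multiplicative, which makes the divisor sums
    explicit. *)
Definition av (m : nat) : R := indic (smooth ps m /\ (m <= x)%nat) * be ^ Om m.

(* [apow j] lists the coefficients of the [j]-th power of the Dirichlet polynomial with coefficients [av]. *)
Fixpoint apow (j n : nat) : R :=
  match j with
  | O => indic (n = 1%nat)
  | S j' => rsum (seq 1 x) (fun m => rsum (seq 1 (x ^ j')) (fun l => indic ((m * l)%nat = n) * (av m * apow j' l)))
  end.

Lemma av_nonneg m : 0 <= av m.
Proof. unfold av. apply Rmult_le_pos; [apply indic_nonneg|apply pow_le; auto]. Qed.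

Lemma apow_nonneg j n : 0 <= apow j n.
Proof.
  revert n. induction j as [|j IH]; intros n; simpl; [apply indic_nonneg|].
  apply rsum_nonneg; intros m _. apply rsum_nonneg; intros l _.
  apply Rmult_le_pos; [apply indic_nonneg|apply Rmult_le_pos; [apply av_nonneg|apply IH]].
Qed.

Lemma apow_smooth j n : (1 <= n)%nat -> ~ smooth ps n -> apow j n = 0.
Proof.
  revert n. induction j as [|j IH]; intros n Hn Hs; simpl.
  - apply indic_false. intros ->. apply Hs. split; [lia|]. intros q [Hq _] Hd. apply Nat.divide_1_r in Hd. lia.
  - apply rsum_0. intros m Hm. apply rsum_0. intros l Hl. apply in_seq in Hm, Hl.
    destruct (indic_cases ((m * l)%nat = n)) as [[E ->]|[_ ->]]; [|ring]. rewrite Rmult_1_l.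
    unfold av. destruct (indic_cases (smooth ps m /\ (m <= x)%nat)) as [[[H1 _] ->]|[_ ->]]; [|ring].
    rewrite IH; [ring|lia|]. intros H2. apply Hs. rewrite <- E. apply smooth_mul; auto.
Qed.

(** By [conv_pow_le], convolving be^Om with (j be)^Om gives at most ((j + 1) be)^Om; the restriction
    to smooth numbers and the cut at x only remove nonnegative terms. *)
Lemma apow_le j n : (1 <= n)%nat -> apow j n <= (INR j * be) ^ Om n.
Proof.
  revert n. induction j as [|j IH]; intros n Hn.
  - simpl. destruct (indic_cases (n = 1%nat)) as [[-> ->]|[_ ->]]; [rewrite Om_1; simpl; lra|].
    apply pow_le. simpl. lra.
  - rewrite S_INR. replace ((INR j + 1) * be) with (be + INR j * be) by ring.
    assert (Hj : 0 <= INR j * be) by (apply Rmult_le_pos; [apply pos_INR|auto]).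
    eapply Rle_trans; [|apply conv_pow_le; auto]. simpl. unfold conv.
    apply Rle_trans with (rsum (seq 1 x) (fun m => indic (Nat.divide m n) * (be ^ Om m * (INR j * be) ^ Om (n / m)))).
    + apply rsum_le. intros m Hm. apply in_seq in Hm.
      apply Rle_trans with (be ^ Om m * rsum (seq 1 (x ^ j)) (fun l => indic ((m * l)%nat = n) * (INR j * be) ^ Om l)).
      * rewrite <- rsum_scal. apply rsum_le. intros l Hl. apply in_seq in Hl.
        assert (H1 : 0 <= av m <= be ^ Om m).
        { split; [apply av_nonneg|]. unfold av. assert (0 <= be ^ Om m) by (apply pow_le; auto).
          generalize (indic_le_1 (smooth ps m /\ (m <= x)%nat)). nra. }
        assert (H2 : 0 <= apow j l <= (INR j * be) ^ Om l) by (split; [apply apow_nonneg|apply IH; lia]).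
        assert (H3 : av m * apow j l <= be ^ Om m * (INR j * be) ^ Om l) by (apply Rmult_le_compat; lra).
        generalize (indic_nonneg ((m * l)%nat = n)). intros H4. nra.
      * replace (indic (Nat.divide m n) * (be ^ Om m * (INR j * be) ^ Om (n / m))) with
          (be ^ Om m * (indic (Nat.divide m n) * (INR j * be) ^ Om (n / m))) by ring.
        apply Rmult_le_compat_l; [apply pow_le; auto|].
        apply (indic_single_le (x ^ j) m n (fun l => (INR j * be) ^ Om l)); [lia|auto|intros; apply pow_le; auto].
    + apply (indic_sum_le (seq 1 x) (divs n) (fun m => Nat.divide m n)).
      * apply seq_NoDup.
      * intros m _ Hd. apply in_divs; auto.
      * intros m _. apply Rmult_le_pos; apply pow_le; auto.
Qed.

(** For squarefree n the convolution identity is exact, and for smooth n <= x all divisors of n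
    escape the cut, so no term is lost. *)
Lemma apow_ge j n : squarefree n -> smooth ps n -> (n <= x)%nat -> (INR j * be) ^ Om n <= apow j n.
Proof.
  revert n. induction j as [|j IH]; intros n Hsq Hsm Hnx.
  - simpl. destruct Hsq as [Hn _]. destruct (indic_cases (n = 1%nat)) as [[-> ->]|[H ->]]; [rewrite Om_1; simpl; lra|].
    rewrite Om_step by lia. simpl. lra.
  - rewrite S_INR. replace ((INR j + 1) * be) with (be + INR j * be) by ring.
    assert (Hj : 0 <= INR j * be) by (apply Rmult_le_pos; [apply pos_INR|auto]).
    destruct Hsq as [Hn Hsq].
    rewrite <- conv_pow_squarefree by (auto; split; auto). simpl. unfold conv.
    assert (Hpos : forall m l, 0 <= indic ((m * l)%nat = n) * (av m * apow j l)).
    { intros. apply Rmult_le_pos; [apply indic_nonneg|apply Rmult_le_pos; [apply av_nonneg|apply apow_nonneg]]. }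
    apply Rle_trans with (rsum (divs n) (fun m => rsum (seq 1 (x ^ j)) (fun l => indic ((m * l)%nat = n) * (av m * apow j l)))).
    + apply rsum_le. intros d Hd. apply in_divs in Hd; auto. destruct (divide_div n d Hn Hd) as (E & Hd1 & Hq1).
      assert (Hdn : (d <= n)%nat) by (apply Nat.divide_pos_le; auto).
      assert (Hqn : (n / d <= n)%nat) by nia.
      assert (Hqd : Nat.divide (n / d) n) by (exists d; auto).
      assert (Hav : av d = be ^ Om d).
      { unfold av. rewrite indic_true; [ring|]. split; [eapply smooth_divide; eauto|lia]. }
      destruct (Nat.le_gt_cases (n / d) (x ^ j)) as [Hle|Hgt].
      * eapply Rle_trans; [|apply (rsum_single_le _ _ (n / d)%nat); [apply in_seq; lia|intros; apply Hpos]].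
        cbv beta. rewrite indic_true by auto. rewrite Rmult_1_l, Hav. apply Rmult_le_compat_l; [apply pow_le; auto|].
        apply IH; [eapply squarefree_divide; eauto; split; auto|eapply smooth_divide; eauto|lia].
      (* A quotient n / d <= x can exceed x^j only for j = 0. Its coefficient (0 be)^Om then
         vanishes because n / d > 1. *)
      * destruct j as [|j].
        -- simpl INR. rewrite (Om_step (n / d)) by (simpl in Hgt; lia). simpl pow. rewrite !Rmult_0_l, Rmult_0_r.
           apply rsum_nonneg. intros; apply Hpos.
        -- exfalso. assert (x <= x ^ S j)%nat.
           { simpl. assert (1 <= x ^ j)%nat by (apply Nat.neq_0_lt_0, Nat.pow_nonzero; lia). nia. }
           lia.
    + apply rsum_incl; [apply NoDup_divs| |].
      * intros d Hd. apply in_divs in Hd; auto. destruct (divide_div n d Hn Hd) as (E & Hd1 & Hq1).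
        assert (d <= n)%nat by (apply Nat.divide_pos_le; auto). apply in_seq. lia.
      * intros m _. apply rsum_nonneg. intros; apply Hpos.
Qed.

(* [main1] and [main2] are the diagonal contributions of [omega] and of its mirror image under the functional equation. *)
Definition main1 (j1 j2 : nat) : R :=
  rsum (seq 1 (x ^ j2)) (fun l => rsum (seq 1 (x ^ j1)) (fun m => indic (Nat.divide m l) * (apow j1 m * apow j2 l / INR l))).

Definition main2 (j1 j2 : nat) : R :=
  rsum (seq 1 (x ^ j1)) (fun m => rsum (seq 1 (x ^ j2)) (fun l => indic (Nat.divide l m) * (apow j1 m * apow j2 l / INR m))).

Lemma apow_div_nonneg j1 j2 m l n : (1 <= n)%nat -> 0 <= apow j1 m * apow j2 l / INR n.
Proof.
  intros Hn. apply Rmult_le_pos; [apply Rmult_le_pos; apply apow_nonneg|].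
  left; apply Rinv_0_lt_compat, lt_0_INR; lia.
Qed.

(** For squarefree smooth l <= x, summing the coefficients at least (k - 1)^Om m over the divisors m
    of l gives at least k^Om l; the coefficient of l itself contributes another k^Om l. *)
Lemma main1_lower j1 j2 k : (1 <= j2)%nat -> primes_list ps -> k = INR j2 * be -> k = INR j1 * be + 1 ->
  rsum (filter (fun n => Nat.leb n x) (subset_products ps)) (fun n => (k ^ 2) ^ Om n / INR n) <= main1 j1 j2.
Proof.
  intros Hj2 Hps E2 E1. unfold main1.
  assert (Hj1 : 0 <= INR j1 * be) by (apply Rmult_le_pos; [apply pos_INR|auto]).
  assert (Hxj : (x <= x ^ j2)%nat).
  { destruct j2 as [|j]; [lia|]. simpl. assert (1 <= x ^ j)%nat by (apply Nat.neq_0_lt_0, Nat.pow_nonzero; lia). nia. }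
  set (Hs := fun l => rsum (seq 1 (x ^ j1)) (fun m => indic (Nat.divide m l) * (apow j1 m * apow j2 l / INR l))).
  apply Rle_trans with (rsum (filter (fun n => Nat.leb n x) (subset_products ps)) Hs).
  - apply rsum_le. intros l Hl. apply filter_In in Hl. destruct Hl as [Hl Hlx]. apply Nat.leb_le in Hlx.
    assert (Hsm : smooth ps l) by (apply subp_smooth; auto; apply Hps).
    assert (Hsq : squarefree l) by (eapply subp_squarefree; eauto). destruct Hsq as [Hl1 Hsq].
    assert (HlR : 0 < INR l) by (apply lt_0_INR; lia).
    apply Rle_trans with (apow j2 l / INR l * conv (fun d => (INR j1 * be) ^ Om d) (fun d => 1 ^ Om d) l).
    + rewrite conv_pow_squarefree by (auto; try lra; split; auto). rewrite <- E1.
      replace ((k ^ 2) ^ Om l) with (k ^ Om l * k ^ Om l) by (rewrite <- Rpow_mult_distr; f_equal; ring).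
      assert (Hge : k ^ Om l <= apow j2 l) by (rewrite E2; apply apow_ge; auto; split; auto).
      assert (0 <= k ^ Om l) by (apply pow_le; lra).
      unfold Rdiv. replace (apow j2 l * / INR l * k ^ Om l) with ((apow j2 l * k ^ Om l) * / INR l) by ring.
      apply Rmult_le_compat_r; [left; apply Rinv_0_lt_compat; auto|]. apply Rmult_le_compat_r; auto.
    + unfold conv, Hs. rewrite <- rsum_scal.
      assert (Hdv : forall d, In d (divs l) -> (INR j1 * be) ^ Om d <= apow j1 d).
      { intros d Hd. apply in_divs in Hd; auto. assert (d <= l)%nat by (apply Nat.divide_pos_le; auto).
        apply apow_ge; [eapply squarefree_divide; eauto; split; auto|eapply smooth_divide; eauto|lia]. }
      assert (Hjj : forall d, In d (divs l) -> (d <= x ^ j1)%nat \/ (INR j1 * be) ^ Om d = 0).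
      { intros d Hd. apply in_divs in Hd; auto. assert (d <= l)%nat by (apply Nat.divide_pos_le; auto).
        destruct j1 as [|j].
        - destruct (Nat.le_gt_cases d 1); [left; simpl; lia|]. right. rewrite Om_step by lia. simpl. ring.
        - left. assert (x <= x ^ S j)%nat.
          { simpl. assert (1 <= x ^ j)%nat by (apply Nat.neq_0_lt_0, Nat.pow_nonzero; lia). nia. }
          lia. }
      set (good := filter (fun d => Nat.leb d (x ^ j1)) (divs l)).
      apply Rle_trans with (rsum good (fun d => apow j1 d * apow j2 l / INR l)).
      * rewrite (filter_sum (divs l) (fun d => Nat.leb d (x ^ j1))).
        match goal with |- ?A + ?B <= _ => assert (EB : B = 0) end.
        { apply rsum_0. intros d Hd. apply filter_In in Hd. destruct Hd as [Hd Hb].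
          apply Bool.negb_true_iff, Nat.leb_gt in Hb. destruct (Hjj d Hd) as [H|H]; [lia|]. rewrite H. ring. }
        rewrite EB, Rplus_0_r. fold good. apply rsum_le. intros d Hd. apply filter_In in Hd.
        rewrite pow1, Rmult_1_r. replace (apow j1 d * apow j2 l / INR l) with (apow j2 l / INR l * apow j1 d) by (field; lra).
        apply Rmult_le_compat_l; [|apply Hdv, Hd].
        apply Rmult_le_pos; [apply apow_nonneg|left; apply Rinv_0_lt_compat; auto].
      * apply (indic_sum_ge (seq 1 (x ^ j1)) good (fun m => Nat.divide m l)).
        -- apply NoDup_filter, NoDup_divs.
        -- intros d Hd. apply filter_In in Hd. destruct Hd as [Hd Hb]. apply Nat.leb_le in Hb. apply in_divs in Hd; auto.
           split; auto. apply in_seq. destruct (divide_div l d Hl1 Hd) as (_ & H & _). lia.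
        -- intros d _ _. apply apow_div_nonneg; auto.
  - apply rsum_incl.
    + apply NoDup_filter, NoDup_subp; auto.
    + intros l Hl. apply filter_In in Hl. destruct Hl as [Hl Hlx]. apply Nat.leb_le in Hlx.
      assert (Hsm : smooth ps l) by (apply subp_smooth; auto; apply Hps). destruct Hsm. apply in_seq. lia.
    + intros l Hl. apply in_seq in Hl. unfold Hs. apply rsum_nonneg. intros m _.
      apply Rmult_le_pos; [apply indic_nonneg|apply apow_div_nonneg; lia].
Qed.

(** Here the larger variable m carries the coefficient (k - 1)^Om m, and its divisors sum to at most
    (k + 1)^Om m. The exponent drops from k^2 to (k - 1)(k + 1) = k^2 - 1, and this is the saving of
    one logarithm. *)
Lemma main2_upper j1 j2 k : k = INR j2 * be -> k = INR j1 * be + 1 ->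
  main2 j1 j2 <= rsum (seq 1 (x ^ j1)) (sterm ps (k ^ 2 - 1)).
Proof.
  intros E2 E1. unfold main2. apply rsum_le. intros m Hm. apply in_seq in Hm.
  assert (HmR : 0 < INR m) by (apply lt_0_INR; lia).
  assert (Hj1 : 0 <= INR j1 * be) by (apply Rmult_le_pos; [apply pos_INR|auto]).
  assert (Hk : 1 <= k) by lra.
  destruct (classic (smooth ps m)) as [Hs|Hs].
  - unfold sterm. rewrite indic_true by auto. rewrite Rmult_1_l.
    apply Rle_trans with (apow j1 m / INR m * conv (fun d => k ^ Om d) (fun d => 1 ^ Om d) m).
    + unfold conv. rewrite <- rsum_scal.
      eapply Rle_trans; [apply (indic_sum_le (seq 1 (x ^ j2)) (divs m) (fun l => Nat.divide l m))|].
      * apply seq_NoDup.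
      * intros l _ Hd. apply in_divs; auto. lia.
      * intros l _. apply apow_div_nonneg; lia.
      * apply rsum_le. intros d Hd. apply in_divs in Hd; [|lia]. destruct (divide_div m d ltac:(lia) Hd) as (_ & Hd1 & _).
        rewrite pow1, Rmult_1_r. replace (apow j1 m * apow j2 d / INR m) with (apow j1 m / INR m * apow j2 d) by (field; lra).
        apply Rmult_le_compat_l; [apply Rmult_le_pos; [apply apow_nonneg|left; apply Rinv_0_lt_compat; auto]|].
        rewrite E2. apply apow_le; auto.
    + apply Rle_trans with (apow j1 m / INR m * (k + 1) ^ Om m).
      * apply Rmult_le_compat_l; [apply Rmult_le_pos; [apply apow_nonneg|left; apply Rinv_0_lt_compat; auto]|].
        apply conv_pow_le; try lra; lia.
      * replace (k ^ 2 - 1) with ((k - 1) * (k + 1)) by ring. rewrite Rpow_mult_distr.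
        assert (apow j1 m <= (k - 1) ^ Om m).
        { replace (k - 1) with (INR j1 * be) by lra. apply apow_le; lia. }
        unfold Rdiv. replace (apow j1 m * / INR m * (k + 1) ^ Om m) with ((apow j1 m * (k + 1) ^ Om m) * / INR m) by ring.
        apply Rmult_le_compat_r; [left; apply Rinv_0_lt_compat; auto|].
        apply Rmult_le_compat_r; [apply pow_le; lra|auto].
  - rewrite rsum_0.
    + apply sterm_nonneg. nra.
    + intros l _. rewrite (apow_smooth j1 m) by (auto; lia). unfold Rdiv. ring.
Qed.

Lemma square_diag_upper j k : k = INR j * be ->
  rsum (seq 1 (x ^ j)) (fun n => apow j n ^ 2 / INR n) <= rsum (seq 1 (x ^ j)) (sterm ps (k ^ 2)).
Proof.
  intros E. assert (Hk : 0 <= k) by (rewrite E; apply Rmult_le_pos; [apply pos_INR|auto]).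
  apply rsum_le. intros n Hn. apply in_seq in Hn.
  destruct (classic (smooth ps n)) as [Hs|Hs].
  - unfold sterm. rewrite indic_true by auto. rewrite Rmult_1_l.
    apply Rmult_le_compat_r; [left; apply Rinv_0_lt_compat, lt_0_INR; lia|].
    replace ((k ^ 2) ^ Om n) with ((k ^ Om n) ^ 2) by (rewrite <- !pow_mult; f_equal; lia).
    apply pow_incr. split; [apply apow_nonneg|]. rewrite E. apply apow_le. lia.
  - rewrite (apow_smooth j n) by (auto; lia). replace (0 ^ 2 / INR n) with 0 by (unfold Rdiv; ring). apply sterm_nonneg. nra.
Qed.

(** Each prime factor of n contributes a factor k <= p. This crude bound serves only the error
    terms, through [tpabs]. *)
Lemma apow_le_id j k n : k = INR j * be -> (forall p, In p ps -> k <= INR p) -> (1 <= n)%nat -> apow j n <= INR n.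
Proof.
  intros E Hp Hn. destruct (classic (smooth ps n)) as [Hs|Hs].
  - eapply Rle_trans; [apply apow_le; auto|]. rewrite <- E. apply (smooth_pow_le ps); auto.
    rewrite E; apply Rmult_le_pos; [apply pos_INR|auto].
  - rewrite apow_smooth by auto. apply pos_INR.
Qed.

Definition DP (f : nat -> R) (X : nat) (t : R) : CC :=
  csum (seq 1 X) (fun n => Cmult (RtoC (f n * / sqrt (INR n))) (cis (- (t * ln (INR n))))).

Lemma csum_indic (n0 X : nat) (F : nat -> CC) : (1 <= n0 <= X)%nat ->
  csum (seq 1 X) (fun n => Cmult (RtoC (indic (n0 = n))) (F n)) = F n0.
Proof.
  intros H.
  assert (G : forall l, NoDup l -> csum l (fun n => Cmult (RtoC (indic (n0 = n))) (F n)) = if in_dec Nat.eq_dec n0 l then F n0 else RtoC 0).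
  { induction l as [|a l IH]; intros Hl; [reflexivity|]. inversion Hl as [|? ? Ha Hl']; subst.
    simpl csum. rewrite IH by auto. destruct (Nat.eq_dec n0 a) as [->|Hne].
    - rewrite indic_true by auto. destruct (in_dec Nat.eq_dec a l); [contradiction|].
      destruct (in_dec Nat.eq_dec a (a :: l)) as [_|Hn]; [ring|]. exfalso; apply Hn; left; auto.
    - rewrite indic_false by auto. destruct (in_dec Nat.eq_dec n0 l) as [Hi|Hi];
      destruct (in_dec Nat.eq_dec n0 (a :: l)) as [Hj|Hj]; try ring.
      + exfalso; apply Hj; right; auto.
      + exfalso. destruct Hj as [Hj|Hj]; [congruence|contradiction]. }
  rewrite G by apply seq_NoDup. destruct (in_dec Nat.eq_dec n0 (seq 1 X)) as [_|Hn]; auto.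
  exfalso. apply Hn, in_seq. lia.
Qed.

Lemma DP_mul (f g : nat -> R) X Y t :
  Cmult (DP f X t) (DP g Y t) =
  DP (fun n => rsum (seq 1 X) (fun m => rsum (seq 1 Y) (fun l => indic ((m * l)%nat = n) * (f m * g l)))) (X * Y) t.
Proof.
  unfold DP. symmetry.
  transitivity (csum (seq 1 (X * Y)) (fun n => csum (seq 1 X) (fun m => csum (seq 1 Y) (fun l =>
     Cmult (RtoC (indic ((m * l)%nat = n))) (Cmult (RtoC (f m * g l * / sqrt (INR n))) (cis (- (t * ln (INR n))))))))).
  { apply csum_ext. intros n _. rewrite RtoC_mult, RtoC_rsum.
    rewrite <- Cmult_assoc, Cmult_comm, <- csum_scal. apply csum_ext. intros m _.
    rewrite RtoC_rsum, <- csum_scal. apply csum_ext. intros l _. rewrite !RtoC_mult. ring. }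
  rewrite csum_swap. rewrite Cmult_comm, <- csum_scal. apply csum_ext. intros m Hm. apply in_seq in Hm.
  rewrite csum_swap, Cmult_comm, <- csum_scal. apply csum_ext. intros l Hl. apply in_seq in Hl.
  rewrite (csum_indic (m * l) (X * Y) (fun n => Cmult (RtoC (f m * g l * / sqrt (INR n))) (cis (- (t * ln (INR n)))))) by nia.
  assert (0 < INR m) by (apply lt_0_INR; lia). assert (0 < INR l) by (apply lt_0_INR; lia).
  rewrite mult_INR, ln_mult, sqrt_mult by lra.
  replace (- (t * (ln (INR m) + ln (INR l)))) with (- (t * ln (INR m)) + - (t * ln (INR l))) by ring. rewrite cis_add.
  rewrite Rinv_mult, !RtoC_mult. ring.
Qed.

Lemma DP_apow j t : Cpow (DP av x t) j = DP (apow j) (x ^ j) t.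
Proof.
  induction j as [|j IH].
  - unfold DP. simpl. rewrite indic_true by auto. rewrite ln_1, Rmult_0_r, Ropp_0, cis_0, sqrt_1, Rinv_1.
    rewrite Rmult_1_r. ring.
  - simpl Cpow. rewrite IH, DP_mul. reflexivity.
Qed.

End resonator.

(** * Generalized Dirichlet polynomials on a grid *)

(* [(c, (m, l))] stands for the function [t |-> c (m / l)^(- i t)] *)
Definition term : Type := (R * (nat * nat))%type.
Definition tc (w : term) : R := fst w.
Definition tn (w : term) : nat := fst (snd w).
Definition td (w : term) : nat := snd (snd w).

Definition tpe (l : list term) (t : R) : CC :=
  csum l (fun w => Cmult (RtoC (tc w)) (cis (- (t * (ln (INR (tn w)) - ln (INR (td w))))))).

Definition tgood (l : list term) : Prop := forall w, In w l -> (1 <= tn w)%nat /\ (1 <= td w)%nat.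

Definition tmul (a b : term) : term := (tc a * tc b, ((tn a * tn b)%nat, (td a * td b)%nat)).
Definition tpm (l l' : list term) : list term := flat_map (fun a => map (tmul a) l') l.
Definition tpconj (l : list term) : list term := map (fun w => (tc w, (td w, tn w))) l.
Definition tpabs (l : list term) : R := rsum l (fun w => Rabs (tc w)).
(** Fractions are not reduced and equal frequencies are not collected: with positive entries a term
    is constant in t exactly when numerator and denominator agree, so this is the total constant
    coefficient. *)
Definition tpdiag (l : list term) : R := rsum l (fun w => indic (tn w = td w) * tc w).

Lemma rsum_flat_map {A B : Type} (h : A -> list B) (l : list A) (f : B -> R) :
  rsum (flat_map h l) f = rsum l (fun a => rsum (h a) f).
Proof. induction l as [|a l IH]; simpl; [reflexivity|rewrite rsum_app, IH; reflexivity]. Qed.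

Lemma csum_flat_map {A B : Type} (h : A -> list B) (l : list A) (f : B -> CC) :
  csum (flat_map h l) f = csum l (fun a => csum (h a) f).
Proof. induction l as [|a l IH]; simpl; [reflexivity|rewrite csum_app, IH; reflexivity]. Qed.

Lemma tgood_tpm l l' : tgood l -> tgood l' -> tgood (tpm l l').
Proof.
  intros H H' w Hw. unfold tpm in Hw. apply in_flat_map in Hw. destruct Hw as (a & Ha & Hw).
  apply in_map_iff in Hw. destruct Hw as (b & <- & Hb). destruct (H a Ha), (H' b Hb). unfold tmul, tn, td in *; cbn [fst snd] in *; split; nia.
Qed.

Lemma tgood_tpconj l : tgood l -> tgood (tpconj l).
Proof.
  intros H w Hw. unfold tpconj in Hw. apply in_map_iff in Hw. destruct Hw as (a & <- & Ha). destruct (H a Ha).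
  unfold tn, td in *; simpl. auto.
Qed.

Lemma tpe_tpm l l' t : tgood l -> tgood l' -> tpe (tpm l l') t = Cmult (tpe l t) (tpe l' t).
Proof.
  intros H H'. unfold tpe, tpm. rewrite csum_flat_map. rewrite Cmult_comm, <- csum_scal.
  apply csum_ext. intros a Ha. rewrite csum_map, Cmult_comm, <- csum_scal. apply csum_ext. intros b Hb.
  destruct (H a Ha) as [A1 A2], (H' b Hb) as [B1 B2]. unfold tmul, tc, tn, td in *; simpl fst in *; simpl snd in *.
  assert (0 < INR (fst (snd a))) by (apply lt_0_INR; lia). assert (0 < INR (snd (snd a))) by (apply lt_0_INR; lia).
  assert (0 < INR (fst (snd b))) by (apply lt_0_INR; lia). assert (0 < INR (snd (snd b))) by (apply lt_0_INR; lia).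
  rewrite !mult_INR, !ln_mult, RtoC_mult by auto.
  match goal with |- context [cis (- (t * (?p + ?q - (?r + ?s))))] =>
    replace (- (t * (p + q - (r + s)))) with (- (t * (p - r)) + - (t * (q - s))) by ring end.
  rewrite cis_add. ring.
Qed.

Lemma RtoC_conj (x : R) : Cconj (RtoC x) = RtoC x.
Proof. unfold Cconj, RtoC; simpl; f_equal; ring. Qed.

Lemma tpe_tpconj l t : tpe (tpconj l) t = Cconj (tpe l t).
Proof.
  unfold tpe, tpconj. rewrite csum_map, Cconj_csum. apply csum_ext. intros w _.
  rewrite Cmult_conj, RtoC_conj, cis_conj. unfold tc, tn, td; simpl. f_equal. f_equal. ring.
Qed.

Lemma tpabs_tpm l l' : tpabs (tpm l l') = tpabs l * tpabs l'.
Proof.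
  unfold tpabs, tpm. rewrite rsum_flat_map. rewrite Rmult_comm, <- rsum_scal. apply rsum_ext. intros a _.
  rewrite rsum_map, Rmult_comm, <- rsum_scal. apply rsum_ext. intros b _. unfold tmul, tc; simpl. apply Rabs_mult.
Qed.

Lemma tpabs_tpconj l : tpabs (tpconj l) = tpabs l.
Proof. unfold tpabs, tpconj. rewrite rsum_map. reflexivity. Qed.

Lemma tpabs_nonneg l : 0 <= tpabs l.
Proof. apply rsum_nonneg. intros; apply Rabs_pos. Qed.

Lemma Cmod_tpe l t : Cmod (tpe l t) <= tpabs l.
Proof.
  unfold tpe, tpabs. eapply Rle_trans; [apply Cmod_csum|]. apply rsum_le. intros w _.
  rewrite Cmod_mult, Cmod_cis, Cmod_R. lra.
Qed.

(** After exchanging the sums, a diagonal term contributes exactly M times its coefficient and any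
    other term at most [E] times its absolute value. *)
Lemma mean_value (l : list term) (u : nat -> R) (M : nat) (E : R) : 0 <= E ->
  (forall w, In w l -> tn w <> td w ->
     Cmod (csum (seq 0 M) (fun i => cis (- (u i * (ln (INR (tn w)) - ln (INR (td w))))))) <= E) ->
  Cmod (Cminus (csum (seq 0 M) (fun i => tpe l (u i))) (RtoC (INR M * tpdiag l))) <= E * tpabs l.
Proof.
  intros HE H. unfold tpe. rewrite csum_swap. unfold tpdiag, tpabs. rewrite <- !rsum_scal, RtoC_rsum, <- csum_minus.
  eapply Rle_trans; [apply Cmod_csum|]. apply rsum_le. intros w Hw. rewrite csum_scal.
  destruct (indic_cases (tn w = td w)) as [[Eq ->]|[Ne ->]].
  - rewrite Eq. rewrite (csum_ext _ _ (fun _ => RtoC 1)).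
    2: { intros i _. rewrite Rminus_diag, Rmult_0_r, Ropp_0, cis_0. reflexivity. }
    rewrite csum_const, length_seq.
    match goal with |- Cmod ?X <= _ => replace X with (RtoC 0) by (rewrite !RtoC_mult; ring) end.
    rewrite Cmod_0. apply Rmult_le_pos; [auto|apply Rabs_pos].
  - rewrite Rmult_0_l, Rmult_0_r. match goal with |- Cmod (Cminus ?X _) <= _ => replace (Cminus X (RtoC 0)) with X by ring end.
    rewrite Cmod_mult, Cmod_R, Rmult_comm. apply Rmult_le_compat_r; [apply Rabs_pos|]. apply H; auto.
Qed.

Lemma x_cos_le_sin x : 0 <= x <= PI -> x * cos x <= sin x.
Proof.
  intros Hx. destruct (MVT_gen sin 0 x cos) as (c & Hc & E).
  - intros z _. auto_derive; auto. ring.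
  - intros z _. apply continuity_sin.
  - rewrite Rmin_left, Rmax_right in Hc by lra. rewrite sin_0 in E.
    assert (cos x <= cos c) by (apply cos_decr_1; lra).
    replace (sin x) with (cos c * x) by lra. nra.
Qed.

(** For the lower bound, g = PI - h is at least PI/5, so cot g <= 1/g <= 5/PI < 2. Keeping h away
    from PI is why the turning 2 h per step is capped at 8 PI / 5. *)
Lemma cot_bound h : 0 < h <= 4 / 5 * PI -> 0 < sin h /\ Rabs (cos h / sin h) <= / h + 2.
Proof.
  intros Hh. generalize PI2_3_2 PI_RGT_0; intros HP HP0.
  assert (Hs : 0 < sin h) by (apply sin_gt_0; lra). split; auto.
  assert (Hi : 0 < / h) by (apply Rinv_0_lt_compat; lra).
  assert (Hu : cos h / sin h <= / h).
  { apply Rmult_le_reg_r with (h * sin h); [nra|].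
    replace (cos h / sin h * (h * sin h)) with (h * cos h) by (field; lra).
    replace (/ h * (h * sin h)) with (sin h) by (field; lra). apply x_cos_le_sin; lra. }
  assert (Hl : - (2) <= cos h / sin h).
  { set (g := PI - h). assert (Hg : 1 / 5 * PI <= g < PI) by (unfold g; lra).
    assert (Hsg : sin g = sin h) by (unfold g; rewrite sin_minus, sin_PI, cos_PI; ring).
    assert (Hcg : cos g = - cos h) by (unfold g; rewrite cos_minus, sin_PI, cos_PI; ring).
    generalize (x_cos_le_sin g ltac:(lra)). rewrite Hsg, Hcg. intros HH.
    apply Rmult_le_reg_r with (sin h); auto. unfold Rdiv. rewrite Rmult_assoc, Rinv_l by lra. nra. }
  apply Rabs_le. lra.
Qed.

Lemma cot_decr a b : 0 < a <= b -> b < PI -> cos b / sin b <= cos a / sin a.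
Proof.
  intros Hab Hb. assert (0 < sin a) by (apply sin_gt_0; lra). assert (0 < sin b) by (apply sin_gt_0; lra).
  assert (0 <= sin (b - a)) by (apply sin_ge_0; lra). rewrite sin_minus in H1.
  apply Rmult_le_reg_r with (sin a * sin b); [nra|].
  replace (cos b / sin b * (sin a * sin b)) with (cos b * sin a) by (field; lra).
  replace (cos a / sin a * (sin a * sin b)) with (cos a * sin b) by (field; lra). lra.
Qed.

(* The whole grid is dense enough that no frequency up to [ln (N X)] resonates with it; the roots alone are not. *)
Lemma grid_sum_bound (u : nat -> R) (M : nat) (d1 d2 lam : R) :
  0 < d1 -> lam <> 0 -> Rabs lam * d2 <= 8 / 5 * PI ->
  (forall i, (i < M)%nat -> d1 <= u (S i) - u i <= d2) ->
  (forall i, (S i < M)%nat -> u (S (S i)) - u (S i) <= u (S i) - u i) ->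
  Cmod (csum (seq 0 M) (fun i => cis (- (u i * lam)))) <= 5 + 4 / (Rabs lam * d1).
Proof.
  intros Hd1 Hlam Hd2 Hsp Hdec. generalize PI_RGT_0; intros HP.
  set (th := fun i => - (u i * lam)).
  set (h := fun i => Rabs lam * (u (S i) - u i) / 2).
  assert (Hal : 0 < Rabs lam) by (apply Rabs_pos_lt; auto).
  assert (Hh : forall i, (i < M)%nat -> 0 < h i <= 4 / 5 * PI /\ Rabs lam * d1 / 2 <= h i).
  { intros i Hi. unfold h. specialize (Hsp i Hi).
    assert (Rabs lam * d1 <= Rabs lam * (u (S i) - u i)) by (apply Rmult_le_compat_l; lra).
    assert (Rabs lam * (u (S i) - u i) <= Rabs lam * d2) by (apply Rmult_le_compat_l; lra).
    assert (0 < Rabs lam * d1) by (apply Rmult_lt_0_compat; auto). lra. }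
  assert (Hhd : forall i, (S i < M)%nat -> h (S i) <= h i).
  { intros i Hi. unfold h. specialize (Hdec i Hi).
    assert (Rabs lam * (u (S (S i)) - u (S i)) <= Rabs lam * (u (S i) - u i)) by (apply Rmult_le_compat_l; lra). lra. }
  assert (Hb : forall i, (i < M)%nat -> Rabs (cos (h i) / sin (h i)) <= 2 / (Rabs lam * d1) + 2).
  { intros i Hi. destruct (Hh i Hi) as [H1 H2]. eapply Rle_trans; [apply cot_bound; auto|].
    assert (/ h i <= / (Rabs lam * d1 / 2)).
    { apply Rinv_le_contravar; auto. assert (0 < Rabs lam * d1) by (apply Rmult_lt_0_compat; auto). lra. }
    replace (/ (Rabs lam * d1 / 2)) with (2 / (Rabs lam * d1)) in H by (field; lra). lra. }
  assert (HG : 0 <= 2 / (Rabs lam * d1) + 2).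
  { assert (0 < 2 / (Rabs lam * d1)) by (apply Rdiv_lt_0_compat; [lra|apply Rmult_lt_0_compat; auto]). lra. }
  replace (5 + 4 / (Rabs lam * d1)) with (1 + 2 * (2 / (Rabs lam * d1) + 2)) by (field; lra).
  destruct (Rtotal_order lam 0) as [Hneg|[H0|Hpos]]; [|contradiction|].
  - assert (Ed : forall i, (th (S i) - th i) / 2 = h i).
    { intros i. unfold th, h. rewrite Rabs_left by auto. field. }
    apply (kusmin_landau th); auto.
    + intros i Hi. rewrite Ed. apply Rgt_not_eq. apply cot_bound, Hh; auto.
    + right. intros i Hi. rewrite !Ed. apply cot_decr.
      * split; [apply Hh; auto|apply Hhd; auto].
      * destruct (Hh i ltac:(lia)). lra.
    + intros i Hi. rewrite Ed. auto.
  - assert (Ed : forall i, (th (S i) - th i) / 2 = - h i).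
    { intros i. unfold th, h. rewrite Rabs_right by lra. field. }
    assert (Ec : forall i, cos (- h i) / sin (- h i) = - (cos (h i) / sin (h i))).
    { intros i. rewrite cos_neg, sin_neg. unfold Rdiv. rewrite Rinv_opp. ring. }
    apply (kusmin_landau th); auto.
    + intros i Hi. rewrite Ed, sin_neg. apply Ropp_neq_0_compat, Rgt_not_eq. apply cot_bound, Hh; auto.
    + left. intros i Hi. rewrite !Ed, !Ec. apply Ropp_le_contravar. apply cot_decr.
      * split; [apply Hh; auto|apply Hhd; auto].
      * destruct (Hh i ltac:(lia)). lra.
    + intros i Hi. rewrite Ed, Ec, Rabs_Ropp. auto.
Qed.

(* The denominator alone controls how close the frequency of a fraction can be to zero. *)
Lemma ln_ratio_lower (a b : nat) : (1 <= a)%nat -> (1 <= b)%nat -> a <> b ->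
  / (INR b + 1) <= Rabs (ln (INR a) - ln (INR b)).
Proof.
  intros Ha Hb Hne. assert (HA : 1 <= INR a) by (apply (le_INR 1); auto). assert (HB : 1 <= INR b) by (apply (le_INR 1); auto).
  destruct (Nat.lt_gt_cases a b) as [H _]. destruct (H Hne) as [Hlt|Hgt].
  - assert (INR a + 1 <= INR b) by (rewrite <- S_INR; apply le_INR; lia).
    assert (ln (INR a) < ln (INR b)) by (apply ln_increasing; lra). rewrite Rabs_left by lra.
    assert (Hl := ln_le_sub1 (INR a / INR b) ltac:(apply Rdiv_lt_0_compat; lra)). rewrite ln_div in Hl by lra.
    assert (/ (INR b + 1) <= 1 - INR a / INR b); [|lra].
    apply Rmult_le_reg_r with (INR b * (INR b + 1)); [nra|].
    replace (/ (INR b + 1) * (INR b * (INR b + 1))) with (INR b) by (field; lra).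
    replace ((1 - INR a / INR b) * (INR b * (INR b + 1))) with ((INR b - INR a) * (INR b + 1)) by (field; lra). nra.
  - assert (INR b + 1 <= INR a) by (rewrite <- S_INR; apply le_INR; lia).
    assert (ln (INR b + 1) <= ln (INR a)) by (apply ln_le; lra).
    generalize (ln_succ_bounds (INR b) ltac:(lra)). intros [L1 _].
    assert (0 < / (INR b + 1)) by (apply Rinv_0_lt_compat; lra).
    rewrite Rabs_right by lra. lra.
Qed.

Definition tpD (f : nat -> R) (X : nat) : list term := map (fun n => (f n * / sqrt (INR n), (n, 1%nat))) (seq 1 X).

Lemma tgood_tpD f X : tgood (tpD f X).
Proof.
  intros w Hw. apply in_map_iff in Hw. destruct Hw as (n & <- & Hn). apply in_seq in Hn. unfold tn, td; simpl. lia.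
Qed.

Lemma tpe_tpD f X t : tpe (tpD f X) t = DP f X t.
Proof.
  unfold tpe, tpD, DP. rewrite csum_map. apply csum_ext. intros n _. unfold tc, tn, td; simpl.
  rewrite ln_1, Rminus_0_r. reflexivity.
Qed.

(* The terms of the partial sum approximating [omega]. *)
Definition tpW (N : nat) : list term :=
  map (fun n => ((-1) ^ n * / sqrt (INR (S n)), (S n, 1%nat))) (seq 0 N) ++
  map (fun n => (- ((-1) ^ n * sqrt 2 * / sqrt (INR (S n))), (S n, 2%nat))) (seq 0 N).

Lemma in_tpW N w : In w (tpW N) -> (1 <= tn w <= N)%nat /\ (1 <= td w <= 2)%nat.
Proof.
  intros Hw. apply in_app_or in Hw. destruct Hw as [Hw|Hw]; apply in_map_iff in Hw;
    destruct Hw as (n & <- & Hn); apply in_seq in Hn; unfold tn, td; simpl; lia.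
Qed.

Lemma tgood_tpW N : tgood (tpW N).
Proof. intros w Hw. apply in_tpW in Hw. lia. Qed.

Lemma tpe_tpW N t : tpe (tpW N) t = Cmult (ep t N) (Cminus (RtoC 1) (Cmult (RtoC (sqrt 2)) (cis (t * ln 2)))).
Proof.
  unfold tpe, tpW, ep. rewrite csum_app, !csum_map.
  rewrite Cmult_comm, <- csum_scal, <- csum_plus. apply csum_ext. intros n _.
  unfold eterm. cbn [tc tn td fst snd].
  replace (ln (INR 1)) with 0 by (simpl; rewrite ln_1; reflexivity). replace (INR 2) with 2 by (simpl; ring).
  rewrite Rminus_0_r. set (S_ := INR (S n)).
  replace (- (t * (ln S_ - ln 2))) with (- (t * ln S_) + t * ln 2) by ring. rewrite cis_add.
  rewrite RtoC_opp, !RtoC_mult. ring.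
Qed.

Lemma sum_inv_sqrt_le N : rsum (seq 0 N) (fun n => / sqrt (INR (S n))) <= 2 * sqrt (INR N).
Proof.
  induction N as [|N IH]; [simpl; rewrite sqrt_0; lra|]. rewrite rsum_seq_S. simpl Nat.add.
  assert (HN : 0 <= INR N) by apply pos_INR. rewrite S_INR in *.
  set (a := sqrt (INR N)) in *. set (b := sqrt (INR N + 1)).
  assert (Ha : a * a = INR N) by (apply sqrt_sqrt; auto). assert (Hb : b * b = INR N + 1) by (apply sqrt_sqrt; lra).
  assert (0 <= a) by apply sqrt_pos. assert (0 < b) by (apply sqrt_lt_R0; lra).
  assert (/ b <= 2 * b - 2 * a); [|lra].
  apply Rmult_le_reg_r with b; auto. rewrite Rinv_l by lra. nra.
Qed.

Lemma tpabs_tpW N : tpabs (tpW N) <= 6 * sqrt (INR N).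
Proof.
  unfold tpabs, tpW. rewrite rsum_app, !rsum_map. cbn [tc fst].
  assert (Hp : forall n, 0 < / sqrt (INR (S n))) by (intros n; apply Rinv_0_lt_compat, sqrt_lt_R0, lt_0_INR; lia).
  assert (Hs2 : 0 <= sqrt 2 <= 2).
  { split; [apply sqrt_pos|]. rewrite <- (sqrt_pow2 2) at 2 by lra. apply sqrt_le_1_alt. lra. }
  rewrite (rsum_ext _ _ (fun n => / sqrt (INR (S n)))).
  2: { intros n _. rewrite Rabs_mult, pow_1_abs, Rmult_1_l. apply Rabs_right. apply Rle_ge; left; auto. }
  rewrite (rsum_ext _ (fun n => Rabs (- _)) (fun n => sqrt 2 * / sqrt (INR (S n)))).
  2: { intros n _. rewrite Rabs_Ropp, !Rabs_mult, pow_1_abs, Rmult_1_l, (Rabs_right (sqrt 2)) by lra.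
       f_equal. apply Rabs_right. apply Rle_ge; left; auto. }
  rewrite rsum_scal. generalize (sum_inv_sqrt_le N). intros.
  assert (0 <= rsum (seq 0 N) (fun n => / sqrt (INR (S n)))) by (apply rsum_nonneg; intros; left; auto).
  nra.
Qed.

Lemma tpabs_tpD f X : (forall n, (1 <= n)%nat -> 0 <= f n <= INR n) -> tpabs (tpD f X) <= INR X ^ 2.
Proof.
  intros Hf. unfold tpabs, tpD. rewrite rsum_map. cbn [tc fst].
  apply Rle_trans with (rsum (seq 1 X) (fun _ => INR X)).
  - apply rsum_le. intros n Hn. apply in_seq in Hn. unfold tc; simpl.
    assert (1 <= INR n) by (apply (le_INR 1); lia). assert (INR n <= INR X) by (apply le_INR; lia).
    destruct (Hf n) as [F1 F2]; [lia|].
    assert (1 <= sqrt (INR n)) by (rewrite <- sqrt_1; apply sqrt_le_1_alt; auto).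
    assert (0 < / sqrt (INR n) <= 1).
    { split; [apply Rinv_0_lt_compat; lra|]. rewrite <- Rinv_1. apply Rinv_le_contravar; lra. }
    rewrite Rabs_right by (apply Rle_ge, Rmult_le_pos; lra). nra.
  - rewrite rsum_const, length_seq. simpl. lra.
Qed.

Lemma tpdiag_square f X :
  tpdiag (tpm (tpD f X) (tpconj (tpD f X))) = rsum (seq 1 X) (fun n => f n ^ 2 / INR n).
Proof.
  unfold tpdiag, tpm, tpconj, tpD. rewrite rsum_flat_map, rsum_map. apply rsum_ext. intros m Hm.
  rewrite rsum_map, !rsum_map. unfold tmul, tc, tn, td; simpl.
  assert (HmR : 0 < INR m) by (apply in_seq in Hm; apply lt_0_INR; lia).
  assert (G : forall l, NoDup l -> rsum l (fun b => indic ((m * 1)%nat = (b + 0)%nat) * (f m * / sqrt (INR m) * (f b * / sqrt (INR b)))) =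
     if in_dec Nat.eq_dec m l then f m ^ 2 / INR m else 0).
  { induction l as [|a l IH]; intros Hl; [reflexivity|]. inversion Hl as [|? ? Ha Hl']; subst.
    simpl rsum. rewrite IH by auto. rewrite Nat.mul_1_r, Nat.add_0_r in *. destruct (Nat.eq_dec m a) as [->|Hne].
    - rewrite indic_true by auto. destruct (in_dec Nat.eq_dec a l); [contradiction|].
      destruct (in_dec Nat.eq_dec a (a :: l)) as [_|Hn]; [|exfalso; apply Hn; left; auto].
      rewrite Rmult_1_l, Rplus_0_r.
      assert (Hs : 0 < sqrt (INR a)) by (apply sqrt_lt_R0; auto).
      transitivity (f a ^ 2 / (sqrt (INR a) * sqrt (INR a))); [field; lra|]. rewrite sqrt_sqrt by lra. reflexivity.
    - rewrite indic_false by auto. destruct (in_dec Nat.eq_dec m l) as [Hi|Hi];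
      destruct (in_dec Nat.eq_dec m (a :: l)) as [Hj|Hj]; try ring.
      + exfalso; apply Hj; right; auto.
      + exfalso. destruct Hj as [Hj|Hj]; [congruence|contradiction]. }
  rewrite G by apply seq_NoDup. destruct (in_dec Nat.eq_dec m (seq 1 X)) as [_|Hn]; [simpl; lra|contradiction].
Qed.

Lemma tpdiag_triple (W : list term) (f g : nat -> R) X Y :
  tpdiag (tpm (tpm W (tpD f X)) (tpconj (tpD g Y))) =
  rsum (seq 1 X) (fun m => rsum (seq 1 Y) (fun l => f m * g l * / sqrt (INR m) * / sqrt (INR l) *
     rsum W (fun w => indic ((tn w * m)%nat = (td w * l)%nat) * tc w))).
Proof.
  unfold tpdiag, tpm, tpconj, tpD. rewrite !rsum_flat_map.
  transitivity (rsum W (fun w => rsum (seq 1 X) (fun m => rsum (seq 1 Y) (fun l =>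
     indic ((tn w * m)%nat = (td w * l)%nat) * (tc w * (f m * / sqrt (INR m)) * (g l * / sqrt (INR l))))))).
  - apply rsum_ext. intros w _. rewrite !rsum_map. apply rsum_ext. intros m _. rewrite !rsum_map.
    apply rsum_ext. intros l _. unfold tmul, tc, tn, td; cbn [fst snd].
    rewrite !Nat.mul_1_r. reflexivity.
  - rewrite rsum_swap. apply rsum_ext. intros m _. rewrite rsum_swap. apply rsum_ext. intros l _.
    rewrite <- rsum_scal. apply rsum_ext. intros w _. ring.
Qed.

Lemma odd_pow (n : nat) : Nat.Odd (S n) -> (-1) ^ n = 1.
Proof. intros [k Hk]. replace n with (2 * k)%nat by lia. apply pow_1_even. Qed.

Lemma even_pow (n : nat) : ~ Nat.Odd (S n) -> (-1) ^ n = -1.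
Proof.
  intros H. destruct (Nat.Even_or_Odd (S n)) as [[k Hk]|Ho]; [|contradiction].
  replace n with (S (2 * (k - 1)))%nat by lia. apply pow_1_odd.
Qed.

Lemma odd_mul_inv a b : Nat.Odd (a * b) -> Nat.Odd a /\ Nat.Odd b.
Proof. intros H. apply Nat.odd_spec in H. rewrite Nat.odd_mul in H. apply andb_prop in H. rewrite !Nat.odd_spec in H. auto. Qed.

(** In the first half of [tpW] the equation n m = l with l odd forces n odd, where the alternating
    sign is +. In the second half n m = 2 l with m odd forces n even, where the alternating sign is
    - and cancels the minus in front. All contributions are nonnegative, and n = l / m alone gives
    the bound. *)
Lemma bracket_lower N m l : (1 <= m)%nat -> (1 <= l <= N)%nat -> Nat.Odd m -> Nat.Odd l ->
  indic (Nat.divide m l) * (sqrt (INR m) * / sqrt (INR l)) <=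
  rsum (tpW N) (fun w => indic ((tn w * m)%nat = (td w * l)%nat) * tc w).
Proof.
  intros Hm Hl Om_ Ol. unfold tpW. rewrite rsum_app, !rsum_map. cbn [tc tn td fst snd].
  assert (Hp : forall n, 0 < / sqrt (INR (S n))) by (intros n; apply Rinv_0_lt_compat, sqrt_lt_R0, lt_0_INR; lia).
  assert (Hs2 : 0 <= sqrt 2) by apply sqrt_pos.
  assert (H1 : forall n, 0 <= indic ((S n * m)%nat = (1 * l)%nat) * ((-1) ^ n * / sqrt (INR (S n)))).
  { intros n. destruct (indic_cases ((S n * m)%nat = (1 * l)%nat)) as [[E ->]|[_ ->]]; [|lra].
    rewrite odd_pow; [generalize (Hp n); lra|]. apply (odd_mul_inv (S n) m). rewrite E, Nat.mul_1_l. auto. }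
  assert (H2 : 0 <= rsum (seq 0 N) (fun n => indic ((S n * m)%nat = (2 * l)%nat) * - ((-1) ^ n * sqrt 2 * / sqrt (INR (S n))))).
  { apply rsum_nonneg. intros n _. destruct (indic_cases ((S n * m)%nat = (2 * l)%nat)) as [[E ->]|[_ ->]]; [|lra].
    rewrite even_pow.
    - generalize (Hp n). nra.
    - intros Ho. assert (Nat.Odd (S n * m)) by (apply Nat.odd_spec; rewrite Nat.odd_mul; apply Nat.odd_spec in Ho, Om_; rewrite Ho, Om_; auto).
      rewrite E in H. destruct H as [k Hk]. lia. }
  match goal with |- _ <= ?A + ?B => enough (indic (Nat.divide m l) * (sqrt (INR m) * / sqrt (INR l)) <= A) end.
  { unfold tc, tn, td in *; cbn [fst snd] in *. lra. }
  destruct (indic_cases (Nat.divide m l)) as [[Hd ->]|[_ ->]].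
  - destruct (divide_div l m ltac:(lia) Hd) as (E & _ & Hq). set (q := (l / m)%nat) in *.
    eapply Rle_trans; [|apply (rsum_single_le _ _ (q - 1)%nat)].
    + unfold tc, tn, td; cbn [fst snd]. replace (S (q - 1)) with q by lia. rewrite indic_true by lia.
      rewrite odd_pow.
      * rewrite E, mult_INR, sqrt_mult by apply pos_INR.
        assert (0 < sqrt (INR m)) by (apply sqrt_lt_R0, lt_0_INR; lia). assert (0 < sqrt (INR q)) by (apply sqrt_lt_R0, lt_0_INR; lia).
        right. field. lra.
      * replace (S (q - 1)) with q by lia. apply (odd_mul_inv m q). rewrite <- E. auto.
    + apply in_seq. nia.
    + intros n _. apply H1.
  - rewrite Rmult_0_l. apply rsum_nonneg. intros n _. apply H1.
Qed.

(** Conjugation swaps numerator and denominator, so the equations become m = n l and 2 m = n l. As l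
    is odd, both force l to divide m, and each has at most one solution n. *)
Lemma bracket_upper N m l : (1 <= m)%nat -> (1 <= l)%nat -> Nat.Odd l ->
  Rabs (rsum (tpconj (tpW N)) (fun w => indic ((tn w * m)%nat = (td w * l)%nat) * tc w)) <=
  2 * (indic (Nat.divide l m) * (sqrt (INR l) * / sqrt (INR m))).
Proof.
  intros Hm Hl Ol. unfold tpconj. rewrite rsum_map. unfold tpW. rewrite rsum_app, !rsum_map. unfold tc, tn, td; cbn [fst snd].
  assert (HmR : 0 < sqrt (INR m)) by (apply sqrt_lt_R0, lt_0_INR; lia).
  assert (HlR : 0 < sqrt (INR l)) by (apply sqrt_lt_R0, lt_0_INR; lia).
  assert (Hs2 : 0 < sqrt 2) by (apply sqrt_lt_R0; lra).
  assert (G : forall c n0 (F : nat -> R), (1 <= c)%nat -> (forall n, Rabs (F n) <= sqrt (INR c) * / sqrt (INR (S n))) ->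
    (Nat.divide l (c * m) -> Nat.divide l m) ->
    Rabs (rsum (seq 0 n0) (fun n => indic ((c * m)%nat = (S n * l)%nat) * F n)) <= indic (Nat.divide l m) * (sqrt (INR l) * / sqrt (INR m))).
  { intros c n0 F Hc HF Hdiv.
    assert (HcR : 0 < sqrt (INR c)) by (apply sqrt_lt_R0, lt_0_INR; lia).
    apply Rle_trans with (rsum (seq 0 n0) (fun n => indic ((c * m)%nat = (S n * l)%nat) * Rabs (F n))).
    { clear. induction (seq 0 n0) as [|a L IH]; cbn [rsum]; [rewrite Rabs_R0; lra|].
      eapply Rle_trans; [apply Rabs_triang|]. rewrite Rabs_mult, (Rabs_right (indic _)) by (apply Rle_ge, indic_nonneg). lra. }
    destruct (indic_cases (Nat.divide l m)) as [[Hd ->]|[Hd ->]].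
    - destruct (divide_div m l Hm Hd) as (E & _ & Hq). set (q := (m / l)%nat) in *.
      eapply Rle_trans; [apply (indic_sum_le (seq 0 n0) ((c * q - 1)%nat :: nil) (fun n => (c * m)%nat = (S n * l)%nat) (fun n => Rabs (F n)))|].
      + apply seq_NoDup.
      + intros n _ En. left. nia.
      + intros; apply Rabs_pos.
      + simpl. rewrite Rplus_0_r, Rmult_1_l. eapply Rle_trans; [apply HF|]. replace (S (c * q - 1)) with (c * q)%nat by nia.
        rewrite E, !mult_INR, !sqrt_mult by apply pos_INR.
        assert (0 < sqrt (INR q)) by (apply sqrt_lt_R0, lt_0_INR; lia). right. field. lra.
    - rewrite Rmult_0_l, rsum_0; [lra|]. intros n _. rewrite indic_false; [ring|]. intros En. apply Hd, Hdiv. exists (S n). auto. }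
  eapply Rle_trans; [apply Rabs_triang|].
  assert (Hp : forall n, 0 < / sqrt (INR (S n))) by (intros n; apply Rinv_0_lt_compat, sqrt_lt_R0, lt_0_INR; lia).
  generalize (G 1%nat N (fun n => (-1) ^ n * / sqrt (INR (S n))) ltac:(lia)). intros G1.
  generalize (G 2%nat N (fun n => - ((-1) ^ n * sqrt 2 * / sqrt (INR (S n)))) ltac:(lia)). intros G2.
  assert (HF1 : forall n, Rabs ((-1) ^ n * / sqrt (INR (S n))) <= sqrt (INR 1) * / sqrt (INR (S n))).
  { intros n. rewrite Rabs_mult, pow_1_abs, Rmult_1_l. change (INR 1) with 1. rewrite sqrt_1, Rmult_1_l.
    rewrite Rabs_right by (apply Rle_ge; left; auto). lra. }
  assert (HF2 : forall n, Rabs (- ((-1) ^ n * sqrt 2 * / sqrt (INR (S n)))) <= sqrt (INR 2) * / sqrt (INR (S n))).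
  { intros n. rewrite Rabs_Ropp, !Rabs_mult, pow_1_abs, Rmult_1_l. change (INR 2) with 2.
    rewrite (Rabs_right (sqrt 2)) by lra. rewrite Rabs_right by (apply Rle_ge; left; auto). lra. }
  assert (G1' := G1 HF1). assert (G2' := G2 HF2). rewrite Nat.mul_1_l in G1'. specialize (G1' (fun H => H)).
  assert (Hdiv2 : Nat.divide l (2 * m) -> Nat.divide l m).
  { intros Hd. apply (Nat.gauss l 2 m); auto.
    assert (Hg := Nat.gcd_divide_r l 2). assert (Hg' := Nat.gcd_divide_l l 2).
    assert (Hle : (Nat.gcd l 2 <= 2)%nat) by (apply Nat.divide_pos_le; auto; lia).
    destruct (Nat.gcd l 2) as [|[|[|k]]]; try lia.
    - destruct Hg. lia.
    - exfalso. destruct Hg' as [k Hk], Ol as [j Hj]. lia. }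
  specialize (G2' Hdiv2). rewrite Nat.mul_1_l. lra.
Qed.

(** * The grid of quarter-turns of the phase *)

Lemma Th_IVT a b v : 1 < a < b -> Th a < v <= Th b -> exists t, a <= t <= b /\ Th t = v.
Proof.
  intros Hab Hv. destruct (Req_dec v (Th b)) as [->|Hne]; [exists b; split; [lra|auto]|].
  (* Clamping the argument to [a, b] produces a function continuous on the whole line, as [IVT]
     requires, whereas continuity of [Th] is known only beyond 1. *)
  set (f := fun t => Th (Rmax a (Rmin t b)) - v).
  assert (Hf : continuity f).
  { intros t. unfold f. apply continuity_pt_filterlim.
    apply (continuous_minus (V := R_NormedModule) (fun t => Th (Rmax a (Rmin t b))) (fun _ => v)); [|apply continuous_const].
    apply (continuous_comp (fun t => Rmax a (Rmin t b)) Th).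
    -
      apply (continuous_ext (fun t => (a + (t + b - Rabs (t - b)) / 2 + Rabs (a - (t + b - Rabs (t - b)) / 2)) / 2)).
      { intros z.
        assert (E : Rmin z b = (z + b - Rabs (z - b)) / 2).
        { unfold Rmin, Rabs. destruct (Rle_dec z b), (Rcase_abs (z - b)); lra. }
        rewrite <- E. unfold Rmax, Rabs. destruct (Rle_dec a (Rmin z b)), (Rcase_abs (a - Rmin z b)); lra. }
      assert (C1 : forall c x, continuous (fun t : R => t + c) x).
      { intros c x. apply (ex_derive_continuous (V := R_NormedModule)); auto_derive; auto. }
      assert (C2 : continuous (fun t => (t + b - Rabs (t - b)) / 2) t).
      { apply (continuous_mult (K := R_AbsRing)); [|apply continuous_const].
        apply (continuous_minus (V := R_NormedModule)); [apply C1|]. apply continuous_Rabs_comp. apply (C1 (- b)). }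
      apply (continuous_mult (K := R_AbsRing)); [|apply continuous_const].
      apply (continuous_plus (V := R_NormedModule)).
      + apply (continuous_plus (V := R_NormedModule)); [apply continuous_const|exact C2].
      + apply continuous_Rabs_comp. apply (continuous_minus (V := R_NormedModule)); [apply continuous_const|exact C2].
    - apply continuity_pt_filterlim, Th_continuous. eapply Rlt_le_trans; [|apply Rmax_l]. lra. }
  assert (E : forall t, a <= t <= b -> f t = Th t - v).
  { intros t Ht. unfold f. rewrite Rmin_left, Rmax_right by lra. reflexivity. }
  destruct (IVT f a b Hf) as (t & Ht & H0); [lra| | |].
  - rewrite E by lra. lra.
  - rewrite E by lra. lra.
  - exists t; split; auto. rewrite E in H0 by lra. lra.
Qed.

(* The points of even index are roots for [phi], those of odd index roots for [phi + PI / 2]. *)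
Record grid (phi T : R) (M : nat) (u : nat -> R) : Prop := {
  grid_range : forall i, (i <= 2 * M)%nat -> T <= u i <= 2 * T;
  grid_step : forall i, (i < 2 * M)%nat -> PI / (ln T + 22) <= u (S i) - u i <= PI / (ln T - 20);
  grid_decr : forall i, (S i < 2 * M)%nat -> u (S (S i)) - u (S i) <= u (S i) - u i;
  grid_Delta : forall i, (i <= 2 * M)%nat -> Defs.Delta (crit (u i)) = Cmult (RtoC ((-1) ^ i)) (cis (2 * phi)) }.

Lemma cis_2pi_Z (x : R) (z : Z) : cis (x + IZR z * (2 * PI)) = cis x.
Proof.
  assert (H : forall n : nat, forall y, cis (y + INR n * (2 * PI)) = cis y).
  { intros n y. rewrite cis_add. replace (INR n * (2 * PI)) with (INR (2 * n) * PI) by (rewrite mult_INR; simpl; ring).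
    rewrite cis_pi, pow_1_even. ring. }
  destruct (Z.le_gt_cases 0 z) as [Hz|Hz].
  - rewrite <- (Z2Nat.id z) by auto. rewrite <- INR_IZR_INZ. apply H.
  - rewrite <- (H (Z.to_nat (- z)) (x + IZR z * (2 * PI))). f_equal.
    rewrite INR_IZR_INZ, Z2Nat.id by lia. rewrite opp_IZR. ring.
Qed.

(** The points solve Th = v0 + i PI/2. Convexity of [Th] makes the gaps decrease; its slope, between
    ln T / 2 - 10 and ln T / 2 + 11 on [T, 2 T], determines their size; the increase of [Th] over
    this interval, divided by [PI], determines [M]. *)
Theorem grid_exists phi T : 400 <= ln T -> 1 <= T ->
  exists M u, grid phi T M u /\ T * ln T / 20 <= INR M /\ 2 * INR M <= T * ln T.
Proof.
  intros HL HT1. generalize PI_RGT_0 PI2_3_2 PI_4; intros HP HP3 HP4. set (L := ln T) in *.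
  assert (HT : 401 <= T). { generalize (ln_le_sub1 T ltac:(lra)). fold L. lra. }
  assert (HL2 : ln (2 * T) <= L + 1).
  { rewrite ln_mult by lra. generalize (ln_le_sub1 2 ltac:(lra)). fold L. lra. }
  assert (Hsl : forall a b, T <= a -> a < b -> b <= 2 * T ->
    (/ 2 * L - 10) * (b - a) <= Th b - Th a <= (/ 2 * L + 11) * (b - a)).
  { intros a b Ha Hab Hb. destruct (Th_slope a b ltac:(lra) Hab) as [S1 S2].
    assert (L <= ln a) by (apply ln_le; lra). assert (ln b <= ln (2 * T)) by (apply ln_le; lra).
    split; (eapply Rle_trans; [|eassumption] || (eapply Rle_trans; [eassumption|])); apply Rmult_le_compat_r; lra. }
  (* [v0] is the first level above [Th T] that is congruent to - phi modulo [PI]; there [Delta]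
     equals [cis (2 * phi)], and each further PI/2 of phase changes its sign. *)
  set (j0 := up ((Th T + phi) / PI)). destruct (archimed ((Th T + phi) / PI)) as [J1 J2]. fold j0 in J1, J2.
  set (v0 := IZR j0 * PI - phi).
  assert (Hv0 : Th T < v0 <= Th T + PI).
  { unfold v0. assert (E : (Th T + phi) / PI * PI = Th T + phi) by (field; lra).
    split; [assert ((Th T + phi) / PI * PI < IZR j0 * PI) by (apply Rmult_lt_compat_r; lra); lra|].
    assert ((IZR j0 - (Th T + phi) / PI) * PI <= 1 * PI) by (apply Rmult_le_compat_r; lra). lra. }
  destruct (Hsl T (2 * T) ltac:(lra) ltac:(lra) ltac:(lra)) as [W1 W2].
  replace (2 * T - T) with T in W1, W2 by ring.
  assert (HT2 : 40 * PI <= Th (2 * T) - Th T) by nra.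
  destruct (nfloor_ex ((Th (2 * T) - v0) / PI)) as [M [M1 M2]].
  { apply Rmult_le_pos; [lra|left; apply Rinv_0_lt_compat; auto]. }
  assert (EM : (Th (2 * T) - v0) / PI * PI = Th (2 * T) - v0) by (field; lra).
  assert (M1' : INR M * PI <= Th (2 * T) - v0) by (rewrite <- EM; apply Rmult_le_compat_r; lra).
  assert (M2' : Th (2 * T) - v0 <= (INR M + 1) * PI) by (rewrite <- EM; apply Rmult_le_compat_r; lra).
  assert (Hu : exists u : nat -> R, forall i, (i <= 2 * M)%nat -> T <= u i <= 2 * T /\ Th (u i) = v0 + INR i * (PI / 2)).
  { apply (choice (fun i t => (i <= 2 * M)%nat -> T <= t <= 2 * T /\ Th t = v0 + INR i * (PI / 2))).
    intros i. destruct (Nat.le_gt_cases i (2 * M)) as [Hi|Hi]; [|exists 0; intros; lia].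
    destruct (Th_IVT T (2 * T) (v0 + INR i * (PI / 2))) as (t & Ht & E); [lra| |exists t; auto].
    generalize (pos_INR i); intros. assert (INR i <= 2 * INR M).
    { apply le_INR in Hi. rewrite mult_INR in Hi. simpl in Hi. lra. }
    split; [nra|]. nra. }
  destruct Hu as [u Hu].
  assert (Hlt : forall i, (i < 2 * M)%nat -> u i < u (S i) /\ Th (u (S i)) - Th (u i) = PI / 2).
  { intros i Hi. destruct (Hu i ltac:(lia)) as [R1 E1]. destruct (Hu (S i) ltac:(lia)) as [R2 E2].
    assert (ED : Th (u (S i)) - Th (u i) = PI / 2) by (rewrite E1, E2, S_INR; ring). split; auto.
    destruct (Rtotal_order (u i) (u (S i))) as [H|[H|H]]; auto.
    - rewrite H in ED. lra.
    - destruct (Hsl (u (S i)) (u i)) as [S1 S2]; try lra. nra. }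
  exists M, u. split; [split|split].
  - intros i Hi. apply Hu; auto.
  - intros i Hi. destruct (Hlt i Hi) as [H1 H2]. destruct (Hu i ltac:(lia)) as [R1 _]. destruct (Hu (S i) ltac:(lia)) as [R2 _].
    destruct (Hsl (u i) (u (S i))) as [S1 S2]; try lra. rewrite H2 in S1, S2. fold L.
    split.
    + apply Rmult_le_reg_r with (L + 22); [lra|]. replace (PI / (L + 22) * (L + 22)) with PI by (field; lra). lra.
    + apply Rmult_le_reg_r with (L - 20); [lra|]. replace (PI / (L - 20) * (L - 20)) with PI by (field; lra). lra.
  - intros i Hi. destruct (Hlt i ltac:(lia)) as [H1 H2]. destruct (Hlt (S i) ltac:(lia)) as [H3 H4].
    destruct (Hu i ltac:(lia)) as [R1 _].
    generalize (Th_convex (u i) (u (S i)) (u (S (S i))) ltac:(lra) H1 H3). rewrite H2, H4. nra.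
  - intros i Hi. destruct (Hu i Hi) as [R1 E]. rewrite Delta_phase by lra. rewrite E. unfold v0.
    rewrite <- cis_pi, <- cis_add.
    rewrite <- (cis_2pi_Z (INR i * PI + 2 * phi) (- (j0 + Z.of_nat i))). f_equal.
    rewrite opp_IZR, plus_IZR, <- INR_IZR_INZ. field.
  - assert (L * T / (4 * PI) - 2 <= INR M).
    { apply Rmult_le_reg_r with PI; auto. replace ((L * T / (4 * PI) - 2) * PI) with (L * T / 4 - 2 * PI) by (field; lra). nra. }
    assert (T * L / 20 <= L * T / (4 * PI) - 2); [|lra].
    assert (L * T / 16 <= L * T / (4 * PI)).
    { unfold Rdiv. apply Rmult_le_compat_l; [nra|]. apply Rinv_le_contravar; lra. }
    nra.
  - apply Rmult_le_reg_r with PI; auto. assert (2 * INR M * PI <= 2 * ((/ 2 * L + 11) * T)) by lra.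
    assert (L * T * 3 <= L * T * PI) by (apply Rmult_le_compat_l; nra). nra.
Qed.

(** * Diagonal terms and moments over the roots *)

Lemma inv_sqrt_mul (a : R) : 0 < a -> / sqrt a * / sqrt a = / a.
Proof. intros H. rewrite <- Rinv_mult, sqrt_sqrt by lra. reflexivity. Qed.

(** The factor (m l)^(-1/2) of the coefficients and (m / l)^(1/2) from [bracket_lower] combine to 1
    / l. The parity hypotheses confine the sum to the odd m and l that [bracket_lower] treats. *)
Lemma tpdiag_lower (f g : nat -> R) X1 X N : (X <= N)%nat ->
  (forall n, 0 <= f n) -> (forall n, 0 <= g n) ->
  (forall n, (1 <= n)%nat -> ~ Nat.Odd n -> f n = 0) -> (forall n, (1 <= n)%nat -> ~ Nat.Odd n -> g n = 0) ->
  rsum (seq 1 X) (fun l => rsum (seq 1 X1) (fun m => indic (Nat.divide m l) * (f m * g l / INR l))) <=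
  tpdiag (tpm (tpm (tpW N) (tpD f X1)) (tpconj (tpD g X))).
Proof.
  intros HN Hf Hg Of Og. rewrite tpdiag_triple, rsum_swap. apply rsum_le. intros m Hm. apply rsum_le. intros l Hl.
  apply in_seq in Hm, Hl. assert (0 < INR m) by (apply lt_0_INR; lia). assert (0 < INR l) by (apply lt_0_INR; lia).
  assert (Z : f m * g l = 0 \/ (Nat.Odd m /\ Nat.Odd l)).
  { destruct (classic (Nat.Odd m)) as [H1|H1]; [|left; rewrite Of by (auto; lia); ring].
    destruct (classic (Nat.Odd l)) as [H2|H2]; [auto|left; rewrite Og by (auto; lia); ring]. }
  destruct Z as [Z|[O1 O2]]; [rewrite Z; unfold Rdiv; lra|].
  apply Rle_trans with (f m * g l * / sqrt (INR m) * / sqrt (INR l) * (indic (Nat.divide m l) * (sqrt (INR m) * / sqrt (INR l)))).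
  - assert (0 < sqrt (INR m)) by (apply sqrt_lt_R0; auto).
    right. replace (f m * g l * / sqrt (INR m) * / sqrt (INR l) * (indic (Nat.divide m l) * (sqrt (INR m) * / sqrt (INR l))))
      with (indic (Nat.divide m l) * (f m * g l * (/ sqrt (INR l) * / sqrt (INR l)) * (/ sqrt (INR m) * sqrt (INR m)))) by ring.
    rewrite inv_sqrt_mul, Rinv_l by lra. unfold Rdiv; ring.
  - apply Rmult_le_compat_l; [|apply bracket_lower; auto; lia].
    repeat (apply Rmult_le_pos; auto); left; apply Rinv_0_lt_compat, sqrt_lt_R0; auto.
Qed.

Lemma tpdiag_upper (f g : nat -> R) X1 X N :
  (forall n, 0 <= f n) -> (forall n, 0 <= g n) ->
  (forall n, (1 <= n)%nat -> ~ Nat.Odd n -> g n = 0) ->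
  Rabs (tpdiag (tpm (tpm (tpconj (tpW N)) (tpD f X1)) (tpconj (tpD g X)))) <=
  2 * rsum (seq 1 X1) (fun m => rsum (seq 1 X) (fun l => indic (Nat.divide l m) * (f m * g l / INR m))).
Proof.
  intros Hf Hg Og. rewrite tpdiag_triple, <- rsum_scal.
  assert (AB : forall (l : list nat) (h : nat -> R), Rabs (rsum l h) <= rsum l (fun n => Rabs (h n))).
  { induction l as [|a l IH]; intros h; simpl; [rewrite Rabs_R0; lra|]. eapply Rle_trans; [apply Rabs_triang|]. generalize (IH h); lra. }
  eapply Rle_trans; [apply AB|]. apply rsum_le. intros m Hm. eapply Rle_trans; [apply AB|].
  rewrite <- rsum_scal. apply rsum_le. intros l Hl.
  apply in_seq in Hm, Hl. assert (0 < INR m) by (apply lt_0_INR; lia). assert (0 < INR l) by (apply lt_0_INR; lia).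
  destruct (classic (Nat.Odd l)) as [O|O]; [|rewrite Og by (auto; lia); rewrite Rmult_0_r, !Rmult_0_l, Rabs_R0; unfold Rdiv; lra].
  assert (P : 0 <= f m * g l * / sqrt (INR m) * / sqrt (INR l)).
  { repeat (apply Rmult_le_pos; auto); left; apply Rinv_0_lt_compat, sqrt_lt_R0; auto. }
  rewrite Rabs_mult, (Rabs_right (f m * g l * / sqrt (INR m) * / sqrt (INR l))) by lra.
  apply Rle_trans with (f m * g l * / sqrt (INR m) * / sqrt (INR l) * (2 * (indic (Nat.divide l m) * (sqrt (INR l) * / sqrt (INR m))))).
  - apply Rmult_le_compat_l; auto. apply bracket_upper; auto; lia.
  - assert (0 < sqrt (INR l)) by (apply sqrt_lt_R0; auto).
    right. replace (f m * g l * / sqrt (INR m) * / sqrt (INR l) * (2 * (indic (Nat.divide l m) * (sqrt (INR l) * / sqrt (INR m)))))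
      with (2 * (indic (Nat.divide l m) * (f m * g l * (/ sqrt (INR m) * / sqrt (INR m)) * (/ sqrt (INR l) * sqrt (INR l))))) by ring.
    rewrite inv_sqrt_mul, Rinv_l by lra. unfold Rdiv; ring.
Qed.

Lemma in_tpm l l' w : In w (tpm l l') -> exists a b, In a l /\ In b l' /\ tn w = (tn a * tn b)%nat /\ td w = (td a * td b)%nat.
Proof.
  intros H. apply in_flat_map in H. destruct H as (a & Ha & H). apply in_map_iff in H. destruct H as (b & <- & Hb).
  exists a, b. auto.
Qed.

Lemma in_tpconj l w : In w (tpconj l) -> exists a, In a l /\ tn w = td a /\ td w = tn a.
Proof. intros H. apply in_map_iff in H. destruct H as (a & <- & Ha). exists a; auto. Qed.

Lemma in_tpD f X w : In w (tpD f X) -> (1 <= tn w <= X)%nat /\ td w = 1%nat.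
Proof. intros H. apply in_map_iff in H. destruct H as (n & <- & Hn). apply in_seq in Hn. unfold tn, td; simpl; lia. Qed.

(** With L = ln T, a step turns by at most (3/2) L PI / (L - 20), which is below 8 PI / 5 as L >=
    400. Since a or b is at most 2 X, the frequency is at least 1 / (2 X + 1), whence a bound of
    order X L. *)
Lemma grid_frequency phi T M u (X Nm a b : nat) : grid phi T M u -> 400 <= ln T -> (1 <= X)%nat ->
  ln (INR Nm) <= 3 / 2 * ln T -> (1 <= a <= Nm)%nat -> (1 <= b <= Nm)%nat -> (a <= 2 * X \/ b <= 2 * X)%nat -> a <> b ->
  Cmod (csum (seq 0 (2 * M)) (fun i => cis (- (u i * (ln (INR a) - ln (INR b)))))) <= 20 * INR X * ln T.
Proof.
  intros G HL HX HN Ha Hb Hm Hne. generalize PI_RGT_0 PI2_3_2; intros HP HP3. set (L := ln T) in *.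
  set (lam := ln (INR a) - ln (INR b)).
  assert (HXR : 1 <= INR X) by (apply (le_INR 1); auto).
  assert (Hlow : / (2 * INR X + 1) <= Rabs lam).
  { assert (Q : forall c d : nat, (1 <= c)%nat -> (1 <= d <= 2 * X)%nat -> c <> d -> / (2 * INR X + 1) <= Rabs (ln (INR c) - ln (INR d))).
    { intros c d Hc Hd Hcd. eapply Rle_trans; [|apply ln_ratio_lower; auto; lia].
      assert (INR d <= 2 * INR X) by (replace 2 with (INR 2) by (simpl; ring); rewrite <- mult_INR; apply le_INR; lia).
      apply Rinv_le_contravar; [generalize (pos_INR d)|]; lra. }
    destruct Hm as [Hm|Hm]; [unfold lam; rewrite Rabs_minus_sym|]; apply Q; auto; lia. }
  assert (Hup : Rabs lam <= 3 / 2 * L).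
  { assert (Q : forall c : nat, (1 <= c <= Nm)%nat -> 0 <= ln (INR c) <= 3 / 2 * L).
    { intros c Hc. assert (1 <= INR c) by (apply (le_INR 1); lia). assert (INR c <= INR Nm) by (apply le_INR; lia).
      split; [rewrite <- ln_1; apply ln_le; lra|]. eapply Rle_trans; [|exact HN]. apply ln_le; lra. }
    unfold lam. generalize (Q a Ha) (Q b Hb). intros. unfold Rabs. destruct (Rcase_abs _); lra. }
  assert (Hi : 0 < / (2 * INR X + 1)) by (apply Rinv_0_lt_compat; lra).
  assert (Hd1 : 0 < PI / (L + 22)) by (apply Rdiv_lt_0_compat; lra).
  eapply Rle_trans; [apply (grid_sum_bound u (2 * M) (PI / (L + 22)) (PI / (L - 20)) lam)|].
  - exact Hd1.
  - intros E. rewrite E, Rabs_R0 in Hlow. lra.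
  - apply Rle_trans with (3 / 2 * L * (PI / (L - 20))).
    + apply Rmult_le_compat_r; auto. left; apply Rdiv_lt_0_compat; lra.
    + apply Rmult_le_reg_r with (L - 20); [lra|]. replace (3 / 2 * L * (PI / (L - 20)) * (L - 20)) with (3 / 2 * L * PI) by (field; lra). nra.
  - intros i Hi'. apply (grid_step _ _ _ _ G); auto.
  - intros i Hi'. apply (grid_decr _ _ _ _ G); auto.
  - assert (Q : 4 / (Rabs lam * (PI / (L + 22))) <= 4 * ((2 * INR X + 1) * ((L + 22) / PI))).
    { unfold Rdiv at 1. rewrite Rinv_mult. apply Rmult_le_compat_l; [lra|].
      rewrite Rinv_div. apply Rmult_le_compat_r; [left; apply Rdiv_lt_0_compat; lra|].
      rewrite <- (Rinv_inv (2 * INR X + 1)). apply Rinv_le_contravar; auto. }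
    assert (Q2 : (L + 22) / PI <= (L + 22) / 3).
    { apply Rmult_le_compat_l; [lra|]. apply Rinv_le_contravar; lra. }
    assert (Q3 : (2 * INR X + 1) * ((L + 22) / PI) <= 3 * INR X * ((L + 22) / 3)).
    { apply Rmult_le_compat; try lra. left; apply Rdiv_lt_0_compat; lra. }
    nra.
Qed.

Lemma csum_seq_even (F : nat -> CC) M :
  csum (seq 0 (2 * M)) (fun i => Cmult (RtoC (1 + (-1) ^ i)) (F i)) = Cmult (RtoC 2) (csum (seq 0 M) (fun j => F (2 * j)%nat)).
Proof.
  induction M as [|M IH]; [simpl; ring|]. replace (2 * S M)%nat with (S (S (2 * M))) by lia.
  rewrite !csum_seq_S, IH, !Nat.add_0_l. rewrite pow_1_even, pow_1_odd.
  replace (1 + 1) with 2 by ring. replace (1 + -1) with 0 by ring. ring.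
Qed.

Lemma rsum_seq_even_le (F : nat -> R) M : (forall i, 0 <= F i) ->
  rsum (seq 0 M) (fun j => F (2 * j)%nat) <= rsum (seq 0 (2 * M)) F.
Proof.
  intros H. induction M as [|M IH]; [simpl; lra|]. replace (2 * S M)%nat with (S (S (2 * M))) by lia.
  rewrite !rsum_seq_S, !Nat.add_0_l. generalize (H (S (2 * M))). lra.
Qed.

(* This trades the sign that separates roots of even and odd index for a conjugation, so that sums over roots become sums over the whole grid. *)
Lemma omega_grid phi T M u i : grid phi T M u -> 0 < T -> (i <= 2 * M)%nat ->
  Cmult (cis (2 * phi)) (Cconj (omega (u i))) = Cmult (RtoC ((-1) ^ i)) (omega (u i)).
Proof.
  intros G HT Hi. generalize (grid_range _ _ _ _ G i Hi); intros.
  rewrite (omega_functional (u i)) at 2 by lra. rewrite (grid_Delta _ _ _ _ G i Hi).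
  rewrite !Cmult_assoc. rewrite <- RtoC_mult, <- Rpow_mult_distr. replace (-1 * -1) with 1 by ring. rewrite pow1. ring.
Qed.

Lemma omega_approx t N : Rabs t <= INR N -> Cmod (Cminus (omega t) (tpe (tpW N) t)) <= 15 / sqrt (INR N + 1).
Proof.
  intros H. rewrite tpe_tpW. unfold omega.
  cmod_replace (Cmult (Cminus (eta (crit t)) (ep t N)) (Cminus (RtoC 1) (Cmult (RtoC (sqrt 2)) (cis (t * ln 2))))).
  rewrite Cmod_mult.
  assert (S2 : 0 <= sqrt 2 <= 3 / 2).
  { split; [apply sqrt_pos|]. rewrite <- (sqrt_pow2 (3 / 2)) by lra. apply sqrt_le_1_alt. lra. }
  assert (B : Cmod (Cminus (RtoC 1) (Cmult (RtoC (sqrt 2)) (cis (t * ln 2)))) <= 5 / 2).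
  { eapply Rle_trans; [apply Cmod_triangle|]. rewrite Cmod_opp, Cmod_mult, Cmod_cis, !Cmod_R, Rabs_R1, Rabs_right by lra. lra. }
  replace (15 / sqrt (INR N + 1)) with (6 * / sqrt (INR N + 1) * (5 / 2)) by (unfold Rdiv; lra).
  apply Rmult_le_compat; try apply Cmod_ge_0; auto. apply eta_approx; auto.
Qed.

(** Twice the sum over the roots is the grid sum with omega plus [cis (2 * phi)] times the grid sum
    with its conjugate, and [mean_value] evaluates both. N >= 2 T makes the truncation valid at all
    grid points, while the bound on N X limits the frequencies. The constant 255 consists of 15 from
    truncating omega and 20 times 12 from the off-diagonal terms. *)
Lemma first_moment_lower phi T M u (f g : nat -> R) X1 X N :
  grid phi T M u -> 400 <= ln T -> 1 <= T -> 2 * INR M <= T * ln T -> (1 <= X1 <= X)%nat ->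
  2 * T <= INR N <= 4 * T -> ln (INR (N * X)) <= 3 / 2 * ln T ->
  (forall n, (1 <= n)%nat -> 0 <= f n <= INR n) -> (forall n, (1 <= n)%nat -> 0 <= g n <= INR n) ->
  INR M * (tpdiag (tpm (tpm (tpW N) (tpD f X1)) (tpconj (tpD g X))) -
           Rabs (tpdiag (tpm (tpm (tpconj (tpW N)) (tpD f X1)) (tpconj (tpD g X)))))
    - 255 * (sqrt T * ln T * INR X ^ 5) <=
  Cmod (csum (seq 0 M) (fun j => Cmult (omega (u (2 * j)%nat)) (Cmult (DP f X1 (u (2 * j)%nat)) (Cconj (DP g X (u (2 * j)%nat)))))).
Proof.
  intros G HL HT HM HX HN HNX Hf Hg. set (L := ln T) in *.
  set (l1 := tpm (tpm (tpW N) _) _). set (l2 := tpm (tpm (tpconj (tpW N)) _) _).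
  set (B := fun t => Cmult (DP f X1 t) (Cconj (DP g X t))).
  set (S := csum (seq 0 M) _).
  assert (HXR : 1 <= INR X) by (apply (le_INR 1); lia). assert (HX1 : 1 <= INR X1) by (apply (le_INR 1); lia).
  assert (HX1X : INR X1 <= INR X) by (apply le_INR; lia).
  assert (N1 : (2 <= N)%nat) by (apply INR_le; simpl; lra).
  assert (sT : 0 < sqrt T) by (apply sqrt_lt_R0; lra). assert (sT2 : sqrt T * sqrt T = T) by (apply sqrt_sqrt; lra).
  assert (HDf : tpabs (tpD f X1) <= INR X ^ 2).
  { eapply Rle_trans; [apply tpabs_tpD; auto|]. apply pow_incr; lra. }
  assert (HDg : tpabs (tpD g X) <= INR X ^ 2) by (apply tpabs_tpD; auto).
  assert (HDD : tpabs (tpD f X1) * tpabs (tpD g X) <= INR X ^ 4).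
  { replace (INR X ^ 4) with (INR X ^ 2 * INR X ^ 2) by ring. apply Rmult_le_compat; auto; apply tpabs_nonneg. }
  assert (HW : tpabs (tpW N) <= 12 * sqrt T).
  { eapply Rle_trans; [apply tpabs_tpW|]. replace (12 * sqrt T) with (6 * (2 * sqrt T)) by ring.
    apply Rmult_le_compat_l; [lra|]. replace 2 with (sqrt (2 ^ 2)) by (apply sqrt_pow2; lra).
    rewrite <- sqrt_mult by lra. apply sqrt_le_1_alt. lra. }
  assert (Hl1 : tpabs l1 <= 12 * sqrt T * INR X ^ 4).
  { unfold l1. rewrite !tpabs_tpm, tpabs_tpconj, Rmult_assoc. apply Rmult_le_compat; auto; [apply tpabs_nonneg|].
    apply Rmult_le_pos; apply tpabs_nonneg. }
  assert (Hl2 : tpabs l2 <= 12 * sqrt T * INR X ^ 4).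
  { unfold l2. rewrite !tpabs_tpm, !tpabs_tpconj, Rmult_assoc. apply Rmult_le_compat; auto; [apply tpabs_nonneg|].
    apply Rmult_le_pos; apply tpabs_nonneg. }
  assert (HE : 0 <= 20 * INR X * L) by nra.
  assert (MV1 : Cmod (Cminus (csum (seq 0 (2 * M)) (fun i => tpe l1 (u i))) (RtoC (INR (2 * M) * tpdiag l1))) <= 20 * INR X * L * tpabs l1).
  { apply mean_value; auto. intros w Hw Hne. unfold l1 in Hw.
    apply in_tpm in Hw. destruct Hw as (a & b & Ha & Hb & E1 & E2). apply in_tpm in Ha. destruct Ha as (c & d & Hc & Hd & E3 & E4).
    apply in_tpW in Hc. apply in_tpD in Hd. apply in_tpconj in Hb. destruct Hb as (e & He & E5 & E6). apply in_tpD in He.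
    destruct Hd as [Hd D0], He as [He E0]. rewrite E3, E5, E0, Nat.mul_1_r in E1. rewrite E4, E6, D0, Nat.mul_1_r in E2.
    apply (grid_frequency phi T M u X (N * X)); auto; [lia|rewrite E1|rewrite E2|rewrite E2; right; apply Nat.mul_le_mono; lia].
    - split; [nia|apply Nat.mul_le_mono; lia].
    - split; [nia|]. apply Nat.le_trans with (2 * X)%nat; apply Nat.mul_le_mono; lia. }
  assert (MV2 : Cmod (Cminus (csum (seq 0 (2 * M)) (fun i => tpe l2 (u i))) (RtoC (INR (2 * M) * tpdiag l2))) <= 20 * INR X * L * tpabs l2).
  { apply mean_value; auto. intros w Hw Hne. unfold l2 in Hw.
    apply in_tpm in Hw. destruct Hw as (a & b & Ha & Hb & E1 & E2). apply in_tpm in Ha. destruct Ha as (c & d & Hc & Hd & E3 & E4).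
    apply in_tpconj in Hc. destruct Hc as (c' & Hc & F1 & F2).
    apply in_tpW in Hc. apply in_tpD in Hd. apply in_tpconj in Hb. destruct Hb as (e & He & E5 & E6). apply in_tpD in He.
    destruct Hd as [Hd D0], He as [He E0]. rewrite E3, E5, E0, F1, Nat.mul_1_r in E1. rewrite E4, E6, D0, F2, Nat.mul_1_r in E2.
    apply (grid_frequency phi T M u X (N * X)); auto; [lia|rewrite E1|rewrite E2|rewrite E1; left; apply Nat.mul_le_mono; lia].
    - split; [nia|]. apply Nat.le_trans with (2 * X)%nat; apply Nat.mul_le_mono; lia.
    - split; [nia|apply Nat.mul_le_mono; lia]. }
  assert (BX : forall t, Cmod (B t) <= INR X ^ 4).
  { intros t. unfold B. rewrite Cmod_mult, Cmod_conj, <- !tpe_tpD. eapply Rle_trans; [|exact HDD].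
    apply Rmult_le_compat; try apply Cmod_ge_0; apply Cmod_tpe. }
  assert (T1 : forall t, tpe l1 t = Cmult (tpe (tpW N) t) (B t)).
  { intros t. unfold l1, B. rewrite !tpe_tpm, tpe_tpconj, !tpe_tpD, Cmult_assoc; auto using tgood_tpm, tgood_tpW, tgood_tpD, tgood_tpconj. }
  assert (T2 : forall t, tpe l2 t = Cmult (Cconj (tpe (tpW N) t)) (B t)).
  { intros t. unfold l2, B. rewrite !tpe_tpm, !tpe_tpconj, !tpe_tpD, Cmult_assoc; auto using tgood_tpm, tgood_tpW, tgood_tpD, tgood_tpconj. }
  assert (AP : forall i, (i < 2 * M)%nat -> Cmod (Cminus (omega (u i)) (tpe (tpW N) (u i))) <= 15 / sqrt T).
  { intros i Hi. generalize (grid_range _ _ _ _ G i ltac:(lia)); intros. eapply Rle_trans; [apply omega_approx; rewrite Rabs_right; lra|].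
    apply Rmult_le_compat_l; [lra|]. apply Rinv_le_contravar; auto. apply sqrt_le_1_alt. lra. }
  assert (DR : forall (F : nat -> CC) (H : nat -> CC), (forall i, (i < 2 * M)%nat -> Cmod (Cminus (F i) (H i)) <= 15 / sqrt T * INR X ^ 4) ->
    Cmod (Cminus (csum (seq 0 (2 * M)) F) (csum (seq 0 (2 * M)) H)) <= 15 * sqrt T * L * INR X ^ 4).
  { intros F H HFH. rewrite <- csum_minus. eapply Rle_trans; [apply Cmod_csum|].
    eapply Rle_trans; [apply (rsum_le _ _ (fun _ => 15 / sqrt T * INR X ^ 4)); intros i Hi; apply in_seq in Hi; apply HFH; lia|].
    rewrite rsum_const, length_seq, mult_INR. replace (INR 2) with 2 by (simpl; ring).
    apply Rle_trans with (T * L * (15 / sqrt T * INR X ^ 4)).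
    - apply Rmult_le_compat_r; auto. apply Rmult_le_pos; [left; apply Rdiv_lt_0_compat; lra|apply pow_le; lra].
    - right. rewrite <- sT2 at 1. field. lra. }
  assert (X45 : INR X ^ 4 <= INR X ^ 5) by (apply Rle_pow; auto; lia).
  assert (E1 : Cmod (Cminus (csum (seq 0 (2 * M)) (fun i => Cmult (omega (u i)) (B (u i)))) (RtoC (INR (2 * M) * tpdiag l1))) <= 255 * (sqrt T * L * INR X ^ 5)).
  { apply Rle_trans with (15 * sqrt T * L * INR X ^ 4 + 20 * INR X * L * tpabs l1).
    - cmod_replace (Cplus (Cminus (csum (seq 0 (2 * M)) (fun i => Cmult (omega (u i)) (B (u i)))) (csum (seq 0 (2 * M)) (fun i => tpe l1 (u i))))
        (Cminus (csum (seq 0 (2 * M)) (fun i => tpe l1 (u i))) (RtoC (INR (2 * M) * tpdiag l1)))).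
      eapply Rle_trans; [apply Cmod_triangle|]. apply Rplus_le_compat; [|exact MV1].
      apply DR. intros i Hi. rewrite T1. cmod_replace (Cmult (Cminus (omega (u i)) (tpe (tpW N) (u i))) (B (u i))).
      rewrite Cmod_mult. apply Rmult_le_compat; auto; apply Cmod_ge_0.
    - assert (20 * INR X * L * tpabs l1 <= 20 * INR X * L * (12 * sqrt T * INR X ^ 4)) by (apply Rmult_le_compat_l; auto).
      assert (sqrt T * L * INR X ^ 4 <= sqrt T * L * INR X ^ 5) by (apply Rmult_le_compat_l; nra). nra. }
  assert (E2 : Cmod (Cminus (csum (seq 0 (2 * M)) (fun i => Cmult (Cconj (omega (u i))) (B (u i)))) (RtoC (INR (2 * M) * tpdiag l2))) <= 255 * (sqrt T * L * INR X ^ 5)).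
  { apply Rle_trans with (15 * sqrt T * L * INR X ^ 4 + 20 * INR X * L * tpabs l2).
    - cmod_replace (Cplus (Cminus (csum (seq 0 (2 * M)) (fun i => Cmult (Cconj (omega (u i))) (B (u i)))) (csum (seq 0 (2 * M)) (fun i => tpe l2 (u i))))
        (Cminus (csum (seq 0 (2 * M)) (fun i => tpe l2 (u i))) (RtoC (INR (2 * M) * tpdiag l2)))).
      eapply Rle_trans; [apply Cmod_triangle|]. apply Rplus_le_compat; [|exact MV2].
      apply DR. intros i Hi. rewrite T2. cmod_replace (Cmult (Cminus (Cconj (omega (u i))) (Cconj (tpe (tpW N) (u i)))) (B (u i))).
      rewrite Cmod_mult, <- Cminus_conj, Cmod_conj. apply Rmult_le_compat; auto; apply Cmod_ge_0.
    - assert (20 * INR X * L * tpabs l2 <= 20 * INR X * L * (12 * sqrt T * INR X ^ 4)) by (apply Rmult_le_compat_l; auto).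
      assert (sqrt T * L * INR X ^ 4 <= sqrt T * L * INR X ^ 5) by (apply Rmult_le_compat_l; nra). nra. }
  set (Err := 255 * (sqrt T * L * INR X ^ 5)) in *.
  set (S1 := csum (seq 0 (2 * M)) (fun i => Cmult (omega (u i)) (B (u i)))) in *.
  set (S2 := csum (seq 0 (2 * M)) (fun i => Cmult (Cconj (omega (u i))) (B (u i)))) in *.
  (* 1 + (-1)^i selects the even indices, and [omega_grid] replaces (-1)^i omega by [cis (2 * phi)]
     times its conjugate. *)
  assert (ES : Cmult (RtoC 2) S = Cplus S1 (Cmult (cis (2 * phi)) S2)).
  { unfold S. rewrite <- (csum_seq_even (fun i => Cmult (omega (u i)) (B (u i)))). unfold S1, S2. rewrite <- csum_scal, <- csum_plus.
    apply csum_ext. intros i Hi. apply in_seq in Hi. rewrite (Cmult_assoc (cis _)), (omega_grid phi T M u) by (auto; try lra; lia).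
    rewrite RtoC_plus. ring. }
  set (D1 := INR (2 * M) * tpdiag l1) in *. set (D2 := INR (2 * M) * tpdiag l2) in *.
  assert (M2 : INR (2 * M) = 2 * INR M) by (rewrite mult_INR; simpl; ring).
  assert (A1 : D1 <= Cmod S1 + Err).
  { apply Rle_trans with (Cmod (RtoC D1)); [rewrite Cmod_R; apply Rle_abs|].
    replace (RtoC D1) with (Cplus S1 (Copp (Cminus S1 (RtoC D1)))) by ring.
    eapply Rle_trans; [apply Cmod_triangle|]. rewrite Cmod_opp. lra. }
  assert (A2 : Cmod S2 <= Rabs D2 + Err).
  { replace S2 with (Cplus (RtoC D2) (Cminus S2 (RtoC D2))) by ring.
    eapply Rle_trans; [apply Cmod_triangle|]. rewrite Cmod_R. lra. }
  assert (A3 : Cmod S1 <= 2 * Cmod S + Cmod S2).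
  { replace S1 with (Cplus (Cmult (RtoC 2) S) (Copp (Cmult (cis (2 * phi)) S2))) by (rewrite ES; ring).
    eapply Rle_trans; [apply Cmod_triangle|]. rewrite Cmod_opp, !Cmod_mult, Cmod_cis, Cmod_R, Rabs_right by lra. lra. }
  assert (A4 : Rabs D2 = 2 * INR M * Rabs (tpdiag l2)).
  { unfold D2. rewrite Rabs_mult, M2, (Rabs_right (2 * INR M)); auto. generalize (pos_INR M); lra. }
  unfold D1 in A1. rewrite M2 in A1. lra.
Qed.

(** By positivity the sum over the roots is at most the sum over the whole grid, where the
    off-diagonal terms are controlled; the price is a factor 2 in the diagonal. *)
Lemma second_moment_upper phi T M u (g : nat -> R) X :
  grid phi T M u -> 400 <= ln T -> (1 <= X)%nat -> ln (INR X) <= 3 / 2 * ln T ->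
  (forall n, (1 <= n)%nat -> 0 <= g n <= INR n) ->
  rsum (seq 0 M) (fun j => Cmod (DP g X (u (2 * j)%nat)) ^ 2) <=
  2 * INR M * rsum (seq 1 X) (fun n => g n ^ 2 / INR n) + 20 * INR X ^ 5 * ln T.
Proof.
  intros G HL HX HN Hg. set (L := ln T) in *.
  assert (HXR : 1 <= INR X) by (apply (le_INR 1); lia).
  eapply Rle_trans; [apply (rsum_seq_even_le (fun i => Cmod (DP g X (u i)) ^ 2)); intros i; apply pow2_ge_0|].
  set (l3 := tpm (tpD g X) (tpconj (tpD g X))).
  assert (HE : 0 <= 20 * INR X * L) by nra.
  assert (MV : Cmod (Cminus (csum (seq 0 (2 * M)) (fun i => tpe l3 (u i))) (RtoC (INR (2 * M) * tpdiag l3))) <= 20 * INR X * L * tpabs l3).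
  { apply mean_value; auto. intros w Hw Hne. unfold l3 in Hw.
    apply in_tpm in Hw. destruct Hw as (a & b & Ha & Hb & E1 & E2).
    apply in_tpD in Ha. apply in_tpconj in Hb. destruct Hb as (e & He & E5 & E6). apply in_tpD in He.
    apply (grid_frequency phi T M u X X); auto; try lia; nia. }
  unfold l3 in MV at 2. rewrite tpdiag_square in MV.
  replace (csum (seq 0 (2 * M)) (fun i => tpe l3 (u i))) with (RtoC (rsum (seq 0 (2 * M)) (fun i => Cmod (DP g X (u i)) ^ 2))) in MV.
  2:{ rewrite RtoC_rsum. apply csum_ext. intros i _. unfold l3. rewrite tpe_tpm, tpe_tpconj, tpe_tpD by auto using tgood_tpD, tgood_tpconj.
      rewrite Cmod2_conj. reflexivity. }
  rewrite <- RtoC_minus, Cmod_R in MV.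
  assert (Hl3 : tpabs l3 <= INR X ^ 4).
  { unfold l3. rewrite tpabs_tpm, tpabs_tpconj. replace (INR X ^ 4) with (INR X ^ 2 * INR X ^ 2) by ring.
    apply Rmult_le_compat; try apply tpabs_nonneg; apply tpabs_tpD; auto. }
  assert (20 * INR X * L * tpabs l3 <= 20 * INR X * L * INR X ^ 4) by (apply Rmult_le_compat_l; auto).
  rewrite mult_INR in MV. replace (INR 2) with 2 in MV by (simpl; ring).
  apply Rabs_le_between in MV. replace (20 * INR X ^ 5 * L) with (20 * INR X * L * INR X ^ 4) by ring. lra.
Qed.

(** * From the resonator to the lower bound over some of the roots *)

(** If a <= eps b^s, the first term on the right suffices. Otherwise b < (a / eps)^(1/s), and
    raising this to the power 2 r - s yields the second term. *)
Lemma young_pointwise (a b eps : R) (r s : nat) : 0 <= a -> 0 <= b -> 0 < eps -> (1 <= s <= r)%nat ->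
  a * b ^ (2 * r - s) <= eps * b ^ (2 * r) + Rpower eps (1 - 2 * (INR r / INR s)) * rpow a (2 * (INR r / INR s)).
Proof.
  intros Ha Hb He Hrs. assert (HsR : 1 <= INR s) by (apply (le_INR 1); lia). assert (HrR : INR s <= INR r) by (apply le_INR; lia).
  assert (Hp : 0 <= Rpower eps (1 - 2 * (INR r / INR s)) * rpow a (2 * (INR r / INR s))).
  { apply Rmult_le_pos; [left; apply exp_pos|]. unfold rpow. destruct (Req_EM_T a 0); [lra|left; apply exp_pos]. }
  destruct (Rle_lt_dec a (eps * b ^ s)) as [H|H].
  - assert (a * b ^ (2 * r - s) <= eps * b ^ s * b ^ (2 * r - s)) by (apply Rmult_le_compat_r; auto; apply pow_le; auto).
    rewrite Rmult_assoc, <- pow_add in H0. replace (s + (2 * r - s))%nat with (2 * r)%nat in H0 by lia. lra.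
  - assert (0 <= eps * b ^ (2 * r)) by (apply Rmult_le_pos; [lra|apply pow_le; auto]).
    destruct (Req_dec b 0) as [->|Hb0]; [rewrite pow_i by lia; lra|]. assert (Hbp : 0 < b) by lra.
    assert (Hbs : 0 < b ^ s) by (apply pow_lt; auto). assert (Hap : 0 < a) by nra.
    apply Rle_trans with (Rpower eps (1 - 2 * (INR r / INR s)) * rpow a (2 * (INR r / INR s))); [|lra].
    unfold rpow. destruct (Req_EM_T a 0); [lra|]. rewrite <- Rpower_pow by auto.
    replace a with (exp (ln a)) at 1 by (apply exp_ln; auto). unfold Rpower. rewrite <- !exp_plus.
    assert (M : forall z w, z <= w -> exp z <= exp w) by (intros z w [Hz|Hz]; [left; apply exp_increasing; auto|right; f_equal; auto]). apply M. clear M.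
    assert (Hl : INR s * ln b <= ln a - ln eps).
    { apply ln_increasing in H; [|nra]. rewrite ln_mult, <- Rpower_pow in H by auto. unfold Rpower in H. rewrite ln_exp in H. lra. }
    rewrite minus_INR, mult_INR by lia. replace (INR 2) with 2 by (simpl; ring).
    apply Rmult_le_reg_r with (INR s); [lra|].
    replace (((1 - 2 * (INR r / INR s)) * ln eps + 2 * (INR r / INR s) * ln a) * INR s)
      with (INR s * ln a + (2 * INR r - INR s) * (ln a - ln eps)) by (field; lra). nra.
Qed.

(** The two factors |1 - 2^s| and |1 - 2^(1-s)| are at most 1 + sqrt 2 <= 5/2, and 25/4 <= 7. The
    denominator in [zeta] does not vanish because sqrt 2 > 1. *)
Lemma Cmod_omega_le t : Cmod (omega t) <= 7 * Cmod (zeta (crit t)).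
Proof.
  unfold omega, zeta.
  assert (E : Cpowr 2 (Cminus (RtoC 1) (crit t)) = Cpowr 2 (crit (- t))).
  { f_equal. unfold Cminus, Cplus, Copp, RtoC, crit; simpl. f_equal; field. }
  rewrite E, Cpowr_2_crit. set (d := Cminus (RtoC 1) (Cmult (RtoC (sqrt 2)) (cis (- t * ln 2)))).
  assert (S2 : 1 < sqrt 2 <= 3 / 2).
  { split; [rewrite <- sqrt_1; apply sqrt_lt_1; lra|]. rewrite <- (sqrt_pow2 (3 / 2)) by lra. apply sqrt_le_1_alt. lra. }
  assert (F : forall x, Cmod (Cminus (RtoC 1) (Cmult (RtoC (sqrt 2)) (cis x))) <= 5 / 2).
  { intros x. eapply Rle_trans; [apply Cmod_triangle|]. rewrite Cmod_opp, Cmod_mult, Cmod_cis, !Cmod_R, Rabs_R1, Rabs_right by lra. lra. }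
  assert (D : 0 < Cmod d).
  { assert (Cmod (Cmult (RtoC (sqrt 2)) (cis (- t * ln 2))) <= Cmod (RtoC 1) + Cmod d).
    { replace (Cmult (RtoC (sqrt 2)) (cis (- t * ln 2))) with (Cplus (RtoC 1) (Copp d)) by (unfold d; ring).
      eapply Rle_trans; [apply Cmod_triangle|]. rewrite Cmod_opp. lra. }
    rewrite Cmod_mult, Cmod_cis, !Cmod_R, Rabs_R1, Rabs_right in H by lra. lra. }
  rewrite Cmod_mult, Cmod_div by (apply Cmod_gt_0; auto).
  assert (I : / (5 / 2) <= / Cmod d) by (apply Rinv_le_contravar; auto; apply F).
  generalize (Cmod_ge_0 (eta (crit t))); intros He. generalize (F (t * ln 2)); intros.
  replace (7 * (Cmod (eta (crit t)) / Cmod d)) with (Cmod (eta (crit t)) * (7 * / Cmod d)) by (unfold Rdiv; ring).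
  apply Rmult_le_compat_l; auto. lra.
Qed.

Lemma rpow_le_scaled (a b c e : R) : 0 <= a -> 0 <= b -> 0 < c -> 0 <= e -> a <= c * b -> rpow a e <= Rpower c e * rpow b e.
Proof.
  intros Ha Hb Hc He H. unfold rpow. destruct (Req_EM_T a 0) as [|Ha0].
  - apply Rmult_le_pos; [left; apply exp_pos|]. destruct (Req_EM_T b 0); [lra|left; apply exp_pos].
  - destruct (Req_EM_T b 0) as [->|Hb0]; [lra|]. rewrite Rpower_mult_distr by lra. apply Rle_Rpower_l; lra.
Qed.

Lemma smooth_odd ps n : (forall p, In p ps -> (2 < p)%nat) -> smooth ps n -> Nat.Odd n.
Proof.
  intros Hp [Hn Hs]. destruct (Nat.Even_or_Odd n) as [[q E]|O]; auto. exfalso.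
  assert (P2 : prime_nat 2).
  { split; [lia|]. intros d Hd. assert (d <= 2)%nat by (apply Nat.divide_pos_le; auto; lia).
    destruct d as [|[|[|d]]]; try lia. destruct Hd; lia. }
  specialize (Hp 2%nat (Hs 2%nat P2 ltac:(exists q; lia))). lia.
Qed.

(** With be = 1/s one has k = r be = (r - s) be + 1, the relation under which the estimates for
    [main1] and [main2] match. The first moment is bounded from below by its diagonal and from above
    by Young's inequality; the part of the latter with |A|^(2r) is moved to the left through the
    second moment. *)
Lemma resonance phi T M u ps x (r s N : nat) eps k :
  grid phi T M u -> 400 <= ln T -> 1 <= T -> 2 * INR M <= T * ln T -> (1 <= s <= r)%nat -> (1 <= x)%nat ->
  primes_list ps -> k = INR r / INR s -> (forall p, In p ps -> (2 < p)%nat /\ k ^ 2 <= INR p) ->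
  2 * T <= INR N <= 4 * T -> (x ^ r <= N)%nat -> ln (INR (N * x ^ r)) <= 3 / 2 * ln T -> 0 < eps ->
  INR M * (main1 ps x (/ INR s) (r - s) r - 2 * main2 ps x (/ INR s) (r - s) r - 2 * eps * rsum (seq 1 (x ^ r)) (sterm ps (k ^ 2)))
    - (255 + 20 * eps) * (sqrt T * ln T * INR (x ^ r) ^ 5) <=
  Rpower eps (1 - 2 * k) * Rpower 7 (2 * k) * rsum (seq 0 M) (fun j => rpow (Cmod (zeta (crit (u (2 * j)%nat)))) (2 * k)).
Proof.
  intros G HL HT HM Hrs Hx Hps Hk Hp HN HxN HNX He. set (L := ln T) in *. set (be := / INR s).
  assert (HsR : 1 <= INR s) by (apply (le_INR 1); lia). assert (HrR : INR s <= INR r) by (apply le_INR; lia).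
  assert (Hbe : 0 <= be) by (left; apply Rinv_0_lt_compat; lra).
  assert (Hk2 : k = INR r * be) by (rewrite Hk; reflexivity).
  assert (Hk1 : k = INR (r - s) * be + 1) by (rewrite Hk, minus_INR by lia; unfold be; field; lra).
  assert (Hk0 : 1 <= k).
  { rewrite Hk. apply Rmult_le_reg_r with (INR s); [lra|]. replace (INR r / INR s * INR s) with (INR r) by (field; lra). lra. }
  set (X := (x ^ r)%nat) in *. set (X1 := (x ^ (r - s))%nat).
  assert (HX1 : (1 <= X1 <= X)%nat).
  { split; [apply Nat.neq_0_lt_0, Nat.pow_nonzero; lia|apply Nat.pow_le_mono_r; lia]. }
  set (f := apow ps x be (r - s)). set (g := apow ps x be r).
  assert (Hf : forall n, (1 <= n)%nat -> 0 <= f n <= INR n).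
  { intros n Hn. split; [apply apow_nonneg; auto|]. apply (apow_le_id ps x be Hbe Hx (r - s) (k - 1)); auto; [lra|].
    intros p Hpp. destruct (Hp p Hpp). nra. }
  assert (Hg : forall n, (1 <= n)%nat -> 0 <= g n <= INR n).
  { intros n Hn. split; [apply apow_nonneg; auto|]. apply (apow_le_id ps x be Hbe Hx r k); auto.
    intros p Hpp. destruct (Hp p Hpp). nra. }
  assert (Od : forall j n, (1 <= n)%nat -> ~ Nat.Odd n -> apow ps x be j n = 0).
  { intros j n Hn Ho. apply apow_smooth; auto. intros Hs. apply Ho. apply (smooth_odd ps); auto. intros p Hpp. apply Hp; auto. }
  generalize (first_moment_lower phi T M u f g X1 X N G HL HT HM HX1 HN HNX Hf Hg). intros F1.
  assert (D1 : main1 ps x be (r - s) r <= tpdiag (tpm (tpm (tpW N) (tpD f X1)) (tpconj (tpD g X)))).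
  { apply tpdiag_lower; auto; intros n; try apply Od; apply apow_nonneg; auto. }
  assert (D2 : Rabs (tpdiag (tpm (tpm (tpconj (tpW N)) (tpD f X1)) (tpconj (tpD g X)))) <= 2 * main2 ps x be (r - s) r).
  { apply tpdiag_upper; auto; intros n; try apply Od; apply apow_nonneg; auto. }
  assert (HXR : 1 <= INR X) by (apply (le_INR 1); lia).
  assert (HlX : ln (INR X) <= 3 / 2 * L).
  { eapply Rle_trans; [|exact HNX]. apply ln_le; [lra|]. apply le_INR. assert (2 <= N)%nat by (apply INR_le; simpl; lra). nia. }
  generalize (second_moment_upper phi T M u g X G HL ltac:(lia) HlX Hg). intros F2.
  assert (D3 : rsum (seq 1 X) (fun n => g n ^ 2 / INR n) <= rsum (seq 1 X) (sterm ps (k ^ 2))) by (apply square_diag_upper; auto).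
  set (sq := rsum (seq 0 M) (fun j => Cmod (DP g X (u (2 * j)%nat)) ^ 2)) in *.
  set (Zs := rsum (seq 0 M) _).
  (* In modulus each summand is |omega| |A|^(2r-s), the exponent for which [young_pointwise] is
     made. *)
  assert (U : Cmod (csum (seq 0 M) (fun j => Cmult (omega (u (2 * j)%nat)) (Cmult (DP f X1 (u (2 * j)%nat)) (Cconj (DP g X (u (2 * j)%nat)))))) <=
    eps * sq + Rpower eps (1 - 2 * k) * Rpower 7 (2 * k) * Zs).
  { eapply Rle_trans; [apply Cmod_csum|]. unfold sq, Zs. rewrite <- !rsum_scal, <- rsum_plus. apply rsum_le. intros j _.
    set (t := u (2 * j)%nat). rewrite !Cmod_mult, Cmod_conj. unfold f, g, X1, X. rewrite <- !DP_apow by auto. rewrite !Cmod_pow.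
    set (b := Cmod (DP (av ps x be) x t)). rewrite <- pow_add. replace (r - s + r)%nat with (2 * r - s)%nat by lia.
    eapply Rle_trans; [apply (young_pointwise _ b eps r s); auto; apply Cmod_ge_0|]. rewrite <- Hk.
    apply Rplus_le_compat; [right; f_equal; rewrite <- pow_mult; f_equal; lia|].
    rewrite Rmult_assoc. apply Rmult_le_compat_l; [left; apply exp_pos|].
    apply rpow_le_scaled; try apply Cmod_ge_0; try lra. apply Cmod_omega_le. }
  assert (sT : 1 <= sqrt T) by (rewrite <- sqrt_1; apply sqrt_le_1_alt; auto).
  assert (HM0 : 0 <= INR M) by apply pos_INR.
  assert (I1 : INR M * (main1 ps x be (r - s) r - 2 * main2 ps x be (r - s) r) <=
     INR M * (tpdiag (tpm (tpm (tpW N) (tpD f X1)) (tpconj (tpD g X))) - Rabs (tpdiag (tpm (tpm (tpconj (tpW N)) (tpD f X1)) (tpconj (tpD g X)))))).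
  { apply Rmult_le_compat_l; lra. }
  assert (I2 : eps * sq <= eps * (2 * INR M * rsum (seq 1 X) (sterm ps (k ^ 2)) + 20 * (sqrt T * L * INR X ^ 5))).
  { apply Rmult_le_compat_l; [lra|]. eapply Rle_trans; [exact F2|]. apply Rplus_le_compat.
    - apply Rmult_le_compat_l; lra.
    - assert (0 <= INR X ^ 5) by (apply pow_le; lra). fold L. rewrite Rmult_assoc. apply Rmult_le_compat_l; [lra|].
      rewrite (Rmult_comm _ L). apply Rmult_le_compat_r; auto. nra. }
  fold L in F1. lra.
Qed.

(** y is the integer part of exp (L / K): then y^K <= e^L, while ln y keeps at least half of L / K
    because y^2 >= y + 1. *)
Lemma power_scale (K : nat) (Y : R) : (1 <= K)%nat -> exists L1, forall L, L1 <= L ->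
  exists y, (3 <= y)%nat /\ Y <= ln (INR y) /\ INR K * ln (INR y) <= L <= 2 * INR K * ln (INR y).
Proof.
  intros HK. assert (HKR : 1 <= INR K) by (apply (le_INR 1); auto).
  exists (INR K * (exp Y + 4)). intros L HL.
  set (v := L / INR K). assert (Ev : INR K * v = L) by (unfold v; field; lra).
  assert (Hv : exp Y + 4 <= v) by (apply Rmult_le_reg_l with (INR K); lra).
  generalize (exp_pos Y); intros HY. generalize (exp_ineq1_le v); intros Hev.
  destruct (nfloor_ex (exp v)) as [y [Y1 Y2]]; [left; apply exp_pos|].
  assert (H3 : (3 <= y)%nat) by (apply INR_le; simpl; lra).
  assert (HyR : 3 <= INR y) by (apply (le_INR 3) in H3; simpl in H3; lra).
  assert (A1 : ln (INR y) <= v) by (rewrite <- (ln_exp v); apply ln_le; lra).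
  assert (A2 : v <= 2 * ln (INR y)).
  { rewrite <- (ln_exp v). replace (2 * ln (INR y)) with (ln (INR y * INR y)) by (rewrite ln_mult by lra; ring).
    apply ln_le; [apply exp_pos|]. nra. }
  exists y. split; auto. split; [|split].
  - rewrite <- (ln_exp Y). apply ln_le; [auto|]. lra.
  - rewrite <- Ev. apply Rmult_le_compat_l; lra.
  - rewrite <- Ev. replace (2 * INR K * ln (INR y)) with (INR K * (2 * ln (INR y))) by ring. apply Rmult_le_compat_l; lra.
Qed.

(** In units of (ln y)^(k^2), [main1] is at least c1, [main2] at most C2 / ln y, and the diagonal of
    the second moment at most C3. The parameters are tuned so that the last two each cost a quarter
    of c1. *)
Theorem moment_lower (r s : nat) (phi k : R) : (1 <= s <= r)%nat -> k = INR r / INR s ->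
  exists c L1, 0 < c /\ forall T, 1 <= T -> L1 <= ln T -> exists l : list R, NoDup l /\
    (forall t, In t l -> 0 < t <= 2 * T /\ Defs.Delta (crit t) = cis (2 * phi)) /\
    c * T * Rpower (ln T) (k ^ 2 + 1) <= rsum l (fun t => rpow (Cmod (zeta (crit t))) (2 * k)).
Proof.
  intros Hrs Hk.
  assert (HsR : 1 <= INR s) by (apply (le_INR 1); lia). assert (HrR : INR s <= INR r) by (apply le_INR; lia).
  assert (Hk0 : 1 <= k).
  { rewrite Hk. apply Rmult_le_reg_r with (INR s); [lra|]. replace (INR r / INR s * INR s) with (INR r) by (field; lra). lra. }
  assert (Hkk : 1 <= k ^ 2) by nra.
  (* [C0] is what Rankin's trick asks for with ka = k^2; [lo] makes all primes odd and keeps k^2 / p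
     below 1/2. *)
  destruct (INR_unbounded (4 * k ^ 2 + 1)) as [C0 HC0]. destruct (INR_unbounded (2 * k ^ 2 + 2)) as [lo Hlo].
  destruct (squarefree_sum_lower (k ^ 2) lo C0) as (c1 & Hc1 & B1); [lra|lra|].
  destruct (euler_upper (k ^ 2 - 1) lo) as (C2 & HC2 & B2); [lra|lra|].
  destruct (euler_upper (k ^ 2) lo) as (C3 & HC3 & B3); [lra|lra|].
  assert (C01 : (1 <= C0)%nat) by (apply INR_le; simpl; lra). assert (lo2 : (2 <= lo)%nat) by (apply INR_le; simpl; lra).
  set (P := (C0 * r)%nat). assert (HP : (1 <= P)%nat) by (unfold P; nia).
  assert (HPR : 1 <= INR P) by (apply (le_INR 1); auto).
  (* With this weight in Young's inequality the second moment costs 2 eps C3 = c1 / 4. *)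
  set (eps := c1 / (8 * C3)). assert (Heps : 0 < eps) by (apply Rdiv_lt_0_compat; lra).
  assert (E3 : eps * C3 = c1 / 8) by (unfold eps; field; lra).
  set (KK := Rpower eps (1 - 2 * k) * Rpower 7 (2 * k)). assert (HKK : 0 < KK) by (apply Rmult_lt_0_compat; apply exp_pos).
  (* The factor 40 gives x^r = y^P <= T^(1/40), so that its fifth power in the error terms stays
     below T^(1/8). The lower bound for ln y makes 2 C2 / ln y at most c1 / 4. *)
  destruct (power_scale (40 * P) (1 + 8 * C2 / c1)) as [L0 HL0]; [lia|].
  (* As soon as Q <= T^(3/8), the error is at most c1 T L / 80, half of the main term c1 T L / 40
     that M >= T L / 20 guarantees. *)
  set (Q := (255 + 20 * eps) * 80 / c1). assert (HQ : 0 < Q) by (apply Rdiv_lt_0_compat; lra).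
  (* ln y is at least ln T / (80 P); [th] is the price of replacing ln y by ln T. *)
  set (th := Rpower (/ (80 * INR P)) (k ^ 2)). assert (Hth : 0 < th) by apply exp_pos.
  exists (c1 / 80 * th / KK), (Rmax (400 + 8 * Q) L0). split.
  { apply Rdiv_lt_0_compat; auto. apply Rmult_lt_0_compat; auto; lra. }
  intros T HT HLT. generalize (Rmax_l (400 + 8 * Q) L0) (Rmax_r (400 + 8 * Q) L0); intros M1 M2.
  set (L := ln T) in *. assert (HL : 400 <= L) by lra. assert (HLQ : 8 * Q <= L) by lra.
  destruct (HL0 L ltac:(lra)) as (y & Hy3 & Hy1 & Hy2 & Hy4).
  replace (INR (40 * P)) with (40 * INR P) in Hy2, Hy4 by (rewrite mult_INR; simpl; ring).
  set (ell := ln (INR y)) in *. assert (H8 : 0 < 8 * C2 / c1) by (apply Rdiv_lt_0_compat; lra).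
  destruct (grid_exists phi T HL HT) as (M & u & G & HM1 & HM2). fold L in HM1, HM2.
  set (x := (y ^ C0)%nat). assert (HyR : 3 <= INR y) by (apply (le_INR 3) in Hy3; simpl in Hy3; lra).
  assert (Hx : (1 <= x)%nat) by (apply Nat.neq_0_lt_0, Nat.pow_nonzero; lia).
  assert (EX : (x ^ r = y ^ P)%nat) by (unfold x, P; rewrite Nat.pow_mul_r; reflexivity).
  assert (HX1 : (1 <= x ^ r)%nat) by (apply Nat.neq_0_lt_0, Nat.pow_nonzero; lia).
  assert (HXR : 1 <= INR (x ^ r)) by (apply (le_INR 1); auto).
  assert (LX : ln (INR (x ^ r)) <= L / 40).
  { rewrite EX, pow_INR, <- Rpower_pow by lra. unfold Rpower. rewrite ln_exp. fold ell. lra. }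
  assert (ET : exp L = T) by (apply exp_ln; lra).
  assert (X5 : INR (x ^ r) ^ 5 <= exp (L / 8)).
  { rewrite <- Rpower_pow by lra. unfold Rpower. apply exp_le. simpl (INR 5). lra. }
  assert (XT : INR (x ^ r) <= T).
  { rewrite <- ET, <- (exp_ln (INR (x ^ r))) by lra. apply exp_le. lra. }
  destruct (nfloor_ex (4 * T)) as [N [N1 N2]]; [lra|].
  assert (HTb : 401 <= T) by (generalize (ln_le_sub1 T ltac:(lra)); fold L; lra).
  set (ps := primes_between lo y).
  assert (Hps : forall p, In p ps -> prime_nat p /\ (2 < p)%nat /\ 2 * k ^ 2 + 2 <= INR p).
  { intros p Hp. apply in_primes_between in Hp. destruct Hp as [Hp Hpp]. split; auto. split; [lia|].
    assert (INR lo <= INR p) by (apply le_INR; lia). lra. }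
  assert (R : INR M * (main1 ps x (/ INR s) (r - s) r - 2 * main2 ps x (/ INR s) (r - s) r - 2 * eps * rsum (seq 1 (x ^ r)) (sterm ps (k ^ 2)))
    - (255 + 20 * eps) * (sqrt T * ln T * INR (x ^ r) ^ 5) <=
    KK * rsum (seq 0 M) (fun j => rpow (Cmod (zeta (crit (u (2 * j)%nat)))) (2 * k))).
  { apply (resonance phi T M u ps x r s N eps k); auto.
    - apply primes_list_primes_between.
    - intros p Hp. destruct (Hps p Hp) as (_ & H2 & H3). split; auto. lra.
    - lra.
    - apply INR_le. lra.
    - rewrite mult_INR, ln_mult by lra. assert (ln (INR N) <= ln (4 * T)) by (apply ln_le; lra).
      rewrite ln_mult in H by lra. generalize (ln_le_sub1 4 ltac:(lra)). fold L in H. fold L. lra. }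
  fold L in R.
  set (be := / INR s) in *.
  assert (Hbe : 0 <= be) by (left; apply Rinv_0_lt_compat; lra).
  assert (Hk2 : k = INR r * be) by (rewrite Hk; reflexivity).
  assert (Hk1 : k = INR (r - s) * be + 1) by (rewrite Hk, minus_INR by lia; unfold be; field; lra).
  set (ll := Rpower ell (k ^ 2)) in *.
  assert (Hll : 1 <= ll).
  { unfold ll. rewrite <- (Rpower_O ell) by lra. apply Rle_Rpower; lra. }
  assert (V1 : c1 * ll <= main1 ps x be (r - s) r).
  { eapply Rle_trans; [apply (B1 y Hy3)|]. apply main1_lower; auto; [lia|apply primes_list_primes_between]. }
  assert (V2 : 2 * main2 ps x be (r - s) r <= c1 / 4 * ll).
  { assert (main2 ps x be (r - s) r <= C2 * Rpower ell (k ^ 2 - 1)).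
    { eapply Rle_trans; [apply (main2_upper ps x be Hbe Hx (r - s) r k); auto|].
      eapply Rle_trans; [|apply (B2 y Hy3)]. apply smooth_sum_le; [lra|]. intros p Hp. destruct (Hps p Hp) as (H1 & H2 & H3). split; auto. lra. }
    assert (ELL : ll = ell * Rpower ell (k ^ 2 - 1)).
    { unfold ll. rewrite <- (Rpower_1 ell) at 2 by lra. rewrite <- Rpower_plus. f_equal. ring. }
    rewrite ELL. assert (0 < Rpower ell (k ^ 2 - 1)) by apply exp_pos.
    assert (8 * C2 <= c1 * ell).
    { apply Rle_trans with (c1 * (8 * C2 / c1)); [right; field; lra|apply Rmult_le_compat_l; lra]. }
    nra. }
  assert (V3 : 2 * eps * rsum (seq 1 (x ^ r)) (sterm ps (k ^ 2)) <= c1 / 4 * ll).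
  { assert (rsum (seq 1 (x ^ r)) (sterm ps (k ^ 2)) <= C3 * ll).
    { eapply Rle_trans; [|apply (B3 y Hy3)]. apply smooth_sum_le; [lra|]. intros p Hp. destruct (Hps p Hp) as (H1 & H2 & H3). split; auto. lra. }
    apply Rle_trans with (2 * eps * (C3 * ll)); [apply Rmult_le_compat_l; lra|].
    right. replace (2 * eps * (C3 * ll)) with (2 * (eps * C3) * ll) by ring. rewrite E3. field. }
  assert (V4 : (255 + 20 * eps) * (sqrt T * L * INR (x ^ r) ^ 5) <= T * L * c1 / 80).
  { assert (ES : sqrt T = exp (L / 2)).
    { rewrite <- (sqrt_pow2 (exp (L / 2))) by (left; apply exp_pos). f_equal. simpl. rewrite Rmult_1_r, <- exp_plus.
      replace (L / 2 + L / 2) with L by field. auto. }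
    assert (EQ : Q * exp (L / 8) <= exp (L / 2)).
    { replace (exp (L / 2)) with (exp (3 * L / 8) * exp (L / 8)) by (rewrite <- exp_plus; f_equal; field).
      apply Rmult_le_compat_r; [left; apply exp_pos|]. generalize (exp_ineq1_le (3 * L / 8)). lra. }
    assert (EQ2 : 255 + 20 * eps = Q * c1 / 80) by (unfold Q; field; lra). rewrite EQ2.
    apply Rle_trans with (Q * c1 / 80 * (sqrt T * L * exp (L / 8))).
    - apply Rmult_le_compat_l; [apply Rlt_le; rewrite <- EQ2; lra|]. apply Rmult_le_compat_l; auto. apply Rmult_le_pos; [apply sqrt_pos|lra].
    - replace T with (sqrt T * sqrt T) at 2 by (apply sqrt_sqrt; lra). rewrite ES at 3.
      replace (Q * c1 / 80 * (sqrt T * L * exp (L / 8))) with (sqrt T * L * c1 / 80 * (Q * exp (L / 8))) by field.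
      replace (sqrt T * exp (L / 2) * L * c1 / 80) with (sqrt T * L * c1 / 80 * exp (L / 2)) by field.
      apply Rmult_le_compat_l; auto. apply Rmult_le_pos; [|lra]. apply Rmult_le_pos; [|lra]. apply Rmult_le_pos; [apply sqrt_pos|lra]. }
  exists (map (fun j => u (2 * j)%nat) (seq 0 M)).
  assert (Hinc : forall i d, (i + d <= 2 * M)%nat -> (1 <= d)%nat -> u i < u (i + d)%nat).
  { intros i d. induction d as [|d IH]; intros Hd H1; [lia|].
    assert (S1 : u (i + d)%nat < u (S (i + d))).
    { generalize (grid_step _ _ _ _ G (i + d) ltac:(lia)); intros [Hs _].
      assert (0 < PI / (ln T + 22)) by (apply Rdiv_lt_0_compat; [apply PI_RGT_0|fold L; lra]). lra. }
    rewrite Nat.add_succ_r. destruct d as [|d]; [rewrite Nat.add_0_r in *; auto|]. specialize (IH ltac:(lia) ltac:(lia)). lra. }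
  split; [|split].
  - apply NoDup_map_inv with (f := fun t => t). rewrite map_map.
    apply NoDup_nth with (d := 0). intros i j Hi Hj E. rewrite length_map, length_seq in Hi, Hj.
    rewrite !(nth_indep _ 0 (u (2 * 0)%nat)) in E by (rewrite length_map, length_seq; auto).
    rewrite !(map_nth (fun j => u (2 * j)%nat)), !seq_nth in E by auto. rewrite !Nat.add_0_l in E.
    destruct (Nat.lt_trichotomy i j) as [H|[H|H]]; auto; exfalso.
    + generalize (Hinc (2 * i)%nat (2 * j - 2 * i)%nat ltac:(lia) ltac:(lia)). replace (2 * i + (2 * j - 2 * i))%nat with (2 * j)%nat by lia. lra.
    + generalize (Hinc (2 * j)%nat (2 * i - 2 * j)%nat ltac:(lia) ltac:(lia)). replace (2 * j + (2 * i - 2 * j))%nat with (2 * i)%nat by lia. lra.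
  - intros t Ht. apply in_map_iff in Ht. destruct Ht as (j & <- & Hj). apply in_seq in Hj.
    generalize (grid_range _ _ _ _ G (2 * j)%nat ltac:(lia)). intros. split; [lra|].
    rewrite (grid_Delta _ _ _ _ G) by lia. rewrite pow_1_even. ring.
  - rewrite rsum_map. apply Rmult_le_reg_l with KK; auto. eapply Rle_trans; [|exact R].
    assert (W1 : INR M * (c1 / 2 * ll) <= INR M * (main1 ps x be (r - s) r - 2 * main2 ps x be (r - s) r - 2 * eps * rsum (seq 1 (x ^ r)) (sterm ps (k ^ 2)))).
    { apply Rmult_le_compat_l; [apply pos_INR|]. lra. }
    assert (TL : 0 < T * L) by nra.
    assert (W2 : T * L / 20 * (c1 / 2 * ll) <= INR M * (c1 / 2 * ll)) by (apply Rmult_le_compat_r; auto; nra).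
    assert (W3 : T * L * c1 / 80 * 1 <= T * L * c1 / 80 * ll).
    { apply Rmult_le_compat_l; auto. apply Rmult_le_pos; [|lra]. apply Rmult_le_pos; lra. }
    assert (W4 : th * Rpower L (k ^ 2) <= ll).
    { unfold th, ll. rewrite Rpower_mult_distr; [|apply Rinv_0_lt_compat; lra|lra]. apply Rle_Rpower_l; [lra|]. split.
      - apply Rmult_lt_0_compat; [apply Rinv_0_lt_compat; lra|lra].
      - apply Rmult_le_reg_l with (80 * INR P); [lra|]. rewrite <- Rmult_assoc, Rinv_r by lra. lra. }
    assert (W5 : T * L * c1 / 80 * (th * Rpower L (k ^ 2)) <= T * L * c1 / 80 * ll).
    { apply Rmult_le_compat_l; auto. apply Rmult_le_pos; [|lra]. apply Rmult_le_pos; lra. }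
    replace (KK * (c1 / 80 * th / KK * T * Rpower L (k ^ 2 + 1))) with (T * L * c1 / 80 * (th * Rpower L (k ^ 2))).
    2:{ rewrite Rpower_plus, Rpower_1 by lra. field. lra. }
    lra.
Qed.

(** * Finiteness of the set of roots and conclusion *)

(* By convexity a level of [Th] is attained at most twice. *)
Lemma Th_level_cover (v : R) : exists l, forall t, 0 < t -> Th t = v -> In t l.
Proof.
  set (P := fun t => 0 < t /\ Th t = v).
  assert (H3 : forall a b c, P a -> P b -> P c -> a < b -> b < c -> False).
  { intros a b c [A1 A2] [B1 B2] [C1 C2] Hab Hbc. generalize (Th_convex a b c ltac:(lra) Hab Hbc). rewrite A2, B2, C2. lra. }
  destruct (classic (exists a, P a)) as [[a Ha]|N1]; [|exists nil; intros t Ht E; exfalso; apply N1; exists t; split; auto].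
  destruct (classic (exists b, P b /\ b <> a)) as [(b & Hb & Hne)|N2].
  - exists (a :: b :: nil). intros t Ht E. assert (Pt : P t) by (split; auto).
    destruct (Req_dec t a) as [->|Ha']; [left; auto|]. destruct (Req_dec t b) as [->|Hb']; [right; left; auto|]. exfalso.
    destruct (Rlt_or_le a b), (Rlt_or_le t a), (Rlt_or_le t b);
      ((apply (H3 t a b); auto; lra) || (apply (H3 a t b); auto; lra) || (apply (H3 a b t); auto; lra) ||
       (apply (H3 t b a); auto; lra) || (apply (H3 b t a); auto; lra) || (apply (H3 b a t); auto; lra) || lra).
  - exists (a :: nil). intros t Ht E. left. apply NNPP. intros Hne. apply N2. exists t. split; [split; auto|auto].
Qed.

Lemma root_level phi t : 0 < t -> Defs.Delta (crit t) = cis (2 * phi) -> exists z : Z, Th t = IZR z * PI - phi.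
Proof.
  intros Ht E. rewrite Delta_phase in E by lra.
  assert (E1 : cis (2 * (Th t + phi)) = RtoC 1).
  { replace (2 * (Th t + phi)) with (2 * phi + 2 * Th t) by ring. rewrite cis_add, <- E, <- cis_add.
    replace (-2 * Th t + 2 * Th t) with 0 by ring. apply cis_0. }
  assert (E2 : cos (2 * (Th t + phi)) = 1) by (change (fst (cis (2 * (Th t + phi))) = fst (RtoC 1)); rewrite E1; reflexivity).
  rewrite cos_2a_sin in E2.
  assert (E3 : sin (Th t + phi) = 0) by nra.
  apply sin_eq_0_0 in E3. destruct E3 as [z Hz]. exists z. lra.
Qed.

(** Roots lie on the levels z PI - phi of [Th] with z an integer. On (0, T] [Th] is bounded, so
    finitely many z occur, and each level is covered by a finite list; a classical filter turns the
    cover into the exact set. *)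
Lemma roots_finite phi T : exists l, NoDup l /\ forall t, In t l <-> (0 < t <= T /\ Defs.Delta (crit t) = cis (2 * phi)).
Proof.
  generalize PI2_3_2; intros HP.
  assert (HC : exists l, forall t, 0 < t <= T -> Defs.Delta (crit t) = cis (2 * phi) -> In t l).
  { destruct (Th_bounded T) as [B HB].
    assert (Cov : forall n : nat, exists l, forall t z, 0 < t <= T -> Th t = IZR z * PI - phi -> (Z.abs z < Z.of_nat n)%Z -> In t l).
    { induction n as [|n [l IH]]; [exists nil; intros; lia|].
      destruct (Th_level_cover (IZR (Z.of_nat n) * PI - phi)) as [l1 H1]. destruct (Th_level_cover (IZR (- Z.of_nat n) * PI - phi)) as [l2 H2].
      exists (l ++ l1 ++ l2). intros t z Ht E Hz. rewrite !in_app_iff.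
      destruct (Z.eq_dec z (Z.of_nat n)) as [->|Hz1]; [right; left; apply H1; auto; lra|].
      destruct (Z.eq_dec z (- Z.of_nat n)) as [->|Hz2]; [right; right; apply H2; auto; lra|].
      left. apply (IH t z); auto. lia. }
    destruct (INR_unbounded (B + Rabs phi)) as [n Hn]. destruct (Cov n) as [l Hl]. exists l. intros t Ht E.
    destruct (root_level phi t ltac:(lra) E) as [z Hz]. apply (Hl t z); auto.
    apply lt_IZR. rewrite <- INR_IZR_INZ, abs_IZR. specialize (HB t ltac:(lra)).
    assert (Rabs (IZR z * PI) <= B + Rabs phi).
    { replace (IZR z * PI) with (Th t + phi) by lra. eapply Rle_trans; [apply Rabs_triang|]. lra. }
    rewrite Rabs_mult, (Rabs_right PI) in H by lra. generalize (Rabs_pos (IZR z)). nra. }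
  destruct HC as [l Hl].
  set (b := fun t => if excluded_middle_informative (0 < t <= T /\ Defs.Delta (crit t) = cis (2 * phi)) then true else false).
  exists (nodup Req_EM_T (filter b l)). split; [apply NoDup_nodup|].
  intros t. rewrite nodup_In, filter_In. unfold b. destruct (excluded_middle_informative _) as [H|H].
  - split; [auto|]. intros _. split; auto. apply Hl; apply H.
  - split; [intros [_ F]; discriminate|contradiction].
Qed.

Lemma is_root_phi_iff phi t : is_root_phi phi t <-> Defs.Delta (crit t) = cis (2 * phi).
Proof.
  unfold is_root_phi.
  replace (Cexp (Cmult Ci (RtoC (2 * phi)))) with (cis (2 * phi)); [split; auto|].
  unfold Cexp, cis, Cmult, Ci, RtoC; cbn [fst snd Re Im].
  replace (0 * (2 * phi) - 1 * 0) with 0 by ring. replace (0 * 0 + 1 * (2 * phi)) with (2 * phi) by ring.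
  rewrite exp_0, !Rmult_1_l. reflexivity.
Qed.

Theorem theorem1 (k : Q) (phi : R) :
  1 <= Q2R k -> 0 <= phi < PI ->
  exists c T0 : R, 0 < c /\
    forall T : R, T0 <= T ->
      exists l : list R, NoDup l /\
        (forall t : R, In t l <-> (0 < t <= T /\ is_root_phi phi t)) /\
        c * T * Rpower (ln T) (Q2R k ^ 2 + 1)
          <= fold_right Rplus 0
               (map (fun t => rpow (Cmod (zeta (crit t))) (2 * Q2R k)) l).
Proof.
  intros Hk _. destruct k as [a b].
  assert (HbR : 0 < INR (Pos.to_nat b)) by (apply lt_0_INR, Pos2Nat.is_pos).
  assert (Eb : IZR (Zpos b) = INR (Pos.to_nat b)) by (rewrite INR_IZR_INZ, positive_nat_Z; reflexivity).
  assert (Ek : Q2R (a # b) = IZR a / INR (Pos.to_nat b)) by (unfold Q2R; simpl; rewrite Eb; reflexivity).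
  assert (Hab : INR (Pos.to_nat b) <= IZR a).
  { rewrite Ek in Hk. apply Rmult_le_reg_r with (/ INR (Pos.to_nat b)); [apply Rinv_0_lt_compat; auto|]. rewrite Rinv_r by lra. exact Hk. }
  assert (Ha : (0 <= a)%Z) by (apply le_IZR; lra).
  assert (Ea : IZR a = INR (Z.to_nat a)) by (rewrite INR_IZR_INZ, Z2Nat.id by auto; reflexivity).
  destruct (moment_lower (Z.to_nat a) (Pos.to_nat b) phi (Q2R (a # b))) as (c & L1 & Hc & H).
  { split; [generalize (Pos2Nat.is_pos b); lia|]. apply INR_le. rewrite <- Ea. auto. }
  { rewrite Ek, Ea. reflexivity. }
  set (kk := Q2R (a # b)) in *. assert (He : 0 < kk ^ 2 + 1) by nra.
  (* The previous bound is applied at T / 2, whose grid lies in [T/2, T]. The factors account for T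
     / 2 and for ln (T / 2) >= (ln T) / 2; the threshold makes ln (T / 2) exceed both [L1] and 1. *)
  exists (c * / 2 * Rpower (/ 2) (kk ^ 2 + 1)), (2 * exp (Rabs L1 + 2)). split.
  { apply Rmult_lt_0_compat; [lra|apply exp_pos]. }
  intros T HT. generalize (exp_ineq1_le (Rabs L1 + 2)) (Rabs_pos L1) (Rle_abs L1); intros HE HL0 HLa.
  destruct (roots_finite phi T) as (l & Hnd & Hl). exists l. split; auto. split; [intros t; rewrite is_root_phi_iff; apply Hl|].
  assert (HL : Rabs L1 + 2 <= ln (T / 2)) by (rewrite <- (ln_exp (Rabs L1 + 2)); apply ln_le; [apply exp_pos|lra]).
  destruct (H (T / 2) ltac:(lra) ltac:(lra)) as (l' & Hnd' & Hl' & Hsum).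
  apply Rle_trans with (rsum l (fun t => rpow (Cmod (zeta (crit t))) (2 * kk))).
  2:{ right. clear. induction l as [|t l IH]; simpl; [reflexivity|rewrite IH; reflexivity]. }
  (* The grid supplies only some of the roots up to T; the others contribute nonnegative terms. *)
  eapply Rle_trans; [|apply (rsum_incl l'); auto].
  - eapply Rle_trans; [|exact Hsum].
    replace (c * / 2 * Rpower (/ 2) (kk ^ 2 + 1) * T * Rpower (ln T) (kk ^ 2 + 1))
      with (c * (T / 2) * (Rpower (/ 2) (kk ^ 2 + 1) * Rpower (ln T) (kk ^ 2 + 1))) by field.
    assert (EL : ln T = ln (T / 2) + ln 2) by (rewrite <- ln_mult by lra; f_equal; field).
    assert (0 < ln 2) by (rewrite <- ln_1; apply ln_increasing; lra). generalize (ln_le_sub1 2 ltac:(lra)); intros.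
    apply Rmult_le_compat_l; [apply Rmult_le_pos; lra|].
    rewrite Rpower_mult_distr by lra. apply Rle_Rpower_l; lra.
  - intros t Ht. apply Hl. destruct (Hl' t Ht). split; auto. lra.
  - intros t _. unfold rpow. destruct (Req_EM_T _ 0); [lra|left; apply exp_pos].
Qed.
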